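(* Let $\Delta\subset\mathfrak t^*\cong\mathbb R^n$ be a Delzant polytope, $M$ the associated toric variety with Guillemin metric $\omega_g$, and $\mathbb D>0$ a smooth function on $\overline\Delta$. For every $T^n$-invariant $\phi\in C^\infty(M)$ such that $\mathsf f=\mathsf g+\phi$ is the local potential of a Kähler metric $\omega_{\mathsf g+\phi}>0$, one has everywhere on $M$ $$H\le C\exp\left\{(2\mathcal R+1)\left(\max_M\phi-\min_M\phi\right)\right\},$$ where $C$ is a constant depending only on $n$, $\max|\mathcal S_{\mathbb D}(f)|$ and $\mathcal R$.
   Context: Identify $\mathfrak t$ and $\mathfrak t^*$ with $\mathbb R^n$, with coordinates $x=(x^1,\dots,x^n)$ and $\xi=(\xi_1,\dots,\xi_n)$. On the open dense complex torus of $M$ use log-affine coordinates $w^i=x^i+\sqrt{-1}\,y^i$, $z^i=e^{w^i/2}$; $T^n$-invariant functions there are functions of $x\in\mathbb R^n$. $\omega_g$ is the Guillemin metric, with $T^n$-invariant local potential $\mathsf g$, regarded on the open torus as a smooth strictly convex function $g(x)$. For a $T^n$-invariant $\phi\in C^\infty(M)$ with $\omega_{\mathsf g+\phi}>0$, put $f=g+\phi$, regarded as a strictly convex function of $x$; its gradient map $\nabla^f(x)=(\partial f/\partial x^1,\dots,\partial f/\partial x^n)$ sends $\mathbb R^n$ onto $\Delta$ (likewise $\nabla^g$). Write $f_{ij}=\partial^2f/\partial x^i\partial x^j$, $(f^{ij})=(f_{ij})^{-1}$, and similarly for $g$; for other functions of $x$, subscripts $i,j$ also denote $x$-derivatives.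 Put $\mathbb D_f=\mathbb D\circ\nabla^f$, $\mathbb D_g=\mathbb D\circ\nabla^g$, $\mathbb F_f=\mathbb D_f\det(f_{ij})$, $\mathbb F_g=\mathbb D_g\det(g_{ij})$, and $$\mathcal S_{\mathbb D}(f)=-\sum_{i,j}f^{ij}\frac{\partial^2\log\mathbb F_f}{\partial x^i\partial x^j}-\sum_{i,j}f^{ij}\frac{\partial\log\mathbb F_f}{\partial x^i}\frac{\partial\log\mathbb D_f}{\partial x^j}.$$ The function $H$ is the global function on $M$ given in any local holomorphic coordinates by $H=\det(g_{i\bar j})/\det(f_{i\bar j})$ (the ratio of determinants of the two Kähler metrics); on the open torus $H=\det(g_{ij})/\det(f_{ij})$. Define $$R_g=\max_M\left\{\Big|\sum_{i,j}g^{ij}(\log\mathbb F_g)_{ij}\Big|+|\nabla_x\log\mathbb F_g|^2\right\},\qquad \mathcal D=\max_{\overline\Delta}|\nabla_\xi\log\mathbb D|,$$ $$\mathcal R=\max\{R_g,\ \mathcal D^2,\ (\operatorname{diam}\Delta)^2\},$$ where $|\nabla_x\log\mathbb F_g|^2=\sum_i(\partial\log\mathbb F_g/\partial x^i)^2$, $|\nabla_\xi\log\mathbb D|^2=\sum_i(\partial\log\mathbb D/\partial\xi_i)^2$, and the quantities in $R_g$ are computed in the coordinates $x$ on the open torus and extended continuously to $M$. *)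

(* Defs.v *)
From HB Require Import structures.
From mathcomp Require Import all_boot all_order all_algebra.
From mathcomp Require Import complex.
From mathcomp Require Import all_classical all_reals all_analysis.

Set Implicit Arguments.
Unset Strict Implicit.
Unset Printing Implicit Defensive.

Import Order.TTheory GRing.Theory Num.Theory.
Import numFieldNormedType.Exports.

Local Open Scope classical_set_scope.
Local Open Scope ring_scope.

Section Calculus.
Context {R : realType}.

(* The norm of the library on 'rV[R]_n is the sup norm, hence this one. *)
Definition dotrv n (v w : 'rV[R]_n) : R := \sum_(i < n) v 0 i * w 0 i.
Definition enorm n (v : 'rV[R]_n) : R := Num.sqrt (dotrv v v).

(* [C^k] on an open set, through iterated directional derivatives in all
   directions: in finite dimension this is the usual notion. *)
Fixpoint Ck_on (V : normedModType R) (U : set V) (k : nat) (f : V -> R)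
    : Prop :=
  (forall x, U x -> {for x, continuous f}) /\
  match k with
  | 0%N => True
  | k'.+1 => forall v : V,
      (forall x, U x -> derivable f x v) /\ Ck_on U k' ('D_v f)
  end.

Definition smooth_on (V : normedModType R) (U : set V) (f : V -> R) : Prop :=
  forall k, Ck_on U k f.

Definition pd n (i : 'I_n) (f : 'rV[R]_n -> R) : 'rV[R]_n -> R :=
  'D_(delta_mx 0 i) f.

Definition grad n (f : 'rV[R]_n -> R) (x : 'rV[R]_n) : 'rV[R]_n :=
  \row_i pd i f x.

Definition hess n (f : 'rV[R]_n -> R) (x : 'rV[R]_n) : 'M[R]_n :=
  \matrix_(i, j) pd i (pd j f) x.

(* C^n, with zeta^k = (zeta.1 0 k) + sqrt(-1) (zeta.2 0 k); it is a real
   normed module, so that the derivatives of the library apply. *)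
Definition Cn (n : nat) : normedModType R := ('rV[R]_n * 'rV[R]_n)%type.

Definition pd_re n (i : 'I_n) (f : Cn n -> R) : Cn n -> R :=
  'D_((delta_mx 0 i, 0) : Cn n) f.
Definition pd_im n (i : 'I_n) (f : Cn n -> R) : Cn n -> R :=
  'D_((0, delta_mx 0 i) : Cn n) f.

(* The matrix (f_{i \bar j}) of f_{i \bar j} = d^2 f / d zeta^i d \bar zeta^j,
   where d/d zeta = (d/da - sqrt(-1) d/db) / 2 and
   d/d \bar zeta = (d/da + sqrt(-1) d/db) / 2 for zeta = a + sqrt(-1) b. *)
Definition levi n (f : Cn n -> R) (z : Cn n) : 'M[R[i]]_n :=
  \matrix_(i, j)
    (((pd_re i (pd_re j f) z + pd_im i (pd_im j f) z) / 4) +i*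
     ((pd_re i (pd_im j f) z - pd_im i (pd_re j f) z) / 4))%C.

Definition posdef_hermitian n (A : 'M[R[i]]_n) : Prop :=
  forall v : 'rV[R[i]]_n, v != 0 ->
    0 < \sum_(i < n) \sum_(j < n) v 0 i * A i j * (v 0 j)^*.

Definition sqmodC (z : R[i]) : R := complex.Re z ^+ 2 + complex.Im z ^+ 2.

End Calculus.

(* Half-spaces l_i(xi) = <xi, u_i> - lambda_i > 0, i < nfacets, with inward
   normals u_i in the lattice Z^n. *)
Record halfspaces (R : realType) (n : nat) := HalfSpaces {
  nfacets : nat;
  normal : 'M[int]_(nfacets, n);
  offset : 'rV[R]_nfacets }.

Section Polytope.
Context {R : realType} {n : nat} (P : halfspaces R n).
Local Notation d := (nfacets P).

Definition lfun (i : 'I_d) (xi : 'rV[R]_n) : R :=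
  \sum_(j < n) xi 0 j * (normal P i j)%:~R - offset P 0 i.

Definition openPoly : set 'rV[R]_n := [set xi | forall i, 0 < lfun i xi].
Definition closedPoly : set 'rV[R]_n := [set xi | forall i, 0 <= lfun i xi].

Definition vertex (p : 'rV[R]_n) : Prop :=
  closedPoly p /\
  forall (a b : 'rV[R]_n) (t : R), closedPoly a -> closedPoly b ->
    0 < t < 1 -> p = t *: a + (1 - t) *: b -> a = b.

(* s enumerates without repetition the facets through p. *)
Definition facets_at (p : 'rV[R]_n) (s : 'I_n -> 'I_d) : Prop :=
  injective s /\ forall i, lfun i p = 0 <-> exists k, s k = i.

(* Every half-space is required to cut out a genuine facet: a redundant l_i
   would change the Guillemin potential. Primitivity of u_i is implied by
   the condition at the vertices. *)
Definition delzant : Prop :=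
  [/\ openPoly !=set0,
      bounded_set closedPoly,
      forall i, exists xi, lfun i xi = 0 /\ forall j, j != i -> 0 < lfun j xi
    & forall p, vertex p -> exists2 s, facets_at p s &
        (\matrix_(k < n, j < n) normal P (s k) j) \in unitmx].

Definition diam : R :=
  sup [set r | exists xi eta, [/\ openPoly xi, openPoly eta &
                                  r = enorm (xi - eta)]].

End Polytope.

(* The toric manifold is taken as M = U / K_C with U = coxU the open set of
   the z in C^d whose vanishing coordinates are indexed by facets with a common
   point, and K_C = coxK the kernel of (C^* )^d -> (C^* )^n,
   t |-> (prod_i t_i^{u_ij})_j. Functions on M are the K_C-invariant functions
   on U (their values outside U are irrelevant). The torus T^n acts on M
   through (S^1)^d, which maps onto it. *)
Section ToricManifold.
Context {R : realType} {n : nat} (P : halfspaces R n).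
Local Notation d := (nfacets P).

Definition coxU : set 'rV[R[i]]_d :=
  [set z : 'rV[R[i]]_d |
    exists2 p, closedPoly P p & forall i, z 0 i = 0 -> lfun i p = 0].

Definition coxK : set 'rV[R[i]]_d :=
  [set t : 'rV[R[i]]_d | (forall i, t 0 i != 0) /\
    forall j, \prod_(i < d) t 0 i ^ normal P i j = 1].

Definition ctimes (t z : 'rV[R[i]]_d) : 'rV[R[i]]_d := \row_i (t 0 i * z 0 i).

(* The holomorphic chart C^n -> M at a vertex: the coordinates of z along the
   n facets of the vertex are free, the others are set to 1. These charts
   cover M. *)
Definition chart_index (s : 'I_n -> 'I_d) : Prop :=
  exists2 p, vertex P p & facets_at p s.

Definition chart (s : 'I_n -> 'I_d) (zeta : Cn n) : 'rV[R[i]]_d :=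
  \row_i if [pick k | s k == i] is Some k
         then (zeta.1 0 k +i* zeta.2 0 k)%C else 1.

Definition smooth_on_M (phi : 'rV[R[i]]_d -> R) : Prop :=
  (forall t z : 'rV[R[i]]_d, coxK t -> coxU z -> phi (ctimes t z) = phi z) /\
  forall s, chart_index s -> smooth_on setT (phi \o chart s).

Definition torus_invariant (phi : 'rV[R[i]]_d -> R) : Prop :=
  forall t z : 'rV[R[i]]_d,
    (forall i, `|t 0 i| = 1) -> coxU z -> phi (ctimes t z) = phi z.

(* On the open torus (C^* )^d / K_C the coordinates z^j = prod_i z_i^{u_ij} are
   exp (w^j / 2), whence x^j = Re w^j = log |z^j|^2. *)
Definition logcoord (z : 'rV[R[i]]_d) : 'rV[R]_n :=
  \row_j \sum_(i < d) (normal P i j)%:~R * ln (sqmodC (z 0 i)).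

(* A T^n-invariant function on M, as a function of x in R^n; by invariance the
   chosen point z above x is irrelevant. *)
Definition on_torus (phi : 'rV[R[i]]_d -> R) (x : 'rV[R]_n) : R :=
  phi (xget 0 [set z : 'rV[R[i]]_d |
    (forall i, z 0 i != 0) /\ logcoord z = x]).

(* Since x = log |z|^2, the symplectic potential of the Guillemin metric is
   sum_i l_i log l_i, without the factor 1/2 of other normalizations;
   0 log 0 = 0 holds because ln 0 = 0. *)
Definition guillemin_v (xi : 'rV[R]_n) : R :=
  \sum_(i < d) lfun i xi * ln (lfun i xi).

Definition guillemin_g (x : 'rV[R]_n) : R :=
  sup [set dotrv x xi - guillemin_v xi | xi in closedPoly P].

(* Potential on U of the pull-back of the Guillemin metric. Where no z_i
   vanishes it equals g (x) - sum_i lambda_i log |z_i|^2 with x = logcoord z,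
   i.e. g up to a pluriharmonic term; the constraint on xi encodes
   l_i(xi) log 0 = -oo for l_i(xi) > 0. Composed with a chart it is a smooth
   local potential of omega_g on that chart. *)
Definition guillemin_pot (z : 'rV[R[i]]_d) : R :=
  sup [set \sum_(i < d) lfun i xi * ln (sqmodC (z 0 i)) - guillemin_v xi
      | xi in [set xi | closedPoly P xi /\
                        forall i, z 0 i = 0 -> lfun i xi = 0]].

(* The matrix of omega_{g + phi} in the coordinates of the chart s. *)
Definition metric (phi : 'rV[R[i]]_d -> R) (s : 'I_n -> 'I_d) (zeta : Cn n)
    : 'M[R[i]]_n :=
  levi ((fun z : 'rV[R[i]]_d => guillemin_pot z + phi z) \o chart s) zeta.

Definition kahler (phi : 'rV[R[i]]_d -> R) : Prop :=
  forall s zeta, chart_index s -> posdef_hermitian (metric phi s zeta).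

(* H at the point of M of coordinates zeta in the chart s; both determinants
   are real, being those of Hermitian matrices. *)
Definition Hratio (phi : 'rV[R[i]]_d -> R) (s : 'I_n -> 'I_d) (zeta : Cn n)
    : R :=
  complex.Re (\det (metric (fun=> 0) s zeta) / \det (metric phi s zeta)).

Definition maxM (phi : 'rV[R[i]]_d -> R) : R := sup (phi @` coxU).
Definition minM (phi : 'rV[R[i]]_d -> R) : R := inf (phi @` coxU).

End ToricManifold.

Section Curvature.
Context {R : realType} {n : nat}.
Implicit Types (D f : 'rV[R]_n -> R) (x : 'rV[R]_n).

Definition pullD D f x : R := D (grad f x).
Definition FF D f x : R := pullD D f x * \det (hess f x).

Definition logpullD D f x : R := ln (pullD D f x).
Definition logFF D f x : R := ln (FF D f x).

Definition trhess f (F : 'rV[R]_n -> R) x : R :=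
  \sum_(i < n) \sum_(j < n) invmx (hess f x) i j * pd i (pd j F) x.

Definition scalS D f x : R :=
  - trhess f (logFF D f) x
  - \sum_(i < n) \sum_(j < n)
      invmx (hess f x) i j * pd i (logFF D f) x * pd j (logpullD D f) x.

(* Quantities which extend continuously from the open torus R^n x T^n to the
   compact M: their maximum over M is the supremum over R^n. *)
Definition max_absS D f : R := sup [set `|scalS D f x| | x in setT].

Definition constRg D (g : 'rV[R]_n -> R) : R :=
  sup [set `|trhess g (logFF D g) x| + enorm (grad (logFF D g) x) ^+ 2
      | x in setT].

Definition constD (P : halfspaces R n) D : R :=
  sup [set enorm (grad (fun eta => ln (D eta)) xi) | xi in closedPoly P].

Definition constR (P : halfspaces R n) D : R :=
  Num.max (constRg D (guillemin_g P))
          (Num.max (constD P D ^+ 2) (diam P ^+ 2)).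

End Curvature.

(* Main.v *)
Require Import Defs.
From HB Require Import structures.
From mathcomp Require Import all_boot all_order all_algebra.
From mathcomp Require Import complex.
From mathcomp Require Import all_classical all_reals all_analysis.
From mathcomp Require Import ring lra.
From mathcomp Require perm.

Set Implicit Arguments.
Unset Strict Implicit.
Unset Printing Implicit Defensive.

Import Order.TTheory GRing.Theory Num.Theory.
Import numFieldNormedType.Exports.

Local Open Scope classical_set_scope.
Local Open Scope ring_scope.

(* Let u_i be the normals of P, e_k the primitive edge vectors at a vertex p,
   w_p their sum, a_ik = <u_i, e_k> and R the constant of the statement.

   On the real points r of the chart of p, log F_g is sum_k <x, e_k> plus a
   smooth function of r which is even in every r_k. Letting r tend to 0, the
   curvature quantity R_g bounds |w_p|^2 by R and the sum over the facets not
   through p of ((sum_k a_ik)^2 + sum_k a_ik^2) / l_i(p) by 5 R / 4. As the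
   a_ik are integers, this controls in terms of n and R alone the edges, the
   normals, the number of facets and the l_i(p), hence also, uniformly on M,
   log det (g_ij) - E, where E = max_q <2 R q + w_q, x> - 2 R g.

   The maximum principle is applied to E - log F_f - (2 R + 1) phi, in which w_q
   is replaced by (1 + e) w_q to make it tend to - oo at infinity. At a maximum
   point one linear function realizes E + 2 R g, and the coefficients are such
   that tr (f^-1 g'') <= C there; so det g'' / det f'' <= C^n by the inequality of
   arithmetic and geometric means, and the comparison with the maximum
   gives the bound on the open torus as e tends to 0. It extends to M by
   continuity. *)

(** * Functions of class C^k *)

(** The natural test function log (F_g / F_f) - A phi does not suffice: the maximum principle
    contracts its Hessian with f^-1, whereas R_g bounds only the trace of (log F_g)'' against g^-1,
    not the form itself. Hence log F_g is replaced by linear functions with the same growth. On the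
    cone of x where the vertex p maximizes <x, .>, log F_g and log F_f are both <w_p, x> + O(1); but
    the maximum of <w_q, x> over q is attained elsewhere, already on the projective line at the
    opposite vertex. Adding 2 R q to w_q makes p the maximizer, thanks to the bound of the sum over
    the facets, and - 2 R g compensates, g being <p, x> + O(1) on that cone. This forces the
    coefficient of phi. In (2 R + 1) f - g = 2 R g + (2 R + 1) phi, the extra g provides the term tr
    (f^-1 g''). In the first-order condition the points q, grad g and grad f of the polytope have
    coefficients 2 R, 1 and - (2 R + 1), of sum zero, so that grad log F_f is bounded there by the
    diameter and |w_q|; the curvature S_D then bounds tr (f^-1 (log F_f)''). *)

Section Calculus.
Context {R : realType}.

Lemma diff_eps (V W : normedModType R) (f : V -> W) x : differentiable f x ->
  forall e, 0 < e -> \forall h \near (0 : V),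
    `|f (h + x) - f x - 'd f x h| <= e * `|h|.
Proof.
move=> /diff_locally /eqaddoP dfx e e0; have := dfx _ e0.
by apply: filterS => h /=; rewrite !fctE /= opprD addrA.
Qed.

(** [L] is a bare map with a proof of linearity, so that explicit candidates for the differential
    (sums over coordinates, matrix products) can be supplied directly. *)
Lemma eps_diff (V W : normedModType R) (f : V -> W) (L : V -> W) x :
  linear L -> continuous L ->
  (forall e, 0 < e -> \forall h \near (0 : V),
    `|f (h + x) - f x - L h| <= e * `|h|) ->
  differentiable f x /\ 'd f x = L :> (V -> W).
Proof.
move=> linL cL H.
pose LM := GRing.isLinear.Build _ _ _ _ L linL.
pose LL : {linear V -> W} := HB.pack L LM.
have E : f \o shift x = cst (f x) + LL +o_ (0 : V) id.
  apply/eqaddoP => e e0; move: (H e e0); apply: filterS => h /=.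
  by rewrite !fctE /= opprD addrA.
have dE : 'd f x = L :> (V -> W) by exact: (diff_unique (df := LL)).
split=> //; apply/diff_locallyP; rewrite dE; split => //.
Qed.

Lemma near_eq_differentiable (V W : normedModType R) (f g : V -> W) x :
  (\forall y \near x, f y = g y) -> differentiable f x -> differentiable g x.
Proof.
move=> fg df.
have fg' : \forall h \near (0 : V), f (h + x) = g (h + x).
  have := fg; rewrite (near_shift 0 x) /=.
  by apply: filterS => h /=; rewrite subr0.
have [] // := @eps_diff _ _ g ('d f x) x; first exact: linearP.
  exact: diff_continuous.
move=> e e0; near=> h.
rewrite -(nbhs_singleton fg) -(near fg' h) //.
by near: h; apply: diff_eps.
Unshelve. all: by end_near. Qed.

Lemma openP (V : normedModType R) (U : set V) x : open U -> U x ->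
  \forall y \near x, U y.
Proof. by move=> oU Ux; apply: open_nbhs_nbhs. Qed.

Lemma eq_differentiable_on (V W : normedModType R) (U : set V) (f g : V -> W) x :
  open U -> (forall y, U y -> f y = g y) -> U x ->
  differentiable f x -> differentiable g x.
Proof.
move=> oU fg Ux; apply: near_eq_differentiable.
by move: (openP oU Ux); apply: filterS.
Qed.

Lemma eq_derive_on (V W : normedModType R) (U : set V) (f g : V -> W) x v :
  open U -> (forall y, U y -> f y = g y) -> U x -> 'D_v f x = 'D_v g x.
Proof.
move=> oU fg Ux; apply: near_eq_derive.
by move: (openP oU Ux); apply: filterS.
Qed.

(* Unlike [Ck_on], this includes Frechet differentiability, so that the chain
   rule applies; [Ck_on_dk] shows that nothing is lost. *)
Fixpoint dk (V : normedModType R) (U : set V) (k : nat) (f : V -> R) : Prop :=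
  (forall x, U x -> differentiable f x) /\
  match k with
  | 0%N => True
  | k'.+1 => forall v : V, dk U k' ('D_v f)
  end.

Definition smo (V : normedModType R) (U : set V) (f : V -> R) :=
  forall k, dk U k f.

Section OneSpace.
Context {V : normedModType R} {U : set V} (oU : open U).
Implicit Types f g : V -> R.

Lemma dk_differentiable k f x : dk U k f -> U x -> differentiable f x.
Proof. by case: k => [|k] [df _]; apply: df. Qed.

Lemma dk_eq k f g : (forall x, U x -> f x = g x) -> dk U k f -> dk U k g.
Proof.
elim: k f g => [|k IH] f g fg [df Df]; split => //.
- by move=> x Ux; apply: (eq_differentiable_on oU fg) => //; apply: df.
- by move=> x Ux; apply: (eq_differentiable_on oU fg) => //; apply: df.
move=> v; apply: IH (Df v) => x Ux; exact: (eq_derive_on _ oU fg).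
Qed.

Lemma dk_pred k f : dk U k.+1 f -> dk U k f.
Proof.
elim: k f => [|k IH] f; first by move=> [].
by move=> [df Df]; split=> // v; apply: IH; apply: Df.
Qed.

Lemma dk_cst k c : dk U k (fun=> c).
Proof.
elim: k c => [|k IH] c; split=> //; try by move=> x _; apply: differentiable_cst.
move=> v; apply: dk_eq (IH 0) => x Ux.
by rewrite derive_cst.
Qed.

Lemma dk_add k f g : dk U k f -> dk U k g -> dk U k (fun x => f x + g x).
Proof.
elim: k f g => [|k IH] f g [df Df] [dg Dg]; split=> //; try by
  move=> x Ux; apply: differentiableD; [apply: df | apply: dg].
move=> v; apply: dk_eq (IH _ _ (Df v) (Dg v)) => x Ux.
by rewrite -deriveD //; apply: diff_derivable; [apply: df|apply: dg].
Qed.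

Lemma dk_mul k f g : dk U k f -> dk U k g -> dk U k (fun x => f x * g x).
Proof.
elim: k f g => [|k IH] f g Hf Hg; have [df Df] := Hf; have [dg Dg] := Hg;
  split=> //; try by
  move=> x Ux; apply: differentiableM; [apply: df | apply: dg].
move=> v; apply: dk_eq (dk_add (IH _ _ (dk_pred Hf) (Dg v))
   (IH _ _ (dk_pred Hg) (Df v))) => x Ux.
by rewrite -deriveM //; apply: diff_derivable; [apply: df|apply: dg].
Qed.

Lemma dk_scale k c f : dk U k f -> dk U k (fun x => c * f x).
Proof. by move=> Hf; apply: dk_mul => //; apply: dk_cst. Qed.

Lemma dk_opp k f : dk U k f -> dk U k (fun x => - f x).
Proof.
move=> Hf; apply: dk_eq (dk_scale (-1) Hf) => x _; exact: mulN1r.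
Qed.

Lemma dk_sub k f g : dk U k f -> dk U k g -> dk U k (fun x => f x - g x).
Proof. by move=> Hf Hg; apply: dk_add => //; apply: dk_opp. Qed.

Lemma dk_inv k f : (forall x, U x -> f x != 0) ->
  dk U k f -> dk U k (fun x => (f x)^-1).
Proof.
move=> f0; elim: k => [|k IH] Hf; have [df Df] := Hf; split=> //; try by
  move=> x Ux; apply: differentiableV; [apply: df|apply: f0].
move=> v; have IHf := IH (dk_pred Hf).
apply: dk_eq (dk_opp (dk_mul (dk_mul IHf IHf) (Df v))) => x Ux.
rewrite [RHS](deriveV (f0 x Ux)); last by apply: diff_derivable; apply: df.
by rewrite expr2 invfM -[RHS]/(_ * _) mulNr.
Qed.

Lemma dk_sum k (I : Type) (r : seq I) (P : pred I) (F : I -> V -> R) :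
  (forall i, P i -> dk U k (F i)) ->
  dk U k (fun x => \sum_(i <- r | P i) F i x).
Proof.
move=> HF; elim: r => [|i r IH].
  by apply: dk_eq (dk_cst k 0) => x _; rewrite big_nil.
case Pi : (P i); last by apply: dk_eq IH => x _; rewrite big_cons Pi.
by apply: dk_eq (dk_add (HF i Pi) IH) => x _; rewrite big_cons Pi.
Qed.

Lemma dk_prod k (I : Type) (r : seq I) (P : pred I) (F : I -> V -> R) :
  (forall i, P i -> dk U k (F i)) ->
  dk U k (fun x => \prod_(i <- r | P i) F i x).
Proof.
move=> HF; elim: r => [|i r IH].
  by apply: dk_eq (dk_cst k 1) => x _; rewrite big_nil.
case Pi : (P i); last by apply: dk_eq IH => x _; rewrite big_cons Pi.
by apply: dk_eq (dk_mul (HF i Pi) IH) => x _; rewrite big_cons Pi.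
Qed.

Lemma differentiable_rV m (h : V -> 'rV[R]_m) x :
  (forall j, differentiable (fun y => h y 0 j) x) -> differentiable h x.
Proof.
move=> dh.
have -> : h = (fun y => \sum_(j < m) (fun z => h z 0 j *: delta_mx 0 j) y).
  by apply/funext => y; rewrite [LHS]row_sum_delta.
have -> : (fun y => \sum_(j < m) (fun z => h z 0 j *: (delta_mx 0 j : 'rV[R]_m)) y)
  = \sum_(j < m) (fun z => h z 0 j *: (delta_mx 0 j : 'rV[R]_m)).
  by apply/funext => y; rewrite fct_sumE.
by apply: differentiable_sum => j; apply: differentiableZl.
Qed.

Lemma diff_rV m (h : V -> 'rV[R]_m) x v :
  (forall j, differentiable (fun y => h y 0 j) x) ->
  'd h x v = \row_j 'D_v (fun y => h y 0 j) x.
Proof.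
move=> dh; have dh' := differentiable_rV dh.
rewrite -deriveE // derive_mx; last by apply: diff_derivable.
by apply/rowP => j; rewrite !mxE.
Qed.

Lemma differentiable_derive_sum m (F : 'rV[R]_m -> R) a v :
  differentiable F a -> 'D_v F a = \sum_(j < m) v 0 j * pd j F a.
Proof.
move=> dF; rewrite deriveE // {1}(row_sum_delta v) linear_sum.
by apply: eq_bigr => j _; rewrite linearZ /= /pd deriveE.
Qed.

Lemma derive_comp_rV m (F : 'rV[R]_m -> R) (h : V -> 'rV[R]_m) x v :
  (forall j, differentiable (fun y => h y 0 j) x) -> differentiable F (h x) ->
  'D_v (F \o h) x = \sum_(j < m) pd j F (h x) * 'D_v (fun y => h y 0 j) x.
Proof.
move=> dh dF; have dh' := differentiable_rV dh.
rewrite deriveE; last exact: differentiable_comp.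
rewrite diff_comp // /= diff_rV // -deriveE // differentiable_derive_sum //.
by apply: eq_bigr => j _; rewrite mxE mulrC.
Qed.

(** The derivative of F o h is the sum of [pd j F (h x)] times the derivatives of the coordinates of
    h, so the induction reduces to the closure of [dk] under sums and products. *)
Lemma dk_comp m k (W : set 'rV[R]_m) (F : 'rV[R]_m -> R) (h : V -> 'rV[R]_m) :
  dk W k F -> (forall x, U x -> W (h x)) ->
  (forall j, dk U k (fun x => h x 0 j)) -> dk U k (fun x => F (h x)).
Proof.
move=> HF hU; elim: k F HF => [|k IH] F [dF DF] Hh; split=> //.
- move=> x Ux; apply: differentiable_comp; last by apply: dF; apply: hU.
  by apply: differentiable_rV => j; apply: (dk_differentiable (Hh j)).
- move=> x Ux; apply: differentiable_comp; last by apply: dF; apply: hU.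
  by apply: differentiable_rV => j; apply: (dk_differentiable (Hh j)).
move=> v.
have Hs : dk U k (fun x => \sum_(j < m)
    pd j F (h x) * 'D_v (fun y => h y 0 j) x).
  apply: dk_sum => j _; apply: dk_mul; last by have [_] := Hh j; apply.
  by apply: IH; [apply: DF | move=> i; apply: dk_pred].
apply: dk_eq Hs => x Ux.
rewrite -derive_comp_rV //; last by apply: dF; apply: hU.
by move=> j; apply: (dk_differentiable (Hh j)).
Qed.

Lemma is_derive_comp1 (F : R -> R) (dF : R) f x v :
  is_derive (f x) 1 F dF -> differentiable f x ->
  differentiable (F \o f) x /\ 'D_v (F \o f) x = dF * 'D_v f x.
Proof.
move=> [HF1 HF2] df.
have dF' : differentiable F (f x) by apply/derivable1_diffP.
split; first exact: differentiable_comp.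
rewrite deriveE; last exact: differentiable_comp.
have e1 : 'd F (f x) 1 = dF by rewrite -deriveE.
rewrite diff_comp // /= (deriveE _ df) -e1; set w := 'd f x v.
by rewrite -{1}[w]mulr1 [LHS]linearZ /= [LHS]mulrC.
Qed.

Lemma dk_expR k f : dk U k f -> dk U k (fun x => expR (f x)).
Proof.
elim: k => [|k IH] Hf; have [df Df] := Hf; split=> //; try by
  move=> x Ux; have [] := is_derive_comp1 0 (is_derive_expR (f x)) (df x Ux).
move=> v; apply: dk_eq (dk_mul (IH (dk_pred Hf)) (Df v)) => x Ux.
by have [_ <-] := is_derive_comp1 v (is_derive_expR (f x)) (df x Ux).
Qed.

Lemma dk_ln k f : (forall x, U x -> 0 < f x) ->
  dk U k f -> dk U k (fun x => ln (f x)).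
Proof.
move=> f0; case: k => [|k] Hf; have [df Df] := Hf; split=> //; try by
  move=> x Ux; have [] := is_derive_comp1 0 (is_derive1_ln (f0 x Ux)) (df x Ux).
move=> v.
have fn0 x : U x -> f x != 0 by move=> Ux; rewrite gt_eqF // f0.
apply: dk_eq (dk_mul (dk_inv fn0 (dk_pred Hf)) (Df v)) => x Ux.
by have [_ <-] := is_derive_comp1 v (is_derive1_ln (f0 x Ux)) (df x Ux).
Qed.

End OneSpace.

Lemma dk_sub_set (V : normedModType R) (U W : set V) k (f : V -> R) : U `<=` W ->
  dk W k f -> dk U k f.
Proof.
move=> UW; elim: k f => [|k IH] f [df Df]; split=> //; try by
  move=> x /UW; apply: df.
by move=> v; exact: IH (Df v).
Qed.

Lemma dk_linear (V W : normedModType R) (U : set V) k (L : {linear V -> R}) :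
  open U -> continuous L -> dk U k L.
Proof.
move=> oU cL; have dL x : differentiable L x by apply: linear_differentiable.
case: k => [|k]; split=> // v.
apply: (dk_eq oU) (dk_cst oU k (L v)) => x Ux.
by rewrite deriveE // diff_lin.
Qed.

Lemma derive_coord m (x v : 'rV[R]_m) j : 'D_v (fun y : 'rV[R]_m => y 0 j : R) x = v 0 j.
Proof.
have /diff_derivable : differentiable (@id 'rV[R]_m) x by [].
move=> /(_ v)/derive_mx; rewrite derive_id => /(congr1 (fun w : 'rV[R]_m => w 0 j)).
by rewrite !mxE.
Qed.

Lemma dk_coord m (U : set 'rV[R]_m) k j : open U -> dk U k (fun x => x 0 j).
Proof.
move=> oU; have dL x : differentiable (fun y : 'rV[R]_m => y 0 j : R) x.
  exact: differentiable_coord.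
case: k => [|k]; split=> // v.
by apply: (dk_eq oU) (dk_cst oU k (v 0 j)) => x Ux; rewrite derive_coord.
Qed.

End Calculus.

(** * Mean value theorem on lines; differentiability from continuous partial derivatives *)

Section Lines.
Context {R : realType}.

Lemma is_derive_line (V : normedModType R) (f : V -> R) x v (t : R) :
  derivable f (t *: v + x) v ->
  is_derive t 1 (fun s : R => f (s *: v + x)) ('D_v f (t *: v + x)).
Proof.
move=> df.
have E : (fun h : R => h^-1 *: (f (h *: v + (t *: v + x)) - f (t *: v + x))) =
  (fun h : R => h^-1 *: (f ((h *: 1 + t) *: v + x) - f (t *: v + x))).
  by apply/funext => h; rewrite addrA -scalerDl [h *: 1]mulr1.
by constructor; rewrite /derivable /derive /= -E.
Qed.

(** Absolute values are used because the increment h will be a coordinate of a vector, of either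
    sign. *)
Lemma MVT_at0 (F dF : R -> R) (h : R) :
  (forall s : R, `|s| <= `|h| -> is_derive s 1 F (dF s)) ->
  exists2 s, `|s| <= `|h| & F h - F 0 = dF s * h.
Proof.
move=> HF.
have cont a b : (forall s, s \in `[a, b] -> `|s| <= `|h|) ->
    {within `[a, b], continuous F}.
  move=> Hab; apply: derivable_within_continuous => s /Hab/HF[] //.
have [h0|h0] := leP 0 h.
  have Hs s : s \in `[0, h] -> `|s| <= `|h|.
    by rewrite in_itv /= => /andP[s0 sh]; rewrite !ger0_norm.
  have [] := @MVT_segment R F dF 0 h h0 _ (cont _ _ Hs).
    by move=> s; rewrite in_itv /= => /andP[s0 sh]; apply: HF; rewrite !ger0_norm // ltW.
  by move=> c /Hs ch E; exists c => //; rewrite E subr0.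
have Hs s : s \in `[h, 0] -> `|s| <= `|h|.
  rewrite in_itv /= => /andP[s0 sh]; rewrite !ler0_norm ?lerN2 //; exact: ltW.
have [] := @MVT_segment R F dF h 0 (ltW h0) _ (cont _ _ Hs).
  move=> s sh; apply: HF; apply: Hs; move: sh; rewrite !in_itv /=.
  by move=> /andP[/ltW -> /ltW ->].
move=> c /Hs ch E; exists c => //.
by rewrite -[LHS]opprB E sub0r mulrN opprK.
Qed.

Lemma MVT_line (V : normedModType R) (f : V -> R) x v (t : R) :
  (forall s, `|s| <= `|t| -> derivable f (s *: v + x) v) ->
  exists2 s, `|s| <= `|t| & f (t *: v + x) - f x = 'D_v f (s *: v + x) * t.
Proof.
move=> df.
have [|s st] := @MVT_at0 (fun s => f (s *: v + x)) (fun s => 'D_v f (s *: v + x)) t.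
  by move=> s /df; apply: is_derive_line.
by rewrite scale0r add0r => E; exists s.
Qed.

Lemma rV_norm_coord m (v : 'rV[R]_m) j : `|v 0 j| <= `|v|.
Proof.
rewrite [leRHS]/Num.Def.normr/= mx_normrE.
by apply: le_trans (le_bigmax _ _ (ord0, j)); rewrite /=.
Qed.

Lemma rV_norm_le m (v : 'rV[R]_m) (e : R) : 0 <= e ->
  (forall j, `|v 0 j| <= e) -> `|v| <= e.
Proof.
move=> e0 H; rewrite [leLHS]/Num.Def.normr/= mx_normrE.
by apply: bigmax_le => // -[i j] _ /=; rewrite ord1.
Qed.

(** The vectors [trunc h k], for k from 0 to m, are the corners of a path from 0 to h parallel to
    the axes. *)
Let trunc m (h : 'rV[R]_m) (k : nat) : 'rV[R]_m :=
  \row_j (if (j < k)%N then h 0 j else 0).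

Lemma continuous_rV_fun m (V : normedModType R) (L : 'rV[R]_m -> V) :
  linear L -> continuous L.
Proof.
move=> linL; pose LL : {linear 'rV[R]_m -> V} :=
  HB.pack L (GRing.isLinear.Build _ _ _ _ L linL).
have -> : L = (fun x => \sum_(j < m) (fun z : 'rV[R]_m => (z 0 j : R) *: L (delta_mx 0 j)) x).
  apply/funext => x; rewrite -[L]/(LL : _ -> _) {1}(row_sum_delta x) linear_sum.
  by apply: eq_bigr => j _; rewrite linearZ.
move=> x; apply: differentiable_continuous.
have -> : (fun x => \sum_(j < m) (fun z : 'rV[R]_m => (z 0 j : R) *: L (delta_mx 0 j)) x)
  = \sum_(j < m) (fun z : 'rV[R]_m => (z 0 j : R) *: L (delta_mx 0 j)).
  by apply/funext => y; rewrite fct_sumE.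
by apply: differentiable_sum => j; apply: differentiableZl; apply: differentiable_coord.
Qed.

(* The increment f (h + x) - f x is split along the coordinates, and the mean
   value theorem applies to each piece. *)
Lemma C1_differentiable m (U : set 'rV[R]_m) (f : 'rV[R]_m -> R) x :
  open U -> U x ->
  (forall j y, U y -> derivable f y (delta_mx 0 j)) ->
  (forall j, {for x, continuous (pd j f)}) ->
  differentiable f x.
Proof.
move=> oU Ux df cf.
pose L (h : 'rV[R]_m) := \sum_(j < m) h 0 j * pd j f x.
have linL : linear L.
  move=> a u v; rewrite /L scaler_sumr -big_split /=; apply: eq_bigr => j _.
  by rewrite !mxE mulrDl -mulrA.
have [] // := @eps_diff R _ _ f L x linL (continuous_rV_fun linL).
move=> e e0.
have m0 : 0 < m%:R + 1 :> R by rewrite ltr_wpDl.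
have near0 : \forall y \near x, forall j, `|pd j f x - pd j f y| <= e / (m%:R + 1).
  apply: (@filter_forall _ _ (fun j y => `|pd j f x - pd j f y| <= e / (m%:R + 1)) (nbhs x) (nbhs_filter x)) => j.
  by have /cvgrPdist_le /(_ (e / (m%:R + 1))) := cf j; apply; rewrite divr_gt0.
have near1 : \forall y \near x, U y /\ forall j, `|pd j f x - pd j f y| <= e / (m%:R + 1).
  by apply: filterS2 (openP oU Ux) near0 => y.
have [d /= d0 Hd] := (nbhs_ballP _ _).1 near1.
apply/nbhs_ballP; exists d => //= h; rewrite -ball_normE /= sub0r normrN => hd.
have Hb y : `|y - x| <= `|h| -> U y /\ forall j, `|pd j f x - pd j f y| <= e / (m%:R + 1).
  by move=> yx; apply: Hd; rewrite -ball_normE /= distrC (le_lt_trans yx).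
have trS (j : 'I_m) : trunc h j.+1 = h 0 j *: delta_mx 0 j + trunc h j.
  apply/rowP => i; rewrite !mxE eqxx /= ltnS leq_eqVlt.
  have [->|ij] := eqVneq i j; first by rewrite eqxx /= ltnn mulr1 addr0.
  by rewrite eq_sym val_eqE eq_sym (negbTE ij) /= mulr0 add0r.
have key (j : 'I_m) : `|f (trunc h j.+1 + x) - f (trunc h j + x) - h 0 j * pd j f x|
    <= e / (m%:R + 1) * `|h|.
  have inb s : `|s| <= `|h 0 j| -> `|s *: delta_mx 0 j + (trunc h j + x) - x| <= `|h|.
    move=> sh; rewrite addrA addrK; apply: rV_norm_le => // i; rewrite !mxE eqxx /=.
    have [->|ij] := eqVneq i j.
      by rewrite ltnn mulr1 addr0 (le_trans sh) // rV_norm_coord.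
    by rewrite mulr0 add0r; case: ifP => _; rewrite ?normr0 // rV_norm_coord.
  have [s sh E] := @MVT_line _ f (trunc h j + x) (delta_mx 0 j) (h 0 j)
    (fun s sh => df j _ (proj1 (Hb _ (inb s sh)))).
  have [_ /(_ j) Hs] := Hb _ (inb s sh).
  rewrite trS -[X in f X]addrA E [h 0 j * _]mulrC -mulrBl normrM distrC.
  by apply: ler_pM => //; apply: rV_norm_coord.
have -> : f (h + x) - f x - L h =
  \sum_(j < m) (f (trunc h j.+1 + x) - f (trunc h j + x) - h 0 j * pd j f x).
  rewrite sumrB -(big_mkord xpredT (fun j => f (trunc h j.+1 + x) - f (trunc h j + x))).
  rewrite telescope_sumr //; congr (f (_ + _) - f _ - _).
    by apply/rowP => i; rewrite mxE ltn_ord.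
  by rewrite -[LHS]add0r; congr (_ + _); apply/rowP => i; rewrite !mxE.
rewrite (le_trans (ler_norm_sum _ _ _)) //.
rewrite (le_trans (ler_sum _ (fun j _ => key j))) // sumr_const card_ord -[leLHS]mulr_natr.
have -> : e / (m%:R + 1) * `|h| * m%:R = e * `|h| * (m%:R / (m%:R + 1)) by ring.
rewrite ler_piMr //; first by rewrite mulr_ge0 // ltW.
by rewrite ler_pdivrMr // mul1r lerDl.
Qed.

(** One order is lost, because the Frechet differentiability of a derivative is deduced from the
    continuity of its partial derivatives. Smooth functions do not feel the loss. *)
Lemma Ck_on_dk m (U : set 'rV[R]_m) k (f : 'rV[R]_m -> R) :
  open U -> Ck_on U k.+1 f -> dk U k f.
Proof.
move=> oU; elim: k f => [|k IH] f /= [cf Df]; split=> //; try by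
  move=> x Ux; apply: (C1_differentiable oU Ux) => [j y Uy|j];
    [have [/(_ _ Uy)] := Df (delta_mx 0 j) |
     have [_ [/(_ x Ux)]] := Df (delta_mx 0 j)].
by move=> v; apply: IH; have [_] := Df v.
Qed.

Lemma smooth_on_smo m (U : set 'rV[R]_m) (f : 'rV[R]_m -> R) :
  open U -> smooth_on U f -> smo U f.
Proof. by move=> oU sf k; apply: Ck_on_dk => //; apply: sf. Qed.

Section Reparametrization.
Variables (n : nat).
(** [Cn n] is a product and not a space of row vectors, so [C1_differentiable] does not apply to it
    directly; the result is transported from R^(2n). *)
Let toCn (w : 'rV[R]_(n + n)) : Cn n := (lsubmx w, rsubmx w).
Let ofCn (z : Cn n) : 'rV[R]_(n + n) := row_mx z.1 z.2.

Lemma derive_toCn (f : Cn n -> R) w v :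
  (derivable f (toCn w) (toCn v) -> derivable (f \o toCn) w v) /\
  'D_v (f \o toCn) w = 'D_(toCn v) f (toCn w).
Proof.
have E : (fun h : R => h^-1 *: ((f \o toCn) (h *: v + w) - (f \o toCn) w)) =
  (fun h : R => h^-1 *: (f (h *: toCn v + toCn w) - f (toCn w))).
  apply/funext => h /=; congr (_ *: (f _ - _)).
  by rewrite /toCn !linearD !linearZ.
by rewrite /derivable /derive E.
Qed.

Lemma toCn_continuous : continuous toCn.
Proof.
move=> w; apply: differentiable_continuous; apply: differentiable_pair.
  exact: differentiable_lsubmx.
exact: differentiable_rsubmx.
Qed.

Lemma Ck_on_toCn k (f : Cn n -> R) : Ck_on setT k f -> Ck_on setT k (f \o toCn).
Proof.
elim: k f => [|k IH] f [cf Df]; split=> //; try by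
  move=> x _; apply: continuous_comp; [apply: toCn_continuous|apply: cf].
move=> v; have [dv Dv] := Df (toCn v); split.
  by move=> x _; apply: (derive_toCn f x v).1; apply: dv.
have -> : 'D_v (f \o toCn) = 'D_(toCn v) f \o toCn.
  by apply/funext => x; rewrite (derive_toCn f x v).2.
exact: IH.
Qed.

Lemma differentiable_ofCn z : differentiable ofCn z.
Proof.
have -> : ofCn = (fun z : Cn n => z.1 *m row_mx 1%:M 0 + z.2 *m row_mx 0 1%:M).
  apply/funext => w; rewrite !mul_mx_row !mulmx1 !mulmx0 add_row_mx addr0 add0r //.
have lin1 : linear (fun z : 'rV[R]_n => z *m row_mx 1%:M 0 : 'rV[R]_(n+n)).
  by move=> a u v; rewrite mulmxDl scalemxAl.
have lin2 : linear (fun z : 'rV[R]_n => z *m row_mx 0 1%:M : 'rV[R]_(n+n)).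
  by move=> a u v; rewrite mulmxDl scalemxAl.
have dlin (L : 'rV[R]_n -> 'rV[R]_(n + n)) u : linear L -> differentiable L u.
  move=> linL; pose LL : {linear 'rV[R]_n -> 'rV[R]_(n + n)} :=
    HB.pack L (GRing.isLinear.Build _ _ _ _ L linL).
  exact: (@linear_differentiable _ _ _ LL u (continuous_rV_fun linL)).
apply: differentiableD.
  apply: (differentiable_comp (f := fst) (g := fun z => z *m _)); last exact: dlin.
  have lf : linear (fst : Cn n -> 'rV[R]_n) by [].
  pose LL : {linear Cn n -> 'rV[R]_n} :=
    HB.pack (fst : Cn n -> _) (GRing.isLinear.Build _ _ _ _ (fst : Cn n -> _) lf).
  by apply: (@linear_differentiable _ _ _ LL z) => w; apply: cvg_fst.
apply: (differentiable_comp (f := snd) (g := fun z => z *m _)); last exact: dlin.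
have lf : linear (snd : Cn n -> 'rV[R]_n) by [].
pose LL : {linear Cn n -> 'rV[R]_n} :=
  HB.pack (snd : Cn n -> _) (GRing.isLinear.Build _ _ _ _ (snd : Cn n -> _) lf).
by apply: (@linear_differentiable _ _ _ LL z) => w; apply: cvg_snd.
Qed.

Lemma ofCnK z : toCn (ofCn z) = z.
Proof. by case: z => a b; rewrite /toCn /ofCn /= row_mxKl row_mxKr. Qed.

Lemma Ck_on_Cn_dk k (f : Cn n -> R) : Ck_on setT k.+1 f -> dk setT k f.
Proof.
have toC (g : Cn n -> R) k' : Ck_on setT k'.+1 g -> forall z, differentiable g z.
  move=> /(@Ck_on_toCn k'.+1) /(Ck_on_dk openT) dg z.
  have -> : g = (g \o toCn) \o ofCn by apply/funext => w /=; rewrite ofCnK.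
  apply: differentiable_comp; first exact: differentiable_ofCn.
  exact: (dk_differentiable dg).
elim: k f => [|k IH] f Hf; split=> //; try by move=> x _; apply: toC Hf _.
by move=> v; apply: IH; case: Hf => _ /(_ v)[].
Qed.

Lemma smooth_on_Cn_smo (f : Cn n -> R) : smooth_on setT f -> smo setT f.
Proof. by move=> sf k; apply: Ck_on_Cn_dk; apply: sf. Qed.

End Reparametrization.

End Lines.

(** * Maxima, convexity, inverse maps and Hessians *)

Section MoreCalculus.
Context {R : realType}.

Lemma MVT_line_pos (V : normedModType R) (f : V -> R) x v (t : R) : 0 < t ->
  (forall s, derivable f (s *: v + x) v) ->
  exists2 s, 0 < s < t & f (t *: v + x) - f x = 'D_v f (s *: v + x) * t.
Proof.
move=> t0 df.
have dF (s : R) : is_derive s 1 (fun s : R => f (s *: v + x)) ('D_v f (s *: v + x)).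
  exact: is_derive_line.
have cF : {within `[0, t], continuous (fun s : R => f (s *: v + x))}.
  by apply: derivable_within_continuous => s _; case: (dF s).
have [s] := @MVT R (fun s : R => f (s *: v + x)) (fun s => 'D_v f (s *: v + x)) 0 t t0
  (fun s _ => dF s) cF.
by rewrite in_itv /= scale0r add0r subr0 => st E; exists s.
Qed.

Lemma derive_pos_gt0 (V : normedModType R) (G : V -> R) x v :
  differentiable G x -> G x = 0 -> 0 < 'D_v G x ->
  exists2 d, 0 < d & forall s, 0 < s -> s < d -> 0 < G (s *: v + x).
Proof.
move=> dG G0 c0.
have /cvgrPdist_lt /(_ _ c0) [d /= d0 Hd] := diff_derivable (v := v) dG.
exists d => // s s0 sd.
have := Hd s; rewrite /= sub0r normrN gtr0_norm // => /(_ sd).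
rewrite gt_eqF // => /(_ isT).
rewrite ltr_norml => /andP[_].
rewrite -[X in X - _]/('D_v G x) ltrBlDl ltrDr.
by rewrite G0 subr0 [_ *: _]/(_ * _) pmulr_rgt0 ?invr_gt0.
Qed.

(** If the second derivative were positive, the first one, which vanishes at x, would be positive on
    a short segment along v, and f would increase there by the mean value theorem. *)
Lemma derive_at_max (V : normedModType R) (f : V -> R) x v :
  dk setT 1 f -> (forall y, f y <= f x) ->
  'D_v f x = 0 /\ 'D_v ('D_v f) x <= 0.
Proof.
move=> [df /(_ v)[ddf _]] fmax.
have dF (s : R) : is_derive s 1 (fun s : R => f (s *: v + x)) ('D_v f (s *: v + x)).
  by apply: is_derive_line; apply: diff_derivable; apply: df.
have z0 : 'D_v f x = 0.
  have l : (-1 : R) <= 1 by lra.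
  have i0 : (0 : R) \in `]-1, 1[ by rewrite in_itv /=; lra.
  have dF' (s : R) : derivable (fun s : R => f (s *: v + x)) s 1 by case: (dF s).
  have mF (s : R) : f (s *: v + x) <= f (0 *: v + x).
    by rewrite scale0r add0r; apply: fmax.
  have [_ H] := @derive1_at_max R (fun s : R => f (s *: v + x)) (-1) 1 0 l
    (fun s _ => dF' s) i0 (fun s _ => mF s).
  by have [_] := dF 0; rewrite H scale0r add0r.
split=> //; rewrite leNgt; apply/negP => c0.
set c : R := 'D_v ('D_v f) x in c0.
have [d d0 Hd] := derive_pos_gt0 (ddf x I) z0 c0.
have d2 : 0 < d / 2 by rewrite divr_gt0.
have [s /andP[s0 sd] E] := @MVT_line_pos _ f x v (d / 2) d2
   (fun s => @diff_derivable _ _ _ f _ v (df (s *: v + x) I)).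
have Ds := Hd s s0 (lt_trans sd _).
have := fmax (d / 2 *: v + x); rewrite -subr_le0 E leNgt.
rewrite mulr_gt0 //; apply: Ds.
by rewrite ltr_pdivrMr // ltr_pMr // ltr1n.
Qed.

Lemma convex_tangent (V : normedModType R) (f : V -> R) x v :
  dk setT 1 f -> (forall y, 0 <= 'D_v ('D_v f) y) ->
  f x + 'D_v f x <= f (v + x).
Proof.
move=> [df /(_ v)[ddf _]] cvx.
have [s /andP[s0 _]] := @MVT_line_pos _ f x v 1 ltr01
   (fun s => @diff_derivable _ _ _ f _ v (df (s *: v + x) I)).
rewrite scale1r mulr1 => E.
have [s' _ E'] := @MVT_line_pos _ ('D_v f) x v s s0
   (fun s => @diff_derivable _ _ _ _ _ v (ddf (s *: v + x) I)).
rewrite addrC -lerBrDr E -subr_ge0 E'.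
by rewrite mulr_ge0 // ltW.
Qed.

(** Takes the place of the inverse function theorem: the inverse branch h will be obtained from a
    variational problem and shown continuous by compactness, so that only its differentiability
    remains. *)
Lemma inverse_differentiable (V : normedModType R) n (h : V -> 'rV[R]_n)
    (Phi : 'rV[R]_n -> 'rV[R]_n) v0 :
  {for v0, continuous h} -> differentiable Phi (h v0) ->
  (forall w, 'd Phi (h v0) w = 0 -> w = 0) ->
  differentiable (Phi \o h) v0 -> differentiable h v0.
Proof.
move=> ch dPhi inj dPh.
pose J := lin1_mx ('d Phi (h v0)).
have JE w : 'd Phi (h v0) w = w *m J by rewrite mul_rV_lin1.
have uJ : J \in unitmx.
  rewrite -row_free_unit -kermx_eq0; apply/eqP/row_matrixP => i; rewrite row0.
  apply: inj; rewrite JE; have /sub_kermxP := row_sub i (kermx J) => //.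
have dN := diff_continuous dPh.
pose L (w : 'rV[R]_n) := w *m invmx J.
have linL : linear L by move=> a u w; rewrite /L mulmxDl scalemxAl.
pose LL : {linear 'rV[R]_n -> 'rV[R]_n} :=
  HB.pack L (GRing.isLinear.Build _ _ _ _ L linL).
have [K K0 HK] := @linear_lipschitz R _ _ LL (continuous_rV_fun linL).
have [KN KN0 HN] := linear_lipschitz dN.
pose N := 'd (Phi \o h) v0.
have linM : linear (fun v => L (N v)).
  by move=> a u w; rewrite /= /N linearP linL.
have cM : continuous (fun v => L (N v)).
  move=> w; apply: continuous_comp; first exact: dN.
  exact: (continuous_rV_fun linL).
have [] // := @eps_diff R _ _ h (fun v => L (N v)) v0 linM cM.
move=> e e0.
pose KM := K * KN.
have KM0 : 0 < KM by rewrite mulr_gt0.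
(* With d the increment of h, the error is at most K (e1 |u| + e2 |d|). Absorbing the term in |d|
   first gives |d| <= 2 (KM + e / 2) |u|; the two constants then make each half of the error at most
   e / 2 |u|. *)
pose e1 := e / (2 * K); pose e2 := e / (4 * K * (KM + e)).
have e10 : 0 < e1 by rewrite divr_gt0 // mulr_gt0.
have e20 : 0 < e2 by rewrite divr_gt0 // !mulr_gt0 // addr_gt0.
have n2 : \forall u \near (0 : V),
    `|Phi (h (u + v0)) - Phi (h v0) - 'd Phi (h v0) (h (u + v0) - h v0)|
      <= e2 * `|h (u + v0) - h v0|.
  have H := diff_eps dPhi e20.
  have : (fun u : V => h (u + v0) - h v0) @ (0 : V) --> (0 : 'rV[R]_n).
    rewrite -[X in _ --> X](subrr (h v0)); apply: cvgB; last exact: cvg_cst.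
    have cs : {for 0, continuous (fun u : V => u + v0)}.
      by apply: cvgD; [exact: cvg_id|exact: cvg_cst].
    by apply: (cvg_comp _ _ cs); rewrite /= add0r; exact: ch.
  move=> /(_ _ H) H'.
  have {}H' : \forall u \near (0 : V),
     `|Phi (h (u + v0) - h v0 + h v0) - Phi (h v0) - 'd Phi (h v0) (h (u + v0) - h v0)|
      <= e2 * `|h (u + v0) - h v0| := H'.
  by apply: filterS H' => u; rewrite subrK.
have n1 := diff_eps dPh e10.
near=> u.
have h1 : `|Phi (h (u + v0)) - Phi (h v0) - N u| <= e1 * `|u| by near: u.
have h2 : `|Phi (h (u + v0)) - Phi (h v0) - 'd Phi (h v0) (h (u + v0) - h v0)|
      <= e2 * `|h (u + v0) - h v0| by near: u.
set d := h (u + v0) - h v0 in h2 *.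
set q := Phi (h (u + v0)) - Phi (h v0) in h1 h2.
have dE : d - L (N u) = L (q - N u) - L (q - 'd Phi (h v0) d).
  transitivity (L ('d Phi (h v0) d) - L (N u)); first by rewrite /L JE mulmxK.
  rewrite /L -!mulmxBl; congr (_ *m _).
  by rewrite opprB [RHS]addrC addrA subrK.
have b1 : `|d - L (N u)| <= K * (e1 * `|u| + e2 * `|d|).
  rewrite dE (le_trans (ler_normB _ _)) // mulrDr; apply: lerD.
    by rewrite (le_trans (HK _)) // ler_wpM2l // ltW.
  by rewrite (le_trans (HK _)) // ler_wpM2l // ltW.
have b2 : `|L (N u)| <= KM * `|u|.
  by rewrite (le_trans (HK _)) // /KM -mulrA ler_wpM2l ?(ltW K0) // HN.
have b3 : `|d| <= KM * `|u| + K * (e1 * `|u| + e2 * `|d|).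
  have E : d = L (N u) + (d - L (N u)) by rewrite addrC subrK.
  by rewrite {1}E (le_trans (ler_normD _ _)) // lerD.
apply: (le_trans b1).
have Ke1 : K * e1 = e / 2 by rewrite /e1; field; rewrite gt_eqF.
have Ke2 : K * e2 = e / (4 * (KM + e)).
  by rewrite /e2; field; rewrite !gt_eqF // addr_gt0.
have u0 : 0 <= `|u| by [].
have d0 : 0 <= `|d| by [].
clear cM linM HN dN; clearbody e1 e2 KM.
move: b3; rewrite mulrDr !mulrA Ke1 Ke2.
set z := e / (4 * (KM + e)).
have zE : z * (KM + e) = e / 4 by rewrite /z; field; rewrite gt_eqF // addr_gt0.
have z0 : 0 < z by rewrite divr_gt0 // mulr_gt0 // addr_gt0.
have z4 : z <= 1 / 4.
  by rewrite /z ler_pdivrMr ?mulr_gt0 ?addr_gt0 //; lra.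
move=> b3.
have b4 : `|d| <= 2 * (KM + e / 2) * `|u| by nra.
have b5 : z * `|d| <= z * (2 * (KM + e / 2) * `|u|) by rewrite ler_wpM2l // ltW.
have b6 : z * (2 * (KM + e / 2) * `|u|) <= e / 2 * `|u|.
  rewrite !mulrA ler_wpM2r //.
  have : 0 <= z * e by rewrite mulr_ge0 // ltW.
  by move: zE; lra.
by lra.
Unshelve. all: by end_near. Qed.

Lemma dk_det (V : normedModType R) (U : set V) k n (A : V -> 'M[R]_n) : open U ->
  (forall i j, dk U k (fun x => A x i j)) -> dk U k (fun x => \det (A x)).
Proof.
move=> oU HA; rewrite /determinant; apply: dk_sum => // s _.
by apply: dk_mul => //; [exact: dk_cst|apply: dk_prod].
Qed.

Lemma dk_invmx (V : normedModType R) (U : set V) k n (A : V -> 'M[R]_n) i j : open U ->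
  (forall i j, dk U k (fun x => A x i j)) -> (forall x, U x -> \det (A x) != 0) ->
  dk U k (fun x => invmx (A x) i j).
Proof.
move=> oU HA A0.
apply: (dk_eq oU (f := fun x => (\det (A x))^-1 * (\adj (A x) i j))).
  by move=> x Ux; rewrite /invmx unitmxE unitfE (A0 x Ux) [RHS]mxE.
apply: dk_mul => //; first by apply: dk_inv => //; apply: dk_det.
apply: (dk_eq oU (f := fun x => cofactor (A x) j i)).
  by move=> x _; rewrite mxE.
rewrite /cofactor; apply: dk_mul => //; first exact: dk_cst.
apply: dk_det => // a b.
by apply: (dk_eq oU) (HA (lift j a) (lift i b)) => x _; rewrite !mxE.
Qed.

Lemma derive_dotrv n (f : 'rV[R]_n -> R) x v : differentiable f x ->
  'D_v f x = dotrv v (grad f x).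
Proof.
move=> df; rewrite differentiable_derive_sum //.
by apply: eq_bigr => j _; rewrite mxE.
Qed.

Lemma derive_hess n (U : set 'rV[R]_n) (f : 'rV[R]_n -> R) x u v :
  open U -> dk U 1 f -> U x ->
  'D_u ('D_v f) x = (u *m hess f x *m v^T) 0 0.
Proof.
move=> oU [df Df] Ux.
have dpd j : differentiable (pd j f) x by have [] := Df (delta_mx 0 j) => /(_ x Ux).
rewrite (eq_derive_on (f := 'D_v f) (g := fun y => \sum_j v 0 j * pd j f y) u oU) //;
  last by move=> y Uy; rewrite differentiable_derive_sum //; apply: df.
have dv j : differentiable (fun y => v 0 j * pd j f y) x.
  by apply: differentiableM.
have -> : (fun y => \sum_j v 0 j * pd j f y) = \sum_j (fun y => v 0 j * pd j f y).
  by apply/funext => y; rewrite fct_sumE.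
rewrite derive_sum; last by move=> j; apply: diff_derivable.
rewrite !mxE; apply: eq_bigr => j _.
rewrite (@deriveM _ _ (cst (v 0 j)) (pd j f)) //; last exact: diff_derivable.
rewrite derive_cst scaler0 addr0 differentiable_derive_sum // !mxE.
rewrite [_ *: _]mulrC; congr (_ * _); apply: eq_bigr => i _; by rewrite mxE.
Qed.

End MoreCalculus.

(** * Positive definite matrices *)

Section PositiveDefinite.
Context {R : realType}.

Definition qf n (A : 'M[R]_n) (v w : 'rV[R]_n) : R := (v *m A *m w^T) 0 0.

Definition posdef n (A : 'M[R]_n) :=
  A^T = A /\ forall v : 'rV[R]_n, v != 0 -> 0 < qf A v v.

Lemma qfE n (A : 'M[R]_n) v w :
  qf A v w = \sum_(i < n) \sum_(j < n) v 0 i * A i j * w 0 j.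
Proof.
rewrite /qf mxE exchange_big /=; apply: eq_bigr => j _.
by rewrite !mxE mulr_suml.
Qed.

Lemma qf_delta n (A : 'M[R]_n) i j : qf A (delta_mx 0 i) (delta_mx 0 j) = A i j.
Proof. by rewrite /qf -rowE trmx_delta -colE !mxE. Qed.

Lemma posdef_ge0 n (A : 'M[R]_n) v : posdef A -> 0 <= qf A v v.
Proof.
move=> [_ pA]; have [->|/pA/ltW//] := eqVneq v 0.
by rewrite /qf mul0mx mul0mx mxE.
Qed.

Lemma posdef_diag_gt0 n (A : 'M[R]_n) i : posdef A -> 0 < A i i.
Proof.
move=> [_ pA]; rewrite -qf_delta; apply: pA.
by apply/negP => /eqP /(congr1 (fun v : 'rV[R]_n => v 0 i));
  rewrite !mxE !eqxx => /eqP; rewrite oner_eq0.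
Qed.

Lemma posdef_unit n (A : 'M[R]_n) : (forall v, v != 0 -> 0 < qf A v v) -> A \in unitmx.
Proof.
move=> pA; rewrite -row_free_unit -kermx_eq0; apply/eqP/row_matrixP => i.
rewrite row0; apply/eqP; apply: contraT => /pA.
by have /sub_kermxP := row_sub i (kermx A); rewrite /qf => ->; rewrite mul0mx mxE ltxx.
Qed.

Lemma posdef_congr n (A T : 'M[R]_n) : posdef A -> T \in unitmx -> posdef (T *m A *m T^T).
Proof.
move=> [sA pA] uT; split; first by rewrite !trmx_mul trmxK sA mulmxA.
move=> v v0; have -> : qf (T *m A *m T^T) v v = qf A (v *m T) (v *m T).
  by rewrite /qf trmx_mul !mulmxA.
by apply: pA; apply: contraNneq v0 => vT; rewrite -(mulmxK uT v) vT mul0mx.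
Qed.

Lemma posdef_inv n (A : 'M[R]_n) : posdef A -> posdef (invmx A).
Proof.
move=> pA; have uA := posdef_unit pA.2.
have := posdef_congr pA (T := invmx A); rewrite unitmx_inv uA => /(_ isT).
by rewrite trmx_inv pA.1 mulVmx // mul1mx.
Qed.

Section Schur.
Variables (n : nat) (A : 'M[R]_(1 + n)).
Hypothesis pA : posdef A.
Let a := A 0 0.
Let b := ursubmx A : 'rV[R]_n.
Let T : 'M[R]_(1 + n) := block_mx 1%:M (a^-1 *: b) 0 1%:M.
Definition schur : 'M[R]_n := drsubmx A - a^-1 *: (b^T *m b).

Let a0 : 0 < a. Proof. exact: posdef_diag_gt0. Qed.

Let AE : A = block_mx a%:M b b^T (drsubmx A).
Proof.
rewrite -{1}[A]submxK; congr block_mx.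
  by apply/matrixP => i j; rewrite !ord1 !mxE eqxx /= /a; congr (A _ _); apply: val_inj.
by rewrite /b -{1}pA.1 trmx_ursub.
Qed.

Lemma schurE : A = T^T *m block_mx a%:M 0 0 schur *m T.
Proof.
rewrite {1}AE /T tr_block_mx !trmx1 trmx0 !mulmx_block !mul1mx !mul0mx !mulmx1 !mulmx0
  !addr0 ?add0r linearZ /=.
rewrite mul_scalar_mx mul_mx_scalar !scalerA mulVf ?gt_eqF // scale1r.
rewrite [(_ *: b)^T]linearZ /= !scalerA mulfV ?gt_eqF // !scale1r -scalemxAr.
by rewrite /schur addrC subrK.
Qed.

Lemma schur_unit : T \in unitmx /\ \det T = 1.
Proof. by split; [rewrite unitmxE|]; rewrite det_ublock !det1 mulr1 ?unitr1. Qed.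

Lemma schur_det : \det A = a * \det schur.
Proof.
have [_ dT] := schur_unit.
by rewrite {1}schurE !det_mulmx det_tr dT mul1r mulr1 det_ublock det_scalar1.
Qed.

Lemma schur_posdef : posdef schur.
Proof.
split.
  rewrite /schur linearB linearZ /= trmx_mul trmxK; congr (_ - _).
  by rewrite trmx_drsub pA.1.
move=> w w0; pose v : 'rV[R]_(1 + n) := row_mx (- (w *m (a^-1 *: b)^T)) w.
have vT : v *m T^T = row_mx 0 w.
  by rewrite /v /T tr_block_mx mul_row_block !trmx1 !mulmx1 trmx0 mulmx0 add0r addNr.
have -> : qf schur w w = qf A v v.
  transitivity (qf (T^T *m block_mx a%:M 0 0 schur *m T) v v); last by rewrite -schurE.
  rewrite /qf !mulmxA vT -[_ *m T *m _]mulmxA -[T *m _]trmxK trmx_mul trmxK vT.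
  by rewrite mul_row_block !mul0mx !mulmx0 !add0r tr_row_mx mul_row_col mul0mx add0r.
apply: pA.2; apply: contraNneq w0 => v0.
by have := congr1 rsubmx v0; rewrite /v row_mxKr => ->; rewrite linear0.
Qed.

Lemma schur_diag i : schur i i <= A (rshift 1 i) (rshift 1 i).
Proof.
rewrite !mxE lerBlDr lerDl mulr_ge0 ?invr_ge0 ?(ltW a0) //.
by rewrite big_ord1 !mxE -expr2 sqr_ge0.
Qed.

End Schur.

(** Cholesky factorization by induction on the size: a square root of the corner and a factor of the
    Schur complement give a factor of A. *)
Lemma posdef_gram n (A : 'M[R]_n) : posdef A -> exists C : 'M[R]_n, A = C^T *m C.
Proof.
elim: n A => [|n IH] A pA; first by exists 0; apply/matrixP => -[].
have a0 : 0 < (A : 'M[R]_(1 + n)) 0 0 by exact: posdef_diag_gt0.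
have [C HC] := IH _ (schur_posdef (pA : posdef (A : 'M[R]_(1 + n)))).
have := schurE (pA : posdef (A : 'M[R]_(1 + n))).
set T := block_mx _ _ _ _ : 'M[R]_(1 + n).
pose s := Num.sqrt ((A : 'M[R]_(1 + n)) 0 0).
pose Q : 'M[R]_(1 + n) := block_mx s%:M 0 0 C.
have QE : block_mx ((A : 'M[R]_(1 + n)) 0 0)%:M 0 0 (schur A) = Q^T *m Q.
  rewrite /Q tr_block_mx !trmx0 tr_scalar_mx mulmx_block !mulmx0 !mul0mx !addr0 !add0r -HC.
  by rewrite -scalar_mxM -expr2 sqr_sqrtr // ltW.
move=> H; exists (Q *m T).
by rewrite {1}H trmx_mul !mulmxA -[in RHS](mulmxA T^T) -QE.
Qed.

(** The determinant is the corner times that of the Schur complement, whose diagonal entries are at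
    most those of A. *)
Lemma hadamard n (A : 'M[R]_n) : posdef A -> 0 < \det A <= \prod_i A i i.
Proof.
elim: n A => [|n IH] A pA; first by rewrite det_mx00 big_ord0 ltr01 lexx.
have a0 : 0 < (A : 'M[R]_(1 + n)) 0 0 by exact: posdef_diag_gt0.
have pS := schur_posdef (pA : posdef (A : 'M[R]_(1 + n))).
have /andP[d0 dle] := IH _ pS.
rewrite (schur_det (pA : posdef (A : 'M[R]_(1 + n)))) mulr_gt0 //=.
rewrite big_ord_recl ler_pM ?(ltW a0) ?(ltW d0) //.
apply: (le_trans dle); apply: ler_prod => i _.
rewrite (ltW (posdef_diag_gt0 i pS)) /=.
apply: le_trans (schur_diag _ i) _.
  exact: pA.
by rewrite le_eqVlt; apply/orP; left; apply/eqP; congr (A _ _); apply: val_inj.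
Qed.

Lemma gram_mxtrace n (A C N : 'M[R]_n) : A = C^T *m C ->
  \sum_(i < n) \sum_(j < n) A i j * N i j = \sum_k qf N (row k C) (row k C).
Proof.
move=> ->; transitivity (\sum_(i < n) \sum_(j < n) \sum_k C k i * N i j * C k j).
  apply: eq_bigr => i _; apply: eq_bigr => j _; rewrite mxE mulr_suml.
  by apply: eq_bigr => k _; rewrite mxE; ring.
transitivity (\sum_(i < n) \sum_k \sum_(j < n) C k i * N i j * C k j).
  by apply: eq_bigr => i _; rewrite exchange_big.
rewrite exchange_big; apply: eq_bigr => k _; rewrite qfE.
by apply: eq_bigr => i _; apply: eq_bigr => j _; rewrite !mxE.
Qed.

Lemma posdef_trace_le0 n (A N : 'M[R]_n) : posdef A ->
  (forall v, qf N v v <= 0) -> \sum_(i < n) \sum_(j < n) A i j * N i j <= 0.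
Proof.
move=> /posdef_gram[C AE] N0; rewrite (gram_mxtrace N AE).
by apply: sumr_le0 => k _.
Qed.

Lemma posdef_trace_ge0 n (A N : 'M[R]_n) : posdef A ->
  (forall v, 0 <= qf N v v) -> 0 <= \sum_(i < n) \sum_(j < n) A i j * N i j.
Proof.
move=> /posdef_gram[C AE] N0; rewrite (gram_mxtrace N AE).
by apply: sumr_ge0 => k _.
Qed.

(** For A = C^T C, Hadamard's inequality bounds the determinant of C B C^T by the product of its
    diagonal entries, each at most its trace. This is the inequality of arithmetic and geometric
    means up to a factor n^n, which goes into the constant. *)
Lemma posdef_det_trace n (A B : 'M[R]_n) : posdef A -> posdef B ->
  \det A * \det B <= (\sum_(i < n) \sum_(j < n) A i j * B i j) ^+ n.
Proof.
move=> pA pB; have [C AE] := posdef_gram pA.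
have uC : C \in unitmx.
  have := posdef_unit pA.2; rewrite AE unitmx_mul => /andP[] //.
have pM := posdef_congr pB uC.
have /andP[_ H] := hadamard pM.
have dE : \det A * \det B = \det (C *m B *m C^T).
  by rewrite AE !det_mulmx det_tr; ring.
rewrite dE (gram_mxtrace B AE); apply: (le_trans H).
have ME i : (C *m B *m C^T) i i = qf B (row i C) (row i C).
  by rewrite -[LHS]qf_delta /qf !mulmxA -rowE -[in LHS]mulmxA -trmx_mul -rowE.
under eq_bigr => i do rewrite ME.
have -> : forall x : R, x ^+ n = \prod_(i < n) x by move=> x; rewrite prodr_const card_ord.
apply: ler_prod => i _; rewrite -ME (ltW (posdef_diag_gt0 i pM)) ME /=.
rewrite (bigD1 i) //= lerDl sumr_ge0 // => j _; exact: posdef_ge0.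
Qed.

Section DiagPlus.
Variables (n : nat) (eta : 'rV[R]_n) (B : 'M[R]_n).
Hypotheses (eta0 : forall k, 0 < eta 0 k) (sB : B^T = B) (B0 : forall v, 0 <= qf B v v).
(** Shape of the Hessian of the symplectic potential in the frame of a vertex: the terms 1 / eta_k
    come from the facets through the vertex, B from the others. *)
Let A := diag_mx (\row_k (eta 0 k)^-1) + B.

Lemma qf_diag (d v w : 'rV[R]_n) : qf (diag_mx d) v w = \sum_k d 0 k * (v 0 k * w 0 k).
Proof.
rewrite /qf mxE; apply: eq_bigr => k _; rewrite mul_mx_diag !mxE; ring.
Qed.

Lemma qf_add (M N : 'M[R]_n) v w : qf (M + N) v w = qf M v w + qf N v w.
Proof. by rewrite /qf mulmxDr mulmxDl mxE. Qed.

Lemma diag_plus_posdef : posdef A.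
Proof.
split; first by rewrite /A linearD /= tr_diag_mx sB.
move=> v v0; rewrite qf_add ltr_wpDr // qf_diag.
have [k vk] : exists k, v 0 k != 0.
  apply/existsP; rewrite -negb_forall; apply: contraNN v0 => /forallP v0.
  by apply/eqP/rowP => k; rewrite mxE; apply/eqP.
have H j : 0 <= (\row_k (eta 0 k)^-1) 0 j * (v 0 j * v 0 j).
  by rewrite mxE mulr_ge0 ?invr_ge0 ?(ltW (eta0 j)) // -expr2 sqr_ge0.
rewrite (bigD1 k) //= ltr_pwDl ?sumr_ge0 //.
by rewrite mxE mulr_gt0 ?invr_gt0 // lt_def -expr2 sqr_ge0 sqrf_eq0 vk.
Qed.

(** For X the inverse, X_kk is the value of the form A on the row k of X; of this value only the
    diagonal term X_kk^2 / eta_k is kept. *)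
Lemma diag_plus_inv_diag k : invmx A k k <= eta 0 k.
Proof.
have pX := posdef_inv diag_plus_posdef.
have uA := posdef_unit diag_plus_posdef.2.
set X := invmx A in pX *.
have E : qf A (row k X) (row k X) = X k k.
  rewrite /qf -row_mul mulVmx // rowE mulmx1 tr_row pX.1 -[X k k]qf_delta /qf trmx_delta.
  by rewrite -mulmxA -colE.
have H : (eta 0 k)^-1 * X k k ^+ 2 <= X k k.
  rewrite -{2}E qf_add ler_wpDr // qf_diag (bigD1 k) //= !mxE -expr2 ler_wpDr //.
  apply: sumr_ge0 => j _; rewrite mxE mulr_ge0 ?invr_ge0 ?(ltW (eta0 j)) //.
  by rewrite -expr2 sqr_ge0.
have Xk := posdef_diag_gt0 k pX.
by move: H; rewrite expr2 mulrA ger_pMl // mulrC ler_pdivrMr // mul1r.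
Qed.

Lemma diag_plus_det_inv : 0 < \det (invmx A) <= \prod_k eta 0 k.
Proof.
have pX := posdef_inv diag_plus_posdef.
have /andP[-> /le_trans] := hadamard pX; apply.
apply: ler_prod => k _; rewrite diag_plus_inv_diag.
by rewrite (ltW (posdef_diag_gt0 k pX)).
Qed.

Lemma diag_plus_det : 0 < \det A <= \prod_k ((eta 0 k)^-1 + B k k).
Proof.
have /andP[-> /le_trans] := hadamard diag_plus_posdef; apply.
apply: ler_prod => k _; rewrite (ltW (posdef_diag_gt0 k diag_plus_posdef)) /=.
by rewrite !mxE eqxx mulr1n.
Qed.

End DiagPlus.

Section Hermitian.
Variables (n : nat) (A : 'M[R[i]]_n).
Hypothesis pA : posdef_hermitian A.

Lemma posdef_hermitian_det : \det A != 0.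
Proof.
suff: A \in unitmx by rewrite unitmxE unitfE.
rewrite -row_free_unit -kermx_eq0; apply/eqP/row_matrixP => i.
rewrite row0; apply/eqP; apply: contraT => v0.
have := pA v0; have /sub_kermxP := row_sub i (kermx A).
set v := row i _ => /rowP vA.
have -> : \sum_i0 \sum_j v 0 i0 * A i0 j * (v 0 j)^* = \sum_j (v *m A) 0 j * (v 0 j)^*.
  rewrite exchange_big; apply: eq_bigr => j _; by rewrite [(v *m A) 0 j]mxE mulr_suml.
by rewrite big1 ?ltxx // => j _; rewrite vA mxE mul0r.
Qed.

Lemma posdef_hermitian_Re (v : 'rV[R]_n) : v != 0 ->
  0 < qf (\matrix_(i, j) complex.Re (A i j)) v v.
Proof.
move=> v0; have w0 : map_mx (fun x : R => x%:C%C) v != 0.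
  apply: contraNneq v0 => w0; apply/eqP/rowP => j.
  by have := congr1 (fun u : 'rV[R[i]]_n => complex.Re (u 0 j)) w0; rewrite !mxE.
have := pA w0; rewrite ltcE => /andP[_]; rewrite qfE.
rewrite raddf_sum /=; under eq_bigr do rewrite raddf_sum /=.
congr (_ < _); apply: eq_bigr => i _; apply: eq_bigr => j _; rewrite !mxE.
case: (A i j) => a b /=; ring.
Qed.

(** [posdef_hermitian] does not ask for symmetry, but a positive element of [R[i]] is real. Testing
    on e_i, e_j and e_i + sqrt(-1) e_j then identifies the real parts of A_ij and A_ji. *)
Lemma posdef_hermitian_Re_sym :
  (\matrix_(i, j) complex.Re (A i j))^T = \matrix_(i, j) complex.Re (A i j).
Proof.
apply/matrixP => i j; rewrite !mxE.
have [->//|ij] := eqVneq i j.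
have sE (v : 'rV[R[i]]_n) (c : R[i]) (g : 'I_n -> R[i]) :
    (forall k, k != i -> k != j -> v 0 k = 0) ->
    \sum_l c * g l * (v 0 l)^* = c * g i * (v 0 i)^* + c * g j * (v 0 j)^*.
  move=> vz; rewrite (bigD1 i) //= (bigD1 j) 1?eq_sym //= big1 ?addr0 // => k /andP[ki kj].
  by rewrite vz // conjC0 mulr0.
have key (a b : R[i]) : a != 0 \/ b != 0 ->
    complex.Im (a * A i i * a^* + a * A i j * b^* + (b * A j i * a^* + b * A j j * b^*)) = 0.
  move=> ab0; pose v : 'rV[R[i]]_n := \row_k (if k == i then a else if k == j then b else 0).
  have vi : v 0 i = a by rewrite mxE eqxx.
  have vj : v 0 j = b by rewrite mxE eq_sym (negbTE ij) eqxx.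
  have vz k : k != i -> k != j -> v 0 k = 0 by move=> ki kj; rewrite mxE (negbTE ki) (negbTE kj).
  have v0 : v != 0.
    case: ab0 => h; apply: contraNneq h => v0; first by rewrite -vi v0 mxE.
    by rewrite -vj v0 mxE.
  have E : \sum_i0 \sum_j0 v 0 i0 * A i0 j0 * (v 0 j0)^* =
      a * A i i * a^* + a * A i j * b^* + (b * A j i * a^* + b * A j j * b^*).
    rewrite (bigD1 i) //= (bigD1 j (P := fun k => k != i)) 1?eq_sym //=.
    rewrite [X in _ + (_ + X) = _]big1 ?addr0; last first.
      by move=> k /andP[ki kj]; rewrite big1 // => l _; rewrite vz // !mul0r.
    by rewrite !sE // vi vj.
  by have := pA v0; rewrite E ltcE => /andP[/eqP].
have k1 := key 1 0 (or_introl (oner_neq0 _)).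
have k2 := key 0 1 (or_intror (oner_neq0 _)).
have k3 := key 1 'i%C (or_introl (oner_neq0 _)).
move: k1 k2 k3; case: (A i i) => a1 a2; case: (A i j) => b1 b2; case: (A j i) => c1 c2.
case: (A j j) => d1 d2 /=; lra.
Qed.

End Hermitian.

End PositiveDefinite.

(** * The Euclidean inner product *)

Section Dot.
Context {R : realType} {n : nat}.
Implicit Types u v w : 'rV[R]_n.

Lemma dotrvC v w : dotrv v w = dotrv w v.
Proof. by apply: eq_bigr => i _; rewrite mulrC. Qed.

Lemma dotrvDl u v w : dotrv (u + v) w = dotrv u w + dotrv v w.
Proof. by rewrite -big_split; apply: eq_bigr => i _; rewrite mxE mulrDl. Qed.

Lemma dotrvZl a v w : dotrv (a *: v) w = a * dotrv v w.
Proof. by rewrite /dotrv mulr_sumr; apply: eq_bigr => i _; rewrite mxE mulrA. Qed.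

Lemma dotrvDr u v w : dotrv w (u + v) = dotrv w u + dotrv w v.
Proof. by rewrite !(dotrvC w) dotrvDl. Qed.

Lemma dotrvZr a v w : dotrv w (a *: v) = a * dotrv w v.
Proof. by rewrite !(dotrvC w) dotrvZl. Qed.

Lemma dotrv0l w : dotrv 0 w = 0.
Proof. by rewrite -(scale0r 0) dotrvZl mul0r. Qed.

Lemma dotrvNl v w : dotrv (- v) w = - dotrv v w.
Proof. by rewrite -scaleN1r dotrvZl mulN1r. Qed.

Lemma dotrvBl u v w : dotrv (u - v) w = dotrv u w - dotrv v w.
Proof. by rewrite dotrvDl dotrvNl. Qed.

Lemma dotrvBr u v w : dotrv w (u - v) = dotrv w u - dotrv w v.
Proof. by rewrite !(dotrvC w) dotrvBl. Qed.

Lemma dotrv_suml (I : Type) (r : seq I) (F : I -> 'rV[R]_n) w :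
  dotrv (\sum_(i <- r) F i) w = \sum_(i <- r) dotrv (F i) w.
Proof.
elim: r => [|i r IH]; first by rewrite !big_nil dotrv0l.
by rewrite !big_cons dotrvDl IH.
Qed.

Lemma dotrv_sumr (I : Type) (r : seq I) (F : I -> 'rV[R]_n) w :
  dotrv w (\sum_(i <- r) F i) = \sum_(i <- r) dotrv w (F i).
Proof. by rewrite dotrvC dotrv_suml; apply: eq_bigr => i _; rewrite dotrvC. Qed.

Lemma dotrv_ge0 v : 0 <= dotrv v v.
Proof. by apply: sumr_ge0 => i _; rewrite -expr2 sqr_ge0. Qed.

Lemma dotrv_eq0 v : (dotrv v v == 0) = (v == 0).
Proof.
apply/eqP/eqP => [|->]; last exact: dotrv0l.
move=> /eqP; rewrite psumr_eq0 => [/allP H|i _]; last by rewrite -expr2 sqr_ge0.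
apply/rowP => i; rewrite mxE; have := H i (mem_index_enum _).
by rewrite -expr2 sqrf_eq0 => /eqP.
Qed.

Lemma dotrv_delta v j : dotrv v (delta_mx 0 j) = v 0 j.
Proof.
rewrite /dotrv (bigD1 j) //= mxE !eqxx mulr1 big1 ?addr0 // => i ij.
by rewrite mxE (negbTE ij) andbF mulr0.
Qed.

Lemma enorm_ge0 v : 0 <= enorm v.
Proof. exact: sqrtr_ge0. Qed.

Lemma enorm_sqr v : enorm v ^+ 2 = dotrv v v.
Proof. by rewrite sqr_sqrtr // dotrv_ge0. Qed.

Lemma enormZ a v : enorm (a *: v) = `|a| * enorm v.
Proof. by rewrite /enorm dotrvZl dotrvZr mulrA -expr2 sqrtrM ?sqr_ge0 // sqrtr_sqr. Qed.

Lemma cauchy_schwarz v w : `|dotrv v w| <= enorm v * enorm w.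
Proof.
have [->|w0] := eqVneq w 0.
  by rewrite dotrvC dotrv0l normr0 mulr_ge0 // enorm_ge0.
have ww : 0 < dotrv w w by rewrite lt_def dotrv_eq0 w0 dotrv_ge0.
rewrite -(@ler_pXn2r _ 2) ?nnegrE ?mulr_ge0 ?enorm_ge0 //.
rewrite exprMn !enorm_sqr real_normK ?num_real //.
have := dotrv_ge0 (v - (dotrv v w / dotrv w w) *: w).
rewrite !dotrvBl !dotrvBr !dotrvZl !dotrvZr (dotrvC w v) => H.
have {}H : 0 <= (dotrv v v - dotrv v w ^+ 2 / dotrv w w).
  by move: H; congr (0 <= _); field; rewrite gt_eqF.
by move: H; rewrite subr_ge0 ler_pdivrMr.
Qed.

Lemma dotrv_le v w a b : enorm v <= a -> enorm w <= b -> `|dotrv v w| <= a * b.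
Proof.
move=> va wb; apply: (le_trans (cauchy_schwarz v w)).
by apply: ler_pM => //; apply: enorm_ge0.
Qed.

Lemma enormD v w : enorm (v + w) <= enorm v + enorm w.
Proof.
rewrite -(@ler_pXn2r _ 2) ?nnegrE ?addr_ge0 ?enorm_ge0 //.
rewrite sqrrD !enorm_sqr dotrvDl !dotrvDr (dotrvC w v).
have := le_trans (ler_norm _) (cauchy_schwarz v w); set x := enorm v * _.
move=> H; rewrite -mulr_natl; lra.
Qed.

Lemma enorm_coord v j : `|v 0 j| <= enorm v.
Proof.
rewrite -(@ler_pXn2r _ 2) ?nnegrE ?enorm_ge0 // enorm_sqr real_normK ?num_real //.
rewrite /dotrv (bigD1 j) //= -expr2 lerDl.
by apply: sumr_ge0 => i _; rewrite -expr2 sqr_ge0.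
Qed.

Lemma dotrv_continuous u : continuous (fun v => dotrv u v).
Proof.
move=> v; apply: differentiable_continuous.
have H : dk setT 0 (fun v : 'rV[R]_n => dotrv u v).
  apply: dk_sum => [|i _]; first exact: openT.
  by apply: dk_scale; [exact: openT | apply: dk_coord; exact: openT].
exact: dk_differentiable H Logic.I.
Qed.

End Dot.

(** * Faces, vertices and diameter of the polytope *)

Section PolytopeFacts.
Context {R : realType} {n : nat} (P : halfspaces R n).
Local Notation d := (nfacets P).

Definition nrm (i : 'I_d) : 'rV[R]_n := \row_j (normal P i j)%:~R.

Lemma lfunE (i : 'I_d) (xi : 'rV[R]_n) : lfun i xi = dotrv (nrm i) xi - offset P 0 i.
Proof. by congr (_ - _); apply: eq_bigr => j _; rewrite mxE mulrC. Qed.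

Lemma lfun_affine (i : 'I_d) (a b : 'rV[R]_n) (t : R) :
  lfun i (t *: a + (1 - t) *: b) = t * lfun i a + (1 - t) * lfun i b.
Proof. by rewrite !lfunE dotrvDr !dotrvZr; ring. Qed.

Lemma lfunD (i : 'I_d) (a b : 'rV[R]_n) : lfun i (a + b) = lfun i a + dotrv (nrm i) b.
Proof. by rewrite !lfunE dotrvDr; ring. Qed.

Lemma lfun_continuous (i : 'I_d) : continuous (lfun (P := P) i).
Proof.
have -> : lfun (P := P) i = (fun xi => dotrv (nrm i) xi - offset P 0 i).
  by apply/funext => xi; rewrite lfunE.
by move=> xi; apply: continuousB; [apply: dotrv_continuous | apply: cst_continuous].
Qed.

Lemma openPoly_closed xi : openPoly P xi -> closedPoly P xi.
Proof. by move=> H i; apply: ltW. Qed.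

Lemma closedPoly_convex a b (t : R) : closedPoly P a -> closedPoly P b ->
  0 <= t <= 1 -> closedPoly P (t *: a + (1 - t) *: b).
Proof.
move=> Pa Pb /andP[t0 t1] i; rewrite lfun_affine.
by rewrite addr_ge0 // mulr_ge0 // subr_ge0.
Qed.

Lemma closed_closedPoly : closed (closedPoly P).
Proof.
have -> : closedPoly P = \bigcap_(i in setT) (lfun (P := P) i @^-1` [set x | 0 <= x]).
  by apply/seteqP; split => xi H i; [move=> _; apply: H|apply: (H i I)].
apply: closed_bigI => i _; apply: preimage_closed; last exact: closed_ge.
by move=> x _; apply: lfun_continuous.
Qed.

Hypothesis bP : bounded_set (closedPoly P).

Lemma compact_closedPoly : compact (closedPoly P).
Proof. exact: bounded_closed_compact bP closed_closedPoly. Qed.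

Lemma compact_face (I : 'I_d -> Prop) :
  compact (closedPoly P `&` [set xi | forall i, I i -> lfun i xi = 0]).
Proof.
have cF0 : closed [set xi : 'rV[R]_n | forall i, I i -> lfun i xi = 0].
  have -> : [set xi : 'rV[R]_n | forall i, I i -> lfun i xi = 0] =
    \bigcap_(i in I) (lfun (P := P) i @^-1` [set 0]).
    by apply/seteqP; split => xi H i; [move=> Ii; apply: H|apply: (H i)].
  apply: closed_bigI => i _; apply: preimage_closed; last exact: closed_eq.
  by move=> x _; apply: lfun_continuous.
by apply: compact_closedI => //; exact: compact_closedPoly.
Qed.

(* Among the maximizers, the point farthest from the origin is extreme. *)
Lemma vertex_argmax (I : 'I_d -> Prop) (c : 'rV[R]_n) :
  (exists xi, closedPoly P xi /\ forall i, I i -> lfun i xi = 0) ->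
  exists p, [/\ vertex P p, (forall i, I i -> lfun i p = 0) &
    forall xi, closedPoly P xi -> (forall i, I i -> lfun i xi = 0) ->
      dotrv c xi <= dotrv c p].
Proof.
move=> [xi0 [Pxi0 Ixi0]].
pose F : set 'rV[R]_n := closedPoly P `&` [set xi | forall i, I i -> lfun i xi = 0].
have cF : compact F by exact: compact_face.
have F0 : F !=set0 by exists xi0.
have wc (A : set 'rV[R]_n) (f : 'rV[R]_n -> R) : continuous f -> {within A, continuous f}.
  by move=> cf; apply: continuous_subspaceT.
have [p0 p0F p0max] := EVT_max_rV F0 cF (wc _ _ (@dotrv_continuous R n c)).
rewrite inE in p0F.
pose K : set 'rV[R]_n := F `&` [set xi | dotrv c xi = dotrv c p0].
have cK : compact K.
  apply: compact_closedI => //.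
  have -> : [set xi | dotrv c xi = dotrv c p0] = (fun xi => dotrv c xi) @^-1` [set dotrv c p0].
    by [].
  apply: preimage_closed; last exact: closed_eq.
  by move=> x _; apply: dotrv_continuous.
have K0 : K !=set0 by exists p0.
have csq : continuous (fun v : 'rV[R]_n => dotrv v v).
  move=> v; apply: differentiable_continuous.
  have H : dk setT 0 (fun v : 'rV[R]_n => dotrv v v).
    apply: dk_sum => [|i _]; first exact: openT.
    by apply: dk_mul; try exact: openT; apply: dk_coord; exact: openT.
  exact: dk_differentiable H Logic.I.
have [p pK pmax] := EVT_max_rV K0 cK (wc _ _ csq).
rewrite inE in pK; case: pK => -[Pp Ip] Ep.
have max xi : closedPoly P xi -> (forall i, I i -> lfun i xi = 0) ->
      dotrv c xi <= dotrv c p.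
  by move=> Pxi Ixi; rewrite Ep; apply: p0max; rewrite inE.
exists p; split => //; split => // a b t Pa Pb /andP[t0 t1] pE.
have t1' : 0 < 1 - t by rewrite subr_gt0.
have Iab i : I i -> lfun i a = 0 /\ lfun i b = 0.
  move=> /Ip; rewrite pE lfun_affine => E.
  have la : 0 <= lfun i a := Pa i.
  have lb : 0 <= lfun i b := Pb i.
  by split; nra.
have Fa : dotrv c a <= dotrv c p by apply: max => // i /Iab[].
have Fb : dotrv c b <= dotrv c p by apply: max => // i /Iab[].
have Ec : dotrv c p = t * dotrv c a + (1 - t) * dotrv c b by rewrite {1}pE dotrvDr !dotrvZr.
have Ea : dotrv c a = dotrv c p by nra.
have Eb : dotrv c b = dotrv c p by nra.
have Ka : dotrv a a <= dotrv p p.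
  apply: pmax; rewrite inE; split; last by rewrite /= Ea.
  by split=> // i /Iab[].
have Kb : dotrv b b <= dotrv p p.
  apply: pmax; rewrite inE; split; last by rewrite /= Eb.
  by split=> // i /Iab[].
(* Strict convexity of the squared norm: as a and b are no farther from the origin than p, the last
   term has to vanish. *)
have E : dotrv p p = t * dotrv a a + (1 - t) * dotrv b b - t * (1 - t) * dotrv (a - b) (a - b).
  rewrite {1 2}pE !(dotrvDl, dotrvDr, dotrvZl, dotrvZr, dotrvNl) (dotrvC b a).
  by rewrite !(dotrvC _ (- b)) !dotrvNl (dotrvC b a); ring.
have ab0 : dotrv (a - b) (a - b) <= 0.
  have tt : 0 < t * (1 - t) by rewrite mulr_gt0.
  rewrite -(pmulr_rle0 _ tt).
  have h1 : t * dotrv a a <= t * dotrv p p by rewrite ler_wpM2l // ltW.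
  have h2 : (1 - t) * dotrv b b <= (1 - t) * dotrv p p by rewrite ler_wpM2l // ltW.
  lra.
apply/eqP; rewrite -subr_eq0 -dotrv_eq0; apply/eqP/le_anti.
by rewrite ab0 dotrv_ge0.
Qed.

Lemma diam_has_ubound : has_ubound [set r | exists xi eta,
  [/\ openPoly P xi, openPoly P eta & r = enorm (xi - eta)]].
Proof.
have [M [_ HM]] := bP.
have HM1 xi : openPoly P xi -> `|xi| <= M + 1.
  by move=> /openPoly_closed; apply: HM; rewrite ltrDl.
exists (Num.sqrt (\sum_(i < n) (M + 1 + (M + 1)) ^+ 2)).
move=> _ [xi [eta [/HM1 Pxi /HM1 Peta ->]]]; rewrite /enorm ler_sqrt ?sumr_ge0 //;
  last by move=> i _; rewrite sqr_ge0.
apply: ler_sum => i _; rewrite -expr2.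
have : `|(xi - eta) 0 i| <= M + 1 + (M + 1).
  apply: (le_trans (rV_norm_coord _ _)); apply: (le_trans (ler_normB _ _)).
  exact: lerD.
by move=> H; rewrite -(real_normK (num_real ((xi - eta) 0 i))) ler_sqr ?nnegrE //;
  exact: le_trans (normr_ge0 _) H.
Qed.

Hypothesis oP : openPoly P !=set0.

(** [diam] is a supremum over the open polytope. Contracting both points by t < 1 towards an
    interior point brings them inside and multiplies their distance by t. *)
Lemma closedPoly_diam xi eta : closedPoly P xi -> closedPoly P eta ->
  enorm (xi - eta) <= diam P.
Proof.
move=> Pxi Peta; have [xi0 Oxi0] := oP.
have op a t : closedPoly P a -> 0 <= t < 1 -> openPoly P (t *: a + (1 - t) *: xi0).
  move=> Pa /andP[t0 t1] i; rewrite lfun_affine ltr_wpDl ?mulr_ge0 ?(Pa i) //.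
  by apply: mulr_gt0; [rewrite subr_gt0|exact: (Oxi0 i)].
have H t : 0 <= t < 1 -> t * enorm (xi - eta) <= diam P.
  move=> t01; apply: (sup_upper_bound _).
    split; last exact: diam_has_ubound.
    by exists (enorm (xi0 - xi0)), xi0, xi0.
  exists (t *: xi + (1 - t) *: xi0), (t *: eta + (1 - t) *: xi0); split; try exact: op.
  rewrite opprD addrACA subrr addr0 -scalerBr enormZ ger0_norm //.
  by case/andP: t01.
have dge0 : 0 <= diam P by have := H 0; rewrite mul0r lexx ltr01; apply.
rewrite leNgt; apply/negP => dlt.
have e0 : 0 < enorm (xi - eta) by apply: le_lt_trans dlt.
have := H ((diam P / enorm (xi - eta) + 1) / 2).
have d1 : 0 <= diam P / enorm (xi - eta) < 1.
  by rewrite divr_ge0 ?(ltW e0) //= ltr_pdivrMr // mul1r.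
set z := _ / _ in d1 *.
have -> : 0 <= (z + 1) / 2 < 1 by lra.
move=> /(_ isT); have zE : z * enorm (xi - eta) = diam P by rewrite /z divfK // gt_eqF.
by nra.
Qed.

Lemma diam_ge0 : 0 <= diam P.
Proof.
by have [xi0 /openPoly_closed H] := oP; apply: le_trans (closedPoly_diam H H); apply: enorm_ge0.
Qed.

End PolytopeFacts.

(** * The function t ln t *)

Section LogFacts.
Context {R : realType}.
Implicit Types a b t : R.

Lemma ln_le_subr1 t : 0 < t -> ln t <= t - 1.
Proof.
move=> t0; have := @le_ln1Dx R (t - 1); have -> : 1 + (t - 1) = t by ring.
by apply; rewrite ltrBrDr addNr.
Qed.

(* Tangent inequality of the convex function [t ln t]. *)
Lemma xlnx_tangent a b : 0 <= a -> 0 < b -> a * ln b + a - b <= a * ln a.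
Proof.
move=> a0 b0; have [->|an0] := eqVneq a 0; first by rewrite !mul0r; lra.
have {an0}a0' : 0 < a by rewrite lt_def an0.
have := @ln_le_subr1 (b / a) (divr_gt0 b0 a0'); rewrite ln_div //.
move=> /(ler_wpM2l a0); rewrite !mulrBr mulrCA mulfV ?gt_eqF // !mulr1; lra.
Qed.

Lemma xlnx_ge t : 0 <= t -> -1 <= t * ln t.
Proof. by move=> t0; have := xlnx_tangent t0 ltr01; rewrite ln1; lra. Qed.

(** From ln u <= u - 1 at u = 1 / sqrt t; it gives the continuity of t ln t at 0. *)
Lemma xlnx_small t : 0 <= t <= 1 -> `|t * ln t| <= 2 * Num.sqrt t.
Proof.
move=> /andP[t0 t1]; have [->|tn0] := eqVneq t 0; first by rewrite mul0r normr0 sqrtr0 mulr0.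
have {tn0}t0' : 0 < t by rewrite lt_def tn0.
have s0 : 0 < Num.sqrt t by rewrite sqrtr_gt0.
rewrite ler0_norm ?mulr_ge0_le0 ?ln_le0 //.
have tE : t = Num.sqrt t ^+ 2 by rewrite sqr_sqrtr.
have := @ln_le_subr1 (Num.sqrt t)^-1; rewrite invr_gt0 => /(_ s0).
rewrite lnV // => H.
rewrite {1 2}tE lnXn //; set r := Num.sqrt t in s0 H *.
have : r * - ln r <= r * (r^-1 - 1) by rewrite ler_wpM2l // ltW.
rewrite mulrBr mulfV ?gt_eqF // => H'.
have : r * (r * - ln r) <= r * (1 - r * 1) by rewrite ler_wpM2l // ltW.
have rr : 0 <= r * r by rewrite mulr_ge0 // ltW.
move=> H2; rewrite mulr2n expr2; lra.
Qed.

Lemma xlnx_continuous : continuous (fun t : R => t * ln t).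
Proof.
move=> t; have [t0|t0|t0] := ltgtP t 0.
- have : \forall y \near t, 0 = y * ln y.
    have := openP (@open_lt R 0) t0; apply: filterS => y /= y0.
    by rewrite ln0 ?mulr0 // ltW.
  move=> H; apply: (cvg_trans (near_eq_cvg H)).
  by rewrite (ln0 (ltW t0)) mulr0; apply: cvg_cst.
- by apply: continuousM; [exact: cvg_id|exact: continuous_ln].
rewrite t0 /continuous_at mul0r; apply/cvgrPdist_le => e e0.
have d0 : 0 < Num.min 1 ((e / 2) ^+ 2) by rewrite lt_min ltr01 exprn_gt0 ?divr_gt0.
apply/nbhs_ballP; exists (Num.min 1 ((e / 2) ^+ 2)) => //= y.
rewrite /= !sub0r !normrN lt_min => /andP[y1 y2].
have [y0|y0] := leP y 0; first by rewrite ln0 // mulr0 normr0 ltW.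
rewrite gtr0_norm // in y1 y2.
apply: le_trans (xlnx_small _) _; first by rewrite (ltW y0) ltW.
have e2 : 0 < e / 2 by rewrite divr_gt0.
rewrite mulrC -ler_pdivlMr // -(ger0_norm (ltW e2)) -sqrtr_sqr.
by rewrite ler_sqrt ?exprn_ge0 ?divr_ge0 ?(ltW e0) // ltW.
Qed.

End LogFacts.

(** * The polytope near a vertex *)

Section ChartData.
Context {R : realType} {n : nat} (P : halfspaces R n).
Local Notation d := (nfacets P).
Variables (s : 'I_n -> 'I_d) (p : 'rV[R]_n).

Definition UZ : 'M[int]_n := \matrix_(k, j) normal P (s k) j.

Record vchart : Prop := VChart {
  vc_in : closedPoly P p;
  vc_fac : facets_at p s;
  vc_unit : UZ \in unitmx }.

(* The edges at p are dual to the normals u_(s k); eta are the coordinates of xi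
   in the frame (p; ed), in which l_(s k) = eta_k and the other l_i are [ll]. *)
Definition ed (k : 'I_n) : 'rV[R]_n := \row_j (invmx UZ j k)%:~R.
(** Kept as an integer: integrality yields the lower bounds of [mass_ge], and these numbers are the
    exponents of the monomials which change charts. *)
Definition acz (i : 'I_d) (k : 'I_n) : int := \sum_j normal P i j * invmx UZ j k.
Definition ac (i : 'I_d) (k : 'I_n) : R := (acz i k)%:~R.
Definition co (i : 'I_d) : R := lfun i p.
Definition ll (i : 'I_d) (eta : 'rV[R]_n) : R := co i + \sum_k eta 0 k * ac i k.
Lemma llE i eta : ll i eta = co i + \sum_k eta 0 k * ac i k.
Proof. by []. Qed.

Definition pt (eta : 'rV[R]_n) : 'rV[R]_n := p + \sum_k eta 0 k *: ed k.
Definition etaof (xi : 'rV[R]_n) : 'rV[R]_n := \row_k lfun (s k) xi.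
Definition inS (i : 'I_d) : bool := [exists k, s k == i].
Definition dom : set 'rV[R]_n := [set eta | forall i, ~~ inS i -> 0 < ll i eta].
Definition nneg (eta : 'rV[R]_n) := forall k, 0 <= eta 0 k.
(* The Legendre transform sends xi to the point of the chart with
   |zeta_k|^2 = eta_k exp (lrho_k), and Psi is then the value of the potential. *)
Definition lrho (k : 'I_n) (eta : 'rV[R]_n) : R :=
  1 + \sum_(i | ~~ inS i) ac i k * (1 + ln (ll i eta)).
Definition Phi (eta : 'rV[R]_n) : 'rV[R]_n := \row_k (eta 0 k * expR (lrho k eta)).
(** Hessian in eta of the sum of l_i ln l_i over the facets which do not contain the vertex. *)
Definition Bmx (eta : 'rV[R]_n) : 'M[R]_n :=
  \matrix_(j, k) \sum_(i | ~~ inS i) ac i j * ac i k / ll i eta.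
Definition Psi (eta : 'rV[R]_n) : R :=
  \sum_k eta 0 k + \sum_(i | ~~ inS i) (ll i eta - co i - co i * ln (ll i eta)).

Hypothesis vc : vchart.
Let Hin := vc_in vc.
Let Hfac := vc_fac vc.
Let Hu := vc_unit vc.

Lemma acE i k : ac i k = dotrv (nrm i) (ed k).
Proof.
rewrite /ac /acz raddf_sum /=; apply: eq_bigr => j _.
by rewrite !mxE intrM.
Qed.

Lemma ac_s l k : ac (s l) k = (l == k)%:R.
Proof.
have := mulmxV Hu => /matrixP/(_ l k); rewrite !mxE => E.
rewrite /ac /acz; transitivity (((l == k)%:R : int)%:~R : R); last by case: (l == k).
congr (_%:~R); rewrite -E; apply: eq_bigr => j _; by rewrite !mxE.
Qed.

Lemma nrm_ed l k : dotrv (nrm (s l)) (ed k) = (l == k)%:R.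
Proof. by rewrite -acE ac_s. Qed.

Lemma dual_sum (i j : 'I_n) : \sum_k (ed k) 0 i * (nrm (s k)) 0 j = (i == j)%:R.
Proof.
have := mulVmx Hu => /matrixP/(_ i j); rewrite !mxE => E.
transitivity (((i == j)%:R : int)%:~R : R); last by case: (i == j).
rewrite -E raddf_sum; apply: eq_bigr => k _.
by rewrite /= !mxE intrM.
Qed.

Lemma nrm_expand v : v = \sum_k dotrv v (ed k) *: nrm (s k).
Proof.
apply/rowP => j; rewrite summxE; under eq_bigr do rewrite mxE /dotrv mulr_suml.
rewrite exchange_big /=; rewrite (bigD1 j) //= [X in _ + X]big1 ?addr0.
  by under eq_bigr do rewrite -mulrA; rewrite -mulr_sumr dual_sum eqxx mulr1.
move=> i ij; under eq_bigr do rewrite -mulrA.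
by rewrite -mulr_sumr dual_sum (negbTE ij) mulr0.
Qed.

Lemma ed_expand v : v = \sum_k dotrv v (nrm (s k)) *: ed k.
Proof.
apply/rowP => j; rewrite summxE; under eq_bigr do rewrite mxE /dotrv mulr_suml.
rewrite exchange_big /=; rewrite (bigD1 j) //= [X in _ + X]big1 ?addr0.
  under eq_bigr do rewrite -mulrA [X in _ * X]mulrC.
  by rewrite -mulr_sumr dual_sum eqxx mulr1.
move=> i ij; under eq_bigr do rewrite -mulrA [X in _ * X]mulrC.
by rewrite -mulr_sumr dual_sum eq_sym (negbTE ij) mulr0.
Qed.

Lemma dot_expand v w : dotrv v w = \sum_k dotrv v (ed k) * dotrv (nrm (s k)) w.
Proof.
by rewrite {1}[v]nrm_expand dotrv_suml; apply: eq_bigr => k _; rewrite dotrvZl.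
Qed.

Lemma inS_s k : inS (s k). Proof. by apply/existsP; exists k. Qed.

Lemma s_inj : injective s. Proof. by case: Hfac. Qed.

Lemma co_s k : co (s k) = 0.
Proof. by apply/(proj2 Hfac); exists k. Qed.

Lemma co_gt0 i : ~~ inS i -> 0 < co i.
Proof.
move=> iS; rewrite lt_def (Hin i) andbT; apply: contraNneq iS => /(proj2 Hfac)[k <-].
exact: inS_s.
Qed.

Lemma co_ge0 i : 0 <= co i. Proof. exact: Hin. Qed.

Lemma sum_facets (F : 'I_d -> R) :
  \sum_i F i = \sum_k F (s k) + \sum_(i | ~~ inS i) F i.
Proof.
rewrite (bigID inS) /=; congr (_ + _).
rewrite -(@big_imset _ _ _ _ _ s predT F) /=; last by move=> i j _ _; apply: s_inj.
apply: eq_bigl => i; apply/existsP/imsetP => [[k /eqP <-]|[k _ ->]]; first by exists k.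
by exists k.
Qed.

Lemma lfun_pt i eta : lfun i (pt eta) = ll i eta.
Proof.
rewrite /pt lfunD /ll /co dotrv_sumr; congr (_ + _); apply: eq_bigr => k _.
by rewrite dotrvZr acE.
Qed.

Lemma ll_co i eta : ll i eta - co i = \sum_k eta 0 k * ac i k.
Proof. by rewrite /ll addrC addKr. Qed.

Lemma ll_s k eta : ll (s k) eta = eta 0 k.
Proof.
rewrite /ll co_s add0r (bigD1 k) //= ac_s eqxx mulr1 big1 ?addr0 // => j jk.
by rewrite ac_s eq_sym (negbTE jk) mulr0.
Qed.

Lemma etaofK xi : pt (etaof xi) = xi.
Proof.
rewrite /pt -[RHS](subrK p) addrC; congr (_ + _); rewrite [RHS]ed_expand.
apply: eq_bigr => k _; congr (_ *: _); rewrite mxE dotrvC dotrvBr.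
have := co_s k; rewrite /co !lfunE => E.
by rewrite -[LHS]subr0 -E; ring.
Qed.

Lemma lfun_etaof i xi : lfun i xi = ll i (etaof xi).
Proof. by rewrite -lfun_pt etaofK. Qed.

Lemma ptK eta : etaof (pt eta) = eta.
Proof. by apply/rowP => k; rewrite mxE lfun_pt ll_s. Qed.

Lemma closed_ll eta : dom eta -> nneg eta -> closedPoly P (pt eta).
Proof.
move=> de ne i; rewrite lfun_pt; have [/existsP[k /eqP <-]|iS] := boolP (inS i).
  by rewrite ll_s.
exact/ltW/de.
Qed.

Lemma dk_ll k i : dk setT k (ll i).
Proof.
apply: dk_add; [exact: openT|exact: dk_cst openT _ _|].
apply: dk_sum => [|j _]; first exact: openT.
by apply: dk_mul; [exact: openT|exact: dk_coord openT|exact: dk_cst openT _ _].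
Qed.

Lemma ll_continuous i : continuous (ll i).
Proof.
move=> eta; apply: differentiable_continuous.
exact: dk_differentiable (dk_ll 0 i) Logic.I.
Qed.

Lemma dom_open : open dom.
Proof.
rewrite openE => eta de.
apply: (@filter_forall _ _ (fun i y => ~~ inS i -> 0 < ll i y) (nbhs eta) (nbhs_filter eta)) => i.
have [iS|iS] := boolP (inS i); first by apply: nearW.
have H : \forall y \near eta, 0 < ll i y.
  exact: (@ll_continuous i eta _ (openP (@open_gt R 0) (de i iS))).
by apply: filterS H.
Qed.

End ChartData.

(** * The equation Phi (eta) = y: value of the potential and uniqueness *)

Section Solution.
Context {R : realType} {n : nat} (P : halfspaces R n).
Local Notation d := (nfacets P).
Variables (s : 'I_n -> 'I_d) (p : 'rV[R]_n).
Hypothesis vc : vchart s p.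
Local Notation ll := (ll s p).
Local Notation co := (co (P := P) p).
Local Notation dom := (dom s p).
Local Notation lrho := (lrho s p).
Local Notation Phi := (Phi s p).
Local Notation Psi := (Psi s p).
Local Notation inS := (inS (P := P) s).

Lemma sum_lrho (eta eta0 : 'rV[R]_n) : \sum_k eta 0 k * lrho k eta0 =
  \sum_k eta 0 k + \sum_(i | ~~ inS i) (ll i eta - co i) * (1 + ln (ll i eta0)).
Proof.
rewrite /lrho; under eq_bigr do rewrite mulrDr mulr1 mulr_sumr.
rewrite big_split /=; congr (_ + _); rewrite exchange_big /=.
apply: eq_bigr => i _; rewrite ll_co mulr_suml.
by apply: eq_bigr => k _; rewrite mulrA.
Qed.

Lemma sum_lrho_split (eta eta0 : 'rV[R]_n) : \sum_k eta 0 k * lrho k eta0 =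
  \sum_k eta 0 k + (\sum_(i | ~~ inS i) ll i eta - \sum_(i | ~~ inS i) co i
   + \sum_(i | ~~ inS i) ll i eta * ln (ll i eta0)
   - \sum_(i | ~~ inS i) co i * ln (ll i eta0)).
Proof.
rewrite sum_lrho -sumrB -big_split -sumrB /=; congr (_ + _).
by apply: eq_bigr => i _; ring.
Qed.

Lemma Psi_split eta : Psi eta = \sum_k eta 0 k +
  (\sum_(i | ~~ inS i) ll i eta - \sum_(i | ~~ inS i) co i
    - \sum_(i | ~~ inS i) co i * ln (ll i eta)).
Proof. by rewrite /Psi -!sumrB. Qed.

Section Value.
Variables (y eta0 : 'rV[R]_n).
Hypotheses (de : dom eta0) (ne : nneg eta0) (yE : Phi eta0 = y).

Lemma PhiE k : y 0 k = eta0 0 k * expR (lrho k eta0).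
Proof. by rewrite -yE mxE. Qed.

Lemma Phi_eq0 k : (y 0 k == 0) = (eta0 0 k == 0).
Proof. by rewrite PhiE mulf_eq0 [X in _ || X]gt_eqF ?orbF // expR_gt0. Qed.

Lemma ln_Phi k : y 0 k != 0 -> ln (y 0 k) = ln (eta0 0 k) + lrho k eta0.
Proof.
rewrite Phi_eq0 => e0.
by rewrite PhiE lnM ?posrE ?expR_gt0 ?expRK // lt_def e0 ne.
Qed.

(** The quantity <x, xi> - v (xi) maximized by the Legendre transform, in the coordinates eta,
    without the constant <x, p> and with y_k = exp <x, e_k>. If y_k = 0 the term eta_k ln y_k should
    be - oo for eta_k > 0, whence the constraint on eta in [potJ_le]. *)
Definition potJ (eta : 'rV[R]_n) : R := \sum_k eta 0 k * ln (y 0 k)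
  - \sum_k eta 0 k * ln (eta 0 k) - \sum_(i | ~~ inS i) ll i eta * ln (ll i eta).

(** The tangent inequality of t ln t is used at the values of eta0. Since eta0 solves the equation,
    the terms linear in eta cancel and [Psi eta0] remains. *)
Lemma potJ_le eta : nneg eta -> (forall i, 0 <= ll i eta) ->
  (forall k, y 0 k = 0 -> eta 0 k = 0) -> potJ eta <= Psi eta0.
Proof.
move=> nn l0 yz.
have h1 : \sum_k eta 0 k * ln (y 0 k) - \sum_k eta 0 k * ln (eta 0 k) <=
    \sum_k (eta 0 k * lrho k eta0 - eta 0 k + eta0 0 k).
  rewrite -sumrB; apply: ler_sum => k _.
  have [yk|yk] := eqVneq (y 0 k) 0.
    have := yk; move=> /eqP; rewrite Phi_eq0 => /eqP ->; rewrite (yz _ yk); lra.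
  have e0 : 0 < eta0 0 k by rewrite lt_def -Phi_eq0 yk ne.
  by rewrite ln_Phi //; have := xlnx_tangent (nn k) e0; lra.
have h2 : - \sum_(i | ~~ inS i) ll i eta * ln (ll i eta) <=
   \sum_(i | ~~ inS i) (ll i eta0 - ll i eta - ll i eta * ln (ll i eta0)).
  rewrite -sumrN; apply: ler_sum => i iS.
  by have := xlnx_tangent (l0 i) (de iS); lra.
rewrite /potJ; apply: (le_trans (lerD h1 h2)).
rewrite big_split sumrB sumrB sumrB sum_lrho_split Psi_split /=; lra.
Qed.

Lemma potJ_eq : potJ eta0 = Psi eta0.
Proof.
rewrite /potJ Psi_split -sumrB.
have -> : \sum_k (eta0 0 k * ln (y 0 k) - eta0 0 k * ln (eta0 0 k)) =
   \sum_k eta0 0 k * lrho k eta0.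
  apply: eq_bigr => k _; have [yk|yk] := eqVneq (y 0 k) 0.
    by have := yk; move=> /eqP; rewrite Phi_eq0 => /eqP ->; rewrite !mul0r subrr.
  by rewrite ln_Phi // mulrDr addrC addKr.
rewrite sum_lrho_split; lra.
Qed.

(* Testing the equation against the vertex, i.e. summing it with the weights
   eta_k, bounds the values of the facets that do not contain the vertex. *)
Lemma ll_lower (L Y : R) i : 1 <= L -> 0 <= Y ->
  (forall j, ll j eta0 <= L) -> (forall j, co j <= L) -> (forall k, y 0 k <= Y) -> ~~ inS i ->
  - (n%:R * (1 + L * Y) + d%:R * (1 + L + L * L)) <= co i * ln (ll i eta0).
Proof.
move=> L1 Y0 lL cL yY iS.
have L0 : 0 <= L by apply: le_trans L1.
have lge j : 0 <= ll j eta0.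
  have [/existsP[k /eqP <-]|/de/ltW//] := boolP (inS j); by rewrite (ll_s vc) ne.
have E : \sum_(j | ~~ inS j) (co j * ln (ll j eta0)) =
   \sum_k (eta0 0 k * ln (eta0 0 k) + eta0 0 k - eta0 0 k * ln (y 0 k))
   + \sum_(j | ~~ inS j) (ll j eta0 * ln (ll j eta0) + ll j eta0 - co j).
  have := potJ_eq; rewrite /potJ Psi_split !sumrB !big_split /=; lra.
have h1 : - (n%:R * (1 + L * Y)) <=
   \sum_k (eta0 0 k * ln (eta0 0 k) + eta0 0 k - eta0 0 k * ln (y 0 k)).
  apply: (@le_trans _ _ (\sum_(k < n) - (1 + L * Y))).
    by rewrite sumr_const card_ord -[leRHS]mulr_natl mulrN.
  apply: ler_sum => k _.
  have ek := ne k; have ekL : eta0 0 k <= L by rewrite -(ll_s vc).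
  have := xlnx_ge ek => h.
  have : eta0 0 k * ln (y 0 k) <= L * Y.
    have [yk|yk] := leP (y 0 k) 0; first by rewrite ln0 // mulr0 mulr_ge0.
    apply: (@le_trans _ _ (eta0 0 k * Y)); last by rewrite ler_wpM2r.
    by rewrite ler_wpM2l // (le_trans _ (yY k)) // ltW // ln_sublinear.
  lra.
have card_le : (#|[pred j | ~~ inS j]|%:R : R) <= d%:R.
  by rewrite ler_nat (leq_trans (max_card _)) // card_ord.
have h2 : - (d%:R * (1 + L)) <=
   \sum_(j | ~~ inS j) (ll j eta0 * ln (ll j eta0) + ll j eta0 - co j).
  apply: (@le_trans _ _ (\sum_(j | ~~ inS j) - (1 + L))).
    rewrite sumr_const -[leRHS]mulr_natl mulrN lerN2 ler_wpM2r //; lra.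
  apply: ler_sum => j jS; have := xlnx_ge (lge j); have := lge j; have := cL j; lra.
have h3 : \sum_(j | ~~ inS j && (j != i)) (co j * ln (ll j eta0)) <= d%:R * (L * L).
  apply: (@le_trans _ _ (\sum_(j | ~~ inS j && (j != i)) (L * L))).
    apply: ler_sum => j /andP[jS _].
    have c0 : 0 <= co j := co_ge0 vc j.
    apply: (@le_trans _ _ (co j * L)); last by rewrite ler_wpM2r.
    rewrite ler_wpM2l // (le_trans _ (lL j)) //.
    by rewrite ltW // ln_sublinear // de.
  rewrite sumr_const -[leLHS]mulr_natl ler_wpM2r ?mulr_ge0 //.
  by rewrite ler_nat (leq_trans (max_card _)) // card_ord.
move: E; rewrite (bigD1 i) //=; lra.
Qed.

End Value.

(** Where y_k is not 0 the equation reads ln eta_k + lrho_k (eta) = ln y_k; elsewhere both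
    coordinates are 0. Pairing the difference of the two equations with eta1 - eta2 equates a sum of
    terms (a - b) (ln a - ln b) >= 0 with the opposite of another such sum, so every term
    vanishes. *)
Lemma Phi_inj eta1 eta2 : dom eta1 -> nneg eta1 -> dom eta2 -> nneg eta2 ->
  Phi eta1 = Phi eta2 -> eta1 = eta2.
Proof.
move=> d1 n1 d2 n2 E.
have lnmono (a b : R) : 0 < a -> 0 < b -> 0 <= (a - b) * (ln a - ln b) ?= iff (a == b).
  move=> a0 b0; split.
    have [ab|ab] := leP a b.
      by rewrite mulr_le0 // subr_le0 // ler_ln.
    by rewrite mulr_ge0 // subr_ge0 ?ler_ln // ltW.
  have [->|ab] := eqVneq a b; first by rewrite subrr mul0r eqxx.
  apply/negbTE; rewrite eq_sym mulf_neq0 // subr_eq0 //.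
  by apply: contraNneq ab => /ln_inj ->.
have key : \sum_k (eta1 0 k - eta2 0 k) * (ln (eta1 0 k) - ln (eta2 0 k)) =
   - \sum_(i | ~~ inS i) (ll i eta1 - ll i eta2) * (ln (ll i eta1) - ln (ll i eta2)).
  transitivity (\sum_k (eta1 0 k - eta2 0 k) * (lrho k eta2 - lrho k eta1)).
    apply: eq_bigr => k _; have [y0|y0] := eqVneq ((Phi eta1) 0 k) 0.
      have := Phi_eq0 (erefl (Phi eta1)) k; rewrite y0 eqxx => /esym/eqP ->.
      have := Phi_eq0 (esym E) k; rewrite y0 eqxx => /esym/eqP ->.
      by rewrite subrr !mul0r.
    congr (_ * _); have := ln_Phi n1 (erefl _) y0.
    by rewrite (ln_Phi n2 (esym E) y0); lra.
  have dE (F : 'I_n -> R) : \sum_k (eta1 0 k - eta2 0 k) * F k =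
      \sum_k (eta1 - eta2) 0 k * F k.
    by apply: eq_bigr => k _; rewrite !mxE.
  rewrite dE; under eq_bigr do rewrite mulrBr.
  rewrite sumrB !sum_lrho opprD addrACA subrr add0r -sumrB -sumrN.
  apply: eq_bigr => i _.
  have -> : ll i (eta1 - eta2) - co i = ll i eta1 - ll i eta2.
    transitivity ((ll i eta1 - co i) - (ll i eta2 - co i)); last by ring.
    rewrite !ll_co -sumrB.
    by apply: eq_bigr => k _; rewrite !mxE mulrBl.
  ring.
have nn : 0 <= \sum_(i | ~~ inS i) (ll i eta1 - ll i eta2) * (ln (ll i eta1) - ln (ll i eta2)).
  by apply: sumr_ge0 => i iS; apply: lnmono; [exact: d1|exact: d2].
have termge0 k : 0 <= (eta1 0 k - eta2 0 k) * (ln (eta1 0 k) - ln (eta2 0 k)).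
  have := Phi_eq0 (erefl (Phi eta1)) k; rewrite (Phi_eq0 (esym E) k) => e0.
  have [z1|z1] := eqVneq (eta1 0 k) 0.
    by rewrite z1 eqxx in e0; rewrite z1 (eqP e0) subrr mul0r.
  rewrite (negbTE z1) in e0.
  by apply: lnmono; rewrite lt_def ?z1 ?e0 ?n1 ?n2.
have z : \sum_k (eta1 0 k - eta2 0 k) * (ln (eta1 0 k) - ln (eta2 0 k)) == 0.
  rewrite eq_le sumr_ge0 ?andbT; last by move=> k _; apply: termge0.
  by rewrite key oppr_le0.
move: z; rewrite psumr_eq0 => [/allP z|k _]; last exact: termge0.
apply/rowP => k; have := z k (mem_index_enum _); rewrite /=.
have := Phi_eq0 (erefl (Phi eta1)) k; rewrite (Phi_eq0 (esym E) k) => e0.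
have [z1|z1] := eqVneq (eta1 0 k) 0.
  by rewrite z1 eqxx in e0; rewrite z1 (eqP e0).
rewrite (negbTE z1) in e0.
have := lnmono (eta1 0 k) (eta2 0 k).
rewrite !lt_def z1 e0 n1 n2 => /(_ isT isT) [_].
by rewrite eq_sym => -> /eqP.
Qed.

End Solution.

Section ContinuousAt.
Context {R : realType} {T : topologicalType}.
Implicit Types (f g : T -> R) (x : T).

Lemma cont_add f g x : {for x, continuous f} -> {for x, continuous g} ->
  {for x, continuous (fun y => f y + g y)}.
Proof. by move=> cf cg; have H : {for x, continuous (f + g)} := continuousD cf cg. Qed.

Lemma cont_sub f g x : {for x, continuous f} -> {for x, continuous g} ->
  {for x, continuous (fun y => f y - g y)}.
Proof. by move=> cf cg; have H : {for x, continuous (f - g)} := continuousB cf cg. Qed.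

Lemma cont_mul f g x : {for x, continuous f} -> {for x, continuous g} ->
  {for x, continuous (fun y => f y * g y)}.
Proof. by move=> cf cg; have H : {for x, continuous (f \* g)} := continuousM cf cg. Qed.

Lemma cont_cst (c : R) x : {for x, continuous (fun=> c)}.
Proof. exact: cst_continuous. Qed.

Lemma sum_continuous_at m (G : 'I_m -> T -> R) x :
  (forall k, {for x, continuous (G k)}) -> {for x, continuous (fun x => \sum_k G k x)}.
Proof.
elim: m G => [|m IH] G cG.
  have -> : (fun x => \sum_(k < 0) G k x) = (fun=> 0) by apply/funext => z; rewrite big_ord0.
  exact: cont_cst.
have -> : (fun x => \sum_k G k x) = (fun x => G ord0 x + \sum_k G (lift ord0 k) x).
  by apply/funext => z; rewrite big_ord_recl.
by apply: cont_add; [exact: cG|apply: IH].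
Qed.

End ContinuousAt.

Lemma affine_continuous (R : realType) (a b : R) : continuous (fun t : R => a + t * b).
Proof.
move=> t; apply: (@cont_add R R (fun=> a) (fun t => t * b) t); first exact: cont_cst.
by apply: (@cont_mul R R id (fun=> b) t); [exact: cvg_id|exact: cont_cst].
Qed.

(** Form of Fermat's rule suited to [maximizer_foc], where maximality appears as t g(t) <= 0 with g
    continuous. *)
Lemma sign_change_eq0 (R : realType) (g : R -> R) : {for 0, continuous g} ->
  (\forall t \near (0 : R), t * g t <= 0) -> g 0 = 0.
Proof.
move=> cg tg; have [g0|g0|//] := ltgtP (g 0) 0; exfalso.
  have H0 : \forall t \near (0 : R), g t < 0 := cg _ (openP (@open_lt R 0) g0).
  have H : \forall t \near (0 : R), t * g t <= 0 /\ g t < 0.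
    by apply: filterS2 tg H0 => t.
  have [D /= D0 HD] := (nbhs_ballP _ _).1 H.
  have D2 : 0 < D / 2 by rewrite divr_gt0.
  have [] := HD (- (D / 2)).
    rewrite -ball_normE /= sub0r opprK gtr0_norm //.
    by rewrite ltr_pdivrMr // ltr_pMr // ltr1n.
  by move=> h1 h2; nra.
have H0 : \forall t \near (0 : R), 0 < g t := cg _ (openP (@open_gt R 0) g0).
have H : \forall t \near (0 : R), t * g t <= 0 /\ 0 < g t.
  by apply: filterS2 tg H0 => t.
have [D /= D0 HD] := (nbhs_ballP _ _).1 H.
have D2 : 0 < D / 2 by rewrite divr_gt0.
have [] := HD (D / 2).
  rewrite -ball_normE /= sub0r normrN gtr0_norm //.
  by rewrite ltr_pdivrMr // ltr_pMr // ltr1n.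
by move=> h1 h2; nra.
Qed.

(** * Existence of the solution by maximizing the Legendre functional *)

Section Existence.
Context {R : realType} {n : nat} (P : halfspaces R n).
Local Notation d := (nfacets P).
Variables (s : 'I_n -> 'I_d) (p : 'rV[R]_n).
Hypotheses (vc : vchart s p) (bP : bounded_set (closedPoly P)).
Local Notation ll := (ll s p).
Local Notation co := (co (P := P) p).
Local Notation dom := (dom s p).
Local Notation lrho := (lrho s p).
Local Notation Phi := (Phi s p).
Local Notation inS := (inS (P := P) s).

Let xlnx (t : R) := t * ln t.

Section FixY.
Variable y : 'rV[R]_n.
Hypothesis y0 : nneg y.

(** The functional [potJ] with all the facets in one sum, since l_(s k) = eta_k. Its maximizer on
    the face cut out by the vanishing coordinates of y will solve the equation. *)
Let F (eta : 'rV[R]_n) := \sum_k eta 0 k * ln (y 0 k) - \sum_i xlnx (ll i eta).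
Let feas (eta : 'rV[R]_n) := (forall i, 0 <= ll i eta) /\ (forall k, y 0 k = 0 -> eta 0 k = 0).

Lemma potential_maximizer : exists2 e, feas e & forall eta, feas eta -> F eta <= F e.
Proof.
pose I (i : 'I_d) := exists2 k, s k = i & y 0 k = 0.
pose A := closedPoly P `&` [set xi | forall i, I i -> lfun i xi = 0].
have cA : compact A by exact: compact_face.
have A0 : A !=set0.
  exists p; split; first exact: vc_in vc.
  by move=> i [k <- _]; exact: (co_s vc).
have fA xi : A xi -> feas (etaof s xi).
  move=> [Pxi Ixi]; split=> [i|k yk]; first by rewrite -(lfun_etaof vc); apply: Pxi.
  by rewrite mxE; apply: Ixi; exists k.
have cE k : continuous (fun xi : 'rV[R]_n => (etaof s xi) 0 k).
  have -> : (fun xi : 'rV[R]_n => (etaof s xi) 0 k) = lfun (P := P) (s k).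
    by apply/funext => xi; rewrite mxE.
  exact: lfun_continuous.
have cF : continuous (fun xi => F (etaof s xi)).
  move=> xi; apply: cont_sub.
    apply: (@sum_continuous_at _ _ _ (fun k xi => (etaof s xi) 0 k * ln (y 0 k))) => k.
    by apply: cont_mul; [exact: cE|exact: cont_cst].
  apply: (@sum_continuous_at _ _ _ (fun i xi => xlnx (ll i (etaof s xi)))) => i.
  have -> : (fun xi => xlnx (ll i (etaof s xi))) = xlnx \o lfun (P := P) i.
    by apply/funext => z /=; rewrite -(lfun_etaof vc).
  apply: continuous_comp; [exact: lfun_continuous|exact: xlnx_continuous].
have [xi xiA xmax] := EVT_max_rV A0 cA (continuous_subspaceT cF).
rewrite inE in xiA.
exists (etaof s xi); first exact: fA.
move=> eta [l0 z0]; rewrite -(ptK vc eta); apply: xmax; rewrite inE; split.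
  by move=> i; rewrite lfun_pt.
by move=> i [k <- yk]; rewrite lfun_pt (ll_s vc) z0.
Qed.

Section Maximizer.
Variable e : 'rV[R]_n.
Hypotheses (fe : feas e) (emax : forall eta, feas eta -> F eta <= F e).

(** The tangent to t ln t is taken at the competitor eta and not at e, some l_i (e) possibly being 0
    as long as their positivity is unknown. *)
Lemma maximizer_ineq eta : feas eta -> (forall i, ll i eta = 0 -> ll i e = 0) ->
  \sum_k (eta 0 k - e 0 k) * ln (y 0 k) <=
  \sum_i (ll i eta - ll i e) * (1 + ln (ll i eta)).
Proof.
move=> fh z; have := emax fh; rewrite /F => H.
have h : \sum_i xlnx (ll i eta) - \sum_i xlnx (ll i e) <=
  \sum_i (ll i eta - ll i e) * (1 + ln (ll i eta)).
  rewrite -sumrB; apply: ler_sum => i _; rewrite /xlnx.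
  have [l0|l0] := eqVneq (ll i eta) 0; first by rewrite (z _ l0) l0; lra.
  have lp : 0 < ll i eta by rewrite lt_def l0 fh.1.
  have := xlnx_tangent (fe.1 i) lp; lra.
have -> : \sum_k (eta 0 k - e 0 k) * ln (y 0 k) =
   \sum_k eta 0 k * ln (y 0 k) - \sum_k e 0 k * ln (y 0 k).
  by rewrite -sumrB; apply: eq_bigr => k _; rewrite mulrBl.
lra.
Qed.

Lemma ll_affine i (a b : 'rV[R]_n) (t : R) :
  ll i (a + t *: (b - a)) = ll i a + t * (ll i b - ll i a).
Proof.
have -> : ll i b - ll i a = \sum_k (b - a) 0 k * ac s i k.
  transitivity ((ll i b - co i) - (ll i a - co i)); first by ring.
  by rewrite !ll_co -sumrB; apply: eq_bigr => k _; rewrite !mxE mulrBl.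
rewrite !llE -[RHS]addrA; congr (_ + _); rewrite mulr_sumr -big_split /=.
by apply: eq_bigr => k _; rewrite !mxE; ring.
Qed.

(** A small multiple of the indicator of the k with y_k not 0: at eta = 0, which is the vertex, the
    l_i of the other facets are positive. *)
Lemma interior_point : exists2 eo, feas eo &
  (forall i, ~~ inS i -> 0 < ll i eo) /\ (forall k, y 0 k != 0 -> 0 < eo 0 k).
Proof.
pose w : 'rV[R]_n := \row_k (y 0 k != 0)%:R.
have H : \forall t \near (0 : R), forall i, ~~ inS i -> 0 < ll i (0 + t *: (w - 0)).
  apply: (@filter_forall _ _ (fun i (t : R) => ~~ inS i -> 0 < ll i (0 + t *: (w - 0)))
    (nbhs (0 : R)) (nbhs_filter (0 : R))) => i.
  have [iS|iS] := boolP (inS i); first by apply: nearW.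
  have c : continuous (fun t : R => ll i 0 + t * (ll i w - ll i 0)).
    exact: affine_continuous.
  have l0 : 0 < ll i 0 + 0 * (ll i w - ll i 0).
    rewrite mul0r addr0 !llE big1 ?addr0; first exact: (co_gt0 vc iS).
    by move=> k _; rewrite mxE mul0r.
  have H0 : \forall t \near (0 : R), 0 < ll i 0 + t * (ll i w - ll i 0)
    := c 0 _ (openP (@open_gt R 0) l0).
  by apply: filterS H0 => t /= lt _; rewrite ll_affine.
have [/= D D0 HD] := (nbhs_ballP _ _).1 H.
have D2 : 0 < D / 2 by rewrite divr_gt0.
have := HD (D / 2); rewrite -ball_normE /= sub0r normrN gtr0_norm // => {}HD.
have {}HD : forall i, ~~ inS i -> 0 < ll i (D / 2 *: w).
  have := HD _; rewrite add0r subr0; apply.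
  by rewrite ltr_pdivrMr // ltr_pMr // ltr1n.
have ek k : y 0 k != 0 -> 0 < (D / 2 *: w) 0 k by move=> yk; rewrite !mxE yk mulr1.
exists (D / 2 *: w) => //; split=> [i|k yk]; last by rewrite !mxE yk eqxx mulr0.
have [/existsP[k /eqP <-]|/HD/ltW//] := boolP (inS i).
by rewrite (ll_s vc) !mxE mulr_ge0 ?ler0n // ltW.
Qed.

(** The slope of t ln t at 0 is - oo. If l_i (e) = 0 while l_i > 0 at the interior point, moving
    from e by a fraction t towards that point contributes l_i (eo) ln t after division by t, which
    is unbounded below, against maximality. *)
Lemma maximizer_pos i : ll i e = 0 -> exists2 k, s k = i & y 0 k = 0.
Proof.
move=> le0; have [eo [lo zo] [po qo]] := interior_point.
have [l00|l00] := eqVneq (ll i eo) 0.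
  have [/existsP[k /eqP ki]|iS] := boolP (inS i).
    exists k => //; apply/eqP; apply: contraT => /qo; rewrite -(ll_s vc) ki l00 ltxx //.
  by have := po i iS; rewrite l00 ltxx.
exfalso.
have lpos : 0 < ll i eo by rewrite lt_def l00 lo.
have main t : 0 < t < 1 -> \sum_k (eo 0 k - e 0 k) * ln (y 0 k) <=
   \sum_j (ll j eo - ll j e) * (1 + ln (ll j eo)) + ll i eo * ln t.
  move=> /andP[t0 t1].
  have lt j : ll j (e + t *: (eo - e)) = (1 - t) * ll j e + t * ll j eo.
    by rewrite ll_affine; ring.
  have t1' : 0 < 1 - t by rewrite subr_gt0.
  have fh : feas (e + t *: (eo - e)).
    split=> [j|k yk]; first by rewrite lt addr_ge0 // mulr_ge0 ?lo ?fe.1 // ltW.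
    by rewrite !mxE zo // fe.2 //; lra.
  have := maximizer_ineq fh; have zz : forall j, ll j (e + t *: (eo - e)) = 0 -> ll j e = 0.
    by move=> j; rewrite lt; have := lo j; have := fe.1 j => h1 h2; nra.
  move=> /(_ zz).
  have -> : \sum_k ((e + t *: (eo - e)) 0 k - e 0 k) * ln (y 0 k) =
      t * \sum_k (eo 0 k - e 0 k) * ln (y 0 k).
    by rewrite mulr_sumr; apply: eq_bigr => k _; rewrite !mxE; ring.
  have -> : \sum_j (ll j (e + t *: (eo - e)) - ll j e) * (1 + ln (ll j (e + t *: (eo - e))))
    = t * \sum_j (ll j eo - ll j e) * (1 + ln (ll j (e + t *: (eo - e)))).
    by rewrite mulr_sumr; apply: eq_bigr => j _; rewrite lt; ring.
  rewrite ler_pM2l // => /le_trans; apply.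
  rewrite (bigD1 i) //= [X in _ <= X + _](bigD1 i) //= [leRHS]addrAC; apply: lerD.
    by rewrite lt le0 mulr0 add0r subr0 lnM ?posrE //; lra.
  apply: ler_sum => j _; rewrite lt.
  have [lz|lz] := eqVneq (ll j eo) 0.
    have -> : ll j e = 0.
      have [/existsP[k /eqP kj]|jS] := boolP (inS j); last first.
        by have := po j jS; rewrite lz ltxx.
      rewrite -kj (ll_s vc); apply: fe.2; apply/eqP; apply: contraT => /qo.
      by rewrite -(ll_s vc) kj lz ltxx.
    by rewrite lz; lra.
  have lp : 0 < ll j eo by rewrite lt_def lz lo.
  have lep := fe.1 j.
  have mp : 0 < (1 - t) * ll j e + t * ll j eo by nra.
  have [lle|lle] := leP (ll j e) (ll j eo).
    apply: ler_wpM2l; first by rewrite subr_ge0.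
    by apply: lerD => //; rewrite ler_ln ?posrE //; nra.
  apply: ler_wnM2l; first by rewrite subr_le0 ltW.
  by apply: lerD => //; rewrite ler_ln ?posrE //; nra.
set Q1 := (X in forall t, _ -> X <= _) in main.
set Q2 := (X in forall t, _ -> _ <= X + _) in main.
(* Chosen so that l_i (eo) ln t = - (|Q2 - Q1| + 1), which violates [main]. *)
pose t := expR (- ((`|Q2 - Q1| + 1) / ll i eo)).
have q0 : 0 < (`|Q2 - Q1| + 1) / ll i eo by rewrite divr_gt0 // ltr_wpDl.
have := main t; rewrite expR_gt0 expR_lt1 oppr_lt0 q0 => /(_ isT).
rewrite expRK mulrN mulrCA mulfV ?gt_eqF // mulr1.
have := ler_norm (Q2 - Q1); lra.
Qed.

Lemma maximizer_dom : dom e.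
Proof.
move=> i iS; rewrite lt_def fe.1 andbT; apply: contraNneq iS => /maximizer_pos[k <- _].
exact: inS_s.
Qed.

(** Small moves along e_k of both signs are feasible: the l_i which vanish at e belong to facets s j
    with y_j = 0, so j is not k and they do not vary in that direction. *)
Lemma maximizer_foc k : y 0 k != 0 -> ln (y 0 k) = 1 + ln (e 0 k)
   + \sum_(i | ~~ inS i) ac s i k * (1 + ln (ll i e)).
Proof.
move=> yk.
have lt (t : R) i : ll i (e + t *: delta_mx 0 k) = ll i e + t * ac s i k.
  rewrite !llE -[RHS]addrA; congr (_ + _).
  transitivity (\sum_j e 0 j * ac s i j + \sum_j t * (j == k)%:R * ac s i j).
    by rewrite -big_split; apply: eq_bigr => j _; rewrite !mxE eqxx mulrDl.
  congr (_ + _); rewrite (bigD1 k) //= eqxx mulr1 big1 ?addr0 // => j jk.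
  by rewrite (negbTE jk) mulr0 mul0r.
have near0 : \forall t \near (0 : R), forall i, 0 < ll i e -> 0 < ll i e + t * ac s i k.
  apply: (@filter_forall _ _ (fun i (t : R) => 0 < ll i e -> 0 < ll i e + t * ac s i k)
    (nbhs (0 : R)) (nbhs_filter (0 : R))) => i.
  have [li|li] := leP (ll i e) 0; first by apply: nearW.
  have c : continuous (fun t : R => ll i e + t * ac s i k).
    exact: affine_continuous.
  have l0 : 0 < ll i e + 0 * ac s i k by rewrite mul0r addr0.
  have H0 : \forall t \near (0 : R), 0 < ll i e + t * ac s i k
    := c 0 _ (openP (@open_gt R 0) l0).
  by apply: filterS H0 => t lt' _.
have zero i : ll i e = 0 -> ac s i k = 0.
  move=> /maximizer_pos[j <- yj]; rewrite (ac_s vc).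
  by case: eqVneq => [jk|//]; rewrite -jk yj eqxx in yk.
pose g (t : R) := ln (y 0 k) - \sum_i ac s i k * (1 + ln (ll i e + t * ac s i k)).
have tg : \forall t \near (0 : R), t * g t <= 0.
  apply: filterS near0 => t Ht.
  have fh : feas (e + t *: delta_mx 0 k).
    split=> [i|j yj].
      rewrite lt; have [l0|l0] := eqVneq (ll i e) 0; first by rewrite l0 zero // mulr0 addr0.
      by apply/ltW/Ht; rewrite lt_def l0 fe.1.
    rewrite !mxE fe.2 // add0r eqxx /=; case: eqVneq => [jk|_]; last by rewrite mulr0.
    by move: yk; rewrite -jk yj eqxx.
  have := maximizer_ineq fh.
  have zz : forall i, ll i (e + t *: delta_mx 0 k) = 0 -> ll i e = 0.
    move=> i; rewrite lt => H; apply/eqP; apply: contraT => l0.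
    by have := Ht i; rewrite H ltxx lt_def l0 fe.1 => /(_ isT).
  move=> /(_ zz).
  have -> : \sum_j ((e + t *: delta_mx 0 k) 0 j - e 0 j) * ln (y 0 j) = t * ln (y 0 k).
    rewrite (bigD1 k) //= !mxE !eqxx big1 ?addr0 => [|j jk]; first by rewrite /= mulr1; ring.
    by rewrite !mxE (negbTE jk) andbF /=; ring.
  have -> : \sum_i (ll i (e + t *: delta_mx 0 k) - ll i e) * (1 + ln (ll i (e + t *: delta_mx 0 k)))
     = t * \sum_i ac s i k * (1 + ln (ll i e + t * ac s i k)).
    by rewrite mulr_sumr; apply: eq_bigr => i _; rewrite lt; ring.
  rewrite /g mulrBr; lra.
have cg : {for 0, continuous g}.
  apply: (@cont_sub R R (fun=> ln (y 0 k))
    (fun t => \sum_i ac s i k * (1 + ln (ll i e + t * ac s i k))) 0); first exact: cont_cst.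
  apply: (@sum_continuous_at R R _ (fun i t => ac s i k * (1 + ln (ll i e + t * ac s i k))) 0) => i.
  apply: (@cont_mul R R (fun=> ac s i k) (fun t => 1 + ln (ll i e + t * ac s i k)) 0).
    exact: cont_cst.
  apply: (@cont_add R R (fun=> 1) (fun t => ln (ll i e + t * ac s i k)) 0).
    exact: cont_cst.
  have [l0|l0] := eqVneq (ll i e) 0.
    rewrite zero //; have -> : (fun t : R => ln (ll i e + t * 0)) = (fun=> ln (ll i e)).
      by apply/funext => t; rewrite mulr0 addr0.
    exact: cont_cst.
  have lc : {for ll i e + 0 * ac s i k, continuous (@ln R)}.
    by apply: continuous_ln; rewrite mul0r addr0 lt_def l0 fe.1.
  exact: (@continuous_comp R R R (fun t : R => ll i e + t * ac s i k) (@ln R) 0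
    (@affine_continuous R (ll i e) (ac s i k) 0) lc).
have g0 : g 0 = 0.
  exact: sign_change_eq0.
move: g0; rewrite /g; under eq_bigr do rewrite mul0r addr0.
rewrite (sum_facets vc).
have -> : \sum_j ac s (s j) k * (1 + ln (ll (s j) e)) = 1 + ln (e 0 k).
  rewrite (bigD1 k) //= (ac_s vc) eqxx mul1r (ll_s vc) big1 ?addr0 // => j jk.
  by rewrite (ac_s vc) (negbTE jk) mul0r.
lra.
Qed.

End Maximizer.

Lemma Phi_surj : exists e, [/\ dom e, nneg e & Phi e = y].
Proof.
have [e fe emax] := potential_maximizer.
have de := maximizer_dom fe emax.
have ne : nneg e by move=> k; rewrite -(ll_s vc); apply: fe.1.
exists e; split => //; apply/rowP => k; rewrite mxE.
have [yk|yk] := eqVneq (y 0 k) 0; first by rewrite fe.2 // mul0r.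
have e0 : 0 < e 0 k.
  rewrite lt_def ne andbT; apply/negP => /eqP; rewrite -(ll_s vc) => /(maximizer_pos fe emax).
  by move=> [j /(s_inj vc) -> yj]; rewrite yj eqxx in yk.
have yp : 0 < y 0 k by rewrite lt_def yk y0.
have := maximizer_foc fe emax yk; rewrite addrAC => H.
have {}H : ln (y 0 k) = lrho k e + ln (e 0 k) by exact: H.
by rewrite -[RHS](@lnK R) ?posrE // H [RHS]expRD [X in _ = _ * X]lnK ?posrE // mulrC.
Qed.

End FixY.
End Existence.

Section LambdaRules.
Context {R : realType} {V : normedModType R}.
Implicit Types (f g : V -> R) (x v : V).

Lemma derive_addf f g x v : differentiable f x -> differentiable g x ->
  'D_v (fun y => f y + g y) x = 'D_v f x + 'D_v g x.
Proof. by move=> df dg; rewrite -deriveD //; apply: diff_derivable. Qed.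

Lemma derive_mulf f g x v : differentiable f x -> differentiable g x ->
  'D_v (fun y => f y * g y) x = f x * 'D_v g x + g x * 'D_v f x.
Proof. by move=> df dg; rewrite -deriveM //; apply: diff_derivable. Qed.

Lemma derive_scalef (c : R) f x v : differentiable f x ->
  'D_v (fun y => c * f y) x = c * 'D_v f x.
Proof. by move=> df; rewrite derive_mulf // derive_cst mulr0 addr0. Qed.

Lemma derive_subf f g x v : differentiable f x -> differentiable g x ->
  'D_v (fun y => f y - g y) x = 'D_v f x - 'D_v g x.
Proof. by move=> df dg; rewrite -deriveB //; apply: diff_derivable. Qed.

Lemma derive_sumf (I : Type) (r : seq I) (Q : pred I) (F : I -> V -> R) x v :
  (forall i, Q i -> differentiable (F i) x) ->
  'D_v (fun y => \sum_(i <- r | Q i) F i y) x = \sum_(i <- r | Q i) 'D_v (F i) x.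
Proof.
move=> dF.
suff H : differentiable (fun y => \sum_(i <- r | Q i) F i y) x /\
  'D_v (fun y => \sum_(i <- r | Q i) F i y) x = \sum_(i <- r | Q i) 'D_v (F i) x by case: H.
elim: r => [|i r [IH1 IH2]].
  have -> : (fun y => \sum_(i <- [::] | Q i) F i y) = cst 0.
    by apply/funext => y; rewrite big_nil.
  by rewrite big_nil derive_cst; split.
case Qi : (Q i); last first.
  have -> : (fun y => \sum_(j <- i :: r | Q j) F j y) = (fun y => \sum_(j <- r | Q j) F j y).
    by apply/funext => y; rewrite big_cons Qi.
  by rewrite big_cons Qi.
have -> : (fun y => \sum_(j <- i :: r | Q j) F j y) =
   (fun y => F i y + \sum_(j <- r | Q j) F j y).
  by apply/funext => y; rewrite big_cons Qi.
rewrite big_cons Qi derive_addf //; last exact: dF.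
by split; [apply: differentiableD => //; exact: dF | rewrite IH2].
Qed.

Lemma derive_expf f x v : differentiable f x ->
  'D_v (fun y => expR (f y)) x = expR (f x) * 'D_v f x.
Proof. by move=> df; have [_ <-] := is_derive_comp1 v (is_derive_expR (f x)) df. Qed.

Lemma derive_lnf f x v : 0 < f x -> differentiable f x ->
  'D_v (fun y => ln (f y)) x = (f x)^-1 * 'D_v f x.
Proof. by move=> f0 df; have [_ <-] := is_derive_comp1 v (is_derive1_ln f0) df. Qed.

End LambdaRules.

Lemma qf_gram (R : realType) n m (a : 'I_m -> 'rV[R]_n) (c : 'I_m -> R) (Q : pred 'I_m) v w :
  qf (\matrix_(j, k) \sum_(i | Q i) a i 0 j * a i 0 k / c i) v w =
  \sum_(i | Q i) dotrv (a i) v * dotrv (a i) w / c i.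
Proof.
rewrite qfE; under eq_bigr do under eq_bigr do rewrite mxE mulr_sumr mulr_suml.
under eq_bigr do rewrite exchange_big.
rewrite exchange_big; apply: eq_bigr => i _.
rewrite /dotrv -mulrA mulr_suml; apply: eq_bigr => j _.
rewrite mulr_suml mulr_sumr; apply: eq_bigr => k _; ring.
Qed.

(** * Continuity of the solution in y *)

Section SolutionMap.
Context {R : realType} {n : nat} (P : halfspaces R n).
Local Notation d := (nfacets P).
Variables (s : 'I_n -> 'I_d) (p : 'rV[R]_n).
Hypotheses (vc : vchart s p) (bP : bounded_set (closedPoly P)).
Local Notation ll := (ll s p).
Local Notation co := (co (P := P) p).
Local Notation dom := (dom s p).
Local Notation lrho := (lrho s p).
Local Notation Phi := (Phi s p).
Local Notation inS := (inS (P := P) s).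
Local Notation Bmx := (Bmx s p).

Definition etaS (y : 'rV[R]_n) : 'rV[R]_n :=
  xget 0 [set e | [/\ dom e, nneg e & Phi e = y]].

Lemma etaSP y : nneg y -> [/\ dom (etaS y), nneg (etaS y) & Phi (etaS y) = y].
Proof.
by move=> y0; have [e He] := Phi_surj vc bP y0; rewrite /etaS; case: xgetP => [x _|/(_ e)].
Qed.

Lemma etaS_eq e y : dom e -> nneg e -> Phi e = y -> etaS y = e.
Proof.
move=> de ne E; have y0 : nneg y by move=> k; rewrite -E mxE mulr_ge0 ?expR_ge0.
have [d1 n1 E1] := etaSP y0.
by apply: (Phi_inj d1 n1 de ne); rewrite E1.
Qed.

Definition arow (i : 'I_d) : 'rV[R]_n := \row_k ac s i k.

Lemma BmxE eta : Bmx eta =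
  \matrix_(j, k) \sum_(i | ~~ inS i) (arow i) 0 j * (arow i) 0 k / ll i eta.
Proof. by apply/matrixP => j k; rewrite !mxE; apply: eq_bigr => i _; rewrite !mxE. Qed.

Lemma Bmx_sym eta : (Bmx eta)^T = Bmx eta.
Proof.
by apply/matrixP => j k; rewrite !mxE; apply: eq_bigr => i _; rewrite [ac s i k * _]mulrC.
Qed.

Lemma Bmx_ge0 eta v : dom eta -> 0 <= qf (Bmx eta) v v.
Proof.
move=> de; rewrite BmxE qf_gram; apply: sumr_ge0 => i iS.
by rewrite divr_ge0 // -?expr2 ?sqr_ge0 // ltW // de.
Qed.

Lemma derive_ll i eta v : 'D_v (ll i) eta = \sum_k v 0 k * ac s i k.
Proof.
rewrite derive_addf; [|exact: differentiable_cst|].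
  rewrite derive_cst add0r derive_sumf => [|k _].
    apply: eq_bigr => k _; rewrite derive_mulf; [|exact: differentiable_coord|exact: differentiable_cst].
    by rewrite derive_cst mulr0 add0r derive_coord mulrC.
  apply: differentiableM; [exact: differentiable_coord|exact: differentiable_cst].
have H : dk setT 0 (fun x : 'rV[R]_n => \sum_k x 0 k * ac s i k).
  apply: dk_sum => [|j _]; first exact: openT.
  by apply: dk_mul; [exact: openT|exact: dk_coord openT|exact: dk_cst openT _ _].
exact: dk_differentiable H Logic.I.
Qed.

Lemma differentiable_ll i eta : differentiable (ll i) eta.
Proof. exact: dk_differentiable (dk_ll s p 0 i) Logic.I. Qed.

Lemma differentiable_ln_ll i eta : dom eta -> ~~ inS i ->
  differentiable (fun e => ln (ll i e)) eta.
Proof.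
move=> de iS.
by have [] := is_derive_comp1 0 (is_derive1_ln (de i iS)) (differentiable_ll i eta).
Qed.

Lemma dk_lnll k i : ~~ inS i -> dk dom k (fun e => ln (ll i e)).
Proof.
move=> iS; apply: dk_ln; first exact: dom_open.
  by move=> e de; apply: de.
by apply: dk_sub_set (dk_ll s p k i).
Qed.

Lemma dk_lrho m k : dk dom m (lrho k).
Proof.
have oD := @dom_open _ _ _ s p.
apply: dk_add => //; first exact: dk_cst.
apply: dk_sum => // i iS; apply: dk_mul => //; first exact: dk_cst.
by apply: dk_add => //; [exact: dk_cst|exact: dk_lnll].
Qed.

Lemma derive_lrho k eta v : dom eta ->
  'D_v (lrho k) eta = \sum_j Bmx eta k j * v 0 j.
Proof.
move=> de.
have dl i : ~~ inS i -> differentiable (fun e => ac s i k * (1 + ln (ll i e))) eta.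
  move=> iS; apply: differentiableM; first exact: differentiable_cst.
  by apply: differentiableD; [exact: differentiable_cst|exact: differentiable_ln_ll].
have E : 'D_v (lrho k) eta = 'D_v (fun e => \sum_(i | ~~ inS i) ac s i k * (1 + ln (ll i e))) eta.
  rewrite derive_addf; [by rewrite derive_cst add0r|exact: differentiable_cst|].
  have H m : dk dom m (fun e => \sum_(i | ~~ inS i) ac s i k * (1 + ln (ll i e))).
    have oD := @dom_open _ _ _ s p.
    apply: dk_sum => // i iS; apply: dk_mul => //; first exact: dk_cst.
    by apply: dk_add => //; [exact: dk_cst|exact: dk_lnll].
  exact: dk_differentiable (H 0%N) de.
rewrite E derive_sumf //.
transitivity (\sum_(i | ~~ inS i) \sum_j ac s i k * ac s i j / ll i eta * v 0 j); last first.
  by rewrite exchange_big; apply: eq_bigr => j _; rewrite mxE mulr_suml.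
apply: eq_bigr => i iS.
rewrite derive_scalef; last first.
  by apply: differentiableD; [exact: differentiable_cst|exact: differentiable_ln_ll].
rewrite derive_addf; [|exact: differentiable_cst|exact: differentiable_ln_ll].
rewrite derive_cst add0r derive_lnf; [|exact: de|exact: differentiable_ll].
rewrite derive_ll !mulr_sumr; apply: eq_bigr => j _; ring.
Qed.

Lemma dk_Phi m k : dk dom m (fun e => Phi e 0 k).
Proof.
have oD := @dom_open _ _ _ s p.
apply: (dk_eq oD (f := fun e => e 0 k * expR (lrho k e))); first by move=> e _; rewrite mxE.
by apply: dk_mul => //; [exact: dk_coord|apply: dk_expR => //; exact: dk_lrho].
Qed.

Lemma derive_Phi k eta v : dom eta -> 'D_v (fun e => Phi e 0 k) eta =
  expR (lrho k eta) * (v 0 k + eta 0 k * \sum_j Bmx eta k j * v 0 j).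
Proof.
move=> de; have dr := dk_differentiable (dk_lrho 0 k) de.
have -> : (fun e => Phi e 0 k) = (fun e => e 0 k * expR (lrho k e)).
  by apply/funext => e; rewrite mxE.
have de' := dk_differentiable (dk_expR (@dom_open _ _ _ s p) (dk_lrho 0 k)) de.
rewrite derive_mulf //; last exact: differentiable_coord.
by rewrite derive_expf // derive_lrho // derive_coord; ring.
Qed.

(** A kernel vector satisfies w_k = - eta_k (B w)_k, so that every w_k (B w)_k is <= 0; their sum is
    >= 0 because B is, hence all of them vanish. *)
Lemma diff_Phi_inj eta w : dom eta -> nneg eta -> 'd Phi eta w = 0 -> w = 0.
Proof.
move=> de ne.
have dP j : differentiable (fun y => Phi y 0 j) eta by exact: dk_differentiable (dk_Phi 0 j) de.
rewrite diff_rV // => /rowP H.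
have {}H k : w 0 k + eta 0 k * \sum_j Bmx eta k j * w 0 j = 0.
  have := H k; rewrite mxE derive_Phi // mxE => /eqP; rewrite mulf_eq0 gt_eqF ?expR_gt0 //=.
  by move/eqP.
set b := fun k => \sum_j Bmx eta k j * w 0 j in H.
have wb k : w 0 k * b k <= 0.
  have -> : w 0 k = - (eta 0 k * b k) by have := H k; rewrite -/(b k); lra.
  by have := sqr_ge0 (b k); have := ne k; rewrite expr2 => h1 h2; nra.
have sb : \sum_k w 0 k * b k == 0.
  rewrite eq_le sumr_le0 //=.
  have := Bmx_ge0 w de; rewrite qfE; congr (_ <= _); apply: eq_bigr => k _.
  by rewrite /b mulr_sumr; apply: eq_bigr => j _; rewrite mulrA.
have z : \sum_k - (w 0 k * b k) == 0 by rewrite sumrN oppr_eq0.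
move: z; rewrite psumr_eq0 => [/allP z|k _]; last by rewrite oppr_ge0.
apply/rowP => k; rewrite mxE; have := z k (mem_index_enum _).
rewrite /= oppr_eq0 mulf_eq0 => /orP[/eqP //|/eqP b0].
by have := H k; rewrite -/(b k) b0 mulr0 addr0.
Qed.

Lemma lfun_bounded : exists2 L, 1 <= L & forall (i : 'I_d) (xi : 'rV[R]_n), closedPoly P xi -> lfun i xi <= L.
Proof.
have Pn0 : closedPoly P !=set0 by exists p; exact: vc_in vc.
have H (i : 'I_d) : {L : R | forall xi, closedPoly P xi -> lfun i xi <= L}.
  apply: cid; have [c _ Hc] := EVT_max_rV Pn0 (compact_closedPoly bP)
    (continuous_subspaceT (@lfun_continuous _ _ P i)).
  by exists (lfun i c) => xi Pxi; apply: Hc; rewrite inE.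
exists (1 + \sum_i `|sval (H i)|); first by rewrite lerDl sumr_ge0.
move=> i xi Pxi; apply: (le_trans (svalP (H i) xi Pxi)).
rewrite (bigD1 i) //= addrCA (le_trans (ler_norm _)) // lerDl addr_ge0 // sumr_ge0 //.
Qed.

(** The solutions stay in a compact set. A cluster point lies in [dom], because [ll_lower] keeps the
    l_i away from 0 uniformly for bounded y; it solves the limit equation, and uniqueness identifies
    it. *)
Lemma etaS_continuous (T : topologicalType) (y : T -> 'rV[R]_n) (v0 : T) :
  (forall v, nneg (y v)) -> {for v0, continuous y} -> {for v0, continuous (fun v => etaS (y v))}.
Proof.
move=> y0 cy; set h := fun v => etaS (y v).
have hP v : [/\ dom (h v), nneg (h v) & Phi (h v) = y v] by apply: etaSP.
have [L L1 HL] := lfun_bounded.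
have llL v i : ll i (h v) <= L.
  by rewrite -lfun_pt; apply: HL; have [? ? _] := hP v; apply: (closed_ll vc).
have hL v : `|h v| <= L.
  apply: rV_norm_le; first by apply: le_trans L1.
  by move=> j; have [_ nh _] := hP v; rewrite ger0_norm // -(ll_s vc).
pose K := [set e : 'rV[R]_n | `|e| <= L + 1].
have cK : compact K.
  apply: bounded_closed_compact.
    by exists (L + 1); split; [exact: num_real|move=> M LM e /= /le_trans; apply; exact: ltW].
  apply: (@preimage_closed _ _ (fun e : 'rV[R]_n => `|e|) [set x | x <= L + 1]); last exact: closed_le.
  by move=> e _; apply: norm_continuous.
have nK : nbhs (h v0) K.
  apply/nbhs_ballP; exists 1 => //= e; rewrite -ball_normE /= => he.
  rewrite /K /= -[X in `|X|](subrK (h v0)) (le_trans (ler_normD _ _)) // addrC lerD //.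
  by rewrite distrC ltW.
have near_y e : 0 < e -> \forall v \near v0, `|y v0 - y v| < e.
  by move=> e0; have /cvgrPdist_lt := cy; apply.
have FK : ((fun v => h v) @ v0) K by apply: nearW => v; apply: (le_trans (hL v)); rewrite lerDl.
have clus c : cluster ((fun v => h v) @ v0) c -> c = h v0.
  move=> Hc.
  have inA (A : set 'rV[R]_n) : closed A -> (\forall v \near v0, A (h v)) -> A c.
    by move=> cA HA; apply: cA => B nB; apply: Hc.
  have nc : nneg c.
    move=> k; apply: (inA [set e : 'rV[R]_n | 0 <= e 0 k]).
      apply: (@preimage_closed _ _ (fun e : 'rV[R]_n => e 0 k) [set x | 0 <= x]); last exact: closed_ge.
      by move=> e _; apply: coord_continuous.
    by apply: nearW => v /=; have [_ nh _] := hP v.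
  pose Y := `|y v0| + 1.
  have Y0 : 0 <= Y by rewrite addr_ge0.
  have nY : \forall v \near v0, forall k, y v 0 k <= Y.
    apply: filterS (near_y 1 ltr01) => v Hv k.
    rewrite (le_trans (ler_norm _)) // (le_trans (rV_norm_coord _ _)) //.
    rewrite -(subrK (y v0) (y v)) (le_trans (ler_normD _ _)) // addrC lerD //.
    by rewrite distrC ltW.
  have dc : dom c.
    move=> i iS; have ci := co_gt0 vc iS.
    set Z := n%:R * (1 + L * Y) + d%:R * (1 + L + L * L) : R.
    apply: (@lt_le_trans _ _ (expR (- Z / co i))); first exact: expR_gt0.
    apply: (inA [set e | expR (- Z / co i) <= ll i e]).
      apply: (@preimage_closed _ _ (ll i) [set x | expR (- Z / co i) <= x]); last exact: closed_ge.
      by move=> e _; apply: ll_continuous.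
    apply: filterS nY => v Hv /=; have [dh nh Eh] := hP v.
    have cL j : co j <= L by apply: HL; exact: vc_in vc.
    have := ll_lower vc dh nh Eh L1 Y0 (llL v) cL Hv iS; rewrite -/Z => H.
    rewrite -[leRHS](@lnK R) ?posrE; last exact: dh.
    by rewrite ler_expR ler_pdivrMr // mulrC.
  have Pc : Phi c = y v0.
    apply/eqP; rewrite -subr_eq0 -normr_eq0; apply: contraT => z0.
    pose e := `|Phi c - y v0|; have e0 : 0 < e by rewrite /e lt_def z0 normr_ge0.
    have dPc : {for c, continuous Phi}.
      apply: differentiable_continuous; apply: differentiable_rV => j.
      exact: dk_differentiable (dk_Phi 0 j) dc.
    have e2 : 0 < e / 2 by rewrite divr_gt0.
    have nB : \forall z \near c, `|Phi c - Phi z| < e / 2.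
      by have /cvgrPdist_lt := dPc; apply.
    have nA : \forall v \near v0, [set z | `|y v0 - Phi z| < e / 2] (h v).
      by apply: filterS (near_y _ e2) => v /=; have [_ _ ->] := hP v.
    have [z [/= zA zB]] := Hc _ _ nA nB.
    have : `|Phi c - y v0| < e / 2 + e / 2.
      rewrite -(subrKA (Phi z)) (le_lt_trans (ler_normD _ _)) // ltrD //.
      by rewrite distrC.
    by rewrite -splitr ltxx.
  by apply/esym; apply: etaS_eq.
have cE : cluster ((fun v => h v) @ v0) = [set h v0].
  apply/seteqP; split=> [c /clus -> //|_ ->].
  have [c [_ Hc]] := cK _ _ FK.
  by rewrite -(clus c Hc).
apply: (@compact_cluster_set1 _ (h v0) _ K) => //; exact: norm_hausdorff.
Qed.

End SolutionMap.

(** * The Guillemin potential in a chart *)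

Section SmoothSolution.
Context {R : realType} {n : nat} (P : halfspaces R n).
Local Notation d := (nfacets P).
Variables (s : 'I_n -> 'I_d) (p : 'rV[R]_n).
Hypotheses (vc : vchart s p) (bP : bounded_set (closedPoly P)).
Local Notation ll := (ll s p).
Local Notation dom := (dom s p).
Local Notation lrho := (lrho s p).
Local Notation Phi := (Phi s p).
Local Notation Psi := (Psi s p).
Local Notation inS := (inS (P := P) s).
Local Notation Bmx := (Bmx s p).
Local Notation etaS := (etaS s p).

(** Jacobian matrix of [Phi] without the row factors exp (lrho_k). In this form it is invertible
    also where some eta_k vanish, unlike the product diag (eta) A to which it equals elsewhere. *)
Definition Mmx (eta : 'rV[R]_n) : 'M[R]_n := 1%:M + diag_mx eta *m Bmx eta.

Lemma MmxE eta k j : Mmx eta k j = (k == j)%:R + eta 0 k * Bmx eta k j.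
Proof. by rewrite /Mmx mul_diag_mx !mxE. Qed.

Lemma pd_Phi k j eta : dom eta ->
  pd j (fun e => Phi e 0 k) eta = expR (lrho k eta) * Mmx eta k j.
Proof.
move=> de; rewrite /pd derive_Phi // MmxE.
have dE i : (delta_mx 0 j : 'rV[R]_n) 0 i = (i == j)%:R by rewrite mxE eqxx.
rewrite dE; congr (_ * (_ + _ * _)).
rewrite (bigD1 j) //= dE eqxx mulr1 big1 ?addr0 // => i ij.
by rewrite dE (negbTE ij) mulr0.
Qed.

Lemma Mmx_det eta : dom eta -> nneg eta -> \det (Mmx eta) != 0.
Proof.
move=> de ne.
suff : (Mmx eta)^T \in unitmx by rewrite unitmx_tr unitmxE unitfE.
rewrite -row_free_unit -kermx_eq0; apply/eqP/row_matrixP => i; rewrite row0.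
have dP j : differentiable (fun y => Phi y 0 j) eta by exact: dk_differentiable (dk_Phi s p 0 j) de.
apply: (diff_Phi_inj de ne); rewrite diff_rV //; apply/rowP => k; rewrite !mxE.
have /sub_kermxP/rowP/(_ k) := row_sub i (kermx (Mmx eta)^T).
rewrite differentiable_derive_sum //; set w := row i _ => H.
under eq_bigr do rewrite pd_Phi // mulrCA.
have {}H : \sum_j w 0 j * (Mmx eta)^T j k = 0 by have := H; rewrite [LHS]mxE [RHS]mxE.
rewrite -mulr_sumr [X in _ * X](_ : _ = 0) ?mulr0 // -[RHS]H; apply: eq_bigr => j _.
by rewrite [X in _ = _ * X]mxE.
Qed.

Lemma dk_Bmx m j k : dk dom m (fun e => Bmx e j k).
Proof.
have oD := @dom_open _ _ _ s p.
apply: (dk_eq oD (f := fun e => \sum_(i | ~~ inS i) ac s i j * ac s i k * (ll i e)^-1)).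
  by move=> e _; rewrite mxE.
apply: dk_sum => // i iS; apply: dk_mul => //; first exact: dk_cst.
apply: dk_inv => //; first by move=> e de; rewrite gt_eqF // de.
by apply: dk_sub_set (dk_ll s p m i).
Qed.

Lemma dk_Mmx m j k : dk dom m (fun e => Mmx e j k).
Proof.
have oD := @dom_open _ _ _ s p.
apply: (dk_eq oD (f := fun e => (j == k)%:R + e 0 j * Bmx e j k)).
  by move=> e _; rewrite MmxE.
apply: dk_add => //; first exact: dk_cst.
by apply: dk_mul => //; [exact: dk_coord|exact: dk_Bmx].
Qed.

Lemma dk_Psi m : dk dom m Psi.
Proof.
have oD := @dom_open _ _ _ s p.
apply: dk_add => //; first by apply: dk_sum => // k _; exact: dk_coord.
apply: dk_sum => // i iS; apply: dk_sub => //.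
  apply: dk_sub => //; last exact: dk_cst.
  by apply: dk_sub_set (dk_ll s p m i).
by apply: dk_mul => //; [exact: dk_cst|exact: dk_lnll].
Qed.

Section Param.
Context {V : normedModType R}.
Variable y : V -> 'rV[R]_n.
Hypotheses (y0 : forall v, nneg (y v)) (dy : forall k, smo setT (fun v => y v 0 k)).

(** The solution along a family of right-hand sides. The families used are [yC] on the chart C^n,
    [yX] on the open torus and [yr] on the real points of the chart. *)
Definition etaV v := etaS (y v).

Lemma etaV_dom v : dom (etaV v). Proof. by have [] := etaSP vc bP (y0 v). Qed.
Lemma etaV_nneg v : nneg (etaV v). Proof. by have [] := etaSP vc bP (y0 v). Qed.
Lemma etaV_Phi v : Phi (etaV v) = y v. Proof. by have [] := etaSP vc bP (y0 v). Qed.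

Lemma differentiable_etaV v : differentiable etaV v.
Proof.
have dyv : differentiable y v.
  by apply: differentiable_rV => j; exact: dk_differentiable (dy j 0%N) Logic.I.
apply: (@inverse_differentiable _ _ _ _ Phi).
- apply: (etaS_continuous vc bP) => //; exact: differentiable_continuous.
- apply: differentiable_rV => j.
  exact: dk_differentiable (dk_Phi s p 0 j) (etaV_dom v).
- by move=> w; apply: diff_Phi_inj; [exact: etaV_dom|exact: etaV_nneg].
have -> : Phi \o etaV = y by apply/funext => w /=; rewrite etaV_Phi.
exact: dyv.
Qed.

Lemma differentiable_etaV_coord v j : differentiable (fun w => etaV w 0 j) v.
Proof.
apply: (@differentiable_comp _ _ _ _ etaV (fun e : 'rV[R]_n => e 0 j : R)).
  exact: differentiable_etaV.
exact: differentiable_coord.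
Qed.

Lemma derive_etaV_rel v w k : \sum_j Mmx (etaV v) k j * 'D_w (fun u => etaV u 0 j) v
  = expR (- lrho k (etaV v)) * 'D_w (fun u => y u 0 k) v.
Proof.
have -> : (fun u => y u 0 k) = (fun e => Phi e 0 k) \o etaV.
  by apply/funext => u /=; rewrite etaV_Phi.
rewrite derive_comp_rV; first last.
- exact: dk_differentiable (dk_Phi s p 0 k) (etaV_dom v).
- by move=> j; exact: differentiable_etaV_coord.
rewrite mulr_sumr; apply: eq_bigr => j _; rewrite pd_Phi; last exact: etaV_dom.
by rewrite expRN !mulrA mulVf ?mul1r // gt_eqF // expR_gt0.
Qed.

Lemma derive_etaV v w j : 'D_w (fun u => etaV u 0 j) v =
  \sum_k invmx (Mmx (etaV v)) j k *
    (expR (- lrho k (etaV v)) * 'D_w (fun u => y u 0 k) v).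
Proof.
have uM : Mmx (etaV v) \in unitmx.
  by rewrite unitmxE unitfE Mmx_det //; [exact: etaV_dom|exact: etaV_nneg].
pose c : 'cV[R]_n := \col_j 'D_w (fun u => etaV u 0 j) v.
have E : Mmx (etaV v) *m c = \col_k (expR (- lrho k (etaV v)) * 'D_w (fun u => y u 0 k) v).
  apply/colP => k; rewrite [LHS]mxE [RHS]mxE -derive_etaV_rel.
  by apply: eq_bigr => i _; rewrite [c _ _]mxE.
have := congr1 (fun x : 'cV[R]_n => x j 0) (mulKmx uM c).
rewrite E [LHS]mxE [RHS]mxE => <-; apply: eq_bigr => k _.
by rewrite [X in _ * X]mxE.
Qed.

(** Bootstrap: by [derive_etaV] the derivatives of [etaV] are expressed through [etaV] itself and
    the derivatives of y, so each order of regularity gives the next one. *)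
Lemma dk_etaV m j : dk setT m (fun v => etaV v 0 j).
Proof.
have oT : open [set: V] := openT.
elim: m j => [|m IH] j; split=> //; try by move=> v _; exact: differentiable_etaV_coord.
move=> w; have dcomp F : dk dom m F -> dk setT m (fun v => F (etaV v)).
  by move=> dF; apply: (dk_comp oT dF) => // v _; exact: etaV_dom.
apply: (dk_eq oT (f := fun v => \sum_k invmx (Mmx (etaV v)) j k *
    (expR (- lrho k (etaV v)) * 'D_w (fun u => y u 0 k) v))).
  by move=> v _; rewrite derive_etaV.
apply: dk_sum => // k _; apply: dk_mul => //.
  apply: dk_invmx => //; first by move=> a b; apply: (dcomp (fun e => Mmx e a b)); exact: dk_Mmx.
  by move=> v _; apply: Mmx_det; [exact: etaV_dom|exact: etaV_nneg].
apply: dk_mul => //; last by have [_] := dy k m.+1; apply.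
apply: dk_expR => //; apply: dk_opp => //.
by apply: (dcomp (lrho k)); exact: dk_lrho.
Qed.

Lemma dk_comp_etaV m F : dk dom m F -> dk setT m (fun v => F (etaV v)).
Proof.
move=> dF; apply: (dk_comp openT dF) => [v _|j]; first exact: etaV_dom.
exact: dk_etaV.
Qed.

End Param.

Lemma sup_max (A : set R) m : A m -> (forall x, A x -> x <= m) -> sup A = m.
Proof.
move=> Am Amax; apply/eqP; rewrite eq_le; apply/andP; split.
  by apply: ge_sup => //; exists m.
by apply: ub_le_sup => //; exists m.
Qed.

Definition yC (zeta : Cn n) : 'rV[R]_n := \row_k (zeta.1 0 k ^+ 2 + zeta.2 0 k ^+ 2).

Lemma chart_s (zeta : Cn n) k : chart s zeta 0 (s k) = (zeta.1 0 k +i* zeta.2 0 k)%C.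
Proof.
rewrite mxE; case: pickP => [j /eqP /(s_inj vc) -> //|/(_ k)].
by rewrite eqxx.
Qed.

Lemma chart_notin (zeta : Cn n) i : ~~ inS i -> chart s zeta 0 i = 1.
Proof.
move=> iS; rewrite mxE; case: pickP => [j ji|//].
by move/negP: iS => []; apply/existsP; exists j.
Qed.

Lemma sqmodC_chart (zeta : Cn n) k : sqmodC (chart s zeta 0 (s k)) = yC zeta 0 k.
Proof. by rewrite chart_s /sqmodC /= mxE. Qed.

Lemma yC_nneg zeta : nneg (yC zeta).
Proof. by move=> k; rewrite mxE addr_ge0 // sqr_ge0. Qed.

Lemma guillemin_vE xi : guillemin_v P xi = \sum_k etaof s xi 0 k * ln (etaof s xi 0 k)
  + \sum_(i | ~~ inS i) ll i (etaof s xi) * ln (ll i (etaof s xi)).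
Proof.
rewrite /guillemin_v (sum_facets vc); congr (_ + _); apply: eq_bigr => k _.
  by rewrite mxE.
by rewrite -(lfun_etaof vc).
Qed.

(** The supremum is attained at the solution for y_k = |zeta_k|^2, and the resulting expression is
    smooth also where some zeta_k vanish. This is how the potential is differentiated on the whole
    chart. *)
Lemma pot_chart (zeta : Cn n) :
  guillemin_pot (chart s zeta) = Psi (etaS (yC zeta)).
Proof.
have [de ne E] := etaSP vc bP (yC_nneg zeta).
have val xi : \sum_(i < d) lfun i xi * ln (sqmodC (chart s zeta 0 i)) - guillemin_v P xi
    = potJ s p (yC zeta) (etaof s xi).
  have -> : \sum_(i < d) lfun i xi * ln (sqmodC (chart s zeta 0 i)) =
      \sum_k etaof s xi 0 k * ln (yC zeta 0 k).
    rewrite (sum_facets vc) [X in _ + X]big1 ?addr0; last first.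
      by move=> i iS; rewrite chart_notin // /sqmodC /= expr1n expr0n addr0 ln1 mulr0.
    by apply: eq_bigr => k _; rewrite sqmodC_chart [etaof s xi 0 k]mxE.
  by rewrite guillemin_vE /potJ opprD addrA.
have y0 k : yC zeta 0 k = 0 <-> chart s zeta 0 (s k) = 0.
  rewrite chart_s mxE; split=> [/eqP|].
    by rewrite paddr_eq0 ?sqr_ge0 // !sqrf_eq0 => /andP[/eqP -> /eqP ->].
  by case=> -> ->; rewrite expr0n addr0.
apply: sup_max.
  exists (pt s p (etaS (yC zeta))); last by rewrite val (ptK vc) (potJ_eq ne E).
  split; first exact: (closed_ll vc).
  move=> i; have [/existsP[k /eqP <-]|iS] := boolP (inS i); last first.
    by rewrite chart_notin // => /eqP; rewrite oner_eq0.
  move=> /y0 /eqP; rewrite (Phi_eq0 E) => /eqP.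
  by rewrite lfun_pt (ll_s vc).
move=> _ [xi [Pxi zxi] <-]; rewrite val; apply: (potJ_le de ne E).
- by move=> k; rewrite mxE; exact: Pxi.
- by move=> i; rewrite -(lfun_etaof vc); exact: Pxi.
- by move=> k /y0 /zxi; rewrite mxE.
Qed.

Definition yX (x : 'rV[R]_n) : 'rV[R]_n := \row_k expR (dotrv x (ed s k)).

Lemma yX_nneg x : nneg (yX x).
Proof. by move=> k; rewrite mxE expR_ge0. Qed.

Lemma yX_gt0 x k : 0 < yX x 0 k. Proof. by rewrite mxE expR_gt0. Qed.

Definition xiX (x : 'rV[R]_n) := pt s p (etaS (yX x)).

Lemma xiX_in x : closedPoly P (xiX x).
Proof. by have [de ne _] := etaSP vc bP (yX_nneg x); exact: (closed_ll vc). Qed.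

Lemma etaX_gt0 x k : 0 < etaS (yX x) 0 k.
Proof.
have [_ ne E] := etaSP vc bP (yX_nneg x).
by rewrite lt_def ne andbT -(Phi_eq0 E) gt_eqF // yX_gt0.
Qed.

Lemma dotrv_potJ x xi : dotrv x xi - guillemin_v P xi = dotrv x p + potJ s p (yX x) (etaof s xi).
Proof.
rewrite guillemin_vE /potJ opprD !addrA; congr (_ - _ - _).
rewrite -{1}(etaofK vc xi) /pt dotrvDr dotrv_sumr; congr (_ + _); apply: eq_bigr => k _.
by rewrite dotrvZr [X in ln X]mxE expRK.
Qed.

Lemma guillemin_gE_max x : guillemin_g P x = dotrv x (xiX x) - guillemin_v P (xiX x) /\
  forall xi, closedPoly P xi -> dotrv x xi - guillemin_v P xi <= guillemin_g P x.
Proof.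
have [de ne E] := etaSP vc bP (yX_nneg x).
have gE : guillemin_g P x = dotrv x p + Psi (etaS (yX x)).
  apply: sup_max.
    exists (xiX x); first exact: xiX_in.
    by rewrite dotrv_potJ (ptK vc) (potJ_eq ne E).
  move=> _ [xi Pxi <-]; rewrite dotrv_potJ lerD2l; apply: (potJ_le de ne E).
  - by move=> k; rewrite mxE; exact: Pxi.
  - by move=> i; rewrite -(lfun_etaof vc); exact: Pxi.
  - by move=> k H; have := yX_gt0 x k; rewrite H ltxx.
split; first by rewrite gE dotrv_potJ (ptK vc) (potJ_eq ne E).
move=> xi Pxi; rewrite gE dotrv_potJ lerD2l; apply: (potJ_le de ne E).
- by move=> k; rewrite mxE; exact: Pxi.
- by move=> i; rewrite -(lfun_etaof vc); exact: Pxi.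
- by move=> k H; have := yX_gt0 x k; rewrite H ltxx.
Qed.

Lemma guillemin_gE x : guillemin_g P x = dotrv x p + Psi (etaS (yX x)).
Proof.
have [de ne E] := etaSP vc bP (yX_nneg x).
by rewrite (guillemin_gE_max x).1 dotrv_potJ (ptK vc) (potJ_eq ne E).
Qed.

Lemma smo_dotrv (w : 'rV[R]_n) : smo setT (fun x => dotrv x w).
Proof.
move=> m; apply: dk_sum => [|j _]; first exact: openT.
by apply: dk_mul; [exact: openT|exact: dk_coord openT|exact: dk_cst openT _ _].
Qed.

Lemma derive_dotrvf (w x v : 'rV[R]_n) : 'D_v (fun x => dotrv x w) x = dotrv v w.
Proof.
rewrite derive_sumf => [|i _]; last first.
  by apply: differentiableM; [exact: differentiable_coord|exact: differentiable_cst].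
apply: eq_bigr => i _; rewrite derive_mulf ?derive_cst ?mulr0 ?add0r ?derive_coord 1?mulrC //.
exact: differentiable_coord.
Qed.

Lemma smo_yX k : smo setT (fun x => yX x 0 k).
Proof.
move=> m; apply: (dk_eq openT (f := fun x => expR (dotrv x (ed s k)))); first by move=> x _; rewrite mxE.
by apply: dk_expR; [exact: openT|exact: smo_dotrv].
Qed.

Lemma derive_yX k x v : 'D_v (fun x => yX x 0 k) x = yX x 0 k * dotrv v (ed s k).
Proof.
have -> : (fun x => yX x 0 k) = (fun x => expR (dotrv x (ed s k))) by apply/funext => z; rewrite mxE.
rewrite derive_expf ?derive_dotrvf ?mxE //.
exact: dk_differentiable (smo_dotrv (ed s k) 0) Logic.I.
Qed.

Lemma smo_guillemin_g : smo setT (guillemin_g P).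
Proof.
move=> m; apply: (dk_eq openT (f := fun x => dotrv x p + Psi (etaV yX x))).
  by move=> x _; rewrite guillemin_gE.
apply: dk_add; [exact: openT|exact: smo_dotrv|].
by apply: dk_comp_etaV; [exact: yX_nneg|exact: smo_yX|exact: dk_Psi].
Qed.

(** Envelope argument: z |-> <z, xiX x> - g (z) is maximal at z = x. *)
Lemma derive_g x v : 'D_v (guillemin_g P) x = dotrv v (xiX x).
Proof.
pose F z := dotrv z (xiX x) - guillemin_g P z.
have dF : dk setT 1 F.
  by apply: dk_sub; [exact: openT|exact: smo_dotrv|exact: smo_guillemin_g].
have [|D0 _] := @derive_at_max R _ F x v dF.
  move=> z; rewrite /F (guillemin_gE_max x).1.
  by have := (guillemin_gE_max z).2 _ (xiX_in x); lra.
move: D0; rewrite derive_subf ?derive_dotrvf; first by move/eqP; rewrite subr_eq0 => /eqP.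
  exact: dk_differentiable (smo_dotrv _ 0) Logic.I.
exact: dk_differentiable (smo_guillemin_g 0) Logic.I.
Qed.

Lemma grad_g x : grad (guillemin_g P) x = xiX x.
Proof. by apply/rowP => j; rewrite mxE /pd derive_g dotrvC dotrv_delta. Qed.

Lemma derive_g_nrm x a : 'D_(nrm (s a)) (guillemin_g P) x =
  dotrv (nrm (s a)) p + etaV yX x 0 a.
Proof.
rewrite derive_g dotrvDr dotrv_sumr; congr (_ + _).
rewrite (bigD1 a) //= dotrvZr (nrm_ed vc) eqxx mulr1 big1 ?addr0 // => k ka.
by rewrite dotrvZr (nrm_ed vc) eq_sym (negbTE ka) mulr0.
Qed.

Lemma derive2_g x a v : 'D_v ('D_(nrm (s a)) (guillemin_g P)) x =
  'D_v (fun z => etaV yX z 0 a) x.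
Proof.
have -> : 'D_(nrm (s a)) (guillemin_g P) = (fun z => dotrv (nrm (s a)) p + etaV yX z 0 a).
  by apply/funext => z; rewrite derive_g_nrm.
have dE : differentiable (fun z => etaV yX z 0 a) x.
  by apply: differentiable_etaV_coord; [exact: yX_nneg|exact: smo_yX].
by rewrite derive_addf // derive_cst add0r.
Qed.

Definition UR : 'M[R]_n := \matrix_(k, j) nrm (s k) 0 j.

(** The normals at a vertex form a basis of the lattice, so the determinant is 1 or -1. Consequently
    Hessian determinants are the same in the coordinates x and along the normals. *)
Lemma UR_det2 : \det UR ^+ 2 = 1.
Proof.
have -> : UR = map_mx intr (UZ s) by apply/matrixP => k j; rewrite !mxE.
rewrite det_map_mx.
have : `|\det (UZ s)|%N == 1%N.
  have := congr1 (fun A => `|\det A|%N) (mulmxV (vc_unit vc)).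
  by rewrite det_mulmx det1 abszM /= => /eqP; rewrite muln_eq1 => /andP[].
case: (\det (UZ s)) => [[|[|m]]|[|m]] //= _.
  by rewrite expr1n.
by rewrite NegzE rmorphN sqrrN expr1n.
Qed.

Lemma UR_unit : UR \in unitmx.
Proof.
rewrite unitmxE unitfE; apply: contraTneq (oner_neq0 R) => d0.
by rewrite -UR_det2 d0 expr0n eqxx.
Qed.

Lemma row_UR k : row k UR = nrm (s k).
Proof. by apply/rowP => j; rewrite !mxE. Qed.

Lemma hessU (f : 'rV[R]_n -> R) x a b : dk setT 1 f ->
  (UR *m hess f x *m UR^T) a b = 'D_(nrm (s a)) ('D_(nrm (s b)) f) x.
Proof.
move=> df.
rewrite (derive_hess _ _ openT df Logic.I) -[LHS]qf_delta /qf.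
by rewrite !mulmxA -rowE -[in LHS]mulmxA -trmx_mul -rowE !row_UR.
Qed.

Definition Amx (eta : 'rV[R]_n) : 'M[R]_n := diag_mx (\row_k (eta 0 k)^-1) + Bmx eta.

Lemma Amx_posdef x : posdef (Amx (etaS (yX x))).
Proof.
have [de ne _] := etaSP vc bP (yX_nneg x).
apply: diag_plus_posdef; first exact: etaX_gt0.
  exact: Bmx_sym.
by move=> v; apply: Bmx_ge0.
Qed.

(** Differentiating Phi (eta) = y along the normals gives M H^T = diag (eta), while M = diag (eta)
    A. This is the duality of the Hessians of g and of its Legendre transform, in dual bases. *)
Lemma hessU_g x : UR *m hess (guillemin_g P) x *m UR^T = invmx (Amx (etaS (yX x))).
Proof.
set H := _ *m _ *m _; set eta := etaS _.
have [sA _] := Amx_posdef x; have uA := posdef_unit (Amx_posdef x).2.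
have e0 k : eta 0 k != 0 by rewrite gt_eqF // etaX_gt0.
have ME : Mmx eta = diag_mx eta *m Amx eta.
  rewrite /Amx mulmxDr mulmx_diag /Mmx; congr (_ + _).
  apply/matrixP => i j; rewrite !mxE; case: eqVneq => [->|_]; last by rewrite mulr0n.
  by rewrite mulfV.
have MH : Mmx eta *m H^T = diag_mx eta.
  apply/matrixP => k a; rewrite mxE; under eq_bigr => j _.
    rewrite [H^T _ _]mxE hessU; last exact: smo_guillemin_g.
    rewrite derive2_g; over.
  rewrite (derive_etaV_rel yX_nneg smo_yX) derive_yX (nrm_ed vc).
  have [_ _ E] := etaSP vc bP (yX_nneg x).
  have := congr1 (fun v : 'rV[R]_n => v 0 k) E; rewrite mxE => <-.
  rewrite /etaV -/eta [RHS]mxE expRN mulrA mulrCA mulVf ?mulr1; last first.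
    by rewrite gt_eqF // expR_gt0.
  by rewrite eq_sym; case: eqVneq => [->|_]; rewrite ?mulr1 ?mulr0 ?mulr1n ?mulr0n.
have AH : Amx eta *m H^T = 1%:M.
  have uD : diag_mx eta \in unitmx.
    by rewrite unitmxE det_diag unitfE; apply/prodf_neq0 => k _.
  by apply: (can_inj (mulKmx uD)); rewrite mulmxA -ME MH mulmx1.
have -> : H = (H^T)^T by rewrite trmxK.
have -> : H^T = invmx (Amx eta) by rewrite -[LHS](mulKmx uA) AH mulmx1.
by rewrite trmx_inv sA.
Qed.

End SmoothSolution.

(** * Charts of the toric manifold *)

Section ComplexFacts.
Context {R : realType}.

Lemma sqmodCM (z w : R[i]) : sqmodC (z * w) = sqmodC z * sqmodC w.
Proof. by case: z => a b; case: w => c e; rewrite /sqmodC /=; ring. Qed.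

Lemma sqmodC_real (x : R) : sqmodC (x%:C)%C = x ^+ 2.
Proof. by rewrite /sqmodC /= expr0n addr0. Qed.

Lemma sqmodC1 : sqmodC (1 : R[i]) = 1.
Proof. by rewrite /sqmodC /= expr1n expr0n addr0. Qed.

Lemma sqmodC0 : sqmodC (0 : R[i]) = 0.
Proof. by rewrite /sqmodC /= expr0n addr0. Qed.

Lemma sqmodC_ge0 (z : R[i]) : 0 <= sqmodC z.
Proof. by rewrite /sqmodC addr_ge0 // sqr_ge0. Qed.

Lemma sqmodC_eq0 (z : R[i]) : (sqmodC z == 0) = (z == 0).
Proof. by case: z => a b; rewrite /sqmodC paddr_eq0 ?sqr_ge0 // !sqrf_eq0 eq_complex. Qed.

Lemma sqmodC_gt0 (z : R[i]) : z != 0 -> 0 < sqmodC z.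
Proof. by move=> z0; rewrite lt_def sqmodC_eq0 z0 sqmodC_ge0. Qed.

Lemma sqmodC_prod (I : Type) (r : seq I) (Q : pred I) (F : I -> R[i]) :
  sqmodC (\prod_(i <- r | Q i) F i) = \prod_(i <- r | Q i) sqmodC (F i).
Proof.
apply: (big_morph (@sqmodC R) sqmodCM).
exact: sqmodC1.
Qed.

Lemma sqmodCX (z : R[i]) (m : int) : sqmodC (z ^ m) = sqmodC z ^ m.
Proof.
have H (k : nat) (w : R[i]) : sqmodC (w ^+ k) = sqmodC w ^+ k.
  elim: k => [|k IH]; first by rewrite !expr0; exact: sqmodC1.
  by rewrite !exprS sqmodCM IH.
have HV (w : R[i]) : sqmodC w^-1 = (sqmodC w)^-1.
  have [->|w0] := eqVneq w 0.
    by rewrite invr0 sqmodC0 invr0.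
  have : sqmodC (w^-1 * w) = 1  by rewrite mulVf // sqmodC1.
  rewrite sqmodCM => E; apply: (@mulIf _ (sqmodC w)); first by rewrite sqmodC_eq0.
  by rewrite E mulVf // sqmodC_eq0.
case: m => k; first exact: H.
by rewrite NegzE -!invr_expz HV; congr (_^-1); apply: H.
Qed.

Lemma norm_sqmodC1 (z : R[i]) : sqmodC z = 1 -> `|z| = 1.
Proof. by rewrite /sqmodC normc_def => ->; rewrite sqrtr1. Qed.

Lemma ln_exprz (x : R) (m : int) : 0 < x -> ln (x ^ m) = m%:~R * ln x.
Proof.
move=> x0; case: m => k; first by rewrite lnXn // -mulr_natl.
rewrite NegzE -invr_expz lnV ?posrE ?exprz_gt0 // rmorphN mulNr; congr (- _).
by rewrite lnXn // -mulr_natl.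
Qed.

Lemma expR_exprz (t : R) (m : int) : expR t ^ m = expR (m%:~R * t).
Proof.
by rewrite -[LHS](@lnK R) ?posrE ?exprz_gt0 ?expR_gt0 // ln_exprz ?expR_gt0 // expRK.
Qed.

End ComplexFacts.

Section Torus.
Context {R : realType} {n : nat} (P : halfspaces R n).
Local Notation d := (nfacets P).

Lemma exprz_sum (x : R[i]) (I : Type) (r : seq I) (F : I -> int) : x != 0 ->
  x ^ (\sum_(i <- r) F i) = \prod_(i <- r) x ^ F i.
Proof.
move=> x0; apply: (big_morph (fun m : int => x ^ m)) => [a b|]; last exact: expr0z.
by rewrite expfzDr.
Qed.

Lemma prod_exprz (I : Type) (r : seq I) (Q : pred I) (F : I -> R[i]) (m : int) :
  (\prod_(i <- r | Q i) F i) ^ m = \prod_(i <- r | Q i) F i ^ m.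
Proof.
apply: (big_morph (fun x : R[i] => x ^ m)) => [a b|]; last exact: exp1rz.
by rewrite expfzMl.
Qed.

Lemma prod_facets (s : 'I_n -> 'I_d) p (F : 'I_d -> R[i]) : vchart s p ->
  \prod_i F i = \prod_k F (s k) * \prod_(i | ~~ inS s i) F i.
Proof.
move=> vc; rewrite (bigID (inS s)) /=; congr (_ * _).
rewrite -(@big_imset _ _ _ _ _ s predT F) /=; last by move=> i j _ _; apply: (s_inj vc).
apply: eq_bigl => i; apply/existsP/imsetP => [[k /eqP <-]|[k _ ->]]; first by exists k.
by exists k.
Qed.

(** [delzant] supplies one unimodular enumeration of the facets at a vertex, while [chart_index]
    admits any enumeration; two of them differ by a permutation of the rows. *)
Lemma unit_chart (s s' : 'I_n -> 'I_d) p : facets_at p s -> facets_at p s' ->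
  UZ s' \in unitmx -> UZ s \in unitmx.
Proof.
move=> [si sE] [s'i s'E] u'.
have H k : exists k', s' k' == s k.
  by have [k' <-] := (s'E (s k)).1 ((sE (s k)).2 (ex_intro _ k erefl)); exists k'.
pose g k := xchoose (H k).
have gE k : s' (g k) = s k by apply/eqP; exact: (xchooseP (H k)).
have gi : injective g by move=> a b ab; apply: si; rewrite -!gE ab.
have -> : UZ s = row_perm (perm.perm gi) (UZ s').
  by apply/matrixP => k j; rewrite !mxE perm.permE gE.
by rewrite row_permE unitmx_mul unitmx_perm.
Qed.

Lemma vchart_of (s : 'I_n -> 'I_d) p : delzant P -> vertex P p -> facets_at p s -> vchart s p.
Proof.
move=> [_ _ _ HU] vp fp; split=> //; first by case: vp.
by have [s' f' u'] := HU p vp; apply: unit_chart f' u'.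
Qed.

Lemma vchart_exists p : delzant P -> vertex P p -> exists s : 'I_n -> 'I_d, vchart s p.
Proof.
move=> HP vp; have [_ _ _ HU] := HP; have [s fs _] := HU p vp.
by exists s; exact: vchart_of.
Qed.

Lemma edge_feasible (s : 'I_n -> 'I_d) p k : vchart s p ->
  exists2 t, 0 < t & closedPoly P (p + t *: ed s k).
Proof.
move=> vc.
have ptE (t : R) : p + t *: ed s k = pt s p (t *: delta_mx 0 k).
  rewrite /pt; congr (_ + _); rewrite (bigD1 k) //= !mxE !eqxx mulr1 big1 ?addr0 // => j jk.
  by rewrite !mxE (negbTE jk) andbF mulr0 scale0r.
have llE (t : R) i : ll s p i (t *: delta_mx 0 k) = co p i + t * ac s i k.
  rewrite /ll; congr (_ + _); rewrite (bigD1 k) //= !mxE !eqxx mulr1 big1 ?addr0 // => j jk.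
  by rewrite !mxE (negbTE jk) andbF mulr0 mul0r.
have H : \forall t \near (0 : R), forall i, ~~ inS s i -> 0 < co p i + t * ac s i k.
  apply: (@filter_forall _ _ (fun i (t : R) => ~~ inS s i -> 0 < co p i + t * ac s i k)
    (nbhs (0 : R)) (nbhs_filter (0 : R))) => i.
  have [iS|iS] := boolP (inS s i); first by apply: nearW.
  have l0 : 0 < co p i + 0 * ac s i k by rewrite mul0r addr0; exact: (co_gt0 vc).
  have H0 : \forall t \near (0 : R), 0 < co p i + t * ac s i k
    := @affine_continuous R (co p i) (ac s i k) 0 _ (openP (@open_gt R 0) l0).
  by apply: filterS H0 => t lt' _.
have [D /= D0 HD] := (nbhs_ballP _ _).1 H.
have D2 : 0 < D / 2 by rewrite divr_gt0.
exists (D / 2) => //; rewrite ptE; apply: (closed_ll vc); last first.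
  by move=> j; rewrite !mxE mulr_ge0 ?ler0n // ltW.
move=> i iS; rewrite llE; apply: HD => //.
by rewrite -ball_normE /= sub0r normrN gtr0_norm // ltr_pdivrMr // ltr_pMr // ltr1n.
Qed.

(** Moving from p along e_k leaves only the facet s k among those through p, so one stays in the
    face cut out by I. *)
Lemma argmax_edge_le (s : 'I_n -> 'I_d) p (I : 'I_d -> Prop) (c : 'rV[R]_n) k : vchart s p ->
  (forall i, I i -> lfun i p = 0) ->
  (forall xi, closedPoly P xi -> (forall i, I i -> lfun i xi = 0) -> dotrv c xi <= dotrv c p) ->
  ~ I (s k) -> dotrv c (ed s k) <= 0.
Proof.
move=> vc Ip pmax Ik; have [t t0 Ht] := edge_feasible k vc.
have := pmax _ Ht; rewrite dotrvDr dotrvZr gerDl pmulr_rle0 //; apply=> i Ii.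
rewrite lfunD dotrvZr -acE (Ip _ Ii) add0r.
have [j ji] := (proj2 (vc_fac vc) i).1 (Ip _ Ii).
have jk : j != k by apply/eqP => E; apply: Ik; rewrite -E ji.
by rewrite -ji (ac_s vc) (negbTE jk) mulr0.
Qed.

Lemma max_vertex (x : 'rV[R]_n) : delzant P -> exists (s : 'I_n -> 'I_d) p, [/\ vchart s p, vertex P p &
   forall k, dotrv x (ed s k) <= 0].
Proof.
move=> HP; have [[xi0 Oxi0] bP _ _] := HP.
have h : exists xi, closedPoly P xi /\ forall i : 'I_d, False -> lfun i xi = 0.
  by exists xi0; split=> //; exact: openPoly_closed.
have [p [vp Ip pmax]] := @vertex_argmax _ _ P bP (fun=> False) x h.
have [s vc] := vchart_exists HP vp.
by exists s, p; split => // k; apply: (argmax_edge_le vc Ip pmax).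
Qed.

Section Invariant.
Variable phi : 'rV[R[i]]_d -> R.
Hypotheses (sphi : smooth_on_M phi) (tphi : torus_invariant phi).

Lemma nonzero_coxU (z : 'rV[R[i]]_d) : closedPoly P !=set0 -> (forall i, z 0 i != 0) -> coxU z.
Proof. by move=> [p Pp] z0; exists p => // i zi; have := z0 i; rewrite zi eqxx. Qed.

(** Polar decomposition of z / z': the moduli form an element of [coxK], by equality of the
    logarithmic coordinates, and the phases lie in (S^1)^d. *)
Lemma logcoord_invariant (z z' : 'rV[R[i]]_d) : closedPoly P !=set0 ->
  (forall i, z 0 i != 0) -> (forall i, z' 0 i != 0) ->
  logcoord z = logcoord z' -> phi z = phi z'.
Proof.
move=> Pn0 z0 z'0 E.
pose t i := (ln (sqmodC (z 0 i)) - ln (sqmodC (z' 0 i))) / 2.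
pose rho : 'rV[R[i]]_d := \row_i ((expR (t i))%:C)%C.
pose th : 'rV[R[i]]_d := \row_i (z 0 i / (rho 0 i * z' 0 i)).
have rho0 i : rho 0 i != 0.
  by rewrite mxE; apply/eqP => /(congr1 (@complex.Re R)) /= /eqP; rewrite gt_eqF // expR_gt0.
have rz : ctimes th (ctimes rho z') = z.
  apply/rowP => i; rewrite /ctimes [LHS]mxE [th _ _]mxE [X in _ * X]mxE.
rewrite divfK //.
  by rewrite mulf_neq0.
have u1 : coxU z' by exact: nonzero_coxU.
have u2 : coxU (ctimes rho z').
  by apply: nonzero_coxU => // i; rewrite mxE mulf_neq0.
rewrite -rz tphi //; last first.
  move=> i; apply: norm_sqmodC1.
  have rzn : rho 0 i * z' 0 i != 0 by rewrite mulf_neq0.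
  apply: (@mulIf _ (sqmodC (rho 0 i * z' 0 i))); first by rewrite sqmodC_eq0.
  rewrite -sqmodCM mul1r [th _ _]mxE divfK // sqmodCM [rho _ _]mxE sqmodC_real.
  have sz := sqmodC_gt0 (z0 i); have sz' := sqmodC_gt0 (z'0 i).
  have -> : expR (t i) ^+ 2 = sqmodC (z 0 i) / sqmodC (z' 0 i).
    rewrite -expRM_natl; have -> : 2%:R * t i = ln (sqmodC (z 0 i)) - ln (sqmodC (z' 0 i)).
      by rewrite /t; field.
    by rewrite expRD expRN !lnK ?posrE.
  by rewrite divfK // gt_eqF.
apply: (proj1 sphi) => //; split=> // j.
have -> : \prod_i rho 0 i ^ normal P i j = ((\prod_i expR ((normal P i j)%:~R * t i))%:C)%C.
  rewrite rmorph_prod; apply: eq_bigr => i _; rewrite mxE -expR_exprz.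
  by rewrite [RHS]/= -(@rmorphXz _ _ (real_complex R)) // unitfE gt_eqF // expR_gt0.
have -> : (1 : R[i]) = ((expR 0)%:C)%C by rewrite expR0.
rewrite -expR_sum; congr ((expR _)%:C)%C.
have := congr1 (fun v : 'rV[R]_n => v 0 j) E; rewrite !mxE => {}E.
under eq_bigr do rewrite /t mulrA.
rewrite -mulr_suml; under eq_bigr do rewrite mulrBr.
by rewrite sumrB E subrr mul0r.
Qed.

Lemma on_torusE (z : 'rV[R[i]]_d) : closedPoly P !=set0 -> (forall i, z 0 i != 0) ->
  on_torus phi (logcoord z) = phi z.
Proof.
move=> Pn0 z0; rewrite /on_torus; case: xgetP => [w _ [w0 wE]|/(_ z) H].
  exact: logcoord_invariant.
by exfalso; apply: H.
Qed.

End Invariant.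

Section OneChart.
Variables (s : 'I_n -> 'I_d) (p : 'rV[R]_n).
Hypotheses (vc : vchart s p) (bP : bounded_set (closedPoly P)).

Definition Xlog (zeta : @Cn R n) : 'rV[R]_n := \sum_k ln (yC zeta 0 k) *: nrm (s k).
Definition generic (zeta : @Cn R n) := forall k, 0 < yC zeta 0 k.

Lemma chart_neq0 zeta i : generic zeta -> chart s zeta 0 i != 0.
Proof.
move=> gz; have [/existsP[k /eqP <-]|iS] := boolP (inS s i).
  by rewrite -sqmodC_eq0 (sqmodC_chart vc) gt_eqF.
by rewrite chart_notin // oner_eq0.
Qed.

Lemma logcoord_chart zeta : logcoord (chart s zeta) = Xlog zeta.
Proof.
apply/rowP => j; rewrite mxE (sum_facets vc) [X in _ + X]big1 ?addr0; last first.
  by move=> i iS; rewrite chart_notin // /sqmodC /= expr1n expr0n addr0 ln1 mulr0.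
rewrite /Xlog summxE; apply: eq_bigr => k _.
by rewrite (sqmodC_chart vc) [RHS]mxE [nrm _ _ _]mxE mulrC.
Qed.

Lemma yX_Xlog zeta : generic zeta -> yX s (Xlog zeta) = yC zeta.
Proof.
move=> gz; apply/rowP => k; rewrite [LHS]mxE /Xlog dotrv_suml (bigD1 k) //=.
rewrite dotrvZl (nrm_ed vc) eqxx mulr1 big1 ?addr0; last first.
  by move=> j jk; rewrite dotrvZl (nrm_ed vc) (negbTE jk) mulr0.
by rewrite lnK ?posrE.
Qed.

Definition zetaX (x : 'rV[R]_n) : @Cn R n := (\row_k expR (dotrv x (ed s k) / 2), 0).

Lemma yC_zetaX x : yC (zetaX x) = yX s x.
Proof.
apply/rowP => k; rewrite !mxE /= expr0n addr0 -expRM_natl; congr expR.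
by rewrite mulrC divfK.
Qed.

Lemma generic_zetaX x : generic (zetaX x).
Proof. by move=> k; rewrite yC_zetaX yX_gt0. Qed.

Lemma Xlog_zetaX x : Xlog (zetaX x) = x.
Proof.
rewrite /Xlog yC_zetaX [RHS](nrm_expand vc); apply: eq_bigr => k _.
by rewrite mxE expRK.
Qed.

Section WithPhi.
Variable phi : 'rV[R[i]]_d -> R.
Hypotheses (sphi : smooth_on_M phi) (tphi : torus_invariant phi).

Definition fpot (x : 'rV[R]_n) : R := guillemin_g P x + on_torus phi x.
Definition Fpot (zeta : @Cn R n) : R := guillemin_pot (chart s zeta) + phi (chart s zeta).

Let Pn0 : closedPoly P !=set0. Proof. by exists p; exact: vc_in vc. Qed.

Lemma on_torus_chart zeta : generic zeta -> on_torus phi (Xlog zeta) = phi (chart s zeta).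
Proof.
by move=> gz; rewrite -logcoord_chart on_torusE // => i; exact: chart_neq0.
Qed.

Lemma fpot_chart zeta : generic zeta -> fpot (Xlog zeta) = dotrv (Xlog zeta) p + Fpot zeta.
Proof.
move=> gz; rewrite /fpot /Fpot on_torus_chart // (pot_chart vc bP) (guillemin_gE vc bP).
by rewrite yX_Xlog // [RHS]addrA.
Qed.

Lemma fpot_zetaX x : fpot x = dotrv x p + Fpot (zetaX x).
Proof. by rewrite -{1 2}(Xlog_zetaX x) fpot_chart //; exact: generic_zetaX. Qed.

End WithPhi.
End OneChart.

(* The coordinates of z in the chart of a vertex which maximizes log |z| on the
   face of z are at most 1 in modulus: M is covered by finitely many polydiscs. *)
Lemma polydisc_cover (phi : 'rV[R[i]]_d -> R) (z : 'rV[R[i]]_d) : delzant P -> smooth_on_M phi ->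
  coxU z -> exists (s : 'I_n -> 'I_d) p (zeta : @Cn R n), [/\ vchart s p, vertex P p, phi z = phi (chart s zeta) &
    forall k, yC zeta 0 k <= 1].
Proof.
move=> HP sphi [xi0 Pxi0 zxi0]; have [_ bP _ _] := HP.
pose c := logcoord z.
have cE xi : dotrv c xi = \sum_i dotrv (nrm i) xi * ln (sqmodC (z 0 i)).
  rewrite {1}/dotrv; under eq_bigr do rewrite mxE mulr_suml.
  rewrite exchange_big; apply: eq_bigr => i _; rewrite /dotrv mulr_suml; apply: eq_bigr => j _.
  by rewrite [nrm _ _ _]mxE; ring.
have [p [vp Ip pmax]] := @vertex_argmax _ _ P bP (fun i => z 0 i = 0) c
  (ex_intro _ xi0 (conj Pxi0 zxi0)).
have [s vc] := vchart_exists HP vp.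
have zn i : ~~ inS s i -> z 0 i != 0.
  by move=> iS; apply/eqP => /Ip zi; have := co_gt0 vc iS; rewrite /co zi ltxx.
(* [t] is the element of [coxK] which carries a point of the chart to z. Off the vertex its entries
   are those of z; on the facets through p they are then prescribed by u_l = sum_k a_lk u_(s k). *)
pose t : 'rV[R[i]]_d := \row_i if [pick k | s k == i] is Some k
  then \prod_(l | ~~ inS s l) z 0 l ^ (- acz s l k) else z 0 i.
pose w k : R[i] := z 0 (s k) * \prod_(l | ~~ inS s l) z 0 l ^ (acz s l k).
pose zeta : @Cn R n := (\row_k complex.Re (w k), \row_k complex.Im (w k)).
have ts k : t 0 (s k) = \prod_(l | ~~ inS s l) z 0 l ^ (- acz s l k).
  rewrite mxE; case: pickP => [j /eqP /(s_inj vc) -> //|/(_ k)]; by rewrite eqxx.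
have tn i : ~~ inS s i -> t 0 i = z 0 i.
  move=> iS; rewrite mxE; case: pickP => [j ji|//].
  by move/negP: iS => []; apply/existsP; exists j.
have cs k : chart s zeta 0 (s k) = w k by rewrite (chart_s vc) !mxE; case: (w k).
have zE : ctimes t (chart s zeta) = z.
  apply/rowP => i; rewrite [LHS]mxE; have [/existsP[k /eqP <-]|iS] := boolP (inS s i).
    rewrite ts cs /w mulrCA -big_split /= big1 ?mulr1 // => l lS.
    by rewrite -expfzDr ?addNr ?expr0z // zn.
  by rewrite tn // chart_notin // mulr1.
have yE k : yC zeta 0 k = sqmodC (w k) by rewrite -(sqmodC_chart vc) cs.
have tK : coxK t.
  split=> [i|j].
    have [/existsP[k /eqP <-]|iS] := boolP (inS s i); last by rewrite tn // zn.
    by rewrite ts; apply/prodf_neq0 => l lS; rewrite expfz_neq0 // zn.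
  rewrite (prod_facets _ vc).
  have -> : \prod_k t 0 (s k) ^ normal P (s k) j =
      \prod_(l | ~~ inS s l) z 0 l ^ (- normal P l j).
    transitivity (\prod_k \prod_(l | ~~ inS s l) z 0 l ^ (- acz s l k * normal P (s k) j)).
      apply: eq_bigr => k _; rewrite ts prod_exprz.
      by apply: eq_bigr => l _; rewrite exprz_exp.
    rewrite exchange_big; apply: eq_bigr => l lS /=.
    rewrite -exprz_sum ?zn //; congr (_ ^ _).
    have /rowP/(_ j) := mulmxKV (vc_unit vc) (row l (normal P)); rewrite !mxE => <-.
    rewrite -sumrN; apply: eq_bigr => k _; rewrite mulNr; congr (- (_ * _)).
      by rewrite mxE; apply: eq_bigr => i _; rewrite mxE.
    by rewrite mxE.
  rewrite -big_split /= big1 // => l lS.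
  by rewrite tn // -expfzDr ?addNr ?expr0z // zn.
exists s, p, zeta; split => //.
  rewrite -{1}zE; apply: (proj1 sphi) => //.
  exists p; first exact: vc_in vc.
  move=> i; have [/existsP[k /eqP <-] _|iS] := boolP (inS s i); first exact: (co_s vc).
  by rewrite chart_notin // => /eqP; rewrite oner_eq0.
move=> k; rewrite yE; have [zk|zk] := eqVneq (z 0 (s k)) 0.
  by rewrite /w zk mul0r sqmodC0.
have ck : dotrv c (ed s k) <= 0.
  by apply: (argmax_edge_le vc Ip pmax) => H; rewrite H eqxx in zk.
have w0 : 0 < sqmodC (w k).
  apply: sqmodC_gt0; rewrite /w mulf_neq0 //.
  by apply/prodf_neq0 => l lS; rewrite expfz_neq0 // zn.
rewrite -[leRHS]expR0 -[leLHS](@lnK R) ?posrE // ler_expR.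
suff -> : ln (sqmodC (w k)) = dotrv c (ed s k) by [].
rewrite cE (sum_facets vc) /w sqmodCM sqmodC_prod lnM ?posrE ?sqmodC_gt0 //; last first.
  by apply: prodr_gt0 => l lS; rewrite sqmodC_gt0 // expfz_neq0 // zn.
congr (_ + _).
  rewrite (bigD1 k) //= (nrm_ed vc) eqxx mul1r big1 ?addr0 // => j jk.
  by rewrite (nrm_ed vc) (negbTE jk) mul0r.
have -> : \prod_(l | ~~ inS s l) sqmodC (z 0 l ^ acz s l k) =
   expR (\sum_(l | ~~ inS s l) dotrv (nrm l) (ed s k) * ln (sqmodC (z 0 l))).
  rewrite expR_sum; apply: eq_bigr => l lS; rewrite sqmodCX -acE -expR_exprz lnK ?posrE //.
  by rewrite sqmodC_gt0 // zn.
by rewrite expRK.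
Qed.

End Torus.

(** * Calculus on C^n and restriction to the real points *)

Section ComplexSpace.
Context {R : realType} {n : nat}.
Local Notation Cn := (@Cn R n).
Implicit Types (zeta v : Cn).

Let oT : open [set: Cn] := openT.

Lemma dk_recoord m j : dk [set: Cn] m (fun zeta => zeta.1 0 j).
Proof.
have lf : linear (fun zeta : Cn => zeta.1 0 j : R) by move=> a u v; rewrite !mxE.
pose LL : {linear Cn -> R} := HB.pack (fun zeta : Cn => zeta.1 0 j : R)
  (GRing.isLinear.Build _ _ _ _ (fun zeta : Cn => zeta.1 0 j : R) lf).
apply: (@dk_linear _ _ Cn _ m LL oT) => z.
by apply: (@continuous_comp _ _ _ fst (fun w : 'rV[R]_n => w 0 j));
  [exact: cvg_fst|exact: coord_continuous].
Qed.

Lemma dk_imcoord m j : dk [set: Cn] m (fun zeta => zeta.2 0 j).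
Proof.
have lf : linear (fun zeta : Cn => zeta.2 0 j : R) by move=> a u v; rewrite !mxE.
pose LL : {linear Cn -> R} := HB.pack (fun zeta : Cn => zeta.2 0 j : R)
  (GRing.isLinear.Build _ _ _ _ (fun zeta : Cn => zeta.2 0 j : R) lf).
apply: (@dk_linear _ _ Cn _ m LL oT) => z.
by apply: (@continuous_comp _ _ _ snd (fun w : 'rV[R]_n => w 0 j));
  [exact: cvg_snd|exact: coord_continuous].
Qed.

Lemma diff_recoord zeta j : differentiable (fun zeta : Cn => zeta.1 0 j) zeta.
Proof. exact: dk_differentiable (dk_recoord 0 j) I. Qed.

Lemma diff_imcoord zeta j : differentiable (fun zeta : Cn => zeta.2 0 j) zeta.
Proof. exact: dk_differentiable (dk_imcoord 0 j) I. Qed.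

Lemma derive_cst_slope (f : Cn -> R) zeta v (c : R) :
  (forall h, f (h *: v + zeta) - f zeta = h * c) -> 'D_v f zeta = c.
Proof.
move=> H; rewrite /derive; apply: cvg_lim => //.
apply: (@cvg_trans _ ((fun=> c) @ (0 : R)^')); last exact: cvg_cst.
apply: near_eq_cvg; near=> h; rewrite /= H -[RHS]/(h^-1 * (h * c)) mulrA mulVf ?mul1r //.
by near: h; exact: nbhs_dnbhs_neq.
Unshelve. all: by end_near. Qed.

Lemma derive_recoord zeta v j : 'D_v (fun zeta : Cn => zeta.1 0 j) zeta = v.1 0 j.
Proof. by apply: derive_cst_slope => h; rewrite !mxE; ring. Qed.

Lemma derive_imcoord zeta v j : 'D_v (fun zeta : Cn => zeta.2 0 j) zeta = v.2 0 j.
Proof. by apply: derive_cst_slope => h; rewrite !mxE; ring. Qed.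

Lemma yC_E k : (fun zeta : Cn => yC zeta 0 k) =
  (fun zeta => zeta.1 0 k * zeta.1 0 k + zeta.2 0 k * zeta.2 0 k).
Proof. by apply/funext => z; rewrite mxE !expr2. Qed.

Lemma smo_yC k : smo [set: Cn] (fun zeta => yC zeta 0 k).
Proof.
move=> m; rewrite yC_E; apply: dk_add => //; apply: dk_mul => //.
- exact: dk_recoord.
- exact: dk_recoord.
- exact: dk_imcoord.
- exact: dk_imcoord.
Qed.

Lemma derive_yC zeta v k : 'D_v (fun zeta : Cn => yC zeta 0 k) zeta =
  2 * (zeta.1 0 k * v.1 0 k + zeta.2 0 k * v.2 0 k).
Proof.
have dr := diff_recoord zeta k; have di := diff_imcoord zeta k.
rewrite yC_E derive_addf; [|exact: differentiableM|exact: differentiableM].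
by rewrite !derive_mulf // derive_recoord derive_imcoord; ring.
Qed.

Lemma derive_slice (F : Cn -> R) (r v : 'rV[R]_n) :
  'D_v (fun r : 'rV[R]_n => F (r, 0)) r = 'D_((v, 0) : Cn) F (r, 0).
Proof.
have E : (fun h : R => h^-1 *: (F (h *: v + r, 0) - F (r, 0))) =
  (fun h : R => h^-1 *: (F (h *: ((v, 0) : Cn) + (r, 0)) - F (r, 0))).
  apply/funext => h; congr (_ *: (F _ - _)).
  by rewrite -[RHS]/((h *: v + r, h *: 0 + 0)) scaler0 addr0.
by rewrite /derive E.
Qed.

Lemma dk_slice m (F : Cn -> R) : dk [set: Cn] m F ->
  dk [set: 'rV[R]_n] m (fun r : 'rV[R]_n => F (r, 0)).
Proof.
have dF (G : Cn -> R) : (forall z, differentiable G z) -> forall r, differentiable (fun r : 'rV[R]_n => G (r, 0)) r.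
  move=> dG r; apply: (@differentiable_comp _ _ _ _ (fun r : 'rV[R]_n => (r, 0) : Cn) G); last exact: dG.
  by apply: differentiable_pair => //; exact: differentiable_cst.
elim: m F => [|m IH] F [df Df]; split=> //; try by move=> r _; apply: dF => z; exact: df.
move=> v; have -> : 'D_v (fun r : 'rV[R]_n => F (r, 0)) =
    (fun r : 'rV[R]_n => 'D_((v, 0) : Cn) F (r, 0)).
  by apply/funext => r; rewrite derive_slice.
exact: (IH _ (Df ((v, 0) : Cn))).
Qed.

End ComplexSpace.

(** Real and imaginary parts of h / (zeta_i conj (zeta_j)), in the form produced by the derivatives
    2 a / |zeta|^2 and 2 b / |zeta|^2 of log |zeta|^2. *)
Lemma levi_algebra (R : realType) (a b x y h : R) :
  a ^+ 2 + b ^+ 2 != 0 -> x ^+ 2 + y ^+ 2 != 0 ->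
  (((2 * (a * (a ^+ 2 + b ^+ 2)^-1) * (2 * (x * (x ^+ 2 + y ^+ 2)^-1))
   + 2 * (b * (a ^+ 2 + b ^+ 2)^-1) * (2 * (y * (x ^+ 2 + y ^+ 2)^-1))) * h / 4) +i*
  ((2 * (a * (a ^+ 2 + b ^+ 2)^-1) * (2 * (y * (x ^+ 2 + y ^+ 2)^-1))
   - 2 * (b * (a ^+ 2 + b ^+ 2)^-1) * (2 * (x * (x ^+ 2 + y ^+ 2)^-1))) * h / 4))%C =
  ((a +i* b)%C)^-1 * (h%:C)%C * (((x +i* y)%C)^*)^-1.
Proof.
move=> y1 y2.
have invE (u v : R) : ((u +i* v)%C)^-1 = ((u / (u ^+ 2 + v ^+ 2)) +i* (- (v / (u ^+ 2 + v ^+ 2))))%C.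
  by [].
have conjE (u v : R) : ((u +i* v)%C)^* = (u +i* (- v))%C by [].
have mulE (u v z t : R) : (u +i* v)%C * (z +i* t)%C = ((u * z - v * t) +i* (u * t + v * z))%C.
  by [].
rewrite conjE !invE -complexr0 !mulE sqrrN.
have y2' : x ^+ 2 + (- y) ^+ 2 != 0 by rewrite sqrrN.
by congr (_ +i* _)%C; field; rewrite y1 y2.
Qed.

(** * The Levi form on the open torus *)

Section LeviGeneric.
Context {R : realType} {n : nat} (P : halfspaces R n).
Local Notation d := (nfacets P).
Local Notation Cn := (@Cn R n).
Variables (s : 'I_n -> 'I_d) (p : 'rV[R]_n).
Hypotheses (vc : vchart s p) (bP : bounded_set (closedPoly P)).
Let oT : open [set: Cn] := openT.

Definition genset : set Cn := [set zeta | generic zeta].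

Lemma genset_open : open genset.
Proof.
rewrite openE => zeta gz.
apply: (@filter_forall _ _ (fun k y => 0 < yC y 0 k) (nbhs zeta) (nbhs_filter zeta)) => k.
have c : {for zeta, continuous (fun z : Cn => yC z 0 k)}.
  exact: differentiable_continuous (dk_differentiable (smo_yC k 0) I).
exact: (c _ (openP (@open_gt R 0) (gz k))).
Qed.

Lemma dk_Xlog m i : dk genset m (fun zeta => Xlog s zeta 0 i).
Proof.
have oG := genset_open.
apply: (dk_eq oG (f := fun zeta => \sum_k ln (yC zeta 0 k) * nrm (s k) 0 i)).
  by move=> z _; rewrite /Xlog summxE; apply: eq_bigr => k _; rewrite [RHS]mxE.
apply: dk_sum => // k _; apply: dk_mul => //; last exact: dk_cst.
apply: (dk_ln oG) => [z gz|]; first exact: gz.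
exact: (dk_sub_set (@subsetT _ _) (smo_yC k m)).
Qed.

Lemma derive_Xlog_comp (f : 'rV[R]_n -> R) zeta v : generic zeta ->
  (forall x, differentiable f x) ->
  'D_v (f \o Xlog s) zeta = \sum_k ('D_v (fun z => yC z 0 k) zeta / yC zeta 0 k) *
     'D_(nrm (s k)) f (Xlog s zeta).
Proof.
move=> gz df; rewrite derive_comp_rV //; last first.
  by move=> j; exact: dk_differentiable (dk_Xlog 0 j) gz.
transitivity (\sum_j \sum_k pd j f (Xlog s zeta) *
  ('D_v (fun z => yC z 0 k) zeta / yC zeta 0 k * nrm (s k) 0 j)).
  apply: eq_bigr => j _; rewrite -mulr_sumr; congr (_ * _).
  have -> : (fun y : Cn => Xlog s y 0 j) = (fun zeta => \sum_k ln (yC zeta 0 k) * nrm (s k) 0 j).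
    by apply/funext => z; rewrite /Xlog summxE; apply: eq_bigr => k _; rewrite [LHS]mxE.
  have dy k : differentiable (fun z : Cn => yC z 0 k) zeta.
    exact: dk_differentiable (smo_yC k 0) I.
  have dl k : differentiable (fun z : Cn => ln (yC z 0 k)) zeta.
    by have [] := is_derive_comp1 0 (is_derive1_ln (gz k)) (dy k).
  rewrite derive_sumf => [|k _].
    apply: eq_bigr => k _; rewrite derive_mulf //.
    by rewrite derive_cst mulr0 add0r derive_lnf // mulrC [_ / _]mulrC.
  by apply: differentiableM.
rewrite exchange_big; apply: eq_bigr => k _.
rewrite differentiable_derive_sum // mulr_sumr; apply: eq_bigr => j _; ring.
Qed.

Let er j : Cn := (delta_mx 0 j, 0).
Let ei j : Cn := (0, delta_mx 0 j).

Let er_E i j : (er i).1 0 j = (i == j)%:R /\ (er i).2 0 j = 0.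
Proof. by rewrite /= !mxE eqxx eq_sym. Qed.
Let ei_E i j : (ei i).1 0 j = 0 /\ (ei i).2 0 j = (i == j)%:R.
Proof. by rewrite /= !mxE eqxx eq_sym. Qed.

Section Function.
Variables (f : 'rV[R]_n -> R) (F : Cn -> R).
Hypotheses (df : smo setT f)
  (fF : forall zeta, generic zeta -> f (Xlog s zeta) = dotrv (Xlog s zeta) p + F zeta).

(** The linear term <x, p> is pluriharmonic in zeta; removing it from f gives the function that [F]
    represents on the chart. *)
Let ft x := f x - dotrv x p.

Let dft m : dk setT m ft.
Proof. by apply: dk_sub; [exact: openT|exact: df|exact: smo_dotrv]. Qed.

Let FE zeta : genset zeta -> F zeta = (ft \o Xlog s) zeta.
Proof. by move=> gz; rewrite /= /ft fF // addrC addKr. Qed.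

Definition uhess (x : 'rV[R]_n) : 'M[R]_n := \matrix_(i, j) 'D_(nrm (s i)) ('D_(nrm (s j)) f) x.

Let D2ft i j x : 'D_(nrm (s i)) ('D_(nrm (s j)) ft) x = uhess x i j.
Proof.
have -> : 'D_(nrm (s j)) ft = (fun x => 'D_(nrm (s j)) f x - dotrv (nrm (s j)) p).
  apply/funext => y; rewrite derive_subf ?derive_dotrvf //.
    exact: dk_differentiable (df 0%N) I.
  exact: dk_differentiable (smo_dotrv p 0) I.
have [_ /(_ (nrm (s j)))[H _]] := df 1%N.
by rewrite mxE derive_subf ?derive_cst ?subr0 //; exact: H.
Qed.

Let alpha j (zeta : Cn) := 2 * (zeta.1 0 j * (yC zeta 0 j)^-1).
Let beta j (zeta : Cn) := 2 * (zeta.2 0 j * (yC zeta 0 j)^-1).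

Let dk_alpha j : dk genset 0 (alpha j) /\ dk genset 0 (beta j).
Proof.
have oG := genset_open.
have H : dk genset 0 (fun z : Cn => (yC z 0 j)^-1).
  apply: (dk_inv oG) => [z gz|]; first by rewrite gt_eqF //; exact: gz.
  exact: (dk_sub_set (@subsetT _ _) (smo_yC j 0)).
split; apply: (dk_scale oG); apply: (dk_mul oG) => //.
  exact: (dk_sub_set (@subsetT _ _) (dk_recoord 0 j)).
exact: (dk_sub_set (@subsetT _ _) (dk_imcoord 0 j)).
Qed.

Let derive_alpha j zeta v : generic zeta ->
  'D_v (alpha j) zeta = 2 * (v.1 0 j * (yC zeta 0 j)^-1 - zeta.1 0 j * (yC zeta 0 j)^-2 *
     (2 * (zeta.1 0 j * v.1 0 j + zeta.2 0 j * v.2 0 j))) /\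
  'D_v (beta j) zeta = 2 * (v.2 0 j * (yC zeta 0 j)^-1 - zeta.2 0 j * (yC zeta 0 j)^-2 *
     (2 * (zeta.1 0 j * v.1 0 j + zeta.2 0 j * v.2 0 j))).
Proof.
move=> gz; have dy : differentiable (fun z : Cn => yC z 0 j) zeta.
  exact: dk_differentiable (smo_yC j 0) I.
have yn : yC zeta 0 j != 0 by rewrite gt_eqF.
have dV : differentiable (fun z : Cn => (yC z 0 j)^-1) zeta by apply: differentiableV.
have DV : 'D_v (fun z : Cn => (yC z 0 j)^-1) zeta = - (yC zeta 0 j)^-2 * 'D_v (fun z => yC z 0 j) zeta.
  by rewrite (deriveV yn) //; apply: diff_derivable.
have dr := diff_recoord zeta j; have di := diff_imcoord zeta j.
rewrite /alpha /beta !derive_scalef; [|exact: differentiableM|exact: differentiableM].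
by rewrite !derive_mulf // DV derive_yC derive_recoord derive_imcoord; split; ring.
Qed.

Let pdF j zeta : generic zeta ->
  pd_re j F zeta = alpha j zeta * 'D_(nrm (s j)) ft (Xlog s zeta) /\
  pd_im j F zeta = beta j zeta * 'D_(nrm (s j)) ft (Xlog s zeta).
Proof.
move=> gz; have dftx x : differentiable ft x by exact: dk_differentiable (dft 0) I.
rewrite /pd_re /pd_im !(eq_derive_on _ genset_open FE gz) !derive_Xlog_comp //.
split; rewrite (bigD1 j) //= [X in _ + X]big1 ?addr0.
- rewrite derive_yC -/(er j) !(proj1 (er_E _ _)) !(proj2 (er_E _ _)) eqxx /= /alpha; ring.
- move=> k kj; rewrite derive_yC -/(er j) (proj1 (er_E _ _)) (proj2 (er_E _ _)).
  by rewrite eq_sym (negbTE kj) /=; ring.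
- by rewrite derive_yC -/(ei j) !(proj1 (ei_E _ _)) !(proj2 (ei_E _ _)) eqxx /= /beta; ring.
move=> k kj; rewrite derive_yC -/(ei j) (proj1 (ei_E _ _)) (proj2 (ei_E _ _)).
by rewrite eq_sym (negbTE kj) /=; ring.
Qed.

Lemma pd_re_generic j zeta : generic zeta ->
  pd_re j F zeta = 2 * (zeta.1 0 j * (yC zeta 0 j)^-1) *
    ('D_(nrm (s j)) f (Xlog s zeta) - dotrv (nrm (s j)) p).
Proof.
move=> gz; rewrite (pdF j gz).1; congr (_ * _).
rewrite derive_subf ?derive_dotrvf //.
  exact: dk_differentiable (df 0%N) I.
exact: dk_differentiable (smo_dotrv p 0) I.
Qed.

Let D1dft j : dk setT 0 ('D_(nrm (s j)) ft).
Proof. by have [_] := dft 1; apply. Qed.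

Let derive_D1 zeta v j : generic zeta -> 'D_v ('D_(nrm (s j)) ft \o Xlog s) zeta =
  \sum_k ('D_v (fun z => yC z 0 k) zeta / yC zeta 0 k) * uhess (Xlog s zeta) k j.
Proof.
move=> gz; rewrite derive_Xlog_comp //; last by move=> x; exact: dk_differentiable (D1dft j) I.
by apply: eq_bigr => k _; rewrite D2ft.
Qed.

Let derive_D1_re zeta i j : generic zeta -> 'D_(er i) ('D_(nrm (s j)) ft \o Xlog s) zeta =
  alpha i zeta * uhess (Xlog s zeta) i j.
Proof.
move=> gz; rewrite derive_D1 // (bigD1 i) //= [X in _ + X]big1 ?addr0.
  by rewrite derive_yC !(proj1 (er_E _ _)) !(proj2 (er_E _ _)) eqxx /= /alpha; ring.
move=> k kj; rewrite derive_yC (proj1 (er_E _ _)) (proj2 (er_E _ _)).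
by rewrite eq_sym (negbTE kj) /=; ring.
Qed.

Let derive_D1_im zeta i j : generic zeta -> 'D_(ei i) ('D_(nrm (s j)) ft \o Xlog s) zeta =
  beta i zeta * uhess (Xlog s zeta) i j.
Proof.
move=> gz; rewrite derive_D1 // (bigD1 i) //= [X in _ + X]big1 ?addr0.
  by rewrite derive_yC !(proj1 (ei_E _ _)) !(proj2 (ei_E _ _)) eqxx /= /beta; ring.
move=> k kj; rewrite derive_yC (proj1 (ei_E _ _)) (proj2 (ei_E _ _)).
by rewrite eq_sym (negbTE kj) /=; ring.
Qed.

Let dcomp zeta j : generic zeta -> differentiable ('D_(nrm (s j)) ft \o Xlog s) zeta.
Proof.
move=> gz; have H : dk genset 0 ('D_(nrm (s j)) ft \o Xlog s).
  by apply: (dk_comp genset_open (D1dft j)) => // k; exact: dk_Xlog.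
exact: dk_differentiable H gz.
Qed.

Let D2F zeta v j : generic zeta ->
  'D_v (pd_re j F) zeta = alpha j zeta * 'D_v ('D_(nrm (s j)) ft \o Xlog s) zeta
    + 'D_(nrm (s j)) ft (Xlog s zeta) * 'D_v (alpha j) zeta /\
  'D_v (pd_im j F) zeta = beta j zeta * 'D_v ('D_(nrm (s j)) ft \o Xlog s) zeta
    + 'D_(nrm (s j)) ft (Xlog s zeta) * 'D_v (beta j) zeta.
Proof.
move=> gz; have [ha hb] := dk_alpha j.
have e1 z : genset z -> pd_re j F z = alpha j z * ('D_(nrm (s j)) ft \o Xlog s) z.
  by move=> gz'; rewrite (pdF j gz').1.
have e2 z : genset z -> pd_im j F z = beta j z * ('D_(nrm (s j)) ft \o Xlog s) z.
  by move=> gz'; rewrite (pdF j gz').2.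
rewrite (eq_derive_on v genset_open e1 gz) (eq_derive_on v genset_open e2 gz).
have da := dk_differentiable ha gz; have db := dk_differentiable hb gz.
have dc := dcomp j gz.
by split; [exact: (derive_mulf v da dc)|exact: (derive_mulf v db dc)].
Qed.

Definition cz (zeta : Cn) k : R[i] := (zeta.1 0 k +i* zeta.2 0 k)%C.

Lemma levi_generic zeta : generic zeta -> levi F zeta =
  \matrix_(i, j) ((cz zeta i)^-1 * ((uhess (Xlog s zeta) i j)%:C)%C * (((cz zeta j)^*)^-1)).
Proof.
move=> gz; apply/matrixP => i j; rewrite !mxE.
set h := 'D_(nrm (s i)) _ _.
have hE : uhess (Xlog s zeta) i j = h by rewrite mxE.
have E1 : pd_re i (pd_re j F) zeta + pd_im i (pd_im j F) zeta =
   (alpha i zeta * alpha j zeta + beta i zeta * beta j zeta) * h.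
  rewrite {1}/pd_re {1}/pd_im -/(er i) -/(ei i) (D2F _ j gz).1 (D2F _ j gz).2.
  rewrite derive_D1_re // derive_D1_im // hE.
  rewrite (derive_alpha j (er i) gz).1 (derive_alpha j (ei i) gz).2.
  rewrite ?(proj1 (er_E _ _)) ?(proj2 (er_E _ _)) ?(proj1 (ei_E _ _)) ?(proj2 (ei_E _ _)).
  have yn : yC zeta 0 j != 0 by rewrite gt_eqF.
  have yE : zeta.1 0 j ^+ 2 + zeta.2 0 j ^+ 2 = yC zeta 0 j by rewrite mxE.
  set G := 'D_(nrm (s j)) ft _.
  have -> : forall x y : R, alpha j zeta * (alpha i zeta * h) + G * x + (beta j zeta * (beta i zeta * h) + G * y)
     = (alpha i zeta * alpha j zeta + beta i zeta * beta j zeta) * h + G * (x + y) by move=> x y; ring.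
  rewrite -[RHS]addr0; congr (_ + _).
  (* For i = j the factor of G is the Laplacian of log |zeta_j|^2, which vanishes. *)
  case: (i == j) => /=; last by ring.
  rewrite [X in G * X](_ : _ = 4 * (yC zeta 0 j)^-1 - 4 * (zeta.1 0 j ^+ 2 + zeta.2 0 j ^+ 2) * (yC zeta 0 j)^-2); last by ring.
  by rewrite yE; field.
have E2' : 'D_(er i) (pd_im j F) zeta - 'D_(ei i) (pd_re j F) zeta =
   (alpha i zeta * beta j zeta - beta i zeta * alpha j zeta) * h.
  have h1 := (D2F (er i) j gz).2; have h2 := (D2F (ei i) j gz).1.
  rewrite (derive_D1_re i j gz) hE (derive_alpha j (er i) gz).2 in h1.
  rewrite (derive_D1_im i j gz) hE (derive_alpha j (ei i) gz).1 in h2.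
  have [e1 e2] := er_E i j; have [e3 e4] := ei_E i j.
  rewrite e1 e2 in h1; rewrite e3 e4 in h2.
  rewrite h1 h2.
  by case: (i == j) => /=; ring.
have E2 : pd_re i (pd_im j F) zeta - pd_im i (pd_re j F) zeta =
   (alpha i zeta * beta j zeta - beta i zeta * alpha j zeta) * h := E2'.
apply: (etrans (congr2 (fun u v : R => (u / 4 +i* (v / 4))%C) E1 E2)).
have yi : zeta.1 0 i ^+ 2 + zeta.2 0 i ^+ 2 != 0.
  by have := gz i; rewrite mxE => /lt0r_neq0.
have yj : zeta.1 0 j ^+ 2 + zeta.2 0 j ^+ 2 != 0.
  by have := gz j; rewrite mxE => /lt0r_neq0.
have := levi_algebra h yi yj.
have -> : zeta.1 0 i ^+ 2 + zeta.2 0 i ^+ 2 = yC zeta 0 i by rewrite mxE.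
have -> : zeta.1 0 j ^+ 2 + zeta.2 0 j ^+ 2 = yC zeta 0 j by rewrite mxE.
exact.
Qed.

End Function.
End LeviGeneric.

(** * Real slices of the charts *)

Section Density.
Context {R : realType}.

Lemma limit_ge0 (V : normedModType R) (h : V -> R) x v : {for x, continuous h} ->
  (forall e : R, 0 < e -> exists2 t : R, 0 < t < e & 0 <= h (t *: v + x)) -> 0 <= h x.
Proof.
move=> ch H; rewrite leNgt; apply/negP => hx.
have H0 : \forall t \near x, h t < 0 := ch _ (openP (@open_lt R 0) hx).
have c0 : {for (0 : R), continuous (fun t : R => t *: v + x)}.
  by apply: continuousD; [exact: scalel_continuous|exact: cst_continuous].
have H1 : \forall t \near ((0 : R) *: v + x), h t < 0 by rewrite scale0r add0r.
have H2 : \forall t \near (0 : R), h (t *: v + x) < 0 := c0 _ H1.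
case/nbhs_ballP: H2 => e e0 He; have [t /andP[t0 te] ht] := H _ e0.
by have := He t; rewrite /ball /= sub0r normrN gtr0_norm // => /(_ te); rewrite ltNge ht.
Qed.

Lemma shift_neq0 n (r : 'rV[R]_n) (e : R) : 0 < e ->
  exists2 t, 0 < t < e & forall k, t + r 0 k != 0.
Proof.
move=> e0; pose m := \big[Num.min/e]_(k | r 0 k != 0) `|r 0 k|.
have m0 : 0 < m.
  rewrite /m; elim/big_ind: _ => // [x y x0 y0|k]; last by rewrite normr_gt0.
  by rewrite lt_min x0.
have me : m <= e by exact: bigmin_le_id.
exists (m / 2); first by apply/andP; split; lra.
move=> k; have [->|rk] := eqVneq (r 0 k) 0; first by rewrite addr0 gt_eqF //; lra.
apply/eqP => h; have := @bigmin_le_cond _ _ _ e k (fun k => r 0 k != 0) (fun k => `|r 0 k|) rk; rewrite -/m.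
have -> : r 0 k = - (m / 2) by lra.
by rewrite normrN ger0_norm; lra.
Qed.

Definition gen n (r : 'rV[R]_n) := forall k, r 0 k != 0.

(** Only finitely many shifts of r along (1, ..., 1) have a zero coordinate, so generic points are
    dense. Relations computed on the open torus extend in this way to all the real points of a
    chart. *)
Lemma gen_ge0 n (h : 'rV[R]_n -> R) : continuous h ->
  (forall r, gen r -> 0 <= h r) -> forall r, 0 <= h r.
Proof.
move=> ch H r; apply: (limit_ge0 (v := const_mx 1)); first exact: ch.
move=> e e0; have [t te Ht] := shift_neq0 r e0; exists t => //.
by apply: H => k; rewrite !mxE mulr1.
Qed.

Lemma gen_eq n (g h : 'rV[R]_n -> R) : continuous g -> continuous h ->
  (forall r, gen r -> g r = h r) -> forall r, g r = h r.
Proof.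
move=> cg ch H r; apply/le_anti/andP; split; rewrite -subr_ge0.
- apply: (gen_ge0 (h := fun r => h r - g r)) => [x|x gx]; last by rewrite H // subrr.
  by apply: continuousB; [exact: ch|exact: cg].
- apply: (gen_ge0 (h := fun r => g r - h r)) => [x|x gx]; last by rewrite H // subrr.
  by apply: continuousB; [exact: cg|exact: ch].
Qed.

Lemma dk_continuous (V : normedModType R) m (f : V -> R) : dk setT m f -> continuous f.
Proof. by move=> df x; apply: differentiable_continuous; exact: (dk_differentiable df). Qed.

Lemma derive_even (V : normedModType R) (h : V -> R) r v : differentiable h r ->
  (forall t : R, h (t *: v + r) = h (- t *: v + r)) -> 'D_v h r = 0.
Proof.
move=> dh H; have E : 'D_(- v) h r = 'D_v h r.
  have EQ : (fun t : R => t^-1 *: (h (t *: - v + r) - h r)) = (fun t => t^-1 *: (h (t *: v + r) - h r)).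
    by apply/funext => t; rewrite scalerN -scaleNr -H.
  transitivity (lim ((fun t : R => t^-1 *: (h (t *: - v + r) - h r)) @ 0^')); first by [].
  by rewrite EQ.
have := E; rewrite !deriveE // linearN /= => E2; lra.
Qed.

Definition mdot n (A B : 'M[R]_n) : R := \sum_i \sum_j A i j * B i j.

Lemma mdot_tr n (A B : 'M[R]_n) : mdot A B = \tr (A *m B^T).
Proof.
by apply: eq_bigr => i _; rewrite mxE; apply: eq_bigr => j _; rewrite mxE.
Qed.

(** Invariance of the trace of f^-1 B under a change of basis; it allows the trace to be computed
    with [Mr], which does not degenerate at infinity. *)
Lemma mdot_congr n (A B V : 'M[R]_n) : A \in unitmx -> V \in unitmx ->
  mdot (invmx (V *m A *m V^T)) (V *m B *m V^T) = mdot (invmx A) B.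
Proof.
move=> uA uV; have uVT : V^T \in unitmx by rewrite unitmx_tr.
have -> : invmx (V *m A *m V^T) = invmx V^T *m invmx A *m invmx V.
  have uVA : V *m A *m V^T \in unitmx by rewrite !unitmx_mul uV uA.
  rewrite -[RHS](mulmxK uVA) !mulmxA (mulmxKV uV) (mulmxKV uA) (mulVmx uVT).
  by rewrite mul1mx.
rewrite !mdot_tr !trmx_mul trmxK !mulmxA (mulmxKV uV) mxtrace_mulC !mulmxA.
by rewrite (mulmxV uVT) mul1mx.
Qed.

End Density.

Lemma Re_slice (R : realType) (a b h : R) : a != 0 -> b != 0 ->
  complex.Re (((a +i* 0)%C)^-1 * (h%:C)%C * (((b +i* 0)%C)^*)^-1) = a^-1 * h * b^-1.
Proof.
move=> a0 b0.
have invE (u v : R) : ((u +i* v)%C)^-1 = ((u / (u ^+ 2 + v ^+ 2)) +i* (- (v / (u ^+ 2 + v ^+ 2))))%C.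
  by [].
have conjE (u v : R) : ((u +i* v)%C)^* = (u +i* (- v))%C by [].
have mulE (u v z t : R) : (u +i* v)%C * (z +i* t)%C = ((u * z - v * t) +i* (u * t + v * z))%C.
  by [].
rewrite conjE !invE -complexr0 !mulE /= oppr0 !expr0n /=.
rewrite !(oppr0, mul0r, mulr0, addr0, subr0, add0r, sub0r).
by field; rewrite a0 b0.
Qed.

Section SliceMachine.
Context {R : realType} {n : nat} (P : halfspaces R n).
Local Notation d := (nfacets P).
Local Notation Cn := (@Cn R n).
Let oT := @openT 'rV[R]_n.

(* Real part of the metric at the real point r of the chart, where it is the
   Hessian of f in the logarithmic coordinates divided by r_i r_j. *)
Definition Mr (F : Cn -> R) (r : 'rV[R]_n) : 'M[R]_n :=
  \matrix_(i, j) complex.Re (levi F (r, 0) i j).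

Lemma dk_Mr (F : Cn -> R) m i j : smo setT F -> dk setT m (fun r => Mr F r i j).
Proof.
move=> dF; apply: (dk_eq oT (f := fun r : 'rV[R]_n => 4^-1 *
  (pd_re i (pd_re j F) (r, 0) + pd_im i (pd_im j F) (r, 0)))).
  by move=> r _; rewrite !mxE /= mulrC.
apply: (dk_scale oT); apply: (dk_add oT).
- by apply: dk_slice; have [_ H] := dF m.+2; have [_] := H (delta_mx 0 j, 0); exact.
- by apply: dk_slice; have [_ H] := dF m.+2; have [_] := H (0, delta_mx 0 j); exact.
Qed.

Lemma yC_slice (r : 'rV[R]_n) k : yC (r, 0) 0 k = r 0 k ^+ 2.
Proof. by rewrite !mxE /= expr0n addr0. Qed.

Lemma gen_generic (r : 'rV[R]_n) : gen r -> generic (r, 0).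
Proof. by move=> gr k; rewrite yC_slice exprn_even_gt0 //= gr. Qed.

Variables (s : 'I_n -> 'I_d) (p : 'rV[R]_n).
Hypotheses (vc : vchart s p) (bP : bounded_set (closedPoly P)).

Definition xl (r : 'rV[R]_n) := Xlog s (r, 0).
Definition rX (x : 'rV[R]_n) : 'rV[R]_n := \row_k expR (dotrv x (ed s k) / 2).

Lemma rX_gt0 x k : 0 < rX x 0 k. Proof. by rewrite mxE expR_gt0. Qed.

Lemma gen_rX x : gen (rX x). Proof. by move=> k; rewrite gt_eqF ?rX_gt0. Qed.

Lemma xl_rX x : xl (rX x) = x. Proof. exact: (Xlog_zetaX vc). Qed.

Lemma rX_sqr x k : rX x 0 k ^+ 2 = expR (dotrv x (ed s k)).
Proof. by rewrite mxE -expRM_natl; congr expR; lra. Qed.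

Lemma smo_rX k : smo setT (fun x => rX x 0 k).
Proof.
move=> m; apply: (dk_eq oT (f := fun x => expR (2^-1 * dotrv x (ed s k)))).
  by move=> x _; rewrite mxE mulrC.
by apply: (dk_expR oT); apply: (dk_scale oT); exact: smo_dotrv.
Qed.

Lemma derive_rX x v k : 'D_v (fun x => rX x 0 k) x = rX x 0 k * (dotrv v (ed s k) / 2).
Proof.
have -> : (fun x => rX x 0 k) = (fun x => expR (2^-1 * dotrv x (ed s k))).
  by apply/funext => z; rewrite mxE mulrC.
have dd : differentiable (fun x => dotrv x (ed s k)) x.
  exact: (dk_differentiable (smo_dotrv _ 0%N)).
rewrite derive_expf; last by apply: differentiableZ.
by rewrite derive_scalef // derive_dotrvf mxE [dotrv x _ / 2]mulrC; ring.
Qed.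

Section Fixed.
Variables (f : 'rV[R]_n -> R) (F : Cn -> R).
Hypotheses (df : smo setT f) (dF : smo setT F)
  (fF : forall zeta, generic zeta -> f (Xlog s zeta) = dotrv (Xlog s zeta) p + F zeta).
Local Notation Mr := (Mr F).

Lemma Mr_gen r i j : gen r ->
  Mr r i j = (r 0 i)^-1 * uhess s f (xl r) i j * (r 0 j)^-1.
Proof.
move=> gr; rewrite mxE (levi_generic df fF (gen_generic gr)) mxE /cz /= !mxE.
by apply: Re_slice; exact: gr.
Qed.

Lemma uhess_UR x : uhess s f x = UR s *m hess f x *m (UR s)^T.
Proof. by apply/matrixP => i j; rewrite hessU // mxE. Qed.

Lemma det_uhess x : \det (uhess s f x) = \det (hess f x).
Proof.
by rewrite uhess_UR !det_mulmx det_tr mulrAC -expr2 (UR_det2 vc) mul1r.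
Qed.

Lemma det_Mr r : gen r -> \det (Mr r) = (\prod_k yC (r, 0) 0 k)^-1 * \det (uhess s f (xl r)).
Proof.
move=> gr; pose dv : 'rV[R]_n := \row_k (r 0 k)^-1.
have -> : Mr r = diag_mx dv *m uhess s f (xl r) *m diag_mx dv.
  by apply/matrixP => i j; rewrite mul_mx_diag mul_diag_mx [RHS]mxE Mr_gen // !mxE.
rewrite !det_mulmx det_diag mulrAC -big_split /= -prodfV; congr (_ * _).
by apply: eq_bigr => k _; rewrite yC_slice !mxE -expr2 exprVn.
Qed.

(** Half the Jacobian matrix of [xl] at the real point [rX x]. *)
Definition Vx x : 'M[R]_n := diag_mx (\row_k (rX x 0 k)^-1) *m UR s.

Lemma Vx_unit x : Vx x \in unitmx.
Proof.
rewrite unitmx_mul (UR_unit vc) andbT unitmxE det_diag unitfE prodf_seq_neq0.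
by apply/allP => k _; rewrite /= mxE invr_eq0 gen_rX.
Qed.

Lemma VxE x (A : 'M[R]_n) i j : (Vx x *m A *m (Vx x)^T) i j =
  (rX x 0 i)^-1 * (UR s *m A *m (UR s)^T) i j * (rX x 0 j)^-1.
Proof.
rewrite /Vx trmx_mul tr_diag_mx !mulmxA mul_mx_diag -!mulmxA mul_diag_mx.
by rewrite !mulmxA !mxE.
Qed.

Lemma Mr_rX x : Mr (rX x) = Vx x *m hess f x *m (Vx x)^T.
Proof.
apply/matrixP => i j; rewrite VxE Mr_gen ?xl_rX ?uhess_UR //; exact: gen_rX.
Qed.

(* The gradient map, extended to the real points with some r_k = 0. *)
Definition Xi (r : 'rV[R]_n) : 'rV[R]_n := p + \sum_k (2^-1 * (r 0 k * pd_re k F (r, 0))) *: ed s k.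

Lemma dk_Xi m j : dk setT m (fun r => Xi r 0 j).
Proof.
apply: (dk_eq oT (f := fun r => p 0 j + \sum_k ed s k 0 j * (2^-1 * (r 0 k * pd_re k F (r, 0))))).
  move=> r _; rewrite /Xi mxE summxE; congr (_ + _); apply: eq_bigr => k _.
  by rewrite [RHS]mxE mulrC.
apply: (dk_add oT); first exact: (dk_cst oT).
apply: (dk_sum oT) => k _; do 2! apply: (dk_scale oT).
apply: (dk_mul oT); first exact: (dk_coord _ _ oT).
by apply: dk_slice; have [_ H] := dF m.+1; exact: (H (delta_mx 0 k, 0)).
Qed.

Lemma Xi_gen r : gen r -> Xi r = grad f (xl r).
Proof.
move=> gr; rewrite /Xi [RHS](ed_expand vc) {1}(ed_expand vc p) -big_split /=.
apply: eq_bigr => k _; rewrite -scalerDl; congr (_ *: _).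
rewrite (pd_re_generic df fF k (gen_generic gr)) yC_slice /= dotrvC.
rewrite (derive_dotrv _ (dk_differentiable (df 0%N) Logic.I)) [dotrv (grad _ _) _]dotrvC.
by rewrite -/(xl r); have a0 : r 0 k != 0 := gr k; field.
Qed.

Section WithD.
Variables (D : 'rV[R]_n -> R) (U : set 'rV[R]_n).
Hypotheses (gP : forall x, closedPoly P (grad f x)) (posM : forall r, posdef (Mr r))
  (oU : open U) (PU : closedPoly P `<=` U) (dD : smo U D)
  (D0 : forall xi, closedPoly P xi -> 0 < D xi).

Lemma hess_posdef x : posdef (hess f x).
Proof.
have uV := Vx_unit x.
have -> : hess f x = invmx (Vx x) *m Mr (rX x) *m (invmx (Vx x))^T.
  move: (Vx x) (Mr_rX x) uV => V -> uV.
  by rewrite trmx_inv !mulmxA (mulVmx uV) mul1mx mulmxK // unitmx_tr.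
by apply: posdef_congr => //; rewrite unitmx_inv.
Qed.

Lemma Xi_in r : closedPoly P (Xi r).
Proof.
move=> i; apply: (gen_ge0 (h := fun r => lfun i (Xi r))) => [|x gx]; last by rewrite Xi_gen //; exact: gP.
apply: (@dk_continuous _ _ 0%N).
apply: (dk_eq oT (f := fun r => \sum_j (normal P i j)%:~R * Xi r 0 j + - offset P 0 i)).
  by move=> x _; congr (_ + _); apply: eq_bigr => j _; rewrite mulrC.
apply: (dk_add oT); last exact: (dk_cst oT).
by apply: (dk_sum oT) => j _; apply: (dk_scale oT); exact: dk_Xi.
Qed.

(* log F_f - sum_k <x, e_k> as a function of r, also where some r_k is 0. *)
Definition Wt (r : 'rV[R]_n) : R := ln (D (Xi r)) + ln (\det (Mr r)).

Lemma det_Mr_gt0 r : 0 < \det (Mr r).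
Proof. by have /andP[] := hadamard (posM r). Qed.

Lemma smo_Wt : smo setT Wt.
Proof.
move=> m; apply: (dk_add oT); apply: (dk_ln oT).
- by move=> r _; apply: D0; exact: Xi_in.
- by apply: (dk_comp oT (dD m)) => [r _|j]; [apply: PU; exact: Xi_in|exact: dk_Xi].
- by move=> r _; exact: det_Mr_gt0.
- by apply: (dk_det oT) => i j; exact: dk_Mr.
Qed.

Let sg (k j : 'I_n) : R := if j == k then -1 else 1.
Definition flip k (r : 'rV[R]_n) : 'rV[R]_n := \row_j (sg k j * r 0 j).

Lemma Wt_flip k r : Wt (flip k r) = Wt r.
Proof.
apply: (gen_eq (g := fun r => Wt (flip k r)) (h := Wt)) => {r}.
- apply: (@dk_continuous _ _ 0%N); apply: (dk_comp oT (smo_Wt 0%N)) => // j.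
  apply: (dk_eq oT (f := fun r => sg k j * r 0 j)); first by move=> r _; rewrite mxE.
  by apply: (dk_scale oT); exact: (dk_coord _ _ oT).
- exact: (dk_continuous (smo_Wt 0%N)).
- move=> r gr; have sq j : sg k j ^+ 2 = 1 by rewrite /sg; case: ifP => _; rewrite ?sqrrN expr1n.
  have yE : yC (flip k r, 0) = yC (r, 0) by apply/rowP => j; rewrite !yC_slice mxE exprMn sq mul1r.
  have gf : gen (flip k r).
    by move=> j; rewrite mxE mulf_neq0 // /sg; case: ifP => _; rewrite ?oppr_eq0 oner_eq0.
  have xE : xl (flip k r) = xl r by rewrite /xl /Xlog yE.
  have E1 : Xi (flip k r) = Xi r.
    by apply: (etrans (Xi_gen gf)); rewrite xE; apply: esym; exact: Xi_gen.
  have E2 : \det (Mr (flip k r)) = \det (Mr r).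
    by apply: (etrans (det_Mr gf)); rewrite xE yE; apply: esym; exact: det_Mr.
  exact: (congr2 (fun a b => ln (D a) + ln b) E1 E2).
Qed.

Lemma derive_Wt0 k (r : 'rV[R]_n) : r 0 k = 0 -> pd k Wt r = 0.
Proof.
move=> rk; have dW : differentiable Wt r by exact: (dk_differentiable (smo_Wt 0%N)).
apply: (derive_even dW) => t; apply: (etrans (esym (Wt_flip k _))).
have E : flip k (t *: delta_mx 0 k + r) = - t *: delta_mx 0 k + r.
  apply/rowP => j; rewrite !mxE /sg eqxx /=.
  by case: eqP => [->|_] /=; rewrite ?rk; ring.
exact: (congr1 Wt E).
Qed.

Lemma ln_prod_exp (G : 'I_n -> R) : ln (\prod_k expR (G k)) = \sum_k G k.
Proof. by rewrite -expR_sum expRK. Qed.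

Lemma logFF_Wt x : logFF D f x = \sum_k dotrv x (ed s k) + Wt (rX x).
Proof.
have gx := gen_rX x.
have EM := det_Mr gx; rewrite xl_rX det_uhess in EM.
have yE : \prod_k yC (rX x, 0) 0 k = \prod_k expR (dotrv x (ed s k)).
  by apply: eq_bigr => k _; rewrite yC_slice rX_sqr.
have y0 : 0 < \prod_k expR (dotrv x (ed s k)) by apply: prodr_gt0 => k _; exact: expR_gt0.
have D1 : 0 < D (Xi (rX x)) by apply: D0; exact: Xi_in.
have M1 := det_Mr_gt0 (rX x).
rewrite /logFF /FF /pullD -{1}(xl_rX x) -Xi_gen //.
have -> : \det (hess f x) = (\prod_k expR (dotrv x (ed s k))) * \det (Mr (rX x)).
  by rewrite EM yE mulVKf // gt_eqF.
rewrite /Wt -ln_prod_exp !lnM ?posrE ?mulr_gt0 //; ring.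
Qed.

Definition slopeWt k (r : 'rV[R]_n) : R := 1 + 2^-1 * (r 0 k * pd k Wt r).

Lemma dk_pdWt m k : dk setT m (pd k Wt).
Proof. by have [_ H] := smo_Wt m.+1; exact: H. Qed.

Lemma derive_logFF x v : 'D_v (logFF D f) x = \sum_k dotrv v (ed s k) * slopeWt k (rX x).
Proof.
have -> : logFF D f = (fun x => \sum_k dotrv x (ed s k) + Wt (rX x)).
  by apply/funext => z; exact: logFF_Wt.
have d1 : differentiable (fun x => \sum_k dotrv x (ed s k)) x.
  by apply: (@dk_differentiable _ _ setT 0%N) => //; apply: (dk_sum oT) => k _; exact: smo_dotrv.
have d2 : differentiable (fun x => Wt (rX x)) x.
  apply: (@dk_differentiable _ _ setT 0%N) => //.
  by apply: (dk_comp oT (smo_Wt 0%N)) => // j; exact: smo_rX.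
rewrite derive_addf // derive_sumf; last by move=> *; exact: (dk_differentiable (smo_dotrv _ 0%N) Logic.I).
rewrite (derive_comp_rV (F := Wt) (h := rX)); last first.
- exact: (dk_differentiable (smo_Wt 0%N)).
- by move=> j; exact: (dk_differentiable (smo_rX j 0%N)).
rewrite -big_split /=; apply: eq_bigr => k _.
rewrite derive_dotrvf derive_rX /slopeWt; ring.
Qed.

Lemma grad_logFF x : grad (logFF D f) x = \sum_k slopeWt k (rX x) *: ed s k.
Proof.
apply/rowP => j; rewrite mxE /pd derive_logFF summxE; apply: eq_bigr => k _.
by rewrite dotrvC dotrv_delta [RHS]mxE mulrC.
Qed.

Lemma smo_logFF : smo setT (logFF D f).
Proof.
move=> m; apply: (dk_eq oT (f := fun x => \sum_k dotrv x (ed s k) + Wt (rX x))).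
  by move=> x _; rewrite logFF_Wt.
apply: (dk_add oT); first by apply: (dk_sum oT) => k _; exact: smo_dotrv.
by apply: (dk_comp oT (smo_Wt m)) => // j; exact: smo_rX.
Qed.

Lemma derive2_logFF x k l : 'D_(nrm (s l)) ('D_(nrm (s k)) (logFF D f)) x =
  4^-1 * ((k == l)%:R * (rX x 0 k * pd k Wt (rX x))
          + rX x 0 k * rX x 0 l * pd l (pd k Wt) (rX x)).
Proof.
have -> : 'D_(nrm (s k)) (logFF D f) = (fun x => 1 + 2^-1 * (rX x 0 k * pd k Wt (rX x))).
  apply/funext => z; rewrite derive_logFF (bigD1 k) //= big1 ?addr0.
    by rewrite (nrm_ed vc) eqxx mul1r.
  by move=> j jk; rewrite (nrm_ed vc) eq_sym (negbTE jk) mul0r.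
have dr : differentiable (fun x => rX x 0 k) x by exact: (dk_differentiable (smo_rX k 0%N)).
have dw : differentiable (fun x => pd k Wt (rX x)) x.
  apply: (@dk_differentiable _ _ setT 0%N) => //.
  by apply: (dk_comp oT (dk_pdWt 0%N k)) => // j; exact: smo_rX.
have dm : differentiable (fun x => rX x 0 k * pd k Wt (rX x)) x by apply: differentiableM.
rewrite derive_addf ?derive_cst ?add0r; [|exact: differentiable_cst|exact: differentiableZ].
rewrite derive_scalef // derive_mulf // derive_rX (nrm_ed vc).
rewrite (derive_comp_rV (F := pd k Wt) (h := rX)); last first.
- exact: (dk_differentiable (dk_pdWt 0%N k)).
- by move=> j; exact: (dk_differentiable (smo_rX j 0%N)).
rewrite (bigD1 l) //= big1 ?addr0; last first.
  by move=> j jl; rewrite derive_rX (nrm_ed vc) eq_sym (negbTE jl) mul0r !mulr0.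
by rewrite derive_rX (nrm_ed vc) eqxx /= [l == k]eq_sym; field.
Qed.

(** In the coordinates r the degenerating factors of f^-1 disappear. The only quotient left, pd k W
    / r_k, stays bounded as r_k tends to 0, because pd k W vanishes where r_k = 0. *)
Lemma trhess_logFF x : trhess f (logFF D f) x = 4^-1 * \sum_l \sum_k
  invmx (Mr (rX x)) l k * ((k == l)%:R * (pd k Wt (rX x) / rX x 0 k) + pd l (pd k Wt) (rX x)).
Proof.
have T : trhess f (logFF D f) x = mdot (invmx (hess f x)) (hess (logFF D f) x).
  by apply: eq_bigr => i _; apply: eq_bigr => j _; rewrite [hess (logFF _ _) _ _ _]mxE.
have uH : hess f x \in unitmx by apply: posdef_unit; have [] := hess_posdef x.
apply: (etrans T); apply: (etrans (esym (mdot_congr _ uH (Vx_unit x)))).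
apply: (etrans (congr1 (fun A => mdot (invmx A) (Vx x *m hess (logFF D f) x *m (Vx x)^T))
  (esym (Mr_rX x)))).
rewrite [LHS]/mdot mulr_sumr; apply: eq_bigr => l _; rewrite mulr_sumr; apply: eq_bigr => k _.
rewrite VxE hessU; last exact: smo_logFF.
rewrite derive2_logFF [RHS]mulrCA; congr (_ * _).
have a0 := gen_rX x k; have b0 := gen_rX x l.
by have [->|_] := eqVneq k l; rewrite /= ?mul1r ?mul0r; field; rewrite ?a0 ?b0.
Qed.

End WithD.
End Fixed.
End SliceMachine.

(** * Bounds by compactness in the charts *)

Section Compactness.
Context {R : realType}.

Lemma cont_bound (T : topologicalType) (A : set T) (h : T -> R) : compact A ->
  (forall x, A x -> {for x, continuous h}) -> exists2 M, 0 <= M & forall x, A x -> `|h x| <= M.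
Proof.
move=> cA ch; have wc : {within A, continuous h}.
  by apply: continuous_in_subspaceT => x; rewrite inE; exact: ch.
have [M [_ HM]] := compact_bounded (continuous_compact wc cA).
exists (`|M| + 1); first by have := normr_ge0 M; lra.
move=> x Ax; apply: (HM (`|M| + 1)); last by exists x.
by have := ler_norm M; lra.
Qed.

Lemma cont_bound_fin (T : topologicalType) (A : set T) (I : finType) (h : I -> T -> R) :
  compact A -> (forall i x, A x -> {for x, continuous (h i)}) ->
  exists2 M, 0 <= M & forall i x, A x -> `|h i x| <= M.
Proof.
move=> cA ch.
have H i : exists M, 0 <= M /\ forall x, A x -> `|h i x| <= M.
  by have [M M0 HM] := cont_bound cA (ch i); exists M.
have [m Hm] := choice H; exists (\sum_i m i); first by apply: sumr_ge0 => i _; have [] := Hm i.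
move=> i x Ax; have [m0 /(_ x Ax) le] := Hm i; apply: (le_trans le).
by rewrite (bigD1 i) //= lerDl; apply: sumr_ge0 => j _; have [] := Hm j.
Qed.

Definition cube n : set 'rV[R]_n := [set r | forall k, 0 <= r 0 k <= 1].

Lemma compact_box n (a b : R) : compact [set r : 'rV[R]_n | forall k, a <= r 0 k <= b].
Proof.
have := @rV_compact R n (fun=> [set` `[a, b]]) (fun=> @segment_compact R a b).
congr compact; apply/seteqP; split => r /= H k; by have := H k; rewrite ?in_itv.
Qed.

Lemma enorm_sum n (I : Type) (r : seq I) (v : I -> 'rV[R]_n) :
  enorm (\sum_(i <- r) v i) <= \sum_(i <- r) enorm (v i).
Proof.
elim/big_rec2: _ => [|i y x _ H]; last by apply: (le_trans (enormD _ _)); rewrite lerD2l.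
by rewrite /enorm dotrv0l sqrtr0.
Qed.

End Compactness.

Section ChartBound.
Context {R : realType} {n : nat} (P : halfspaces R n).
Local Notation d := (nfacets P).
Local Notation Cn := (@Cn R n).
Variables (s : 'I_n -> 'I_d) (p : 'rV[R]_n) (f : 'rV[R]_n -> R) (F : Cn -> R)
  (D : 'rV[R]_n -> R) (U : set 'rV[R]_n).
Hypotheses (vc : vchart s p) (df : smo setT f) (dF : smo setT F)
  (fF : forall zeta, generic zeta -> f (Xlog s zeta) = dotrv (Xlog s zeta) p + F zeta)
  (gP : forall x, closedPoly P (grad f x)) (posM : forall r, posdef (Mr F r))
  (PU : closedPoly P `<=` U) (dD : smo U D) (D0 : forall xi, closedPoly P xi -> 0 < D xi).
Local Notation W := (Wt s p F D).

Let sW : smo setT W.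
Proof. exact: (smo_Wt vc df dF fF gP posM PU dD D0). Qed.

Let dW m k : dk setT m (pd k W).
Proof. by have [_ H] := sW m.+1; exact: H. Qed.

Lemma rX_cube x : (forall k, dotrv x (ed s k) <= 0) -> cube (rX s x).
Proof.
move=> H k; rewrite (ltW (rX_gt0 _ _ _)) mxE -[leRHS]expR0 ler_expR /=.
by have := H k; lra.
Qed.

Lemma pdWt_quot M (r : 'rV[R]_n) k :
  (forall k l r, cube r -> `|pd l (pd k W) r| <= M) -> cube r -> 0 < r 0 k ->
  `|pd k W r / r 0 k| <= M.
Proof.
move=> HM cr rk; pose r' : 'rV[R]_n := \row_j (if j == k then 0 else r 0 j).
have rE t : t *: delta_mx 0 k + r' = \row_j (if j == k then t else r 0 j).
  by apply/rowP => j; rewrite !mxE eqxx /=; case: eqP => _ /=; rewrite ?mulr1 ?mulr0 ?addr0 ?add0r.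
have rE1 : r 0 k *: delta_mx 0 k + r' = r.
  by rewrite rE; apply/rowP => j; rewrite mxE; case: eqP => [->|].
have [t /andP[t0 t1]] := MVT_line_pos (f := pd k W) (x := r') (v := delta_mx 0 k) rk
  (fun t => @diff_derivable _ _ _ _ _ _ (dk_differentiable (dW 0%N k) Logic.I)).
rewrite rE1 (derive_Wt0 (r := r') vc df dF fF gP posM PU dD D0); last by rewrite mxE eqxx.
rewrite subr0 => ->; rewrite mulfK ?gt_eqF //; apply: HM.
rewrite rE => j; rewrite mxE; case: eqP => _; last exact: cr.
by have /andP[_ r1] := cr k; apply/andP; split; lra.
Qed.

Lemma chart_logFF_bound : exists M, forall x, (forall k, dotrv x (ed s k) <= 0) ->
  `|trhess f (logFF D f) x| <= M /\ enorm (grad (logFF D f) x) <= M.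
Proof.
have cc : compact (@cube R n) by exact: compact_box.
have ct (h : 'rV[R]_n -> R) : dk setT 0 h -> forall x, cube x -> {for x, continuous h}.
  by move=> dh x _; exact: (dk_continuous dh).
have [M1 M10 H1] := cont_bound_fin (h := fun k : 'I_n => pd k W) cc (fun k => ct _ (dW 0%N k)).
have [M2 M20 H2] := cont_bound_fin (h := fun kl : 'I_n * 'I_n => pd kl.2 (pd kl.1 W)) cc
  (fun kl => ct _ ((dW 1%N kl.1).2 (delta_mx 0 kl.2))).
have dI l k : dk setT 0 (fun r => invmx (Mr F r) l k).
  apply: dk_invmx => [|i j|r _]; first exact: openT; first exact: dk_Mr.
  by rewrite gt_eqF // (det_Mr_gt0 posM).
have [M3 M30 H3] := cont_bound_fin (h := fun kl : 'I_n * 'I_n => fun r => invmx (Mr F r) kl.1 kl.2)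
  cc (fun kl => ct _ (dI kl.1 kl.2)).
pose B1 := 4^-1 * \sum_(l < n) \sum_(k < n) (M3 * (M2 + M2)).
pose B2 := \sum_(k < n) ((1 + 2^-1 * M1) * enorm (ed s k)).
exists (Num.max B1 B2) => x xe; have cr := rX_cube xe; rewrite !le_max; split; apply/orP; [left|right].
- rewrite (trhess_logFF vc df dF fF gP posM PU dD D0) normrM ger0_norm //.
  rewrite ler_pM2l //; apply: (le_trans (ler_norm_sum _ _ _)); apply: ler_sum => l _.
  apply: (le_trans (ler_norm_sum _ _ _)); apply: ler_sum => k _.
  rewrite normrM ler_pM //; first exact: (H3 (l, k)).
  apply: (le_trans (ler_normD _ _)); apply: lerD; last exact: (H2 (k, l)).
  rewrite normrM; have q := pdWt_quot (M := M2) (fun k l => H2 (k, l)) cr (rX_gt0 s x k).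
  by case: (k == l) => /=; rewrite ?normr1 ?normr0 ?mul1r ?mul0r.
- rewrite (grad_logFF vc df dF fF gP posM PU dD D0).
  apply: (le_trans (enorm_sum _ _)); apply: ler_sum => k _; rewrite enormZ.
  apply: ler_wpM2r; first exact: enorm_ge0.
  apply: (le_trans (ler_normD _ _)); rewrite normr1 lerD2l normrM ger0_norm //.
  rewrite ler_pM2l // normrM -[leRHS]mul1r ler_pM //; last exact: H1.
  by have /andP[a b] := cr k; rewrite ger0_norm.
Qed.

End ChartBound.

Section Charts.
Context {R : realType} {n : nat} (P : halfspaces R n).
Local Notation d := (nfacets P).

(* There are finitely many charts. *)
Lemma chart_uniform (G : ('I_n -> 'I_d) -> R -> Prop) :
  (forall s M M', M <= M' -> G s M -> G s M') ->
  (forall s p, vchart s p -> vertex P p -> exists M, G s M) ->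
  exists2 M, 0 <= M & forall (s : 'I_n -> 'I_d) p, vchart s p -> vertex P p -> G s M.
Proof.
move=> mono H.
have K (t : {ffun 'I_n -> 'I_d}) : exists M, 0 <= M /\ forall p, vchart t p -> vertex P p -> G t M.
  have [[p [vc vp]]|no] := pselect (exists p, vchart t p /\ vertex P p).
    have [M HM] := H _ _ vc vp; exists (`|M|); split => // _ _ _.
    by apply: mono HM; exact: ler_norm.
  by exists 0; split => // p vc vp; case: no; exists p.
have [m Hm] := choice K; exists (\sum_t m t); first by apply: sumr_ge0 => t _; have [] := Hm t.
move=> s p vc vp.
have sE : s = [ffun k => s k] by apply/funext => k; rewrite ffunE.
rewrite sE in vc *; have [_ /(_ p vc vp)] := Hm [ffun k => s k].
apply: mono; rewrite (bigD1 [ffun k => s k]) //= lerDl.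
by apply: sumr_ge0 => t _; have [] := Hm t.
Qed.

End Charts.

(** * Potentials f = g + phi *)

Section Potential.
Context {R : realType} {n : nat} (P : halfspaces R n).
Local Notation d := (nfacets P).
Local Notation Cn := (@Cn R n).
Let oT := @openT 'rV[R]_n.
Variable phi : 'rV[R[i]]_d -> R.
Hypotheses (HP : delzant P) (sphi : smooth_on_M phi) (tphi : torus_invariant phi).

Let bP : bounded_set (closedPoly P). Proof. by case: HP. Qed.

Lemma smo_phi_chart (s : 'I_n -> 'I_d) p : vchart s p -> vertex P p ->
  smo setT (phi \o chart s).
Proof.
move=> vc vp; apply: smooth_on_Cn_smo; apply: sphi.2; exists p => //; exact: vc_fac vc.
Qed.

Lemma smo_Fpot (s : 'I_n -> 'I_d) p : vchart s p -> vertex P p -> smo setT (Fpot s phi).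
Proof.
move=> vc vp m; apply: (dk_eq (@openT Cn) (f := fun zeta => Psi s p (etaV s p (@yC R n) zeta)
  + (phi \o chart s) zeta)).
  by move=> zeta _; rewrite /Fpot (pot_chart vc bP).
apply: (dk_add (@openT Cn)); last exact: smo_phi_chart vc vp m.
by apply: (dk_comp_etaV vc bP (@yC_nneg R n)) => [k|]; [exact: smo_yC|exact: dk_Psi].
Qed.

Lemma smo_fpot : smo setT (fpot phi).
Proof.
have [s [p [vc vp _]]] := max_vertex 0 HP.
move=> m; apply: (dk_eq oT (f := fun x => dotrv x p + Fpot s phi (rX s x, 0))).
  by move=> x _; rewrite (fpot_zetaX vc bP sphi tphi).
apply: (dk_add oT); first exact: smo_dotrv.
apply: (dk_comp oT (dk_slice (smo_Fpot vc vp m))) => // j; exact: smo_rX.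
Qed.

Lemma phi_bounded : exists2 K, 0 <= K & forall z, coxU z -> `|phi z| <= K.
Proof.
pose G (s : 'I_n -> 'I_d) (M : R) := forall zeta : Cn, (forall k, yC zeta 0 k <= 1) ->
  `|phi (chart s zeta)| <= M.
have [||K K0 HK] := @chart_uniform _ _ P G.
- by move=> s M M' le H zeta y1; apply: (le_trans (H _ y1)).
- move=> s p vc vp.
  pose B : set 'rV[R]_n := [set r | forall k, -1 <= r 0 k <= 1].
  have cB : compact (B `*` B) by apply: compact_setX; exact: compact_box.
  have [M _ HM] := cont_bound (h := (phi \o chart s : Cn -> R)) cB
    (fun x _ => dk_continuous (smo_phi_chart vc vp 0%N) (x := x)).
  exists M => zeta y1; apply: HM; split => k.
    have := y1 k; rewrite mxE; have := sqr_ge0 (zeta.2 0 k); nra.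
  by have := y1 k; rewrite mxE; have := sqr_ge0 (zeta.1 0 k); nra.
exists K => // z /(polydisc_cover HP sphi)[s [p [zeta [vc vp -> y1]]]].
exact: (HK s p).
Qed.

Lemma on_torus_bounded : exists2 K, 0 <= K & forall x, `|on_torus phi x| <= K.
Proof.
have [s [p [vc vp _]]] := max_vertex 0 HP.
have [K K0 HK] := phi_bounded; exists K => // x.
rewrite -(Xlog_zetaX vc x) (on_torus_chart vc sphi tphi); last exact: generic_zetaX.
apply: HK; apply: nonzero_coxU; first by exists p; exact: vc_in vc.
by move=> i; apply: (chart_neq0 vc) => k; exact: generic_zetaX.
Qed.

Hypothesis posM : forall (s : 'I_n -> 'I_d) p, vchart s p -> vertex P p ->
  forall r, posdef (Mr (Fpot s phi) r).

Lemma fpot_hess_posdef x : posdef (hess (fpot phi) x).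
Proof.
have [s [p [vc vp _]]] := max_vertex 0 HP.
apply: (hess_posdef vc smo_fpot (F := Fpot s phi)); last exact: posM vc vp.
by move=> zeta; exact: fpot_chart.
Qed.

(* By convexity, <grad f, u> is bounded below by the slope at infinity of f
   along - u. *)
Lemma fpot_grad_in x : closedPoly P (grad (fpot phi) x).
Proof.
have [s [p [vc vp _]]] := max_vertex 0 HP.
have [K K0 HK] := on_torus_bounded.
move=> i; rewrite leNgt; apply/negP => neg.
set c := lfun i (grad (fpot phi) x) in neg.
(* Makes t |c| = 2 K + 1, more than the oscillation of phi, which is at most 2 K. *)
pose t := (2 * K + 1) / - c.
have t0 : 0 < t by rewrite divr_gt0 //; lra.
have tc : t * - c = 2 * K + 1 by rewrite /t mulfVK // gt_eqF //; lra.
pose v : 'rV[R]_n := - t *: nrm i.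
have := convex_tangent x (v := v) (smo_fpot 1%N).
have dd y : 'D_v ('D_v (fpot phi)) y = qf (hess (fpot phi) y) v v.
  exact: (derive_hess v v oT (smo_fpot 1%N) Logic.I).
case/(_ _)/Wrap => [y|]; first by rewrite dd; apply: posdef_ge0; exact: fpot_hess_posdef.
rewrite (derive_dotrv _ (dk_differentiable (smo_fpot 0%N) Logic.I)) dotrvZl.
have gi : lfun i (grad (fpot phi) x) = dotrv (nrm i) (grad (fpot phi) x) - offset P 0 i.
  by rewrite lfunE dotrvC.
have gle : guillemin_g P (v + x) <= guillemin_g P x - t * offset P 0 i.
  have [-> _] := guillemin_gE_max vc bP (v + x).
  have := (guillemin_gE_max vc bP x).2 _ (xiX_in vc bP (v + x)).
  rewrite dotrvDl dotrvZl => H; have := xiX_in vc bP (v + x) i; rewrite lfunE dotrvC => H2.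
  by nra.
rewrite /fpot => H.
have /ler_normlP[a1 a2] := HK x; have /ler_normlP[b1 b2] := HK (v + x).
have E : c = dotrv (nrm i) (grad (fpot phi) x) - offset P 0 i by [].
move: H; rewrite -/(fpot phi) => H; nra.
Qed.

Section Density.
Variables (D : 'rV[R]_n -> R) (U : set 'rV[R]_n).
Hypotheses (oU : open U) (PU : closedPoly P `<=` U) (dD : smo U D) (DU : forall xi, U xi -> 0 < D xi).
Local Notation f := (fpot phi).

Let lnD eta := ln (D eta).

Lemma smo_lnD : smo U lnD.
Proof. by move=> m; apply: (dk_ln oU). Qed.

Lemma constD_ge xi : closedPoly P xi -> enorm (grad lnD xi) <= constD P D.
Proof.
have cP := compact_closedPoly bP.
have ch (j : 'I_n) x : closedPoly P x -> {for x, continuous (pd j lnD)}.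
  move=> Px; apply: differentiable_continuous.
  by have [_ /(_ (delta_mx 0 j)) H] := smo_lnD 1%N; apply: H.1; exact: PU.
have [M M0 HM] := cont_bound_fin (h := fun j : 'I_n => pd j lnD) cP ch.
move=> Pxi; apply: ub_le_sup; last by exists xi.
exists (\sum_(j < n) M * enorm (delta_mx 0 j : 'rV[R]_n)) => _ [eta Peta <-].
have -> : grad lnD eta = \sum_j pd j lnD eta *: delta_mx 0 j.
  by rewrite [LHS]row_sum_delta; apply: eq_bigr => j _; rewrite mxE.
apply: (le_trans (enorm_sum _ _)); apply: ler_sum => j _; rewrite enormZ.
by apply: ler_wpM2r; [exact: enorm_ge0|exact: HM].
Qed.

(** By the chain rule the gradient of log D_f is f'' applied to (grad log D) (grad f). The factor
    f'' cancels against f^-1, which leaves an inner product of two bounded vectors. *)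
Lemma scalSE x : scalS D f x =
  - trhess f (logFF D f) x - dotrv (grad (logFF D f) x) (grad lnD (grad f x)).
Proof.
rewrite /scalS; congr (_ - _).
have E j : pd j (logpullD D f) x = \sum_m pd m lnD (grad f x) * hess f x j m.
  rewrite /pd (derive_comp_rV (F := lnD) (h := grad f)).
  - apply: eq_bigr => m _; rewrite [hess _ _ _ _]mxE; congr (_ * _); congr ('D_ _ _ _).
    by apply/funext => y; rewrite mxE.
  - move=> m; have [_ /(_ (delta_mx 0 m)) H] := smo_fpot 1%N.
    have -> : (fun y => grad f y 0 m) = pd m f by apply/funext => y; rewrite mxE.
    exact: H.1.
  - by apply: (dk_differentiable (smo_lnD 0%N)); apply: PU; exact: fpot_grad_in.
under eq_bigr do under eq_bigr do rewrite E.
have uH : hess f x \in unitmx by apply: posdef_unit; have [] := fpot_hess_posdef x.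
transitivity (\sum_i pd i (logFF D f) x * \sum_m (invmx (hess f x) *m hess f x) i m * pd m lnD (grad f x)).
  apply: eq_bigr => i _; rewrite mulr_sumr.
  under [RHS]eq_bigr => m _ do rewrite mxE mulr_suml mulr_sumr.
  rewrite exchange_big /=; apply: eq_bigr => j _; rewrite mulr_sumr; apply: eq_bigr => m _; ring.
apply: eq_bigr => i _; rewrite mulVmx // !mxE (bigD1 i) //= big1 ?addr0.
  by rewrite mxE eqxx mul1r.
by move=> m mi; rewrite mxE eq_sym (negbTE mi) mul0r.
Qed.

(** Every x lies over the unit cube of the chart at a vertex which maximizes it. This bound depends
    on phi; it only ensures that the suprema in [constRg] and [max_absS] are taken over bounded
    sets, and so are upper bounds. *)
Lemma logFF_bound : exists2 M, 0 <= M & forall x,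
  `|trhess f (logFF D f) x| <= M /\ enorm (grad (logFF D f) x) <= M.
Proof.
pose G (s : 'I_n -> 'I_d) (M : R) := forall x, (forall k, dotrv x (ed s k) <= 0) ->
  `|trhess f (logFF D f) x| <= M /\ enorm (grad (logFF D f) x) <= M.
have [||M M0 HM] := @chart_uniform _ _ P G.
- by move=> s M M' le H x xe; have [a b] := H x xe; split; apply: (le_trans _ le).
- move=> s p vc vp; apply: (chart_logFF_bound vc smo_fpot (smo_Fpot vc vp) _ fpot_grad_in (posM vc vp) PU dD).
    by move=> zeta; exact: fpot_chart.
  by move=> xi /PU; exact: DU.
exists M => // x; have [s [p [vc vp xe]]] := max_vertex x HP.
exact: (HM s p vc vp x xe).
Qed.

Lemma constRg_ge x :
  `|trhess f (logFF D f) x| + enorm (grad (logFF D f) x) ^+ 2 <= constRg D f.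
Proof.
apply: ub_le_sup; last by exists x.
have [M M0 HM] := logFF_bound; exists (M + M ^+ 2) => _ [y _ <-]; have [a b] := HM y.
by apply: lerD => //; rewrite lerXn2r ?nnegrE ?enorm_ge0.
Qed.

Lemma max_absS_ge x : `|scalS D f x| <= max_absS D f.
Proof.
apply: ub_le_sup; last by exists x.
have [M M0 HM] := logFF_bound; exists (M + M * constD P D) => _ [y _ <-]; have [a b] := HM y.
rewrite scalSE -opprD normrN; apply: (le_trans (ler_normD _ _)); apply: lerD => //.
apply: (le_trans (cauchy_schwarz _ _)); apply: ler_pM => //; try exact: enorm_ge0.
by apply: constD_ge; exact: fpot_grad_in.
Qed.

End Density.
End Potential.

(** * Limit of the trace and gradient of log F at a vertex *)

Section TraceLimit.
Context {R : realType} {n : nat} (P : halfspaces R n).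
Local Notation d := (nfacets P).
Local Notation Cn := (@Cn R n).
Local Notation one := (const_mx 1 : 'rV[R]_n).

Lemma line_continuous (V : normedModType R) (f : V -> R) v (t : R) : dk setT 0 f ->
  {for t, continuous (fun t : R => f (t *: v))}.
Proof.
move=> df; apply: (@continuous_comp R V R (fun t : R => t *: v) f t).
  exact: scalel_continuous.
exact: (dk_continuous df).
Qed.

Lemma quotient_continuous (V : normedModType R) (f : V -> R) (v : V) :
  differentiable f 0 -> f 0 = 0 ->
  {for (0 : R), continuous (fun t : R => if t == 0 then 'D_v f 0 else f (t *: v) / t)}.
Proof.
move=> df f0; apply/continuous_withinNx; rewrite eqxx.
have H : (fun h : R => h^-1 *: ((f \o shift 0) (h *: v) - f 0)) @ 0^' --> 'D_v f 0.
  exact: diff_derivable.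
apply: cvg_trans H; apply: near_eq_cvg.
apply: (filterS _ (nbhs_dnbhs_neq (0 : R))) => t t0.
by rewrite (negbTE t0) /= addr0 f0 subr0 mulrC.
Qed.

Variables (s : 'I_n -> 'I_d) (p : 'rV[R]_n) (f : 'rV[R]_n -> R) (F : Cn -> R)
  (D : 'rV[R]_n -> R) (U : set 'rV[R]_n).
Hypotheses (vc : vchart s p) (df : smo setT f) (dF : smo setT F)
  (fF : forall zeta, generic zeta -> f (Xlog s zeta) = dotrv (Xlog s zeta) p + F zeta)
  (gP : forall x, closedPoly P (grad f x)) (posM : forall r, posdef (Mr F r))
  (PU : closedPoly P `<=` U) (dD : smo U D) (D0 : forall xi, closedPoly P xi -> 0 < D xi).
Local Notation W := (Wt s p F D).

Let sW : smo setT W.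
Proof. exact: (smo_Wt vc df dF fF gP posM PU dD D0). Qed.

Let dW m k : dk setT m (pd k W).
Proof. by have [_ H] := sW m.+1; exact: H. Qed.

Let ddW m k l : dk setT m (pd l (pd k W)).
Proof. by have [_ H] := dW m.+1 k; exact: H. Qed.

(** pd k W vanishes on the hyperplane r_k = 0, which contains the axis of index l. *)
Lemma pd2_Wt0 k l : l != k -> pd l (pd k W) 0 = 0.
Proof.
move=> lk; apply: (derive_even (dk_differentiable (dW 0%N k) Logic.I)) => t.
by rewrite !(derive_Wt0 vc df dF fF gP posM PU dD D0) // !mxE eqxx /= eq_sym (negbTE lk) mulr0 addr0.
Qed.

(** The limit is taken along r = t (1, ..., 1). Both pd k W / r_k and pd k (pd k W) tend to the pure
    second derivative at 0, which turns the factor 1/4 into 1/2; in the gradient only the sum of the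
    edges survives. *)
Lemma trace_limit C :
  (forall x, `|trhess f (logFF D f) x| + enorm (grad (logFF D f) x) ^+ 2 <= C) ->
  `|2^-1 * \sum_k invmx (Mr F 0) k k * pd k (pd k W) 0| + enorm (\sum_k ed s k) ^+ 2 <= C.
Proof.
move=> HC.
pose q k (t : R) := if t == 0 then 'D_one (pd k W) 0 else pd k W (t *: one) / t.
pose inv (l k : 'I_n) (r : 'rV[R]_n) : R := invmx (Mr F r) l k.
have dI l k : dk setT 0 (inv l k).
  apply: dk_invmx => [|i j|r _]; first exact: openT; first exact: dk_Mr.
  by rewrite gt_eqF // (det_Mr_gt0 posM).
have W0 k : pd k W 0 = 0 by apply: (derive_Wt0 vc df dF fF gP posM PU dD D0); rewrite mxE.
pose G (t : R) := 4^-1 * \sum_l \sum_k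
  inv l k (t *: one) * ((k == l)%:R * q k t + pd l (pd k W) (t *: one)).
pose w j (t : R) := \sum_k (1 + 2^-1 * (t * pd k W (t *: one))) * ed s k 0 j.
have cq k : {for (0 : R), continuous (q k)}.
  by apply: quotient_continuous; [exact: (dk_differentiable (dW 0%N k))|exact: W0].
have cG : {for (0 : R), continuous G}.
  apply: cont_mul; first exact: cont_cst.
  apply: sum_continuous_at => l; apply: sum_continuous_at => k.
  have c1 : {for (0 : R), continuous (fun t : R => inv l k (t *: one))}.
    exact: line_continuous.
  have c2 : {for (0 : R), continuous (fun t : R => pd l (pd k W) (t *: one))}.
    by apply: line_continuous; exact: ddW.
  have c3 : {for (0 : R), continuous (fun t : R => (k == l)%:R * q k t)}.
    by apply: cont_mul; [exact: cont_cst|exact: cq].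
  by apply: (@cont_mul R R _ _ 0 c1); exact: cont_add.
have cw j : {for (0 : R), continuous (w j)}.
  apply: sum_continuous_at => k; apply: cont_mul; last exact: cont_cst.
  apply: cont_add; first exact: cont_cst.
  apply: cont_mul; first exact: cont_cst.
  by apply: cont_mul; [exact: cvg_id|apply: line_continuous; exact: dW].
(* The absolute value is treated through its two signs, e = 1 and e = - 1, so that the limit
   concerns a continuous function. *)
have key (e : R) : `|e| <= 1 -> 0 <= C - e * G 0 - \sum_j w j 0 * w j 0.
  move=> e1; pose h t := C - e * G t - \sum_j w j t * w j t.
  apply: (@limit_ge0 R R h 0 1).
    apply: cont_sub; last by apply: sum_continuous_at => j; apply: cont_mul; exact: cw.
    by apply: cont_sub; [exact: cont_cst|apply: cont_mul; [exact: cont_cst|exact: cG]].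
  move=> eps eps0; exists (eps / 2); first by apply/andP; split; lra.
  set t := eps / 2; have t0 : 0 < t by rewrite /t; lra.
  have -> : t *: (1 : R) + 0 = t by rewrite addr0 -[RHS]mulr1.
  (* The point of the open torus lying over r = t (1, ..., 1). *)
  pose x : 'rV[R]_n := \sum_k (2 * ln t) *: nrm (s k).
  have rx : rX s x = t *: one.
    apply/rowP => j; rewrite !mxE mulr1 /x dotrv_suml (bigD1 j) //= big1 ?addr0.
      by rewrite dotrvZl (nrm_ed vc) eqxx mulr1 mulrAC divff // mul1r lnK.
    by move=> k kj; rewrite dotrvZl (nrm_ed vc) (negbTE kj) mulr0.
  have := HC x.
  rewrite (trhess_logFF vc df dF fF gP posM PU dD D0) (grad_logFF vc df dF fF gP posM PU dD D0).
  rewrite rx enorm_sqr.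
  have -> : 4^-1 * (\sum_l \sum_k invmx (Mr F (t *: one)) l k *
      ((k == l)%:R * (pd k W (t *: one) / (t *: one) 0 k) + pd l (pd k W) (t *: one))) = G t.
    rewrite /G; congr (_ * _); apply: eq_bigr => l _; apply: eq_bigr => k _.
    by rewrite /q (gt_eqF t0) mxE mxE mulr1.
  have -> : dotrv (\sum_k slopeWt s p F D k (t *: one) *: ed s k) (\sum_k slopeWt s p F D k (t *: one) *: ed s k) =
      \sum_j w j t * w j t.
    have E j : (\sum_k slopeWt s p F D k (t *: one) *: ed s k) 0 j = w j t.
      by rewrite summxE; apply: eq_bigr => k _; rewrite mxE /slopeWt !mxE mulr1.
    by apply: eq_bigr => j _; rewrite E.
  move=> le; rewrite /h; have : e * G t <= `|G t|.
    apply: (le_trans (ler_norm _)); rewrite normrM.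
    by apply: ler_piMl.
  by lra.
have E0 : 2^-1 * \sum_k invmx (Mr F 0) k k * pd k (pd k W) 0 = G 0.
  rewrite /G (_ : 2^-1 = 4^-1 * 2 :> R) -?mulrA ?mulr_sumr; last by field.
  apply: eq_bigr => l _; congr (_ * _); rewrite [RHS](bigD1 l) //= eqxx mul1r big1 ?addr0.
    rewrite /inv scale0r /q eqxx (differentiable_derive_sum _ (dk_differentiable (dW 0%N l) Logic.I)).
    rewrite (bigD1 l) //= big1 ?addr0 ?mxE ?mul1r; first ring.
    by move=> j jl; rewrite pd2_Wt0 ?mulr0.
  by move=> k kl; rewrite (negbTE kl) mul0r add0r scale0r pd2_Wt0 ?mulr0 // eq_sym.
have W2 : enorm (\sum_k ed s k) ^+ 2 = \sum_j w j 0 * w j 0.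
  have E j : (\sum_k ed s k) 0 j = w j 0.
    by rewrite summxE; apply: eq_bigr => k _; rewrite mul0r mulr0 addr0 mul1r.
  by rewrite enorm_sqr; apply: eq_bigr => j _; rewrite E.
rewrite E0 W2 -lerBrDr ler_norml; apply/andP; split.
- by have := key (-1); rewrite normrN normr1 lexx => /(_ isT); lra.
- by have := key 1; rewrite normr1 lexx => /(_ isT); lra.
Qed.

End TraceLimit.

(** * Positivity of the metric at the real points of a chart *)

Section PositiveSlices.
Context {R : realType} {n : nat} (P : halfspaces R n).
Local Notation d := (nfacets P).
Local Notation Cn := (@Cn R n).
Let oT := @openT 'rV[R]_n.

Lemma kahler_posdef (phi : 'rV[R[i]]_d -> R) (s : 'I_n -> 'I_d) p r : kahler phi ->
  vchart s p -> vertex P p -> posdef (Mr (Fpot s phi) r).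
Proof.
move=> kphi vc vp.
have pA : posdef_hermitian (metric phi s (r, 0)).
  by apply: kphi; exists p => //; exact: vc_fac vc.
by split; [exact: posdef_hermitian_Re_sym pA|exact: posdef_hermitian_Re pA].
Qed.

Lemma zero_smooth_on_M : smooth_on_M ((fun=> 0) : 'rV[R[i]]_d -> R).
Proof.
split=> // s _ k; change (Ck_on setT k ((fun=> 0) : Cn -> R)).
elim: k => [|k IH]; first by split=> // x _; exact: cst_continuous.
split=> [x _|v]; first exact: cst_continuous.
split=> [x _|]; first exact: derivable_cst.
suff -> : 'D_v ((fun=> 0) : Cn -> R) = (fun=> 0) by exact: IH.
by apply/funext => x; rewrite derive_cst.
Qed.

Lemma zero_torus_invariant : torus_invariant ((fun=> 0) : 'rV[R[i]]_d -> R).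
Proof. by []. Qed.

Lemma fpot0 : fpot ((fun=> 0) : 'rV[R[i]]_d -> R) = guillemin_g P.
Proof. by apply/funext => x; rewrite /fpot /on_torus addr0. Qed.

Hypothesis HP : delzant P.
Let bP : bounded_set (closedPoly P). Proof. by case: HP. Qed.

Variables (s : 'I_n -> 'I_d) (p : 'rV[R]_n).
Hypotheses (vc : vchart s p) (vp : vertex P p).

Local Notation F0 := (Fpot s ((fun=> 0) : 'rV[R[i]]_d -> R)).

Lemma Fpot0_gen (zeta : Cn) : generic zeta ->
  guillemin_g P (Xlog s zeta) = dotrv (Xlog s zeta) p + F0 zeta.
Proof.
move=> gz; rewrite -fpot0; apply: (fpot_chart vc bP) => //; exact: zero_smooth_on_M.
Qed.

Definition yr (r : 'rV[R]_n) : 'rV[R]_n := yC (r, 0).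

Lemma yr_nneg r : nneg (yr r). Proof. exact: yC_nneg. Qed.

Lemma smo_yr k : smo setT (fun r => yr r 0 k).
Proof. by move=> m; exact: (dk_slice (smo_yC k m)). Qed.

Definition eS r := etaV s p yr r.

Definition NB (r : 'rV[R]_n) : 'M[R]_n := diag_mx r *m Bmx s p (eS r) *m diag_mx r.
Definition th (r : 'rV[R]_n) : 'rV[R]_n := \row_k expR (- lrho s p k (eS r)).
(** Candidate for the inverse of the matrix of the Guillemin metric at r. For generic r it is diag
    (r) A diag (r), and r_k^2 / eta_k = exp (lrho_k) removes the division by eta_k. It is positive
    definite for all r, and [Mr_Nm] then gives the positivity of the metric also where some r_k
    vanish. *)
Definition Nm (r : 'rV[R]_n) : 'M[R]_n := diag_mx (\row_k (th r 0 k)^-1) + NB r.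

Lemma NmE r k l : Nm r k l =
  (k == l)%:R * expR (lrho s p k (eS r)) + r 0 k * Bmx s p (eS r) k l * r 0 l.
Proof.
rewrite /Nm /NB mxE mul_mx_diag mul_diag_mx !mxE expRN invrK; congr (_ + _).
by case: eqP => [->|_]; rewrite /= ?mulr1n ?mul1r ?mulr0n ?mul0r.
Qed.

Lemma Nm_posdef r : posdef (Nm r).
Proof.
apply: diag_plus_posdef.
- by move=> k; rewrite mxE expR_gt0.
- by rewrite !trmx_mul tr_diag_mx Bmx_sym mulmxA.
- move=> v; have := Bmx_ge0 (v *m diag_mx r) (etaV_dom vc bP yr_nneg r).
  by rewrite /qf trmx_mul tr_diag_mx !mulmxA.
Qed.

Lemma dk_Nm m k l : dk setT m (fun r => Nm r k l).
Proof.
have ce G := dk_comp_etaV vc bP yr_nneg smo_yr (m := m) (F := G).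
apply: (dk_eq oT (f := fun r => (k == l)%:R * expR (lrho s p k (eS r)) + r 0 k * Bmx s p (eS r) k l * r 0 l)).
  by move=> r _; rewrite NmE.
apply: (dk_add oT).
  by apply: (dk_scale oT); apply: (dk_expR oT); apply: (ce (lrho s p k)); exact: dk_lrho.
apply: (dk_mul oT); last exact: (dk_coord _ _ oT).
apply: (dk_mul oT); first exact: (dk_coord _ _ oT).
by apply: (ce (fun e => Bmx s p e k l)); exact: dk_Bmx.
Qed.

Lemma Nm_gen r : gen r -> Nm r = diag_mx r *m Amx s p (eS r) *m diag_mx r.
Proof.
move=> gr; apply/matrixP => k l; rewrite NmE mul_mx_diag mul_diag_mx !mxE.
have := congr1 (fun v : 'rV[R]_n => v 0 k) (etaV_Phi vc bP yr_nneg r).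
rewrite mxE [RHS]yC_slice => E.
have e0 : eS r 0 k != 0.
  by apply: contraTneq (sqr_ge0 (r 0 k)) => e0; move: E; rewrite -/(eS r) e0 mul0r => /esym/eqP; rewrite sqrf_eq0 (negbTE (gr k)).
rewrite mulrDr mulrDl; congr (_ + _).
case: eqP => [<-|_]; rewrite /= ?mulr1n ?mul1r ?mulr0n ?mul0r ?mulr0 ?mul0r //.
by rewrite mulrAC -expr2 -E mulrAC mulfV // mul1r.
Qed.

Lemma Mr_Nm r : Mr F0 r *m Nm r = 1%:M.
Proof.
have dM : forall i j, continuous (fun r => Mr F0 r i j).
  by move=> i j; apply: (@dk_continuous _ _ 0%N); apply: dk_Mr; exact: (smo_Fpot HP zero_smooth_on_M vc vp).
apply/matrixP => i j.
apply: (gen_eq (g := fun r => (Mr F0 r *m Nm r) i j) (h := fun=> (1%:M : 'M[R]_n) i j)) => {r}.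
- move=> r; have -> : (fun r => (Mr F0 r *m Nm r) i j) = (fun r => \sum_k Mr F0 r i k * Nm r k j).
    by apply/funext => z; rewrite mxE.
  apply: sum_continuous_at => k; apply: cont_mul; first exact: dM.
  exact: (dk_continuous (dk_Nm 0%N k j)).
- by move=> r; exact: cst_continuous.
- move=> r gr; congr (fun_of_matrix _ i j).
  have yE : yX s (xl s r) = yr r by rewrite (yX_Xlog vc (gen_generic gr)).
  have uA : Amx s p (eS r) \in unitmx.
    by apply: posdef_unit; have [] := Amx_posdef vc bP (xl s r); rewrite yE.
  pose dv : 'rV[R]_n := \row_k (r 0 k)^-1.
  have E : Mr F0 r = diag_mx dv *m invmx (Amx s p (eS r)) *m diag_mx dv.
    apply/matrixP => k l; rewrite mul_mx_diag mul_diag_mx [RHS]mxE.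
    rewrite (Mr_gen (smo_guillemin_g vc bP) Fpot0_gen) // uhess_UR; last exact: (smo_guillemin_g vc bP).
    by rewrite (hessU_g vc bP) yE [in RHS]mxE [dv 0 k]mxE [dv 0 l]mxE.
  have dd : diag_mx dv *m diag_mx r = 1%:M.
    rewrite mulmx_diag -diag_const_mx; congr diag_mx; apply/rowP => k.
    by rewrite !mxE mulVf // gr.
  rewrite E (Nm_gen gr) !mulmxA -(mulmxA _ (diag_mx dv) (diag_mx r)) dd mulmx1.
  by rewrite -(mulmxA _ (invmx _)) mulVmx // mulmx1 dd.
Qed.

Lemma Mr0_posdef r : posdef (Mr F0 r).
Proof.
have [_ uN] := mulmx1_unit (Mr_Nm r).
have -> : Mr F0 r = invmx (Nm r) by rewrite -[LHS](mulmxK uN) Mr_Nm mul1mx.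
by apply: posdef_inv; exact: Nm_posdef.
Qed.

Lemma invmx_Mr0 r : invmx (Mr F0 r) = Nm r.
Proof.
have [uM _] := mulmx1_unit (Mr_Nm r).
by rewrite -[RHS](mulKmx uM) Mr_Nm mulmx1.
Qed.

End PositiveSlices.

(** * The curvature bound at a vertex *)

Section VertexLimit.
Context {R : realType} {n : nat} (P : halfspaces R n).
Local Notation d := (nfacets P).
Local Notation Cn := (@Cn R n).
Let oT := @openT 'rV[R]_n.

(** The function [W] is computed explicitly only on the axes; the derivative along an axis depends
    on nothing else. *)
Lemma line_derive (V : normedModType R) (f g : V -> R) v (t : R) :
  (forall t : R, f (t *: v) = g (t *: v)) -> 'D_v f (t *: v) = 'D_v g (t *: v).
Proof.
move=> fg; have EQ : (fun h : R => h^-1 *: (f (h *: v + t *: v) - f (t *: v))) =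
    (fun h => h^-1 *: (g (h *: v + t *: v) - g (t *: v))).
  by apply/funext => h; rewrite -scalerDl !fg.
transitivity (lim ((fun h : R => h^-1 *: (f (h *: v + t *: v) - f (t *: v))) @ 0^')); first by [].
by rewrite EQ.
Qed.

Lemma open_gt0 (V : normedModType R) (U : set V) (f : V -> R) : open U -> dk U 0 f ->
  open [set x | U x /\ 0 < f x].
Proof.
move=> oU df; rewrite openE => x [Ux fx]; rewrite /interior /=.
have cf : {for x, continuous f} by apply: differentiable_continuous; exact: (dk_differentiable df).
have H0 : \forall y \near x, 0 < f y := cf _ (openP (@open_gt R 0) fx).
by have H1 := openP oU Ux; apply: filterS2 H1 H0.
Qed.

Variables (s : 'I_n -> 'I_d) (p : 'rV[R]_n) (D : 'rV[R]_n -> R) (U : set 'rV[R]_n).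
Hypotheses (HP : delzant P) (vc : vchart s p) (vp : vertex P p)
  (oU : open U) (PU : closedPoly P `<=` U) (dD : smo U D) (DU : forall xi, U xi -> 0 < D xi).
Let bP : bounded_set (closedPoly P). Proof. by case: HP. Qed.

Local Notation F0 := (Fpot s ((fun=> 0) : 'rV[R[i]]_d -> R)).
Local Notation W := (Wt s p F0 D).
Local Notation eS := (eS s p).
Local Notation B := (Bmx s p).
Local Notation lnD := (fun eta => ln (D eta)).

Let sg : smo setT (guillemin_g P). Proof. exact: (smo_guillemin_g vc bP). Qed.
Let sF : smo setT F0. Proof. exact: (smo_Fpot HP (zero_smooth_on_M P) vc vp). Qed.
Let gP x : closedPoly P (grad (guillemin_g P) x).
Proof. by rewrite (grad_g vc bP); exact: xiX_in. Qed.
Let D0 xi : closedPoly P xi -> 0 < D xi. Proof. by move/PU; exact: DU. Qed.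
Let fF (zeta : Cn) : generic zeta ->
  guillemin_g P (Xlog s zeta) = dotrv (Xlog s zeta) p + F0 zeta.
Proof. exact: (Fpot0_gen HP vc). Qed.
Let posM r : posdef (Mr F0 r). Proof. exact: (Mr0_posdef HP vc vp). Qed.

Let dW m k : dk setT m (pd k W).
Proof. by have [_ H] := smo_Wt vc sg sF fF gP posM PU dD D0 m.+1; exact: H. Qed.

Let deS m j : dk setT m (fun r => eS r 0 j).
Proof. exact: (dk_etaV vc bP yr_nneg smo_yr). Qed.

Let eS_Phi r k : eS r 0 k * expR (lrho s p k (eS r)) = r 0 k ^+ 2.
Proof.
have := congr1 (fun v : 'rV[R]_n => v 0 k) (etaV_Phi vc bP yr_nneg r).
by rewrite mxE [RHS]yC_slice.
Qed.

Lemma eS0 (r : 'rV[R]_n) k : r 0 k = 0 -> eS r 0 k = 0.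
Proof.
move=> rk; have /eqP := eS_Phi r k.
by rewrite rk expr0n mulf_eq0 (gt_eqF (expR_gt0 _)) orbF => /eqP.
Qed.

Lemma Xi_eS (r : 'rV[R]_n) : Xi s p F0 r = pt s p (eS r).
Proof.
apply/rowP => j; apply: (gen_eq (g := fun r => Xi s p F0 r 0 j) (h := fun r => pt s p (eS r) 0 j)) => {r}.
- exact: (dk_continuous (dk_Xi _ _ sF 0%N j)).
- apply: (@dk_continuous _ _ 0%N).
  apply: (dk_eq oT (f := fun r => p 0 j + \sum_k ed s k 0 j * eS r 0 k)).
    by move=> r _; rewrite mxE summxE; congr (_ + _); apply: eq_bigr => k _; rewrite [RHS]mxE mulrC.
  apply: (dk_add oT); first exact: (dk_cst oT).
  by apply: (dk_sum oT) => k _; apply: (dk_scale oT); exact: deS.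
- move=> r gr; rewrite (Xi_gen vc sg fF gr) (grad_g vc bP) /xiX.
  by rewrite (yX_Xlog vc (gen_generic gr)).
Qed.

(* [Wt] of the Guillemin potential on the k-th axis, through eta: the matrix
   [Nm] inverse to the metric is diagonal there. *)
Definition axisWt k (eta : 'rV[R]_n) : R := ln (D (pt s p eta)) - \sum_j lrho s p j eta
  - ln (1 + eta 0 k * B eta k k).

Lemma W_axis k (t : R) : W (t *: delta_mx 0 k) = axisWt k (eS (t *: delta_mx 0 k)).
Proof.
set r := t *: delta_mx 0 k.
have rE j : r 0 j = t * (j == k)%:R by rewrite !mxE eqxx.
clearbody r.
have BB : 0 <= B (eS r) k k.
  by have := Bmx_ge0 (delta_mx 0 k) (etaV_dom vc bP yr_nneg r); rewrite qf_delta.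
have e0 : 0 <= eS r 0 k by exact: (etaV_nneg vc bP yr_nneg r k).
have NE : Nm s p r = diag_mx (\row_j (expR (lrho s p j (eS r)) *
    (if j == k then 1 + eS r 0 k * B (eS r) k k else 1))).
  apply/matrixP => j l; rewrite NmE !mxE !rE.
  have [<-|jl] := eqVneq j l; rewrite /= ?mul1r ?mul0r ?mulr1n ?mulr0n ?add0r.
    have [->|jk] := eqVneq j k; rewrite /= ?mulr1 ?mulr0 ?mul0r ?addr0 //.
    have := eS_Phi r k; rewrite rE eqxx /= mulr1 => E.
    rewrite mulrDr mulr1; congr (_ + _); rewrite mulrA [expR _ * _]mulrC E; ring.
  have [jk|jk] := eqVneq j k; rewrite /= ?mulr0 ?mul0r //.
  by rewrite -jk eq_sym (negbTE jl) !mulr0.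
have N0 : 0 < \det (Nm s p r) by have /andP[] := hadamard (Nm_posdef HP vc r).
have ME : \det (Mr F0 r) = (\det (Nm s p r))^-1.
  have := congr1 determinant (Mr_Nm HP vc vp r); rewrite det_mulmx det1 => E.
  by rewrite -[LHS](mulfK (lt0r_neq0 N0)) E mul1r.
rewrite /Wt Xi_eS ME lnV ?posrE // /axisWt -addrA; congr (_ + _); rewrite -opprD; congr (- _).
rewrite NE det_diag (eq_bigr (fun j => expR (lrho s p j (eS r)) *
  (if j == k then 1 + eS r 0 k * B (eS r) k k else 1))); last by move=> j _; rewrite mxE.
rewrite big_split /= -big_mkcond big_pred1_eq lnM ?posrE; first by rewrite ln_prod_exp.
- by apply: prodr_gt0 => j _; exact: expR_gt0.
- by rewrite ltr_pwDl // mulr_ge0.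
Qed.

Definition dom2 k : set 'rV[R]_n :=
  [set eta | (dom s p eta /\ 0 < 1 + eta 0 k * B eta k k) /\ U (pt s p eta)].

Let pt_coord m j : dk [set: 'rV[R]_n] m (fun eta => pt s p eta 0 j).
Proof.
apply: (dk_eq oT (f := fun eta => p 0 j + \sum_k ed s k 0 j * eta 0 k)).
  by move=> r _; rewrite mxE summxE; congr (_ + _); apply: eq_bigr => k _; rewrite [RHS]mxE mulrC.
apply: (dk_add oT); first exact: (dk_cst oT).
by apply: (dk_sum oT) => k _; apply: (dk_scale oT); exact: (dk_coord _ _ oT).
Qed.

Let dk_1B m k : dk (dom s p) m (fun eta => 1 + eta 0 k * B eta k k).
Proof.
have oD := @dom_open _ _ _ s p.
apply: (dk_add oD); first exact: (dk_cst oD).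
by apply: (dk_mul oD); [exact: (dk_coord _ _ oD)|exact: dk_Bmx].
Qed.

Lemma dom2_open k : open (dom2 k).
Proof.
apply: openI; first by apply: open_gt0; [exact: (@dom_open _ _ _ s p)|exact: dk_1B].
apply: open_comp => // eta _; apply: differentiable_continuous; apply: differentiable_rV => j.
exact: (dk_differentiable (pt_coord 0%N j)).
Qed.

Lemma dk_axisWt m k : dk (dom2 k) m (axisWt k).
Proof.
have o2 := @dom2_open k.
have sub : dom2 k `<=` dom s p by move=> eta [[]].
apply: (dk_sub o2); last first.
  by apply: (dk_ln o2) => [eta [[]]|] //; apply: dk_sub_set sub _; exact: dk_1B.
apply: (dk_sub o2); last first.
  by apply: (dk_sum o2) => j _; apply: dk_sub_set sub _; exact: dk_lrho.
apply: (dk_ln o2) => [eta [_ /DU]|] //.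
apply: (dk_comp o2 (dD m)) => [eta []|j] //.
by apply: dk_sub_set (pt_coord m j).
Qed.

Lemma eS_dom2 k r : dom2 k (eS r).
Proof.
have dr := etaV_dom vc bP yr_nneg r; have nr := etaV_nneg vc bP yr_nneg r.
split; last by apply: PU; exact: closed_ll.
have e0 : 0 <= eS r 0 k by exact: nr.
have b0 : 0 <= B (eS r) k k by have := Bmx_ge0 (delta_mx 0 k) dr; rewrite qf_delta.
by split=> //; rewrite ltr_pwDl // mulr_ge0.
Qed.

Lemma derive_eS_axis k (t : R) j : pd k (fun r => eS r 0 j) (t *: delta_mx 0 k) =
  (j == k)%:R * (t * (2 * expR (- lrho s p k (eS (t *: delta_mx 0 k))) /
     (1 + eS (t *: delta_mx 0 k) 0 k * B (eS (t *: delta_mx 0 k)) k k))).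
Proof.
set r := t *: delta_mx 0 k.
have rE l : r 0 l = t * (l == k)%:R by rewrite !mxE eqxx.
have dy l : 'D_(delta_mx 0 k) (fun u => yr u 0 l) r = 2 * (t * (l == k)%:R).
  rewrite /yr (derive_slice (fun zeta => yC zeta 0 l)) derive_yC /= rE !mxE eqxx /=.
  by case: (l == k); rewrite /= !(mulr0, mulr1, mul0r, addr0).
have rel l := derive_etaV_rel vc bP yr_nneg smo_yr r (delta_mx 0 k) l.
have x0 l : l != k -> pd k (fun r => eS r 0 l) r = 0.
  move=> lk; have := rel l; rewrite dy (negbTE lk) /= !mulr0 (bigD1 l) //= big1 ?addr0.
    by rewrite MmxE eqxx eS0 ?rE ?(negbTE lk) ?mulr0 // mul0r addr0 mul1r.
  by move=> i il; rewrite MmxE eq_sym (negbTE il) add0r eS0 ?rE ?(negbTE lk) ?mulr0 // !mul0r.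
have [->|jk] := eqVneq j k; last by rewrite x0 // mul0r.
have [[_ B0] _] := eS_dom2 k r.
have := rel k; rewrite dy eqxx (bigD1 k) //= big1 ?addr0; last first.
  by move=> i ik; have := x0 i ik; rewrite /pd => ->; rewrite mulr0.
rewrite MmxE eqxx /= => E; rewrite /pd mul1r.
apply: (mulfI (lt0r_neq0 B0)); rewrite [LHS]E; field.
by rewrite gt_eqF.
Qed.

Definition axis_slope k (r : 'rV[R]_n) : R := pd k (axisWt k) (eS r) *
  (2 * expR (- lrho s p k (eS r)) / (1 + eS r 0 k * B (eS r) k k)).

Lemma pdW_axis k (t : R) : pd k W (t *: delta_mx 0 k) = t * axis_slope k (t *: delta_mx 0 k).
Proof.
rewrite {1}/pd (@line_derive _ W (fun r => axisWt k (eS r))); last exact: W_axis.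
rewrite (derive_comp_rV (F := axisWt k) (h := eS)); last first.
- by apply: (dk_differentiable (dk_axisWt 0%N k)); exact: eS_dom2.
- by move=> j; exact: (dk_differentiable (deS 0%N j)).
rewrite (bigD1 k) //= big1 ?addr0.
  by have := derive_eS_axis k t k; rewrite eqxx mul1r /pd => ->; rewrite /axis_slope mulrCA.
by move=> j jk; have := derive_eS_axis k t j; rewrite (negbTE jk) mul0r /pd => ->; rewrite mulr0.
Qed.

(** On the axis pd k W is t times a differentiable function, so its derivative at 0 is the value of
    that function. A second derivative of [W] thus reduces to a first derivative of [axisWt] at eta
    = 0. *)
Lemma pd2W_axis k : pd k (pd k W) 0 = axis_slope k 0.
Proof.
have o2 := @dom2_open k.
have d2 (G : 'rV[R]_n -> R) : dk (dom2 k) 0 G -> dk setT 0 (fun r => G (eS r)).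
  by move=> dG; apply: (dk_comp oT dG) => [r _|j]; [exact: eS_dom2|exact: deS].
have dY : dk setT 0 (axis_slope k).
  apply: (dk_mul oT); first by apply: d2; have [_ H] := dk_axisWt 1%N k; exact: H.
  apply: (dk_mul oT).
    apply: (dk_scale oT); apply: (dk_expR oT); apply: (dk_opp oT); apply: (d2 (lrho s p k)).
    by apply: dk_sub_set (dk_lrho s p 0%N k) => eta [[]].
  apply: (dk_inv oT) => [r _|]; first by rewrite gt_eqF //; have [[]] := eS_dom2 k r.
  by apply: (d2 (fun eta => 1 + eta 0 k * B eta k k)); apply: dk_sub_set (dk_1B 0%N k) => eta [[]].
have -> : pd k (pd k W) 0 = 'D_(delta_mx 0 k) (fun r : 'rV[R]_n => r 0 k * axis_slope k r) 0.
  rewrite {1}/pd -(scale0r (delta_mx 0 k : 'rV[R]_n)); apply: line_derive => t.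
  by rewrite pdW_axis mxE !mxE !eqxx mulr1.
rewrite derive_mulf; [|exact: (dk_differentiable (dk_coord 0%N k oT))|exact: (dk_differentiable dY)].
by rewrite derive_coord !mxE !eqxx mul0r add0r mulr1.
Qed.

Lemma eS_0 : eS 0 = 0.
Proof. by apply/rowP => k; rewrite [RHS]mxE eS0 // mxE. Qed.

Lemma pd_axisWt0 k : pd k (axisWt k) 0 =
  dotrv (grad lnD p) (ed s k) - \sum_j B 0 j k - B 0 k k.
Proof.
have p0 : pt s p 0 = p by rewrite /pt big1 ?addr0 // => j _; rewrite mxE scale0r.
have [[d0 B0] U0] : dom2 k 0 by rewrite -eS_0; exact: eS_dom2.
have oD := @dom_open _ _ _ s p.
have dln : dk U 0 lnD by apply: (dk_ln oU).
have e1 : differentiable (fun eta => lnD (pt s p eta)) 0.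
  have o2 := @dom2_open k; apply: (@dk_differentiable _ _ (dom2 k) 0%N) => //.
  by apply: (dk_comp o2 dln) => [eta []|j] //; apply: dk_sub_set (pt_coord 0%N j).
have e2 j : differentiable (lrho s p j) 0 by exact: (dk_differentiable (dk_lrho s p 0%N j)).
have e3 : differentiable (fun eta : 'rV[R]_n => eta 0 k * B eta k k) 0.
  apply: (@dk_differentiable _ _ (dom s p) 0%N) => //.
  by apply: (dk_mul oD); [exact: (dk_coord _ _ oD)|exact: dk_Bmx].
have e4 : differentiable (fun eta : 'rV[R]_n => 1 + eta 0 k * B eta k k) 0.
  exact: (dk_differentiable (dk_1B 0%N k)).
have e5 : differentiable (fun eta : 'rV[R]_n => ln (1 + eta 0 k * B eta k k)) 0.
  have o3 := open_gt0 oD (dk_1B 0%N k).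
  have dl : dk [set eta | dom s p eta /\ 0 < 1 + eta 0 k * B eta k k] 0
      (fun eta => ln (1 + eta 0 k * B eta k k)).
    by apply: (dk_ln o3) => [eta []|] //; apply: dk_sub_set (dk_1B 0%N k) => eta [].
  by apply: (dk_differentiable dl); split.
rewrite /pd /axisWt derive_subf; last first.
- exact: e5.
- apply: differentiableB => //; apply: (@dk_differentiable _ _ (dom s p) 0%N) => //.
  by apply: (dk_sum oD) => j _; exact: dk_lrho.
rewrite derive_subf //; last first.
  by apply: (@dk_differentiable _ _ (dom s p) 0%N) => //; apply: (dk_sum oD) => j _; exact: dk_lrho.
rewrite derive_sumf; last by move=> *; exact: e2.
congr (_ - _ - _).
- rewrite (derive_comp_rV (F := lnD) (h := pt s p)); last first.
  + by rewrite p0; apply: (dk_differentiable dln); rewrite -p0.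
  + by move=> j; exact: (dk_differentiable (pt_coord 0%N j)).
  rewrite p0; apply: eq_bigr => m _; rewrite [grad _ _ _ _]mxE; congr (_ * _).
  have -> : (fun eta => pt s p eta 0 m) = (fun eta => p 0 m + \sum_k ed s k 0 m * eta 0 k).
    by apply/funext => r; rewrite mxE summxE; congr (_ + _); apply: eq_bigr => i _; rewrite mxE mulrC.
  have dc i : differentiable (fun eta : 'rV[R]_n => eta 0 i) 0 by exact: (dk_differentiable (dk_coord 0%N i oT)).
  have dci i : differentiable (fun eta : 'rV[R]_n => ed s i 0 m * eta 0 i) 0 by apply: differentiableZ.
  rewrite derive_addf; [|exact: differentiable_cst|].
    rewrite derive_cst add0r derive_sumf; last by move=> *; exact: dci.
    rewrite (bigD1 k) //= big1 ?addr0; first by rewrite derive_scalef // derive_coord [X in _ * X]mxE !eqxx mulr1.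
    by move=> i ik; rewrite derive_scalef // derive_coord [X in _ * X]mxE (negbTE ik) andbF mulr0.
  apply: (@dk_differentiable _ _ setT 0%N) => //; apply: (dk_sum oT) => i _.
  by apply: (dk_scale oT); exact: (dk_coord _ _ oT).
- apply: eq_bigr => j _; rewrite derive_lrho // (bigD1 k) //= big1 ?addr0.
    by rewrite [X in _ * X]mxE !eqxx mulr1.
  by move=> i ik; rewrite [X in _ * X]mxE (negbTE ik) andbF mulr0.
- rewrite derive_lnf // derive_addf //.
  rewrite derive_cst add0r derive_mulf; last 2 first.
  + exact: (dk_differentiable (dk_coord 0%N k oT)).
  + by apply: (dk_differentiable (dk_Bmx s p 0%N k k)).
  by rewrite derive_coord !mxE !eqxx !mul0r addr0 invr1 mul1r add0r mulr1.
Qed.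

(** In the limit the entry exp (lrho_k) of [Nm] cancels the factor exp (- lrho_k) of [axis_slope],
    and 1/2 cancels its factor 2: only the derivatives of [axisWt] remain. *)
Lemma vertex_bound :
  `|\sum_k (dotrv (grad lnD p) (ed s k) - \sum_j B 0 j k - B 0 k k)|
    + enorm (\sum_k ed s k) ^+ 2 <= constRg D (guillemin_g P).
Proof.
have H := trace_limit vc sg sF fF gP posM PU dD D0 (C := constRg D (guillemin_g P)).
rewrite -(fpot0 P) in H *.
have HM (s' : 'I_n -> 'I_d) p' : vchart s' p' -> vertex P p' ->
    forall r, posdef (Mr (Fpot s' ((fun=> 0) : 'rV[R[i]]_d -> R)) r).
  by move=> vc' vp' r; exact: (Mr0_posdef HP vc' vp').
have Hx := constRg_ge HP (zero_smooth_on_M P) (@zero_torus_invariant R n P) HM PU dD DU.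
have := H Hx; congr (`|_| + _ <= _); rewrite mulr_sumr; apply: eq_bigr => k _.
have z : (0 : 'rV[R]_n) 0 k = 0 by rewrite mxE.
rewrite (invmx_Mr0 HP vc vp) pd2W_axis /axis_slope NmE eS_0 !z eqxx !mul0r !addr0 pd_axisWt0 mul1r divr1.
rewrite expRN; have := expR_gt0 (lrho s p k 0); set e := expR _ => e0; field.
by rewrite gt_eqF.
Qed.

End VertexLimit.

(** * Bounds depending on n and R only *)

Section Controlled.
Context {R : realType} {n : nat}.
Implicit Types (P : halfspaces R n) (rho : R).

(** Divided by l_i(p), this is the contribution of the facet i to sum_jk B_jk + sum_k B_kk at the
    vertex. *)
Definition mass P (s : 'I_n -> 'I_(nfacets P)) i : R :=
  (\sum_k ac s i k) ^+ 2 + \sum_k ac s i k ^+ 2.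

(* What the vertices of P retain of the bound on the curvature quantity R_g. *)
Definition controlled P rho : Prop :=
  [/\ delzant P, diam P ^+ 2 <= rho &
   forall (s : 'I_n -> 'I_(nfacets P)) p, vchart s p -> vertex P p ->
    enorm (\sum_k ed s k) ^+ 2 <= rho /\
    \sum_(i | ~~ inS s i) mass s i / co p i <= 5 / 4 * rho].

Lemma controlled_constR P (D : 'rV[R]_n -> R) U rho : delzant P ->
  open U -> closedPoly P `<=` U -> smo U D -> (forall xi, U xi -> 0 < D xi) ->
  constR P D <= rho -> controlled P rho.
Proof.
move=> HP oU PU dD DU; rewrite /constR !ge_max => /and3P[Rg Rd Rm]; split=> // s p vc vp.
have := vertex_bound HP vc vp oU PU dD DU.
set w := \sum_k ed s k; set b := grad _ p; set A := \sum_k _.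
have AE : A = dotrv b w - \sum_(i | ~~ inS s i) mass s i / co p i.
  rewrite /A !sumrB -dotrv_sumr -/w -addrA -opprD; congr (_ - _).
  have l0 i : ll s p i 0 = co p i by rewrite /ll big1 ?addr0 // => k _; rewrite mxE mul0r.
  under eq_bigr do under eq_bigr do rewrite mxE.
  under [X in _ + X]eq_bigr do rewrite mxE.
  rewrite [X in _ + X]exchange_big /=.
  under eq_bigr do rewrite exchange_big /=.
  rewrite exchange_big /= -big_split /=; apply: eq_bigr => i _; rewrite l0 /mass mulrDl.
  congr (_ + _); last by rewrite mulr_suml; apply: eq_bigr => k _; rewrite -expr2.
  rewrite expr2 mulr_sumr mulr_suml; apply: eq_bigr => k _.
  rewrite mulr_suml mulr_suml; apply: eq_bigr => j _; ring.
have cb := constD_ge HP oU PU dD DU (vc_in vc); rewrite -/b in cb.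
have := cauchy_schwarz b w; have b0 := enorm_ge0 b; have w0 := enorm_ge0 w.
have : `|A| + enorm w ^+ 2 <= constRg D (guillemin_g P) -> `|dotrv b w| <= enorm b * enorm w ->
    enorm w ^+ 2 <= rho /\ \sum_(i | ~~ inS s i) mass s i / co p i <= 5 / 4 * rho.
  rewrite {1}AE; set S := \sum_(i | _) _; set x := enorm w in w0 *; set c := enorm b in b0 cb *.
  move=> H1 H2; have c2 : c ^+ 2 <= rho.
    by apply: le_trans Rd; rewrite lerXn2r ?nnegrE //; exact: le_trans b0 cb.
  have [a1 a2] : - `|dotrv b w - S| <= dotrv b w - S /\ 0 <= `|dotrv b w - S|.
    by split; [rewrite lerNl -normrN ler_norm|].
  have [a3 a4] : dotrv b w <= `|dotrv b w| /\ x ^+ 2 <= rho by split; [exact: ler_norm|lra].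
  (* With x = |w| and c = |grad log D|, the sum S is at most rho - x^2 + c x <= rho + c^2 / 4, and
     c^2 <= rho: this is the origin of 5/4. *)
  split=> //; have := sqr_ge0 (x - c / 2); nra.
by move=> K cs vb; exact: K.
Qed.

Section Fixed.
Variables (P : halfspaces R n) (rho : R) (s : 'I_n -> 'I_(nfacets P)) (p : 'rV[R]_n).
Hypotheses (cP : controlled P rho) (vc : vchart s p) (vp : vertex P p).
Local Notation d := (nfacets P).

Let HP : delzant P. Proof. by case: cP. Qed.
Let bP : bounded_set (closedPoly P). Proof. by case: HP. Qed.
Let oP : openPoly P !=set0. Proof. by case: HP. Qed.

Lemma diam_le : diam P <= rho + 1.
Proof.
have [_ d2 _] := cP; have d0 := diam_ge0 bP oP.
have := sqr_ge0 (diam P - 1); nra.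
Qed.

Lemma mass_ge0 i : 0 <= mass s i.
Proof. by rewrite addr_ge0 ?sqr_ge0 // sumr_ge0 // => k _; exact: sqr_ge0. Qed.

Lemma mass_le i : ~~ inS s i -> 4 * mass s i <= 5 * rho * co p i.
Proof.
move=> iS; have [_ _ /(_ s p vc vp)[_]] := cP; rewrite (bigD1 i) //= => H.
have c0 := co_gt0 vc iS.
have : 0 <= \sum_(j | ~~ inS s j && (j != i)) mass s j / co p j.
  apply: sumr_ge0 => j _; rewrite divr_ge0 ?mass_ge0 //; exact: co_ge0 vc _.
have : mass s i / co p i * co p i = mass s i by rewrite mulfVK // gt_eqF.
set q := mass s i / co p i in H *; nra.
Qed.

Lemma ac_neq0 i : exists k, acz s i k != 0.
Proof.
apply: contrapT => no; have z k : ac s i k = 0.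
  apply: contrapT => h; apply: no; exists k; apply/eqP => h2; apply: h; by rewrite /ac h2.
have n0 : nrm i = 0.
  by rewrite (nrm_expand vc (nrm i)) big1 // => k _; rewrite -acE z scale0r.
have [[xi xio] _ /(_ i)[eta [ei _]] _] := HP.
have := xio i; rewrite lfunE; move: ei; rewrite lfunE n0 !dotrv0l => ->.
by rewrite ltxx.
Qed.

(** With Z = sum_k a_ik and Q = sum_k a_ik^2, which are integers, Q >= 1 since the normal is not 0,
    and Z^2 >= - Z. *)
Lemma mass_ge i : 1 <= mass s i /\ 1 - \sum_k ac s i k <= mass s i.
Proof.
have [k0 k00] := ac_neq0 i.
pose Z : int := \sum_k acz s i k; pose Q : int := \sum_k acz s i k ^+ 2.
have sq (m : int) : `|m| <= m ^+ 2.
  rewrite -real_normK ?num_real // expr2; have := normr_ge0 m.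
  by rewrite le_eqVlt => /orP[/eqP <-|m0]; rewrite ?mulr0 // ler_peMl // -gtz0_ge1.
have Q1 : 1 <= Q.
  rewrite /Q (bigD1 k0) //= -[leLHS]addr0 lerD //; last by apply: sumr_ge0 => k _; exact: sqr_ge0.
  by apply: le_trans (sq _); rewrite -gtz0_ge1 normr_gt0.
have QZ : - Z <= Q.
  rewrite /Q /Z -sumrN; apply: ler_sum => k _; apply: le_trans (sq _).
  by rewrite -normrN ler_norm.
have mE : mass s i = (Z ^+ 2 + Q)%:~R.
  rewrite rmorphD rmorphXn /= /Z /Q !rmorph_sum /=; congr (_ + _).
  by apply: eq_bigr => k _; rewrite rmorphXn.
have sE : \sum_k ac s i k = Z%:~R by rewrite /Z rmorph_sum.
have Z2 := sqr_ge0 Z.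
have [h1 h2] : 1 <= Z ^+ 2 + Q /\ 1 - Z <= Z ^+ 2 + Q.
  split; first by lra.
  have [Z0|Z0] := leP 0 Z; first by lra.
  have Z1 : 1 <= - Z by rewrite -gtz0_ge1 oppr_gt0.
  by nra.
rewrite mE sE; split.
  by have : ((1 : int)%:~R : R) <= (Z ^+ 2 + Q)%:~R by rewrite ler_int.
have : ((1 - Z)%:~R : R) <= (Z ^+ 2 + Q)%:~R by rewrite ler_int.
by rewrite rmorphB.
Qed.

Lemma rho_gt0 : (0 < n)%N -> 0 < rho.
Proof.
move=> n0; pose k := Ordinal n0.
have [t t0 tP] := edge_feasible k vc.
have e0 : 0 < enorm (ed s k).
  rewrite lt_neqAle enorm_ge0 andbT; apply/eqP => e0.
  have := cauchy_schwarz (nrm (s k)) (ed s k); rewrite (nrm_ed vc) eqxx -e0 mulr0 normr1.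
  by rewrite ler10.
have := closedPoly_diam bP oP tP (vc_in vc).
rewrite addrC addKr enormZ gtr0_norm // => H; have [_ d2 _] := cP.
have : 0 < t * enorm (ed s k) by rewrite mulr_gt0.
nra.
Qed.

Hypothesis n0 : (0 < n)%N.

Lemma ac_le_mass i k : ac s i k ^+ 2 <= mass s i.
Proof.
rewrite /mass [X in _ + X](bigD1 k) //=; have : 0 <= \sum_(j | j != k) ac s i j ^+ 2.
  by apply: sumr_ge0 => j _; exact: sqr_ge0.
have := sqr_ge0 (\sum_k ac s i k); lra.
Qed.

Lemma ac_int i k : ac s i k < 0 -> 1 <= - ac s i k.
Proof.
rewrite /ac ltrz0 => h.
have : ((1 : int)%:~R : R) <= (- acz s i k)%:~R by rewrite ler_int -gtz0_ge1 oppr_gt0.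
by rewrite rmorphN.
Qed.

(** The segment from p along t e_k with t = 4 / (5 rho) stays in the polytope: a negative a_ik
    satisfies |a_ik| <= a_ik^2 <= 5 rho l_i(p) / 4, the first inequality by integrality. Its length
    is therefore at most the diameter. *)
Lemma edge_le k : enorm (ed s k) <= 5 / 4 * rho * (rho + 1).
Proof.
have r0 := rho_gt0 n0; pose t := 4 / (5 * rho).
have t0 : 0 < t by rewrite divr_gt0 // mulr_gt0.
have tr : 5 * rho * t = 4 by rewrite /t mulrC mulfVK // mulf_neq0 // gt_eqF.
have tP : closedPoly P (p + t *: ed s k).
  move=> i; have -> : lfun i (p + t *: ed s k) = co p i + t * ac s i k.
    by rewrite /co !lfunE dotrvDr dotrvZr acE; ring.
  have [iS|iS] := boolP (inS s i).
    have /existsP[j /eqP <-] := iS; rewrite (co_s vc) (ac_s vc) add0r.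
    by rewrite mulr_ge0 ?ler0n // ltW.
  have m1 := mass_le iS; have m2 := ac_le_mass i k; have c0 := co_gt0 vc iS.
  have [a0|a0] := leP 0 (ac s i k); first by have := mulr_ge0 (ltW t0) a0; lra.
  have a1 := ac_int a0; set a := ac s i k in a0 a1 m2 *.
  have a2 : - a <= a ^+ 2 by nra.
  have : 4 * - a <= 5 * rho * co p i by lra.
  rewrite -tr => H; have : t * - a <= co p i.
    by rewrite -(@ler_pM2l _ (5 * rho)) ?mulr_gt0 // mulrA.
  lra.
have := closedPoly_diam bP oP tP (vc_in vc).
rewrite addrC addKr enormZ gtr0_norm // => H; have dl := diam_le.
have : 5 / 4 * rho * (t * enorm (ed s k)) <= 5 / 4 * rho * (rho + 1).
  by rewrite ler_wpM2l //; [lra|lra].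
have -> : 5 / 4 * rho * (t * enorm (ed s k)) = enorm (ed s k).
  by rewrite mulrA (_ : 5 / 4 * rho * t = 1) ?mul1r //; lra.
by [].
Qed.

Lemma co_ge i : ~~ inS s i -> 4 <= 5 * rho * co p i.
Proof. by move=> iS; have := mass_le iS; have [] := mass_ge i; lra. Qed.

(* Half-integer slack: 2 rho l_i(p) >= (8/5) N_i, while 1 - a_i <= N_i. *)
Lemma vertex_slack i (e : R) : 0 <= e <= 1 / 2 -> ~~ inS s i ->
  (1 + e) * (1 - \sum_k ac s i k) <= 2 * rho * co p i.
Proof.
move=> /andP[e0 e1] iS; have m1 := mass_le iS; have [m2 m3] := mass_ge i; nra.
Qed.

End Fixed.

Section Cofactor.
Import perm.

(** The expansion is enlarged to a sum over all permutations, and each term to the full product E^n,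
    as E >= 1. *)
Lemma cofactor_bound (E : R) : 1 <= E -> exists2 B, 0 <= B & forall (A : 'M[R]_n) i j,
  (forall i j, `|A i j| <= E) -> `|cofactor A i j| <= B.
Proof.
move=> E1; have E0 : 0 <= E by lra.
exists (\sum_(t : {perm 'I_n}) E ^+ n); first by apply: sumr_ge0 => t _; exact: exprn_ge0.
move=> A i j H; rewrite expand_cofactor; apply: (le_trans (ler_norm_sum _ _ _)).
rewrite big_mkcond /=; apply: ler_sum => t _; case: ifP => _; last exact: exprn_ge0.
rewrite normrM normrX normrN1 expr1n mul1r normr_prod.
have -> : E ^+ n = \prod_(k < n) E by rewrite prodr_const card_ord.
rewrite big_mkcond /=; apply: ler_prod => k _; case: ifP => _; rewrite ?ler01 //=.
by rewrite normr_ge0 H.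
Qed.

End Cofactor.

Lemma enorm_le_coord (v : 'rV[R]_n) B : 0 <= B -> (forall j, `|v 0 j| <= B) -> enorm v <= n%:R * B.
Proof.
move=> B0 H; have -> : v = \sum_j v 0 j *: delta_mx 0 j by exact: row_sum_delta.
apply: (le_trans (enorm_sum _ _)).
have -> : n%:R * B = \sum_(j < n) B by rewrite sumr_const card_ord mulr_natl.
apply: ler_sum => j _; rewrite enormZ.
have -> : enorm (delta_mx 0 j : 'rV[R]_n) = 1.
  by rewrite /enorm dotrv_delta mxE !eqxx sqrtr1.
by rewrite mulr1.
Qed.

(* Every facet passes through a vertex, where the normals are the rows of the
   inverse transpose of the matrix of edges; hence its cofactors. *)
Lemma normal_bound rho : (0 < n)%N -> exists2 B, 1 <= B & forall P i, controlled P rho ->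
  enorm (nrm (P := P) i) <= B.
Proof.
move=> n0; pose E := `|5 / 4 * rho * (rho + 1)| + 1.
have E1 : 1 <= E by rewrite lerDr.
have [B B0 HB] := cofactor_bound E1.
exists (n%:R * B + 1); first by rewrite lerDr mulr_ge0.
move=> P i cP; have HP : delzant P by case: cP.
have bP : bounded_set (closedPoly P) by case: HP.
have [xi [xi0 xip]] : exists xi, lfun i xi = 0 /\ forall j, j != i -> 0 < lfun j xi by case: HP.
have [|q [vq qi _]] := @vertex_argmax _ _ P bP (fun j => j = i) 0.
  exists xi; split=> [j|j -> //]; have [->|ji] := eqVneq j i; first by rewrite xi0.
  by apply: ltW; exact: xip.
have [s vc] := vchart_exists HP vq.
have [k ki] := ((vc_fac vc).2 i).1 (qi i erefl).
rewrite -ki; apply: le_trans (_ : n%:R * B <= _); last by rewrite lerDl.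
apply: enorm_le_coord => // j.
pose M : 'M[R]_n := \matrix_(j, k) ed s k 0 j.
have UM : UR s *m M = 1%:M.
  apply/matrixP => a b; rewrite !mxE -(nrm_ed vc a b); apply: eq_bigr => l _.
  by rewrite !mxE.
have [uU uM] := mulmx1_unit UM.
have MU : UR s = invmx M by rewrite -[LHS](mulmxK uM) UM mul1mx.
have dM : `|\det M| = 1.
  have := congr1 (fun A => \det A ^+ 2) UM; rewrite det_mulmx exprMn (UR_det2 vc) mul1r det1 expr1n.
  by move/eqP; rewrite sqrf_eq1 => /orP[] /eqP ->; rewrite ?normrN normr1.
have -> : nrm (s k) 0 j = UR s k j by rewrite [RHS]mxE.
rewrite MU /invmx uM mxE normrM normfV dM invr1 mul1r mxE; apply: HB => a b.
rewrite mxE; apply: (le_trans (enorm_coord _ _)); apply: (le_trans (edge_le cP vc vq n0 b)).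
by apply: (le_trans (ler_norm _)); rewrite lerDl.
Qed.

(** Quantitative, polytope-independent form of the compactness of the charts: on the unit polydisc,
    eta_k is y_k up to bounded factors and g is <x, p> up to a bounded term. *)
Lemma chart_bounds rho : (0 < n)%N -> exists2 K, 0 <= K & forall P, controlled P rho ->
  forall (s : 'I_n -> 'I_(nfacets P)) p y, vchart s p -> vertex P p ->
  nneg y -> (forall k, y 0 k <= 1) ->
  [/\ forall k, `|lrho s p k (etaS s p y)| <= K,
      forall k, etaS s p y 0 k * Bmx s p (etaS s p y) k k <= K &
      `|Psi s p (etaS s p y)| <= K].
Proof.
move=> n0; have [U U1 HU] := normal_bound rho n0.
pose r := `|rho|; have r0 : 0 <= r by exact: normr_ge0.
have rr : rho <= r by exact: ler_norm.
(* [L] bounds the l_i on the polytope (normal times diameter), [N] the number of facets (each one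
   not through p contributes at least 1 / L to the sum of the masses over l_i(p)), [T] the constant
   of [ll_lower], [Lam] the |ln l_i| off the vertex and [A] the |a_ik|; [K1], [K2], [K3] are the
   three bounds. *)
pose L := U * (r + 1) + 1; have L1 : 1 <= L by rewrite lerDr mulr_ge0 //; lra.
pose N := n%:R + 5 / 4 * r * L.
pose T := n%:R * (1 + L * 1) + N * (1 + L + L * L).
pose Lam := 5 / 4 * r * T + L.
pose A := U * (5 / 4 * r * (r + 1)).
have N0 : 0 <= N by rewrite addr_ge0 // !mulr_ge0 //; lra.
have T0 : 0 <= T by rewrite addr_ge0 // mulr_ge0 //; nra.
have Lam0 : 0 <= Lam by rewrite addr_ge0 ?mulr_ge0 //; lra.
have A0 : 0 <= A by rewrite !mulr_ge0 //; lra.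
pose K1 := 1 + N * (A * (1 + Lam)).
pose K2 := L * (N * (A * A * expR Lam)).
pose K3 := n%:R * L + N * (L + L + L * Lam).
have [K10 K20 K30] : [/\ 0 <= K1, 0 <= K2 & 0 <= K3].
  have eL := expR_gt0 Lam.
  by split; rewrite ?addr_ge0 ?mulr_ge0 ?addr_ge0 ?mulr_ge0 ?mulr_ge0 //; nra.
exists (K1 + K2 + K3); first by apply: addr_ge0 => //; exact: addr_ge0.
move=> P cP s p y vc vp y0 y1; have HP : delzant P by case: cP.
have bP : bounded_set (closedPoly P) by case: HP.
have oP : openPoly P !=set0 by case: HP.
have lL (i : 'I_(nfacets P)) (xi : 'rV[R]_n) : closedPoly P xi -> lfun i xi <= L.
  move=> Pxi.
  have [xi' [xi0 xip]] : exists xi, lfun i xi = 0 /\ forall j, j != i -> 0 < lfun j xi by case: HP.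
  have Pxi' : closedPoly P xi'.
    by move=> j; have [->|ji] := eqVneq j i; [rewrite xi0|apply: ltW; exact: xip].
  have -> : lfun i xi = dotrv (nrm i) (xi - xi').
    by rewrite -[LHS]subr0 -xi0 !lfunE dotrvBr; ring.
  apply: (le_trans (ler_norm _)); apply: (le_trans (cauchy_schwarz _ _)).
  have := closedPoly_diam bP oP Pxi Pxi'; have := diam_le cP; have := HU P i cP.
  have := enorm_ge0 (nrm (P := P) i); have := enorm_ge0 (xi - xi').
  rewrite /L; nra.
have cL (i : 'I_(nfacets P)) : co p i <= L by apply: lL; exact: vc_in vc.
have dN : (nfacets P)%:R <= N.
  have -> : (nfacets P)%:R = \sum_(i < nfacets P) (1 : R) by rewrite sumr_const card_ord.
  rewrite (sum_facets vc) sumr_const card_ord lerD2l.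
  have [_ _ /(_ s p vc vp)[_ H]] := cP.
  apply: (@le_trans _ _ (\sum_(i | ~~ inS s i) (mass s i / co p i) * L)).
    apply: ler_sum => i iS; have c0 := co_gt0 vc iS; have [m1 _] := mass_ge cP vc i.
    rewrite -(@ler_pM2r _ (co p i)) // mul1r mulrAC mulfVK ?gt_eqF //.
    by have := cL i; nra.
  rewrite -mulr_suml ler_wpM2r //; first lra.
  by apply: (le_trans H); rewrite ler_wpM2l.
have [de ne EP] := etaSP vc bP y0.
set eta := etaS s p y in de ne EP *.
have Peta : closedPoly P (pt s p eta) by exact: closed_ll.
have lle i : ll s p i eta <= L by rewrite -lfun_pt; exact: lL.
have lnb i : ~~ inS s i -> `|ln (ll s p i eta)| <= Lam.
  move=> iS; have l0 := de i iS; have c0 := co_gt0 vc iS.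
  have up : ln (ll s p i eta) <= L by have := ln_le_subr1 l0; have := lle i; lra.
  have lo := ll_lower vc de ne EP L1 ler01 lle cL y1 iS.
  have TT : n%:R * (1 + L * 1) + (nfacets P)%:R * (1 + L + L * L) <= T.
    by rewrite lerD2l ler_wpM2r //; nra.
  have cg := co_ge cP vc vp iS.
  rewrite ler_norml; apply/andP; split; last first.
    by apply: (le_trans up); rewrite lerDr !mulr_ge0 //; lra.
  have [le0|gt0] := leP 0 (ln (ll s p i eta)); first by lra.
  set l := ln _ in gt0 lo up *; have H : - T <= co p i * l by lra.
  have : co p i * - l <= T by lra.
  have : 4 <= 5 * r * co p i by nra.
  move=> h1 h2; have : 4 * - l <= 5 * r * T.
    by apply: (@le_trans _ _ (5 * r * co p i * - l)); nra.
  rewrite /Lam; lra.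
have acb i k : `|ac s i k| <= A.
  rewrite acE; apply: dotrv_le; first exact: HU.
  apply: (le_trans (edge_le cP vc vp n0 k)).
  have rp := rho_gt0 cP vc n0; have -> : r = rho by exact: gtr0_norm.
  by [].
have sumb (F : 'I_(nfacets P) -> R) (M : R) : 0 <= M -> (forall i, ~~ inS s i -> `|F i| <= M) ->
    `|\sum_(i | ~~ inS s i) F i| <= N * M.
  move=> M0 HF; apply: (le_trans (ler_norm_sum _ _ _)).
  apply: (@le_trans _ _ (\sum_(i < nfacets P) M)); last first.
    by rewrite sumr_const card_ord -[leLHS]mulr_natl ler_wpM2r.
  by rewrite big_mkcond /=; apply: ler_sum => i _; case: ifP => // iS; exact: HF.
have lnabs i : ~~ inS s i -> `|1 + ln (ll s p i eta)| <= 1 + Lam.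
  by move=> iS; apply: (le_trans (ler_normD _ _)); rewrite normr1 lerD2l lnb.
split=> [k|k|].
- apply: (@le_trans _ _ K1); last lra.
  apply: (le_trans (ler_normD _ _)); rewrite normr1 lerD2l.
  apply: sumb => [|i iS]; first by rewrite mulr_ge0 //; lra.
  by rewrite normrM ler_pM ?lnabs.
- apply: (@le_trans _ _ K2); last lra.
  have e0 : 0 <= eta 0 k by exact: ne.
  have eL : eta 0 k <= L by rewrite -(ll_s vc (p := p)); exact: lle.
  have bb : Bmx s p eta k k <= N * (A * A * expR Lam).
    rewrite mxE; apply: (le_trans (ler_norm _)); apply: sumb => [|i iS].
      by apply: mulr_ge0; [exact: mulr_ge0|exact: expR_ge0].
    rewrite normrM normrM ler_pM ?mulr_ge0 // ?ler_pM //.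
    have l0 := de i iS; rewrite gtr0_norm ?invr_gt0 //.
    rewrite -[ll s p i eta]lnK ?posrE // -expRN ler_expR.
    by have := lnb i iS; rewrite ler_norml => /andP[]; lra.
  apply: (@le_trans _ _ (eta 0 k * (N * (A * A * expR Lam)))); first by rewrite ler_wpM2l.
  apply: ler_wpM2r eL; apply: mulr_ge0 => //.
  by apply: mulr_ge0; [exact: mulr_ge0|exact: expR_ge0].
- apply: (@le_trans _ _ K3); last lra.
  apply: (le_trans (ler_normD _ _)); apply: lerD.
    apply: (le_trans (ler_norm_sum _ _ _)).
    have -> : n%:R * L = \sum_(k < n) L by rewrite sumr_const card_ord mulr_natl.
    apply: ler_sum => k _; rewrite ger0_norm; last exact: ne.
    by rewrite -(ll_s vc (p := p)); exact: lle.
  apply: sumb => [|i iS]; first by nra.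
  have l0 := de i iS; have c0 := co_gt0 vc iS; have c1 := cL i; have l1 := lle i.
  have := lnb i iS => lb.
  apply: (le_trans (ler_normB _ _)); apply: lerD.
    apply: (le_trans (ler_normB _ _)); apply: lerD; rewrite gtr0_norm //.
  by rewrite normrM gtr0_norm // ler_pM // ltW.
Qed.

End Controlled.

(** T + 1 in place of T keeps the logarithm meaningful when T = 0. *)
Lemma ln_ratio_le (R : realType) (a b t T : R) m : 0 < a -> 0 < b -> 0 <= t -> t <= T ->
  b^-1 * a <= t ^+ m -> ln a - ln b <= m%:R * ln (T + 1).
Proof.
move=> a0 b0 t0 tT H; have T1 : 0 < T + 1 by lra.
rewrite -lnV ?posrE // -lnM ?posrE ?invr_gt0 // mulr_natl -lnXn //.
rewrite ler_ln ?posrE ?mulr_gt0 ?invr_gt0 ?exprn_gt0 // mulrC; apply: (le_trans H).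
by rewrite lerXn2r ?nnegrE //; lra.
Qed.

Lemma sub2_scaleE (R : realType) m k (M1 M2 M3 : 'M[R]_(m, k)) a i j :
  (M1 - M2 - a *: M3) i j = M1 i j - M2 i j - a * M3 i j.
Proof. by rewrite !mxE. Qed.

Lemma mul_sub2 (R : comNzRingType) (a b c k l : R) :
  a * (b - c - k * l) = a * b - a * c - k * (a * l).
Proof. ring. Qed.

(** Final comparison as linear arithmetic. The suffix 0 marks values at the maximum point; [lg] and
    [lf] are the logarithms of the Hessian determinants, S and S' the sums of the <x, e_k>, q1 and
    q2 the values of [Psi], c0 the value of the maximizing linear function. *)
Lemma maximum_arith (R : realFieldType)
    (lgx lfx lg0 lf0 Dx D0 S S' e c0 q1 q2 px p0 fx f0 A N K rho lnT osc : R) :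
  2 * rho * px + (1 + e) * S - 2 * rho * (px + q1) - (Dx + lfx) - A * fx <=
    c0 - 2 * rho * (p0 + q2) - (D0 + lf0) - A * f0 ->
  c0 <= 2 * rho * p0 + (1 + e) * S' -> lgx <= S + N * K -> - lg0 <= - S' + N * (K + K) ->
  lg0 - lf0 <= lnT -> Dx - D0 <= rho -> 2 * rho * q1 <= 2 * (rho * K) ->
  - (2 * rho * q2) <= 2 * (rho * K) -> A * fx - A * f0 <= A * osc -> e * S' <= 0 ->
  lgx - lfx <= 3 * (N * K) + 4 * (rho * K) + rho + lnT + A * osc - e * S.
Proof. lra. Qed.

(** * The maximum principle *)

Section MaximumPrinciple.
Context {R : realType} {n : nat} (P : halfspaces R n).
Local Notation d := (nfacets P).
Let oT := @openT 'rV[R]_n.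

(** The vertex is determined by its facets, so the finite set of maps s also enumerates the
    vertices. *)
Lemma vchart_uniq (s : 'I_n -> 'I_d) p q : vchart s p -> vchart s q -> p = q.
Proof.
move=> vp vq; rewrite -(etaofK vp q) /pt big1 ?addr0 // => k _.
by rewrite mxE ((vc_fac vq).2 (s k)).2 ?scale0r //; exists k.
Qed.

Variables (phi : 'rV[R[i]]_d -> R) (D : 'rV[R]_n -> R) (U : set 'rV[R]_n) (rho : R).
Hypotheses (n0 : (0 < n)%N) (HP : delzant P) (sphi : smooth_on_M phi) (tphi : torus_invariant phi)
  (posM : forall (s : 'I_n -> 'I_d) p, vchart s p -> vertex P p ->
     forall r, posdef (Mr (Fpot s phi) r))
  (oU : open U) (PU : closedPoly P `<=` U) (dD : smo U D) (DU : forall xi, U xi -> 0 < D xi)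
  (rhoE : constR P D <= rho).

Let bP : bounded_set (closedPoly P). Proof. by case: HP. Qed.
Let oP : openPoly P !=set0. Proof. by case: HP. Qed.
Let cP : controlled P rho. Proof. exact: (controlled_constR HP oU PU dD DU rhoE). Qed.
Let rho0 : 0 < rho.
Proof. by have [s [p [vc _ _]]] := max_vertex 0 HP; exact: (rho_gt0 cP vc n0). Qed.

Local Notation f := (fpot phi).
Local Notation g := (guillemin_g P).
Local Notation F := (logFF D (fpot phi)).
Local Notation lnD := (fun eta => ln (D eta)).
Variables (A Tm : R).
Hypothesis AE : A = 2 * rho + 1.
Let A0 : 0 <= A. Proof. by rewrite AE addr_ge0 // mulr_ge0 // ltW. Qed.

Let df : smo setT f. Proof. exact: smo_fpot. Qed.
Let dg : smo setT g.
Proof. by have [s [p [vc _ _]]] := max_vertex 0 HP; exact: (smo_guillemin_g vc bP). Qed.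
Let gP x : closedPoly P (grad f x). Proof. exact: fpot_grad_in. Qed.
Let D0 xi : closedPoly P xi -> 0 < D xi. Proof. by move/PU; exact: DU. Qed.
Let fF (s : 'I_n -> 'I_d) p : vchart s p -> forall zeta : @Cn R n, generic zeta ->
  f (Xlog s zeta) = dotrv (Xlog s zeta) p + Fpot s phi zeta.
Proof. by move=> vc zeta; exact: fpot_chart. Qed.
Let dF : smo setT F.
Proof.
have [s [p [vc vp _]]] := max_vertex 0 HP.
exact: (smo_logFF vc df (smo_Fpot HP sphi vc vp) (fF vc) gP (posM vc vp) PU dD D0).
Qed.
Let hf x : posdef (hess f x). Proof. exact: fpot_hess_posdef. Qed.

Definition maxchart x (s : 'I_n -> 'I_d) p : Prop :=
  [/\ vchart s p, vertex P p & forall k, dotrv x (ed s k) <= 0].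

Definition edsum x (s : 'I_n -> 'I_d) : R := \sum_k dotrv x (ed s k).

Let edsum_le0 x s p : maxchart x s p -> edsum x s <= 0.
Proof. by case=> _ _ H; apply: sumr_le0 => k _; exact: H. Qed.

Let grad_g_in x : closedPoly P (grad g x).
Proof.
have [s [p [vc _ _]]] := max_vertex x HP.
by rewrite (grad_g vc bP); exact: xiX_in.
Qed.

(** The bound depends on phi. It serves only for the existence of a maximum and does not enter the
    final constant. *)
Lemma logFF_chart : exists2 M, 0 <= M & forall x (s : 'I_n -> 'I_d) p, maxchart x s p ->
  `|F x - edsum x s| <= M.
Proof.
pose G (s : 'I_n -> 'I_d) (M : R) := forall x, (forall k, dotrv x (ed s k) <= 0) ->
  `|F x - edsum x s| <= M.
have [||M M0 HM] := @chart_uniform _ _ P G.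
- by move=> s M M' le H x xe; apply: le_trans (H x xe) le.
- move=> s p vc vp.
  have dW := smo_Wt vc df (smo_Fpot HP sphi vc vp) (fF vc) gP (posM vc vp) PU dD D0.
  have [M _ HM] := cont_bound (h := Wt s p (Fpot s phi) D) (@compact_box R n 0 1)
    (fun r _ => dk_continuous (dW 0%N) (x := r)).
  exists M => x xe; rewrite (logFF_Wt vc df (smo_Fpot HP sphi vc vp) (fF vc) gP (posM vc vp) D0).
  by rewrite addrC addKr; apply: HM; exact: rX_cube.
by exists M => // x s p [vc vp xe]; exact: (HM s p vc vp x xe).
Qed.

Definition weight (e : R) (s : 'I_n -> 'I_d) (p : 'rV[R]_n) : 'rV[R]_n :=
  (2 * rho) *: p + (1 + e) *: \sum_k ed s k.

Let dot_weight e s p x : dotrv x (weight e s p) = 2 * rho * dotrv x p + (1 + e) * edsum x s.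
Proof. by rewrite /weight dotrvDr !dotrvZr dotrv_sumr. Qed.

Let nrm_weight e s p (i : 'I_d) : dotrv (nrm i) (weight e s p) =
  2 * rho * (offset P 0 i + co p i) + (1 + e) * \sum_k ac s i k.
Proof.
have -> : offset P 0 i + co p i = dotrv (nrm i) p by rewrite /co lfunE addrC subrK.
by rewrite dot_weight; congr (_ + _ * _); apply: eq_bigr => k _; rewrite acE.
Qed.

(* At x the largest weight is that of a vertex which maximizes x: this is where
   [vertex_slack] enters. *)
Lemma weight_max (e : R) x s p s' p' : 0 <= e <= 1 / 2 -> maxchart x s p -> vchart s' p' -> vertex P p' ->
  dotrv x (weight e s' p') <= dotrv x (weight e s p).
Proof.
move=> e01 [vc vp xe] vc' vp'; rewrite (dot_expand vc) (dot_expand vc x (weight e s p)).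
apply: ler_sum => k _; apply: ler_wnM2l; first exact: xe.
have base (t : 'I_n -> 'I_d) q i : vchart t q -> vertex P q -> inS t i ->
    dotrv (nrm i) (weight e t q) = 2 * rho * offset P 0 i + (1 + e).
  move=> vt vq /existsP[j /eqP <-]; rewrite nrm_weight (co_s vt) addr0 (bigD1 j) //= big1 ?addr0.
    by rewrite (ac_s vt) eqxx mulr1.
  by move=> l lj; rewrite (ac_s vt) eq_sym (negbTE lj).
rewrite (base _ _ _ vc vp (inS_s _ _)).
have [iS|iS] := boolP (inS s' (s k)); first by rewrite (base _ _ _ vc' vp' iS).
by rewrite nrm_weight; have := vertex_slack cP vc' vp' e01 iS; lra.
Qed.

(** One function for each vertex: each is smooth, while the maximum over the vertices, the function
    of interest, is not. *)
Definition barrier e (s : 'I_n -> 'I_d) p x : R := dotrv x (weight e s p) + g x - F x - A * f x.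

Let barrierE e s p x : barrier e s p x = dotrv x (weight e s p) - 2 * rho * g x - F x - A * on_torus phi x.
Proof. by rewrite /barrier /fpot AE; ring. Qed.

Let dk_barrier e s p m : dk setT m (barrier e s p).
Proof.
apply: (dk_sub oT); last by apply: (dk_scale oT); exact: df.
apply: (dk_sub oT); last exact: dF.
by apply: (dk_add oT); [exact: smo_dotrv|exact: dg].
Qed.

(** The largest weight is that of the vertex p maximizing x. Against it 2 rho g and log F_f cancel
    up to bounded terms and leave e sum_k <x, e_k>, which is at most - e |x| / B since the normals
    have length at most B. *)
Lemma barrier_coercive (e : R) : 0 < e <= 1 / 2 -> exists C B, 0 < B /\
  forall (s : 'I_n -> 'I_d) p x, vchart s p -> vertex P p -> barrier e s p x <= C - e / B * enorm x.
Proof.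
move=> /andP[e0 e1]; have [B B1 HB] := normal_bound (R := R) rho n0.
have [K K0 HK] := chart_bounds (R := R) rho n0.
have [M M0 HM] := logFF_chart; have [L L0 HL] := on_torus_bounded HP sphi tphi.
exists (2 * rho * K + M + A * L), B; split; first by lra.
move=> s' p' x vc' vp'; have [s [p mx]] := max_vertex x HP.
have [vc vp xe] := mx.
have y1 k : yX s x 0 k <= 1 by rewrite mxE -[leRHS]expR0 ler_expR.
have [_ _ HPsi] := HK P cP s p (yX s x) vc vp (yX_nneg s x) y1.
have xB : enorm x <= B * - edsum x s.
  rewrite {1}(nrm_expand vc x); apply: (le_trans (enorm_sum _ _)).
  rewrite -sumrN mulr_sumr; apply: ler_sum => k _; rewrite enormZ ler0_norm // mulrC.
  by apply: ler_wpM2r; [rewrite oppr_ge0|exact: HB].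
have cm : dotrv x (weight e s' p') <= dotrv x (weight e s p) by apply: weight_max; rewrite ?(ltW e0).
rewrite barrierE; have := HM x s p mx; have := HL x; move: HPsi cm.
rewrite !dot_weight (guillemin_gE vc bP) !ler_norml => /andP[a1 a2] cm /andP[b1 b2] /andP[c1 c2].
have eB : e / B * enorm x <= e * - edsum x s.
  rewrite mulrAC ler_pdivrMr ?(lt_le_trans ltr01) // -mulrA [_ * B]mulrC.
  by rewrite ler_wpM2l // ltW.
have rK : - (2 * rho * Psi s p (etaS s p (yX s x))) <= 2 * rho * K.
  by rewrite -mulrN ler_wpM2l ?mulr_ge0 ?(ltW rho0) // lerNl.
have AL : - (A * on_torus phi x) <= A * L by rewrite -mulrN ler_wpM2l // lerNl.
lra.
Qed.

(** The maximum is taken jointly over the vertices and the points. At a joint maximum the function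
    of the vertex found is itself maximal, so the derivative tests apply to a smooth function. *)
Lemma barrier_max (e : R) : 0 < e <= 1 / 2 -> exists s0 p0 x0, [/\ vchart s0 p0, vertex P p0 &
  forall (s : 'I_n -> 'I_d) p x, vchart s p -> vertex P p -> barrier e s p x <= barrier e s0 p0 x0].
Proof.
move=> e01; have [e0 _] := andP e01; have [C [B [B0 HC]]] := barrier_coercive e01.
have [s1 [p1 [vc1 vp1 _]]] := max_vertex 0 HP.
pose m := barrier e s1 p1 0; pose r := `|B / e * (C - m)| + 1.
have r0 : 0 <= r by rewrite addr_ge0.
pose bx : set 'rV[R]_n := [set x | forall k, - r <= x 0 k <= r].
have cbx : compact bx by exact: compact_box.
have bx0 : bx 0 by move=> k; rewrite mxE oppr_le0 r0.
have out s p x : vchart s p -> vertex P p -> ~ bx x -> barrier e s p x <= m.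
  move=> vc vp nb; apply: (le_trans (HC s p x vc vp)).
  have rx : r < enorm x.
    rewrite ltNge; apply/negP => le; apply: nb => k.
    by rewrite -ler_norml (le_trans (enorm_coord x k)).
  have eB : 0 < e / B by rewrite divr_gt0.
  have : e / B * r <= e / B * enorm x by rewrite ler_wpM2l // ltW.
  have : e / B * (B / e * (C - m)) <= e / B * r.
    by rewrite ler_wpM2l ?(ltW eB) // /r (le_trans (ler_norm _)) // lerDl.
  have -> : e / B * (B / e * (C - m)) = C - m by field; rewrite !gt_eqF.
  lra.
pose Q (t : {ffun 'I_n -> 'I_d}) := exists p, vchart t p /\ vertex P p.
have H (t : {ffun 'I_n -> 'I_d}) : exists px : 'rV[R]_n * 'rV[R]_n, Q t ->
    [/\ vchart t px.1, vertex P px.1 & forall x, bx x -> barrier e t px.1 x <= barrier e t px.1 px.2].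
  have [[p [vc vp]]|no] := pselect (Q t); last by exists (0, 0) => q; case: no.
  have wc : {within bx, continuous (barrier e t p)}.
    by apply: continuous_subspaceT; exact: (dk_continuous (dk_barrier e t p 0%N)).
  have [x _ Hx] := @compact_EVT_max _ R (barrier e t p) bx (ex_intro _ 0 bx0) cbx wc.
  by exists (p, x) => _; split=> // z bz; apply: Hx; rewrite inE.
have [px Hpx] := choice H.
have sE (s : 'I_n -> 'I_d) : s = [ffun k => s k] by apply/funext => k; rewrite ffunE.
have Q1 : `[< Q [ffun k => s1 k] >] by apply/asboolP; exists p1; rewrite -sE.
pose v (t : {ffun 'I_n -> 'I_d}) : R := barrier e t (px t).1 (px t).2.
case: (@arg_maxP _ _ _ [ffun k => s1 k] (fun t : {ffun 'I_n -> 'I_d} => `[< Q t >]) v Q1) => t /asboolP Qt Ht.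
have [vct vpt Hmax] := Hpx t Qt.
have inbx s p x : vchart s p -> vertex P p -> bx x -> barrier e s p x <= v t.
  move=> vc vp bxx; have vcf : vchart [ffun k => s k] p by rewrite -sE.
  have -> : barrier e s p x = barrier e [ffun k => s k] p x by rewrite -sE.
  have Qs : Q [ffun k => s k] by exists p.
  have [vc2 _ H2] := Hpx _ Qs; rewrite (vchart_uniq vcf vc2).
  by apply: (le_trans (H2 x bxx)); apply: Ht; apply/asboolP.
exists t, (px t).1, (px t).2; split=> // s p x vc vp; rewrite -/(v t).
have [bxx|nb] := pselect (bx x); first exact: inbx vc vp bxx.
by apply: (le_trans (out s p x vc vp nb)); exact: inbx vc1 vp1 bx0.
Qed.

Hypothesis TmE : A * n%:R + max_absS D f + (2 * rho + 5 / 2) * rho <= Tm.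
Definition mixed_trace x : R := \sum_(i < n) \sum_(j < n) invmx (hess f x) i j * hess g x i j.

Let hg x : posdef (hess g x).
Proof.
have [s [p [vc vp _]]] := max_vertex 0 HP.
rewrite -(fpot0 P); apply: (fpot_hess_posdef HP (zero_smooth_on_M P) (@zero_torus_invariant R n P)).
by move=> s' p' vc' vp' r; exact: (Mr0_posdef HP vc' vp').
Qed.

Let derive_barrier e s p x v :
  'D_v (barrier e s p) x = dotrv v (weight e s p) + 'D_v g x - 'D_v F x - A * 'D_v f x.
Proof.
have d0 (h : 'rV[R]_n -> R) : smo setT h -> differentiable h x.
  by move=> dh; exact: (dk_differentiable (dh 0%N)).
have d1 := d0 _ (smo_dotrv (weight e s p)); have d2 := d0 _ dg; have d3 := d0 _ dF; have d4 := d0 _ df.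
have d12 : differentiable (fun x => dotrv x (weight e s p) + g x) x by exact: differentiableD.
have d123 : differentiable (fun x => dotrv x (weight e s p) + g x - F x) x by exact: differentiableB.
rewrite /barrier derive_subf //; last exact: differentiableZ.
by rewrite derive_subf // derive_addf // derive_scalef // derive_dotrvf.
Qed.

Let derive2_barrier e s p x v : 'D_v ('D_v (barrier e s p)) x =
  'D_v ('D_v g) x - 'D_v ('D_v F) x - A * 'D_v ('D_v f) x.
Proof.
have -> : 'D_v (barrier e s p) = (fun x => dotrv v (weight e s p) + 'D_v g x - 'D_v F x - A * 'D_v f x).
  by apply/funext => y; exact: derive_barrier.
have d0 (h : 'rV[R]_n -> R) : smo setT h -> differentiable ('D_v h) x.
  by move=> dh; have [_ /(_ v) H] := dh 1%N; exact: H.1.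
have d2 := d0 _ dg; have d3 := d0 _ dF; have d4 := d0 _ df.
have d12 : differentiable (fun x => dotrv v (weight e s p) + 'D_v g x) x.
  by apply: differentiableD => //; exact: differentiable_cst.
have d123 : differentiable (fun x => dotrv v (weight e s p) + 'D_v g x - 'D_v F x) x by exact: differentiableB.
rewrite derive_subf //; last exact: differentiableZ.
rewrite derive_subf // derive_addf // derive_scalef //.
by rewrite derive_cst add0r.
Qed.

Lemma mixed_trace_ge0 x : 0 <= mixed_trace x.
Proof.
apply: posdef_trace_ge0; first exact: posdef_inv.
by move=> v; exact: posdef_ge0.
Qed.

Lemma mixed_trace_max (e : R) s0 p0 x0 : 0 <= e <= 1 / 2 -> vchart s0 p0 -> vertex P p0 ->
  (forall x, barrier e s0 p0 x <= barrier e s0 p0 x0) -> mixed_trace x0 <= Tm.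
Proof.
move=> /andP[e0 e1] vc vp mx.
have e1' : 0 <= 1 + e by lra.
have e2 : 1 + e <= 3 / 2 by lra.
have dm v := derive_at_max v (dk_barrier e s0 p0 1%N) mx.
have d1 (h : 'rV[R]_n -> R) v : smo setT h -> 'D_v ('D_v h) x0 = qf (hess h x0) v v.
  by move=> dh; exact: (derive_hess v v oT (dh 1%N) Logic.I).
pose N := hess g x0 - hess F x0 - A *: hess f x0.
have qN v : qf N v v <= 0.
  have [_] := dm v; rewrite derive2_barrier !d1 //.
  by rewrite /qf /N 2!mulmxBr 2!mulmxBl -scalemxAr -scalemxAl sub2_scaleE.
have uH : hess f x0 \in unitmx by apply: posdef_unit; have [] := hf x0.
have trN : mixed_trace x0 - trhess f F x0 - A * n%:R <= 0.
  have := posdef_trace_le0 (posdef_inv (hf x0)) qN.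
  have -> : \sum_(i < n) \sum_(j < n) invmx (hess f x0) i j * N i j =
      mixed_trace x0 - mdot (invmx (hess f x0)) (hess F x0) - A * mdot (invmx (hess f x0)) (hess f x0).
    rewrite /mixed_trace /mdot mulr_sumr -!sumrB; apply: eq_bigr => i _.
    rewrite mulr_sumr -!sumrB; apply: eq_bigr => j _.
    have -> : N i j = hess g x0 i j - hess F x0 i j - A * hess f x0 i j by exact: sub2_scaleE.
    exact: mul_sub2.
  have EF : mdot (invmx (hess f x0)) (hess F x0) = trhess f F x0.
    by apply: eq_bigr => i _; apply: eq_bigr => j _; rewrite [hess F _ _ _]mxE.
  have Ef : mdot (invmx (hess f x0)) (hess f x0) = n%:R.
    by have [sH _] := hf x0; rewrite mdot_tr sH mulVmx // mxtrace1.
  by rewrite EF Ef.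
(* First-order condition. Since A = 2 rho + 1, the points p0, grad g and grad f group into
   differences of points of the polytope. *)
have gr : grad F x0 = (2 * rho) *: (p0 - grad f x0) + (grad g x0 - grad f x0)
    + (1 + e) *: \sum_k ed s0 k.
  apply/rowP => j; have [] := dm (delta_mx 0 j); rewrite derive_barrier dotrvC dotrv_delta /weight => H _.
  rewrite AE in H; rewrite !mxE in H *; rewrite /pd; lra.
have [_ dm2 /(_ s0 p0 vc vp)[w2 _]] := cP.
pose q := Num.sqrt rho; have q0 : 0 <= q by exact: sqrtr_ge0.
have q2 : q ^+ 2 = rho by rewrite sqr_sqrtr // ltW.
have qle z : 0 <= z -> z ^+ 2 <= rho -> z <= q.
  by move=> z0; rewrite -q2 ler_pXn2r // nnegrE.
have dq : diam P <= q by apply: qle => //; exact: diam_ge0.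
have wq : enorm (\sum_k ed s0 k) <= q by apply: qle => //; exact: enorm_ge0.
have bq xi : closedPoly P xi -> enorm (grad lnD xi) <= q.
  move=> Px; have H := constD_ge HP oU PU dD DU Px.
  apply: (le_trans H); apply: qle; first exact: le_trans (enorm_ge0 _) H.
  by apply: le_trans rhoE; rewrite /constR !le_max lexx !orbT.
(* All the lengths are at most q = sqrt rho: 2 rho comes from p0 - grad f, and 5/2 is 1 for grad g -
   grad f plus 3/2 >= 1 + e for the sum of the edges. *)
have Fq : enorm (grad F x0) <= (2 * rho + 5 / 2) * q.
  rewrite gr; apply: (le_trans (enormD _ _)).
  have -> : (2 * rho + 5 / 2) * q = (2 * rho * q + q) + 3 / 2 * q by field.
  apply: lerD; last first.
    by rewrite enormZ (ger0_norm e1'); apply: ler_pM => //; exact: enorm_ge0.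
  apply: (le_trans (enormD _ _)); apply: lerD.
    rewrite enormZ ger0_norm ?mulr_ge0 ?(ltW rho0) // ler_wpM2l ?mulr_ge0 ?(ltW rho0) //.
    by apply: le_trans dq; apply: closedPoly_diam => //; exact: vc_in vc.
  by apply: le_trans dq; exact: (closedPoly_diam bP oP (grad_g_in x0) (gP x0)).
have dFb := dotrv_le Fq (bq _ (gP x0)).
have Sx := max_absS_ge HP sphi tphi posM oU PU dD DU x0.
rewrite (scalSE HP sphi tphi posM oU PU dD DU) -/F in Sx.
move: dFb Sx; rewrite !ler_norml => /andP[h1 h2] /andP[h3 h4].
have qq : (2 * rho + 5 / 2) * q * q = (2 * rho + 5 / 2) * rho by rewrite -mulrA -expr2 q2.
rewrite qq in h1 h2; apply: le_trans TmE; lra.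
Qed.

Lemma ratio_max x : 0 <= Tm -> mixed_trace x <= Tm ->
  ln (\det (hess g x)) - ln (\det (hess f x)) <= n%:R * ln (Tm + 1).
Proof.
move=> Tm0 le.
have /andP[g0 _] := hadamard (hg x); have /andP[f0 _] := hadamard (hf x).
have := posdef_det_trace (posdef_inv (hf x)) (hg x).
rewrite det_inv => H; apply: ln_ratio_le g0 f0 (mixed_trace_ge0 x) le H.
Qed.

Lemma ln_etaX (s : 'I_n -> 'I_d) p x k : vchart s p ->
  etaS s p (yX s x) 0 k = expR (dotrv x (ed s k) - lrho s p k (etaS s p (yX s x))).
Proof.
move=> vc; have [_ _ E] := etaSP vc bP (yX_nneg s x).
have := congr1 (fun v : 'rV[R]_n => v 0 k) E; rewrite !mxE => E1.
by rewrite expRD -E1 -mulrA -expRD subrr expR0 mulr1.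
Qed.

Lemma det_hess_g (s : 'I_n -> 'I_d) p x : vchart s p ->
  \det (hess g x) = \det (invmx (Amx s p (etaS s p (yX s x)))).
Proof.
move=> vc; rewrite -(hessU_g vc bP) !det_mulmx det_tr mulrAC -expr2 (UR_det2 vc) mul1r //.
Qed.

(** Both inequalities are Hadamard's, for the inverse of A and for A. In the second one 1 / eta_k +
    B_kk = (1 + eta_k B_kk) / eta_k, so a bound of the product eta_k B_kk suffices although B_kk and
    1 / eta_k come from different facets. *)
Lemma det_hess_g_bounds K x s p : maxchart x s p ->
  (forall k, `|lrho s p k (etaS s p (yX s x))| <= K) ->
  (forall k, etaS s p (yX s x) 0 k * Bmx s p (etaS s p (yX s x)) k k <= K) ->
  ln (\det (hess g x)) <= edsum x s + n%:R * K /\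
  - ln (\det (hess g x)) <= - edsum x s + n%:R * (K + K).
Proof.
case=> vc vp xe Kl KB; set eta := etaS s p (yX s x) in Kl KB *.
have [de ne _] := etaSP vc bP (yX_nneg s x); rewrite -/eta in de ne.
have e0 k : 0 < eta 0 k by exact: (etaX_gt0 vc bP).
have nK (M : R) : n%:R * M = \sum_(k < n) M by rewrite sumr_const card_ord mulr_natl.
have B0 v : 0 <= qf (Bmx s p eta) v v by exact: Bmx_ge0.
split.
- have /andP[d0 d1] := diag_plus_det_inv e0 (Bmx_sym s p eta) B0.
  rewrite (det_hess_g x vc) -/eta /Amx.
  apply: (@le_trans _ _ (ln (\prod_k eta 0 k))).
    by rewrite ler_ln ?posrE //; exact: lt_le_trans d0 d1.
  rewrite (eq_bigr (fun k => expR (dotrv x (ed s k) - lrho s p k eta))); last first.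
    by move=> k _; exact: ln_etaX.
  rewrite ln_prod_exp nK /edsum -big_split /=; apply: ler_sum => k _; rewrite lerD2l.
  by have := Kl k; rewrite ler_norml => /andP[]; lra.
- have /andP[d0 d1] := diag_plus_det e0 (Bmx_sym s p eta) B0.
  rewrite (det_hess_g x vc) -/eta det_inv lnV ?posrE //; rewrite opprK /Amx.
  pose h k := - dotrv x (ed s k) + (K + K).
  apply: (@le_trans _ _ (ln (\prod_k expR (h k)))).
    have pp : \prod_k ((eta 0 k)^-1 + Bmx s p eta k k) <= \prod_k expR (h k).
      apply: ler_prod => k _; apply/andP; split.
        apply: addr_ge0; first by rewrite invr_ge0 ltW.
        by have := B0 (delta_mx 0 k); rewrite qf_delta.
      have -> : (eta 0 k)^-1 + Bmx s p eta k k = (eta 0 k)^-1 * (1 + eta 0 k * Bmx s p eta k k).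
        by rewrite mulrDr mulr1 mulKf // gt_eqF.
      apply: (@le_trans _ _ ((eta 0 k)^-1 * expR K)).
        rewrite ler_wpM2l ?invr_ge0 ?(ltW (e0 k)) //.
        apply: (@le_trans _ _ (expR (eta 0 k * Bmx s p eta k k))); first exact: expR_ge1Dx.
        by rewrite ler_expR.
      rewrite {1}/eta (ln_etaX x k vc) -/eta -expRN -expRD ler_expR /h.
      by have := Kl k; rewrite ler_norml => /andP[]; lra.
    rewrite ler_ln ?posrE //; first by apply: (le_trans d1).
    by apply: prodr_gt0 => k _; exact: expR_gt0.
  by rewrite ln_prod_exp nK /edsum -sumrN -big_split.
Qed.

(** Mean value theorem on the segment: the oscillation is at most the diameter times the maximal
    gradient, each at most sqrt rho. *)
Lemma lnD_osc xi xi' : closedPoly P xi -> closedPoly P xi' -> lnD xi - lnD xi' <= rho.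
Proof.
move=> Px Px'; pose v := xi - xi'.
have inP (t : R) : 0 <= t <= 1 -> closedPoly P (t *: v + xi').
  move=> t01; have -> : t *: v + xi' = t *: xi + (1 - t) *: xi'.
    by rewrite /v scalerBr scalerBl scale1r -addrA [- _ + _]addrC.
  exact: closedPoly_convex.
have dl : smo U lnD by exact: smo_lnD.
have der (t : R) : 0 <= t <= 1 -> is_derive t 1 (fun t : R => lnD (t *: v + xi')) ('D_v lnD (t *: v + xi')).
  move=> t01; apply: is_derive_line; apply: diff_derivable; apply: (dk_differentiable (dl 0%N)).
  by apply: PU; exact: inP.
have [||t] := @MVT R (fun t : R => lnD (t *: v + xi')) (fun t => 'D_v lnD (t *: v + xi')) 0 1 ltr01.
- by move=> t; rewrite in_itv /= => /andP[a b]; apply: der; rewrite !ltW.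
- by apply: derivable_within_continuous => t; rewrite in_itv /= => ab; have := der t ab; case.
rewrite in_itv /= => /andP[a b]; have t01 : 0 <= t <= 1 by rewrite !ltW.
rewrite scale1r scale0r add0r subr0 mulr1 /v subrK => ->.
rewrite derive_dotrv; last first.
  by apply: (dk_differentiable (dl 0%N)); apply: PU; have := inP t t01; rewrite /v.
have := inP t t01; rewrite /v => Pt.
have cd := constD_ge HP oU PU dD DU Pt; have dd := closedPoly_diam bP oP Px Px'.
apply: (le_trans (ler_norm _)); apply: (le_trans (dotrv_le dd cd)).
have := rhoE; rewrite /constR !ge_max => /and3P[_ h1 h2].
have := sqr_ge0 (diam P - constD P D); nra.
Qed.

Lemma log_ratio_bound K osc : 0 <= Tm -> 0 <= K ->
  (forall x s p, maxchart x s p ->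
    [/\ forall k, `|lrho s p k (etaS s p (yX s x))| <= K,
        forall k, etaS s p (yX s x) 0 k * Bmx s p (etaS s p (yX s x)) k k <= K &
        `|Psi s p (etaS s p (yX s x))| <= K]) ->
  (forall x y, on_torus phi x - on_torus phi y <= osc) ->
  forall x, ln (\det (hess g x)) - ln (\det (hess f x)) <=
    3 * (n%:R * K) + 4 * (rho * K) + rho + n%:R * ln (Tm + 1) + A * osc.
Proof.
move=> Tm0 K0 HK Hosc x; have [s [p mx]] := max_vertex x HP.
set C := 3 * _ + _ + _ + _ + _.
have es0 := edsum_le0 mx.
have lF y : F y = lnD (grad f y) + ln (\det (hess f y)).
  have /andP[f0 _] := hadamard (hf y).
  by rewrite /logFF /FF /pullD lnM ?posrE // D0.
have main e : 0 < e <= 1 / 2 -> ln (\det (hess g x)) - ln (\det (hess f x)) <= C - e * edsum x s.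
  move=> e01; have [s0 [p0 [x0 [vc0 vp0 H0]]]] := barrier_max e01.
  have e01' : 0 <= e <= 1 / 2 by case/andP: e01 => a b; rewrite (ltW a).
  have [s' [p' mx']] := max_vertex x0 HP.
  have T0 := ratio_max Tm0 (mixed_trace_max e01' vc0 vp0 (fun y => H0 s0 p0 y vc0 vp0)).
  have [vc vp xe] := mx; have [vc' vp' xe'] := mx'.
  have [k1 k2 k3] := HK x s p mx; have [k1' k2' k3'] := HK x0 s' p' mx'.
  have [b1 _] := det_hess_g_bounds mx k1 k2.
  have [_ b2] := det_hess_g_bounds mx' k1' k2'.
  have cm := weight_max e01' mx' vc0 vp0.
  have := H0 s p x vc vp; rewrite !barrierE !lF.
  have Do := lnD_osc (gP x) (gP x0); have Ho := Hosc x x0.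
  have es0' := edsum_le0 mx'.
  move: cm k3 k3'; rewrite !dot_weight (guillemin_gE vc bP x) (guillemin_gE vc' bP x0) !ler_norml.
  rewrite -(dot_weight e s0 p0 x0).
  set Q1 := Psi _ _ _; set Q2 := Psi _ _ _ => cm /andP[a1 a2] /andP[c1 c2].
  have rQ1 : 2 * rho * Q1 <= 2 * (rho * K).
    by rewrite -mulrA; apply: ler_wpM2l; [exact: ler0n|apply: ler_wpM2l; [exact: ltW|]].
  have rQ2 : - (2 * rho * Q2) <= 2 * (rho * K).
    have Q2K : - Q2 <= K by rewrite lerNl.
    by rewrite -mulrN -mulrA ler_wpM2l // ler_wpM2l // ltW.
  have Ao : A * on_torus phi x - A * on_torus phi x0 <= A * osc by rewrite -mulrBr ler_wpM2l.
  have ee : e * edsum x0 s' <= 0 by rewrite mulr_ge0_le0 //; case/andP: e01'.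
  rewrite /C => Hpsi.
  exact: (maximum_arith Hpsi cm b1 b2 T0 Do rQ1 rQ2 Ao ee).
apply/ler_addgt0Pr => del del0.
(* The error - e sum_k <x, e_k> depends on x, which is fixed here, and the left side is independent
   of e: letting e tend to 0 is legitimate pointwise. *)
pose e := Num.min (1 / 2) (del / (1 - edsum x s)).
have t0 : 0 < 1 - edsum x s by lra.
have e0 : 0 < e by rewrite lt_min divr_gt0 //= divr_gt0.
have e01 : 0 < e <= 1 / 2 by rewrite e0 ge_min lexx.
apply: (le_trans (main e e01)); rewrite lerD2l.
have : e <= del / (1 - edsum x s) by rewrite ge_min lexx orbT.
rewrite ler_pdivlMr // => H; lra.
Qed.

End MaximumPrinciple.

(** * Extension to the whole manifold *)

Section ComplexContinuity.
Context {R : realType} {n : nat}.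
Local Notation Cn := (@Cn R n).
Let oT := @openT Cn.

Definition cdk (h : Cn -> R[i]) : Prop :=
  dk setT 0 (fun z => complex.Re (h z)) /\ dk setT 0 (fun z => complex.Im (h z)).

Lemma cdk_cst c : cdk (fun=> c).
Proof. by split; exact: (dk_cst oT). Qed.

Lemma cdk_add h k : cdk h -> cdk k -> cdk (fun z => h z + k z).
Proof.
case=> h1 h2 [k1 k2]; split.
- apply: (dk_eq oT (f := fun z => complex.Re (h z) + complex.Re (k z))); last exact: (dk_add oT).
  by move=> z _; case: (h z) (k z) => a b [].
- apply: (dk_eq oT (f := fun z => complex.Im (h z) + complex.Im (k z))); last exact: (dk_add oT).
  by move=> z _; case: (h z) (k z) => a b [].
Qed.

Lemma cdk_mul h k : cdk h -> cdk k -> cdk (fun z => h z * k z).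
Proof.
case=> h1 h2 [k1 k2]; split.
- apply: (dk_eq oT (f := fun z => complex.Re (h z) * complex.Re (k z) - complex.Im (h z) * complex.Im (k z))).
    by move=> z _; case: (h z) (k z) => a b [].
  by apply: (dk_sub oT); exact: (dk_mul oT).
- apply: (dk_eq oT (f := fun z => complex.Re (h z) * complex.Im (k z) + complex.Im (h z) * complex.Re (k z))).
    by move=> z _; case: (h z) (k z) => a b [].
  by apply: (dk_add oT); exact: (dk_mul oT).
Qed.

Lemma cdk_det (A : Cn -> 'M[R[i]]_n) : (forall i j, cdk (fun z => A z i j)) ->
  cdk (fun z => \det (A z)).
Proof.
move=> dA; rewrite /determinant.
have cs (I : Type) (r : seq I) (h : I -> Cn -> R[i]) : (forall i, cdk (h i)) ->
    cdk (fun z => \sum_(i <- r) h i z).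
  move=> ch; elim: r => [|i r IH].
    by under eq_fun do rewrite big_nil; exact: cdk_cst.
  by under eq_fun do rewrite big_cons; exact: cdk_add.
have cp (I : Type) (r : seq I) (h : I -> Cn -> R[i]) : (forall i, cdk (h i)) ->
    cdk (fun z => \prod_(i <- r) h i z).
  move=> ch; elim: r => [|i r IH].
    by under eq_fun do rewrite big_nil; exact: cdk_cst.
  by under eq_fun do rewrite big_cons; exact: cdk_mul.
by apply: cs => t; apply: cdk_mul; [exact: cdk_cst|apply: cp => i; exact: dA].
Qed.

Lemma cdk_levi (F : Cn -> R) i j : smo setT F -> cdk (fun z => levi F z i j).
Proof.
move=> sF; have d2 (u v : Cn) : dk setT 0 ('D_u ('D_v F)).
  by have [_ H] := sF 2%N; have [_] := H v; exact.
split.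
- apply: (dk_eq oT (f := fun z => 4^-1 * (pd_re i (pd_re j F) z + pd_im i (pd_im j F) z))).
    by move=> z _; rewrite mxE /= mulrC.
  by apply: (dk_scale oT); apply: (dk_add oT); exact: d2.
- apply: (dk_eq oT (f := fun z => 4^-1 * (pd_re i (pd_im j F) z - pd_im i (pd_re j F) z))).
    by move=> z _; rewrite mxE /= mulrC.
  by apply: (dk_scale oT); apply: (dk_sub oT); exact: d2.
Qed.

Lemma Re_div_continuous (a b : Cn -> R[i]) z : cdk a -> cdk b -> (forall z, b z != 0) ->
  {for z, continuous (fun z => complex.Re (a z / b z))}.
Proof.
move=> [a1 a2] [b1 b2] b0.
apply: (dk_continuous (m := 0%N)); apply: (dk_eq oT (f := fun z =>
  (complex.Re (a z) * complex.Re (b z) + complex.Im (a z) * complex.Im (b z)) * (sqmodC (b z))^-1)).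
  by move=> w _; rewrite /sqmodC; case: (a w) (b w) => x y [u v] /=; ring.
apply: (dk_mul oT); first by apply: (dk_add oT); exact: (dk_mul oT).
apply: (dk_inv oT) => [w _|]; first by rewrite sqmodC_eq0.
by apply: (dk_add oT); exact: (dk_mul oT).
Qed.

End ComplexContinuity.

(** The factor in front depends on the point only; being common to both metrics, it disappears from
    the ratio H. *)
Lemma det_conj_scaled (R : realType) m (M : 'M[R[i]]_m) (a : 'I_m -> R[i]) (H : 'M[R]_m) :
  M = \matrix_(i, j) ((a i)^-1 * ((H i j)%:C)%C * ((a j)^*)^-1) ->
  \det M = (\prod_k (a k)^-1 * \prod_k ((a k)^*)^-1) * ((\det H)%:C)%C.
Proof.
move=> ->.
have -> : \matrix_(i, j) ((a i)^-1 * ((H i j)%:C)%C * ((a j)^*)^-1) =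
    diag_mx (\row_k (a k)^-1) *m map_mx (real_complex R) H *m diag_mx (\row_k ((a k)^*)^-1).
  by apply/matrixP => i j; rewrite mul_mx_diag mul_diag_mx !mxE.
rewrite !det_mulmx !det_diag det_map_mx mulrAC.
under eq_bigr do rewrite mxE; under [X in _ * X * _]eq_bigr do rewrite mxE.
by [].
Qed.

Lemma Re_ratio (R : realType) (c : R[i]) (a b : R) : c != 0 ->
  complex.Re ((c * (a%:C)%C) / (c * (b%:C)%C)) = a / b.
Proof.
by move=> c0; rewrite invfM mulrACA divff // mul1r -fmorphV -rmorphM.
Qed.

Lemma div_le_exp (R : realType) (a b c : R) : 0 < a -> 0 < b -> ln a - ln b <= c ->
  a / b <= expR c.
Proof.
by move=> a0 b0 H; rewrite -[leLHS]lnK ?posrE ?divr_gt0 // ler_expR ln_div ?posrE.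
Qed.

Section Ratio.
Context {R : realType} {n : nat} (P : halfspaces R n).
Local Notation d := (nfacets P).
Local Notation Cn := (@Cn R n).
Variable phi : 'rV[R[i]]_d -> R.
Hypotheses (HP : delzant P) (sphi : smooth_on_M phi) (tphi : torus_invariant phi) (kphi : kahler phi).

Let bP : bounded_set (closedPoly P). Proof. by case: HP. Qed.

Lemma det_levi_generic (s : 'I_n -> 'I_d) p (f : 'rV[R]_n -> R) (F : Cn -> R) zeta :
  vchart s p -> smo setT f ->
  (forall zeta, generic zeta -> f (Xlog s zeta) = dotrv (Xlog s zeta) p + F zeta) ->
  generic zeta -> \det (levi F zeta) =
    (\prod_k (cz zeta k)^-1 * \prod_k ((cz zeta k)^*)^-1) * ((\det (hess f (Xlog s zeta)))%:C)%C.
Proof.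
move=> vc df fF gz; apply: (etrans (det_conj_scaled (levi_generic df fF gz))).
exact: (congr1 (fun r : R => _ * (r%:C)%C) (det_uhess vc df _)).
Qed.

Lemma Hratio_generic (s : 'I_n -> 'I_d) p zeta : vchart s p -> vertex P p -> generic zeta ->
  Hratio phi s zeta =
  \det (hess (guillemin_g P) (Xlog s zeta)) / \det (hess (fpot phi) (Xlog s zeta)).
Proof.
move=> vc vp gz; rewrite /Hratio.
have E0 := det_levi_generic vc (smo_guillemin_g vc bP) (Fpot0_gen HP vc) gz.
have fF (z : Cn) : generic z -> fpot phi (Xlog s z) = dotrv (Xlog s z) p + Fpot s phi z.
  exact: fpot_chart.
have E1 := det_levi_generic vc (smo_fpot HP sphi tphi) fF gz.
transitivity (complex.Re (\det (levi (Fpot s ((fun=> 0) : 'rV[R[i]]_d -> R)) zeta)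
  / \det (levi (Fpot s phi) zeta))); first by [].
apply: (etrans (congr2 (fun a b => complex.Re (a / b)) E0 E1)); apply: Re_ratio.
have cz0 k : cz zeta k != 0.
  apply: contraTneq (gz k) => /eqP; rewrite mxE eq_complex /= => /andP[/eqP -> /eqP ->].
  by rewrite expr0n addr0 ltxx.
by rewrite mulf_neq0 //; apply/prodf_neq0 => k _; rewrite invr_eq0 ?conjC_eq0.
Qed.

Lemma on_torus_val x : exists2 z, coxU z & on_torus phi x = phi z.
Proof.
have [s [p [vc vp _]]] := max_vertex 0 HP.
exists (chart s (zetaX s x)); last first.
  by rewrite -{1}(Xlog_zetaX vc x) (on_torus_chart vc sphi tphi) //; exact: generic_zetaX.
apply: nonzero_coxU; first by exists p; exact: vc_in vc.
by move=> i; apply: (chart_neq0 vc) => k; exact: generic_zetaX.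
Qed.

Lemma on_torus_osc x y : on_torus phi x - on_torus phi y <= maxM phi - minM phi.
Proof.
have [K K0 HK] := phi_bounded HP sphi.
have [z Uz ->] := on_torus_val x; have [w Uw ->] := on_torus_val y.
apply: lerB.
- apply: ub_le_sup; last by exists z.
  by exists K => _ [u Uu <-]; apply: (le_trans (ler_norm _)); exact: HK.
- apply: ge_inf; last by exists w.
  exists (- K) => _ [u Uu <-]; rewrite lerNl; apply: le_trans (HK u Uu).
  by rewrite -normrN ler_norm.
Qed.

(** The denominator does not vanish on the chart, because the metric is positive definite, so H is
    continuous there; and the points with all zeta_k nonzero are dense. *)
Lemma Hratio_le (s : 'I_n -> 'I_d) B zeta : chart_index s ->
  (forall x, \det (hess (guillemin_g P) x) / \det (hess (fpot phi) x) <= B) ->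
  Hratio phi s zeta <= B.
Proof.
move=> cs HB; have [p vp fp] := cs; have vc := vchart_of HP vp fp.
rewrite -subr_ge0.
have metric0 z : \det (metric phi s z) != 0 by apply: posdef_hermitian_det; exact: kphi.
apply: (@limit_ge0 R Cn (fun z => B - Hratio phi s z) zeta (const_mx 1, 0)).
  apply: cont_sub; first exact: cont_cst.
  apply: Re_div_continuous => //; apply: cdk_det => i j; apply: cdk_levi.
    exact: (smo_Fpot HP (zero_smooth_on_M P) vc vp).
  exact: (smo_Fpot HP sphi vc vp).
move=> e e0; have [t te Ht] := shift_neq0 zeta.1 e0; exists t => //.
rewrite subr_ge0 (Hratio_generic vc vp); first exact: HB.
move=> k; rewrite mxE /= !mxE mulr1 ltr_pwDl ?sqr_ge0 //.
by rewrite exprn_even_gt0 //= Ht.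
Qed.

End Ratio.

Theorem theorem3p1 (R : realType) :
  exists C : nat -> R -> R -> R,
    forall (n : nat) (P : halfspaces R n) (D : 'rV[R]_n -> R)
      (phi : 'rV[R[i]]_(nfacets P) -> R),
      (0 < n)%N ->
      delzant P ->
      (exists U : set 'rV[R]_n,
        [/\ open U, closedPoly P `<=` U & smooth_on U D]) ->
      (forall xi, closedPoly P xi -> 0 < D xi) ->
      smooth_on_M phi ->
      torus_invariant phi ->
      kahler phi ->
      let f := fun x => guillemin_g P x + on_torus phi x in
      let calR := constR P D in
      forall (s : 'I_n -> 'I_(nfacets P)) (zeta : Cn n),
        chart_index s ->
        Hratio phi s zeta <=
          C n (max_absS D f) calR *
            expR ((2 * calR + 1) * (maxM phi - minM phi)).
Proof.
(* The bound of [chart_bounds] is chosen as a function of n and R before any polytope is given: this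
   is what makes the constant depend on nothing else but the curvature. *)
have H (nr : nat * R) : exists K, (0 < nr.1)%N -> 0 <= K /\
    forall P : halfspaces R nr.1, controlled P nr.2 ->
    forall (s : 'I_nr.1 -> 'I_(nfacets P)) p y, vchart s p -> vertex P p ->
    nneg y -> (forall k, y 0 k <= 1) ->
    [/\ forall k, `|lrho s p k (etaS s p y)| <= K,
      forall k, etaS s p y 0 k * Bmx s p (etaS s p y) k k <= K &
      `|Psi s p (etaS s p y)| <= K].
  have [n0|] := posnP nr.1; first by exists 0; rewrite n0.
  by move=> n0; have [K K0 HK] := chart_bounds (R := R) nr.2 n0; exists K.
have [K HK] := choice H.
(* The absolute value makes the bound of tr (f^-1 g'') nonnegative for all arguments, so that ln (Tm
   + 1) is the logarithm of a positive number. *)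
pose Tm (n : nat) (S r : R) := `|(2 * r + 1) * n%:R + S + (2 * r + 5 / 2) * r|.
exists (fun n S r => expR (3 * (n%:R * K (n, r)) + 4 * (r * K (n, r)) + r
  + n%:R * ln (Tm n S r + 1))).
move=> n P D phi n0 HP [U [oU PU sD]] D0 sphi tphi kphi f calR s zeta cs.
have dD : smo U D := smooth_on_smo oU sD.
(* D is positive on the closed polytope only; its domain is shrunk so that log D is smooth on an
   open neighbourhood. *)
pose W := [set x | U x /\ 0 < D x].
have oW : open W by apply: open_gt0; [exact: oU|exact: dD].
have PW : closedPoly P `<=` W by move=> x Px; split; [exact: PU|exact: D0].
have dDW : smo W D by move=> m; apply: dk_sub_set (dD m) => x [].
have DW xi : W xi -> 0 < D xi by case.
have cP : controlled P calR := controlled_constR HP oW PW dDW DW (lexx _).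
have [K0 HK1] := HK (n, calR) n0.
have posM (t : 'I_n -> 'I_(nfacets P)) p : vchart t p -> vertex P p ->
    forall r, posdef (Mr (Fpot t phi) r).
  by move=> vc vp r; apply: kahler_posdef vc vp.
have bound := log_ratio_bound n0 HP sphi tphi posM oW PW dDW DW (lexx _) (erefl (2 * calR + 1))
  (ler_norm _) (normr_ge0 _) K0 _ (on_torus_osc HP sphi tphi).
rewrite -expRD; apply: (Hratio_le HP sphi tphi kphi _ cs) => x.
have /andP[g0 _] : 0 < \det (hess (guillemin_g P) x) <= \prod_i hess (guillemin_g P) x i i.
  apply: hadamard; rewrite -(fpot0 P).
  apply: (fpot_hess_posdef HP (zero_smooth_on_M P) (@zero_torus_invariant R n P)).
  by move=> t p vc vp r; exact: (Mr0_posdef HP vc vp).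
have /andP[f0 _] := hadamard (fpot_hess_posdef HP sphi tphi posM x).
apply: (div_le_exp g0 f0); apply: bound => y t p [vc vp ye]; apply: (HK1 P cP t p (yX t y) vc vp); first exact: yX_nneg.
by move=> k; rewrite mxE -[leRHS]expR0 ler_expR.
Qed.
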